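(* Let $\mathcal{D}$ be a unital, separable, strongly self-absorbing and $K_1$-injective $C^*$-algebra, and let $A$ be a separable unital $C^*$-algebra. Let $\iota:\mathcal{D}\to A\otimes\mathcal{D}$ be defined by $\iota(d)=\mathbf{1}_A\otimes d$. If $e\in\mathcal{K}\otimes A\otimes\mathcal{D}$ is a projection, and $\varphi,\psi:\mathcal{D}\to e(\mathcal{K}\otimes A\otimes\mathcal{D})e$ are two unital $*$-homomorphisms, then $\varphi$ and $\psi$ are strongly asymptotically unitarily equivalent (as maps into $e(\mathcal{K}\otimes A\otimes\mathcal{D})e$), and hence $[\varphi]=[\psi]\in KK(\mathcal{D},A\otimes\mathcal{D})$. Moreover, $$KK(\mathcal{D},A\otimes\mathcal{D})=\{[\varphi]-n[\iota]\;|\;\varphi:\mathcal{D}\to\mathcal{K}\otimes A\otimes\mathcal{D}\text{ is a }*\text{-homomorphism},\ n\in\mathbb{N}\}.$$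
   Context: $\mathcal{K}$ denotes the compact operators on a separable infinite-dimensional Hilbert space. A $*$-homomorphism $\varphi:\mathcal{D}\to\mathcal{K}\otimes A\otimes\mathcal{D}$ defines a class $[\varphi]\in KK(\mathcal{D},A\otimes\mathcal{D})$ via the stability isomorphism $KK(\mathcal{D},\mathcal{K}\otimes A\otimes\mathcal{D})\cong KK(\mathcal{D},A\otimes\mathcal{D})$; a $*$-homomorphism into the corner $e(\mathcal{K}\otimes A\otimes\mathcal{D})e$ is regarded as a map into $\mathcal{K}\otimes A\otimes\mathcal{D}$. For a unital $C^*$-algebra $B$, $\mathcal{U}(B)$ is its unitary group and $\mathcal{U}_0(B)$ the connected component of $\mathbf{1}_B$ in $\mathcal{U}(B)$ (norm topology). Two $*$-homomorphisms $\sigma,\gamma:C\to B$ are approximately unitarily equivalent, $\sigma\approx_{\mathrm{u}}\gamma$, if there is a sequence $(u_n)_{n\in\mathbb{N}}$ of unitaries in $B$ with $\|u_n\sigma(c)u_n^*-\gamma(c)\|\to 0$ for every $c\in C$. They are strongly asymptotically unitarily equivalent if there is a norm-continuous path $(u_t)_{t\in[0,\infty)}$ of unitaries in $B$ with $u_0=\mathbf{1}_B$ (hence $u_t\in\mathcal{U}_0(B)$ for all $t$) and $\|u_t\sigma(c)u_t^*-\gamma(c)\|\to 0$ as $t\to\infty$ for every $c\in C$. A separable unital $C^*$-algebra $\mathcal{D}$ is strongly self-absorbing if $\mathcal{D}\neq\mathbb{C}$ and there is an isomorphism $\varphi:\mathcal{D}\to\mathcal{D}\otimes\mathcal{D}$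 such that $\varphi\approx_{\mathrm{u}}\mathrm{id}_{\mathcal{D}}\otimes\mathbf{1}_{\mathcal{D}}$, where $\mathrm{id}_{\mathcal{D}}\otimes\mathbf{1}_{\mathcal{D}}$ is the map $d\mapsto d\otimes\mathbf{1}_{\mathcal{D}}$. Strongly self-absorbing $C^*$-algebras are known to be simple and nuclear, so $C^*$-tensor products with $\mathcal{D}$ are unambiguous. A unital $C^*$-algebra $\mathcal{D}$ is $K_1$-injective if the canonical map $\mathcal{U}(\mathcal{D})/\mathcal{U}_0(\mathcal{D})\to K_1(\mathcal{D})$ is injective. *)

(* Defs.v *)
From HB Require Import structures.
From mathcomp Require Import all_boot all_order all_algebra complex.
From mathcomp Require Import all_classical all_reals topology normedtype.

Set Implicit Arguments.
Unset Strict Implicit.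
Unset Printing Implicit Defensive.

Import Order.TTheory GRing.Theory Num.Theory numFieldNormedType.Exports.

Local Open Scope classical_set_scope.
Local Open Scope ring_scope.

(* Not necessarily unital, which is why the product is not that of a MathComp
   ring.  The norm of MathComp-Analysis takes its values in the scalars, here
   [R[i]], whose order is [z <= w] iff [w - z] is a nonnegative real. *)
HB.mixin Record isCStarAlgebra (R : realType) (A : Type)
    of CompleteNormedModule (complex R) A := {
  cmul : A -> A -> A;
  cstar : A -> A;
  cmulA : associative cmul;
  cmulDl : left_distributive cmul +%R;
  cmulDr : right_distributive cmul +%R;
  cmulZl : forall (z : complex R) x y, cmul (z *: x) y = z *: cmul x y;
  cmulZr : forall (z : complex R) x y, cmul x (z *: y) = z *: cmul x y;
  cstarK : involutive cstar;
  cstarD : {morph cstar : x y / x + y};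
  cstarZ : forall (z : complex R) x, cstar (z *: x) = z^* *: cstar x;
  cstarM : forall x y, cstar (cmul x y) = cmul (cstar y) (cstar x);
  cnormM : forall x y, `|cmul x y| <= `|x| * `|y|;
  cnorm_star : forall x, `|cmul (cstar x) x| = `|x| ^+ 2
}.

#[short(type="cstarAlgType")]
HB.structure Definition CStarAlgebra (R : realType) :=
  {A of CompleteNormedModule (complex R) A & isCStarAlgebra R A}.

HB.mixin Record CStarAlgebra_isUnital (R : realType) (A : Type)
    of CStarAlgebra R A := {
  cone : A;
  cmul1l : left_id cone (cmul : A -> A -> A);
  cmul1r : right_id cone (cmul : A -> A -> A)
}.

#[short(type="unitalCstarAlgType")]
HB.structure Definition UnitalCStarAlgebra (R : realType) :=
  {A of CStarAlgebra R A & CStarAlgebra_isUnital R A}.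

Arguments cone {R} s.

Notation "x ** y" := (cmul x y) (at level 40, left associativity).

Definition separable (T : topologicalType) : Prop :=
  exists2 S : set T, countable S & dense S.

Section CStarBasics.
Context {R : realType}.
Implicit Types A B C D : cstarAlgType R.

Lemma cmul0l A (x : A) : 0 ** x = 0.
Proof. by apply: (addrI (0 ** x)); rewrite -cmulDl !addr0. Qed.

Lemma cmul0r A (x : A) : x ** 0 = 0.
Proof. by apply: (addrI (x ** 0)); rewrite -cmulDr !addr0. Qed.

Lemma cstar0 A : cstar (0 : A) = 0.
Proof. by apply: (addrI (cstar 0)); rewrite -cstarD !addr0. Qed.

Lemma cmulNl A (x y : A) : (- x) ** y = - (x ** y).
Proof. by apply: (addrI (x ** y)); rewrite -cmulDl !subrr cmul0l. Qed.

Lemma cmulNr A (x y : A) : x ** (- y) = - (x ** y).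
Proof. by apply: (addrI (x ** y)); rewrite -cmulDr !subrr cmul0r. Qed.

Lemma cstarN A (x : A) : cstar (- x) = - cstar x.
Proof. by apply: (addrI (cstar x)); rewrite -cstarD !subrr cstar0. Qed.

Lemma cstar_mul_eq0 A (d : A) : (forall w, cstar w ** d = 0) -> d = 0.
Proof.
move=> /(_ d) d0; apply/eqP; rewrite -normr_eq0 -sqrf_eq0 -cnorm_star d0.
by rewrite normr0.
Qed.

Record starHom A B := StarHom {
  sh_fun :> A -> B;
  sh_linear : linear sh_fun;
  sh_mul : {morph sh_fun : x y / x ** y};
  sh_star : {morph sh_fun : x / cstar x}
}.

Lemma star_comp_subproof A B C (g : starHom B C) (f : starHom A B) :
  linear (g \o f) /\
  {morph g \o f : x y / x ** y} /\ {morph g \o f : x / cstar x}.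
Proof.
split=> [z x y|]; first by rewrite /= !sh_linear.
by split=> [x y|x] /=; rewrite ?sh_mul ?sh_star.
Qed.

Definition star_comp A B C (g : starHom B C) (f : starHom A B) : starHom A C :=
  let p := star_comp_subproof g f in StarHom p.1 p.2.1 p.2.2.

Definition projection A (e : A) : Prop := cstar e = e /\ e ** e = e.

Lemma projection_one (A : unitalCstarAlgType R) : projection (cone A).
Proof.
split; last exact: cmul1l.
have h : cstar (cstar (cone A) ** cone A) = cstar (cone A) ** cone A.
  by rewrite cstarM cstarK.
by move: h; rewrite cmul1r cstarK.
Qed.

Definition corner A (e : A) : set A := [set x | e ** x ** e = x].

(* The unitary group of the unital C*-algebra [e A e]; for [e] the unit of [A]
   this is the unitary group of [A]. *)
Definition unitaries A (e : A) : set A :=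
  [set u | [/\ e ** u = u, u ** e = u, cstar u ** u = e & u ** cstar u = e]].

(* In the next two definitions [sigma] and [gamma] are seen as maps into the
   unital C*-algebra [e B e]. *)
Definition approx_unitarily_equivalent C B (e : B) (sigma gamma : C -> B) :=
  exists u : nat -> B, (forall n, unitaries e (u n)) /\
    forall c, (fun n => u n ** sigma c ** cstar (u n)) @ \oo --> gamma c.

Definition strongly_asymp_unitarily_equivalent C B (e : B)
    (sigma gamma : C -> B) :=
  exists u : R -> B,
    [/\ {within `[0, +oo[, continuous u},
        u 0 = e,
        (forall t, 0 <= t -> unitaries e (u t))
      & forall c, (fun t => u t ** sigma c ** cstar (u t)) @ +oo --> gamma c].

End CStarBasics.

HB.mixin Record isHilbert (R : realType) (H : Type)
    of CompleteNormedModule (complex R) H := {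
  inner : H -> H -> complex R;
  inner_linear : forall y (z : complex R) x x',
    inner (z *: x + x') y = z * inner x y + inner x' y;
  inner_conj : forall x y, inner y x = (inner x y)^*;
  inner_norm : forall x, inner x x = `|x| ^+ 2
}.

#[short(type="hilbertType")]
HB.structure Definition Hilbert (R : realType) :=
  {H of CompleteNormedModule (complex R) H & isHilbert R H}.

Section Operators.
Context {R : realType}.
Implicit Types A B K T : cstarAlgType R.
Implicit Types H : hilbertType R.

(* An injective *-homomorphism from [A] to the bounded operators on [H]:
   everywhere defined operators with an adjoint are bounded. *)
Record faithfulRep A H := FaithfulRep {
  rep_fun :> A -> H -> H;
  rep_linear : forall a, linear (rep_fun a);
  rep_linear_alg : forall x, linear (rep_fun^~ x);
  rep_mul : forall a b x, rep_fun (a ** b) x = rep_fun a (rep_fun b x);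
  rep_star : forall a x y,
    inner (rep_fun a x) y = inner x (rep_fun (cstar a) y);
  rep_inj : forall a, (forall x, rep_fun a x = 0) -> a = 0
}.

Definition infinite_dimensional H : Prop :=
  ~ exists (n : nat) (v : 'I_n -> H), forall x, exists c : 'I_n -> complex R,
      x = \sum_(i < n) c i *: v i.

Definition compact_operator H (S : H -> H) : Prop :=
  linear S /\ compact (closure (S @` [set x : H | `|x| <= 1])).

(* [K] is the algebra of compact operators on [H], acting through [comp_rep]. *)
Record compactOperators K H := CompactOperators {
  comp_rep :> faithfulRep K H;
  comp_image : forall S : H -> H,
    compact_operator S <-> exists k : K, comp_rep k = S
}.

Definition rank_one_projection K H (piK : compactOperators K H) (p : K) :=
  exists2 xi : H, `|xi| = 1 & forall x, piK p x = inner x xi *: xi.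

Lemma innerZl H (z : complex R) (x y : H) : inner (z *: x) y = z * inner x y.
Proof.
have i0 : inner (0 : H) y = 0.
  have := inner_linear y 1 (0 : H) 0; rewrite scale1r mul1r addr0 => h.
  by apply: (addrI (inner (0 : H) y)); rewrite -h addr0.
by rewrite -[z *: x]addr0 inner_linear i0 addr0.
Qed.

Lemma innerZr H (z : complex R) (x y : H) : inner x (z *: y) = z^* * inner x y.
Proof. by rewrite inner_conj innerZl rmorphM (inner_conj y x). Qed.

Lemma inner_ext H (x y : H) : (forall w, inner w x = inner w y) -> x = y.
Proof.
move=> xy; apply/eqP; rewrite -subr_eq0 -normr_eq0 -sqrf_eq0; apply/eqP.
rewrite -inner_norm.
have xy' w : inner x w = inner y w by rewrite inner_conj xy (inner_conj w y).
rewrite [X in inner X _]addrC -[X in inner (X + _) _]scaleN1r inner_linear.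
by rewrite mulN1r xy' addrC subrr.
Qed.

Lemma rep_ext A H (pi : faithfulRep A H) a b :
  (forall x, pi a x = pi b x) -> a = b.
Proof.
move=> ab; apply/eqP; rewrite -subr_eq0; apply/eqP/(rep_inj (f := pi)) => x.
by rewrite [a - b]addrC -scaleN1r rep_linear_alg ab scaleN1r addrC subrr.
Qed.

Lemma rank_one_projectionP K H (piK : compactOperators K H) (p : K) :
  rank_one_projection piK p -> projection p.
Proof.
case=> xi xi1 pE; split; apply: (rep_ext (pi := piK)) => x.
  apply: inner_ext => w; rewrite -rep_star !pE innerZl innerZr (inner_conj x xi).
  by rewrite mulrC.
by rewrite rep_mul !pE innerZl inner_norm xi1 expr1n mulr1.
Qed.

Record hilbertTensor (H1 H2 H : hilbertType R) := HilbertTensor {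
  htens :> H1 -> H2 -> H;
  htens_inner : forall x y x' y',
    inner (htens x y) (htens x' y') = inner x x' * inner y y';
  htens_dense : dense [set z | exists n (x : 'I_n -> H1) (y : 'I_n -> H2),
    z = \sum_(i < n) htens (x i) (y i)]
}.

(* [T] is the minimal (spatial) C*-tensor product of [A] and [B] with elementary
   tensors [tens a b]: the closed span of the operators [pi1 a (x) pi2 b], for
   faithful representations [pi1] and [pi2]. *)
Record cstarTensor A B T := CStarTensor {
  tens :> A -> B -> T;
  tens_linear_l : forall b, linear (tens^~ b);
  tens_linear_r : forall a, linear (tens a);
  tens_mul : forall a a' b b',
    tens (a ** a') (b ** b') = tens a b ** tens a' b';
  tens_star : forall a b, tens (cstar a) (cstar b) = cstar (tens a b);
  tens_dense : dense [set z | exists n (a : 'I_n -> A) (b : 'I_n -> B),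
    z = \sum_(i < n) tens (a i) (b i)];
  tens_spatial : exists (H1 H2 H : hilbertType R) (h : hilbertTensor H1 H2 H)
    (pi1 : faithfulRep A H1) (pi2 : faithfulRep B H2) (pi : faithfulRep T H),
    forall a b x y, pi (tens a b) (h x y) = h (pi1 a x) (pi2 b y)
}.

Lemma tens_proj_subproof A B T (t : cstarTensor A B T) (e : A) :
  projection e ->
  {morph t e : x y / x ** y} /\ {morph t e : x / cstar x}.
Proof.
case=> eS ee; split=> [x y|x]; first by rewrite -tens_mul ee.
by rewrite -tens_star eS.
Qed.

Definition tens_proj A B T (t : cstarTensor A B T) (e : A)
    (he : projection e) : starHom B T :=
  StarHom (tens_linear_r t e) (tens_proj_subproof t he).1
    (tens_proj_subproof t he).2.

End Operators.

Section StronglySelfAbsorbing.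
Context {R : realType}.

Definition isomorphic_to_scalars (D : cstarAlgType R) : Prop :=
  exists f : complex R -> D,
    [/\ bijective f, linear (f : (complex R)^o -> D),
        (forall z w, f (z * w) = f z ** f w) & forall z, f z^* = cstar (f z)].

Definition strongly_self_absorbing (D : unitalCstarAlgType R) : Prop :=
  [/\ separable D,
      ~ isomorphic_to_scalars D
    & exists (T : cstarAlgType R) (t : cstarTensor D D T) (phi : starHom D T),
        bijective phi /\
        approx_unitarily_equivalent (t (cone D) (cone D)) phi
          (fun d => t d (cone D))].

End StronglySelfAbsorbing.

Section K1.
Context {R : realType} (D : unitalCstarAlgType R).

Definition mxcmul n (X Y : 'M[D]_n) : 'M[D]_n :=
  \matrix_(i, j) \sum_(k < n) X i k ** Y k j.

Definition mxcstar n (X : 'M[D]_n) : 'M[D]_n := \matrix_(i, j) cstar (X j i).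

Definition mxcone n : 'M[D]_n := \matrix_(i, j) if i == j then cone D else 0.

(* The norm topology of M_n(D) is the entrywise topology, which is the one that
   the library puts on matrices. *)
Definition mxunitaries n : set 'M[D]_n :=
  [set U | mxcmul (mxcstar U) U = mxcone n /\ mxcmul U (mxcstar U) = mxcone n].

(* [diag(U, 1, ..., 1)], of size [m], for [n <= m]. *)
Definition mxpad n m (U : 'M[D]_n) : 'M[D]_m :=
  \matrix_(i, j)
    match (insub (i : nat) : option 'I_n), (insub (j : nat) : option 'I_n) with
    | Some i', Some j' => U i' j'
    | _, _ => if i == j then cone D else 0
    end.

(* Equality in K_1(D), the inductive limit of the groups U_n(D) / U_n(D)_0
   along [U |-> diag(U, 1)]. *)
Definition K1_equiv n (U : 'M[D]_n) m (V : 'M[D]_m) : Prop :=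
  exists k : nat, [/\ (n <= k)%N, (m <= k)%N
    & connected_component (@mxunitaries k) (mxpad k U) (mxpad k V)].

(* The elements of K_1(D), as sets of unitary matrices of arbitrary size. *)
Definition K1_class n (U : 'M[D]_n) : set {m : nat & 'M[D]_m} :=
  [set V | mxunitaries (tagged V) /\ K1_equiv U (tagged V)].

Definition unitaries0 : set D :=
  connected_component (unitaries (cone D)) (cone D).

Definition U0_coset (u : D) : set D := [set u ** w | w in unitaries0].

(* Injectivity of U(D) / U_0(D) -> K_1(D). *)
Definition K1_injective : Prop :=
  forall u v : D, unitaries (cone D) u -> unitaries (cone D) v ->
    K1_class (const_mx u : 'M[D]_1) = K1_class (const_mx v : 'M[D]_1) ->
    U0_coset u = U0_coset v.

End K1.

Section Multipliers.
Context {R : realType}.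
Implicit Types C D : cstarAlgType R.

(* The multiplier algebra M(C) is the algebra of adjointable operators on [C],
   seen as a Hilbert module over itself, with inner product [x^* y]; such
   operators are automatically linear, bounded and right [C]-linear. *)
Record multiplier C := Multiplier {
  mult_fun :> C -> C;
  mult_adj : C -> C;
  mult_adjP : forall x y, cstar (mult_fun x) ** y = cstar x ** mult_adj y
}.

Lemma mult_adjP' C (s : multiplier C) x y :
  cstar (mult_adj s x) ** y = cstar x ** s y.
Proof.
have := congr1 cstar (mult_adjP s y x).
by rewrite !cstarM !cstarK => ->.
Qed.

Lemma cstar_mul_inj C (x y : C) :
  (forall w, cstar w ** x = cstar w ** y) -> x = y.
Proof.
move=> xy; apply/eqP; rewrite -subr_eq0; apply/eqP/cstar_mul_eq0 => w.
by rewrite cmulDr cmulNr xy subrr.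
Qed.

Lemma mult_add C (s : multiplier C) : {morph s : x y / x + y}.
Proof.
move=> x y; apply: cstar_mul_inj => w.
by rewrite -mult_adjP' !cmulDr !mult_adjP'.
Qed.

Lemma mult_scale C (s : multiplier C) (z : complex R) x : s (z *: x) = z *: s x.
Proof.
apply: cstar_mul_inj => w.
by rewrite -mult_adjP' !cmulZr mult_adjP'.
Qed.

Lemma mult_linear C (s : multiplier C) : linear s.
Proof. by move=> z x y; rewrite mult_add mult_scale. Qed.

Lemma mult_mul C (s : multiplier C) x y : s (x ** y) = s x ** y.
Proof.
apply: cstar_mul_inj => w.
by rewrite -mult_adjP' !cmulA mult_adjP'.
Qed.

Definition mult_swap C (s : multiplier C) : multiplier C :=
  Multiplier (mult_adjP' s).

(* A *-homomorphism from [D] to M(C). *)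
Record multRep D C := MultRep {
  mrep_fun :> D -> C -> C;
  mrep_linear : forall x, linear (mrep_fun^~ x);
  mrep_mul : forall a b x, mrep_fun (a ** b) x = mrep_fun a (mrep_fun b x);
  mrep_star : forall a x y,
    cstar (mrep_fun a x) ** y = cstar x ** mrep_fun (cstar a) y
}.

(* A Cuntz pair: two *-homomorphisms from [D] to M(C) whose difference takes its
   values in [C], embedded in M(C) by left multiplication. *)
Record cuntzPair D C := CuntzPair {
  cp_pos : multRep D C;
  cp_neg : multRep D C;
  cp_diff : D -> C;
  cp_diffP : forall a x, cp_pos a x - cp_neg a x = cp_diff a ** x
}.

(* Two isometries of M(C) whose range projections add up to 1; they exist when
   [C] is stable. *)
Record cuntzIsometries C := CuntzIsometries {
  iso1 : multiplier C;
  iso2 : multiplier C;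
  iso1K : forall x, mult_adj iso1 (iso1 x) = x;
  iso2K : forall x, mult_adj iso2 (iso2 x) = x;
  iso_sum : forall x, iso1 (mult_adj iso1 x) + iso2 (mult_adj iso2 x) = x
}.

Lemma mult0 C (s : multiplier C) : s 0 = 0.
Proof. by apply: (addrI (s 0)); rewrite -mult_add !addr0. Qed.

Lemma multN C (s : multiplier C) x : s (- x) = - s x.
Proof. by apply: (addrI (s x)); rewrite -mult_add !subrr mult0. Qed.

Lemma iso21 C (S : cuntzIsometries C) x : mult_adj (iso2 S) (iso1 S x) = 0.
Proof.
have := iso_sum S (iso1 S x); rewrite iso1K -[RHS]addr0 => /addrI h.
by rewrite -[LHS](iso2K S) h; exact: (mult0 (mult_swap (iso2 S))).
Qed.

Lemma iso12 C (S : cuntzIsometries C) x : mult_adj (iso1 S) (iso2 S x) = 0.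
Proof.
have := iso_sum S (iso2 S x); rewrite iso2K -[RHS]add0r => /addIr h.
by rewrite -[LHS](iso1K S) h; exact: (mult0 (mult_swap (iso1 S))).
Qed.

Section Operations.
Context {D C : cstarAlgType R}.

Lemma mrep_zero_subproof :
  (forall x : C, linear (fun _ : D => (0 : C))) /\
  (forall (a : D) (x y : C), cstar 0 ** y = cstar x ** 0).
Proof.
by split=> [_ z a b|a x y]; rewrite ?scaler0 ?addr0// cstar0 cmul0l cmul0r.
Qed.

Definition mrep_zero : multRep D C :=
  @MultRep D C (fun _ _ => 0) mrep_zero_subproof.1
    (fun _ _ _ => erefl) mrep_zero_subproof.2.

Lemma mrep_hom_subproof (f : starHom D C) :
  (forall x, linear (fun a => f a ** x)) /\
  (forall a b x, f (a ** b) ** x = f a ** (f b ** x)) /\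
  (forall a x y, cstar (f a ** x) ** y = cstar x ** (f (cstar a) ** y)).
Proof.
split=> [x z a b|]; first by rewrite sh_linear cmulDl cmulZl.
by split=> [a b x|a x y]; rewrite ?sh_mul ?cstarM ?sh_star cmulA.
Qed.

Definition mrep_hom (f : starHom D C) : multRep D C :=
  let p := mrep_hom_subproof f in
  @MultRep D C (fun a x => f a ** x) p.1 p.2.1 p.2.2.

Definition mrep_add_fun (S : cuntzIsometries C) (r s : multRep D C) a x :=
  iso1 S (r a (mult_adj (iso1 S) x)) + iso2 S (s a (mult_adj (iso2 S) x)).

Lemma mrep_add_subproof (S : cuntzIsometries C) (r s : multRep D C) :
  let f := mrep_add_fun S r s in
  (forall x, linear (f^~ x)) /\
  (forall a b x, f (a ** b) x = f a (f b x)) /\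
  (forall a x y, cstar (f a x) ** y = cstar x ** f (cstar a) y).
Proof.
rewrite /mrep_add_fun; split=> [x z a b|].
  by rewrite !mrep_linear !mult_linear scalerDr addrACA.
split=> [a b x|a x y].
- have adj1 := mult_add (mult_swap (iso1 S)).
  have adj2 := mult_add (mult_swap (iso2 S)).
  rewrite /= in adj1 adj2; rewrite adj1 adj2 !iso1K !iso2K iso12 iso21.
  by rewrite addr0 add0r !mrep_mul.
- rewrite cstarD cmulDl !mult_adjP !mrep_star cmulDr -!mult_adjP'.
  by [].
Qed.

Definition mrep_add (S : cuntzIsometries C) (r s : multRep D C) : multRep D C :=
  let p := mrep_add_subproof S r s in MultRep p.1 p.2.1 p.2.2.

Lemma cp_zero_subproof a x : mrep_zero a x - mrep_zero a x = (0 : C) ** x.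
Proof. by rewrite subrr cmul0l. Qed.

Definition cp_zero : cuntzPair D C :=
  @CuntzPair D C mrep_zero mrep_zero (fun=> 0) cp_zero_subproof.

Lemma cp_opp_subproof (x : cuntzPair D C) a y :
  cp_neg x a y - cp_pos x a y = - cp_diff x a ** y.
Proof. by rewrite cmulNl -cp_diffP opprB. Qed.

Definition cp_opp (x : cuntzPair D C) : cuntzPair D C :=
  @CuntzPair D C (cp_neg x) (cp_pos x) (fun a => - cp_diff x a)
    (cp_opp_subproof x).

(* [s k s^*], which lies in [C] *)
Definition mult_conj (s : multiplier C) (k : C) : C :=
  cstar (s (cstar (s k))).

Lemma mult_conjE (s : multiplier C) k x :
  mult_conj s k ** x = s (k ** mult_adj s x).
Proof. by rewrite /mult_conj mult_adjP cstarK mult_mul. Qed.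

Lemma cp_add_subproof S (x y : cuntzPair D C) a z :
  mrep_add S (cp_pos x) (cp_pos y) a z - mrep_add S (cp_neg x) (cp_neg y) a z =
  (mult_conj (iso1 S) (cp_diff x a) + mult_conj (iso2 S) (cp_diff y a)) ** z.
Proof.
rewrite /= /mrep_add_fun cmulDl !mult_conjE -!cp_diffP !mult_add !multN.
by rewrite opprD addrACA.
Qed.

(* [s_1 x s_1^* + s_2 y s_2^*] *)
Definition cp_add (S : cuntzIsometries C) (x y : cuntzPair D C) :
    cuntzPair D C :=
  CuntzPair (cp_add_subproof S x y).

Lemma cp_hom_subproof (f : starHom D C) a x :
  mrep_hom f a x - mrep_zero a x = f a ** x.
Proof. by rewrite /= subr0. Qed.

Definition cp_hom (f : starHom D C) : cuntzPair D C :=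
  CuntzPair (cp_hom_subproof f).

(* Strict continuity of the two *-homomorphisms, norm continuity of their
   difference; continuity of [t |-> x f_t(a)] is that of
   [t |-> f_t(a^* ) x^*]. *)
Definition cp_homotopic (x y : cuntzPair D C) : Prop :=
  exists h : R -> cuntzPair D C,
    [/\ h 0 = x, h 1 = y,
        (forall a c, {within `[0, 1], continuous (fun t => cp_pos (h t) a c)}),
        (forall a c, {within `[0, 1], continuous (fun t => cp_neg (h t) a c)})
      & forall a, {within `[0, 1], continuous (fun t => cp_diff (h t) a)}].

Definition kk_class (x : cuntzPair D C) : set (cuntzPair D C) :=
  [set y | cp_homotopic x y].

Implicit Types X Y : set (cuntzPair D C).

(* The sum of two classes does not depend on the choice of the isometries. *)
Definition kk_add X Y : set (cuntzPair D C) :=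
  [set z | exists (S : cuntzIsometries C) x y,
     [/\ X x, Y y & cp_homotopic (cp_add S x y) z]].

Definition kk_opp X : set (cuntzPair D C) :=
  [set z | exists2 x, X x & cp_homotopic (cp_opp x) z].

Definition kk_sub X Y := kk_add X (kk_opp Y).

Definition kk_natmul (n : nat) X := iter n (kk_add X) (kk_class cp_zero).

(* For a stable [C] = K (x) B, this is the image of the class of [f] under the
   stability isomorphism from KK(D, K (x) B) to KK(D, B). *)
Definition kk_hom (f : starHom D C) := kk_class (cp_hom f).

End Operations.

(* KK(D, B), where [C] is the stabilization of [B], that is the tensor product
   of the compact operators and [B]: the set of homotopy classes of Cuntz pairs
   from [D] to M(C). *)
Definition KK D C : set (set (cuntzPair D C)) := range (@kk_class D C).

End Multipliers.

Arguments KK {R} D C.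

(* Main.v *)
(* Unital endomorphisms of [D] are approximately inner, and [D] is generated by
   two commuting copies [gam D] and [bet D] of itself, which are exchanged,
   approximately, by unitaries that are close to a commutator, hence in the path
   component of the unit by K_1-injectivity.  For [C = K (x) A (x) D] this gives
   an endomorphism [g] of [C], a limit of conjugations by unitaries of
   [1 (x) 1 (x) D], whose range commutes with [1 (x) 1 (x) bet D].  By nuclearity,
   a homomorphism [s : D -> e C e] extends along [gam] to a homomorphism
   [gam a ** bet b |-> g (s a) (1 (x) 1 (x) bet b)] whose values on [bet D] depend
   only on [e]; the images under two such extensions of a unitary exchanging
   [gam] and [bet] intertwine the two homomorphisms on finite sets.  In the same
   way a unitary in the component of [e] which almost commutes with the image of
   [s] is joined to [e] through such unitaries, so that the intertwiners can be
   assembled into a continuous path.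

   For the second part, let [x] be a Cuntz pair.  Conjugation by the path from 1
   to [g], followed by the path from [gam] to [bet], joins [x] to a pair
   [(P bet, Q bet)], where [P] and [Q] are projections of M(C) commuting with
   [bet D] and [P - Q] is in [C].  Adding a degenerate pair, null-homotopic by a
   swindle, and conjugating by an isometry turns [Q] into [s_1 s_1^*]; spectral
   calculus then makes [P] equal to [Q] off a diagonal projection of finite
   rank.  What remains is a difference of two homomorphisms into [C], of which
   the second has unit equivalent to the unit of [n] copies of [iota], hence is
   homotopic to these copies by the first part. *)
Require Import Defs.
From HB Require Import structures.
From mathcomp Require Import all_boot all_order all_algebra complex.
From mathcomp Require Import all_classical all_reals topology normedtype.
From mathcomp Require Import sequences trigo ring lra.
From mathcomp Require finmap.
From Stdlib Require Ncring Ncring_tac.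

Set Implicit Arguments.
Unset Strict Implicit.
Unset Printing Implicit Defensive.

Import Order.TTheory GRing.Theory Num.Theory numFieldNormedType.Exports.
Import -(notations) Ncring.
Import -(notations) Ncring_tac.

Local Open Scope classical_set_scope.
Local Open Scope ring_scope.

(** * Identities in noncommutative rings and abelian groups *)

(** Functional calculus is built from the C*-identity alone: square roots, inverse square roots,
    signs and polar parts are limits of polynomial iterations, and self-adjointness or commutation
    pass to them because they hold along the iterates. Multipliers act on [C] and are never normed;
    strict continuity is continuity of the values.

    Approximate unitary equivalence gives unitaries but no paths. The paths come from
    K_1-injectivity: diag(v, v^* ) is joined to 1 by rotations, so a commutator is trivial in K_1
    and lies in the component of 1.

    The obstacle in the uniqueness part is that [e] is not invariant under conjugation by the
    unitaries of 1 (x) 1 (x) D. The intertwiners are found in the corner of [g e]; they are brought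
    back to that of [e] by undoing one of the conjugations that approximate [g] and rotating the
    resulting projection, which is close to [e], onto [e]. *)

Section NoncommutativeRing.
Context (S : pzRingType).

#[local] Instance nc_ops :
  @Ring_ops S 0 1 +%R *%R (fun x y => x - y) -%R eq := {}.

Lemma nc_ring : @Ring S _ _ _ _ _ _ _ nc_ops.
Proof.
constructor; try exact: RelationClasses.eq_equivalence;
  try (by move=> ? ? -> ? ? ->); try (by move=> ? ? ->);
  rewrite /addition/multiplication/zero/one/opposite/subtraction/equality/=;
  intros.
- exact: add0r.
- exact: addrC.
- exact: addrA.
- exact: mul1r.
- exact: mulr1.
- exact: mulrA.
- exact: mulrDl.
- exact: mulrDr.
- by [].
- exact: subrr.
Qed.

End NoncommutativeRing.

Ltac ncr := match goal with |- @eq ?T ?a ?b =>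
  let S := constr:(ltac:(exact: (T : pzRingType)) : pzRingType) in
  let o := fresh in pose (o := nc_ops S : @Ring_ops T 0 1 +%R *%R (fun x y => x - y) -%R eq);
  let r := fresh in pose proof (r := nc_ring S : @Ring T _ _ _ _ _ _ _ o);
  change (@equality T (@eq_notation T _ _ _ _ _ _ _ o) a b); non_commutative_ring end.


(* The square-zero extension of [Z] by an abelian group, through which
   [non_commutative_ring] decides the identities of abelian groups. *)
Section SquareZeroExtension.
Context (V : zmodType).

Definition szext : Type := (V * int)%type.
HB.instance Definition _ := GRing.Zmodule.on szext.

Definition szmul (x y : szext) : szext := (y.1 *~ x.2 + x.1 *~ y.2, x.2 * y.2).

Lemma szmulA : associative szmul.
Proof.
move=> [x a] [y b] [z c]; rewrite /szmul /= mulrA; congr pair.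
by rewrite !mulrzDl -!mulrzA addrA (mulrC b a) (mulrC c a).
Qed.
Lemma szmul1 : left_id ((0, 1) : szext) szmul.
Proof. by move=> [x a]; rewrite /szmul /= mul0rz addr0 mul1r mulr1z. Qed.
Lemma szmulr1 : right_id ((0, 1) : szext) szmul.
Proof. by move=> [x a]; rewrite /szmul /= mul0rz add0r mulr1 mulr1z. Qed.
Lemma szmulDl : left_distributive szmul +%R.
Proof.
move=> [x a] [y b] [z c]; rewrite /szmul /= mulrDl; congr pair.
by rewrite mulrzDl mulrzDr addrACA.
Qed.
Lemma szmulDr : right_distributive szmul +%R.
Proof.
move=> [x a] [y b] [z c]; rewrite /szmul /= mulrDr; congr pair.
by rewrite mulrzDl mulrzDr addrACA.
Qed.
HB.instance Definition _ := GRing.Zmodule_isPzRing.Build szext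
  szmulA szmul1 szmulr1 szmulDl szmulDr.

Definition szin (x : V) : szext := (x, 0).
Lemma szin_inj : injective szin. Proof. by move=> x y []. Qed.
Lemma szinD x y : szin (x + y) = szin x + szin y.
Proof. by congr pair. Qed.
Lemma szinN x : szin (- x) = - szin x.
Proof. by congr pair. Qed.
Lemma szin0 : szin 0 = 0. Proof. by []. Qed.

End SquareZeroExtension.

Ltac zmod := apply: szin_inj; rewrite ?(szinD, szinN, szin0); ncr.

(** * Norms of C*-algebras and the ring of multipliers *)

Section RealNorm.
Context {R : realType}.
Implicit Types V W : normedModType (complex R).

(** The norm takes its values in the scalars. Its real part carries the same information, by [nrmE],
    and lives in [R], where real arithmetic applies. *)
Definition nrm {V : normedZmodType (complex R)} (x : V) : R := complex.Re `|x|.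
Definition rc (r : R) : complex R := Complex r 0.

Lemma rcE r : rc r = r%:C%C. Proof. by []. Qed.
Lemma rcD r s : rc (r + s) = rc r + rc s. Proof. by rewrite !rcE rmorphD. Qed.
Lemma rcM r s : rc (r * s) = rc r * rc s. Proof. by rewrite !rcE rmorphM. Qed.
Lemma rcN r : rc (- r) = - rc r. Proof. by rewrite !rcE rmorphN. Qed.
Lemma rc0 : rc 0 = 0. Proof. by []. Qed.
Lemma rc1 : rc 1 = 1. Proof. by []. Qed.
Lemma le_rc r s : (rc r <= rc s) = (r <= s).
Proof. by rewrite /rc lecE /= eqxx. Qed.
Lemma lt_rc r s : (rc r < rc s) = (r < s).
Proof. by rewrite /rc ltcE /= eqxx. Qed.
Lemma rc_conj r : (rc r)^* = rc r.
Proof. by rewrite /rc /Num.conj /= oppr0. Qed.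

Lemma nrmE (V : normedZmodType (complex R)) (x : V) : `|x| = rc (nrm x).
Proof.
rewrite /nrm /rc; have := normr_ge0 x; rewrite lecE /= => /andP[/eqP h _].
by case: `|x| h => a b /= ->.
Qed.

Lemma nrm_ge0 (V : normedZmodType (complex R)) (x : V) : 0 <= nrm x.
Proof. by rewrite -le_rc -nrmE normr_ge0. Qed.

Lemma nrmD (V : normedZmodType (complex R)) (x y : V) :
  nrm (x + y) <= nrm x + nrm y.
Proof. by rewrite -le_rc rcD -!nrmE ler_normD. Qed.

Lemma nrmN (V : normedZmodType (complex R)) (x : V) : nrm (- x) = nrm x.
Proof. by rewrite /nrm normrN. Qed.

Lemma nrmB (V : normedZmodType (complex R)) (x y : V) :
  nrm (x - y) <= nrm x + nrm y.
Proof. by rewrite -(nrmN y) nrmD. Qed.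

Lemma nrmBC (V : normedZmodType (complex R)) (x y : V) :
  nrm (x - y) = nrm (y - x).
Proof. by rewrite -nrmN opprB. Qed.

Lemma nrm_tri (V : normedZmodType (complex R)) (z x y : V) :
  nrm (x - y) <= nrm (x - z) + nrm (z - y).
Proof. by rewrite -[x](subrK z) -addrA addrK nrmD. Qed.

Lemma nrm0 (V : normedZmodType (complex R)) : nrm (0 : V) = 0.
Proof. by rewrite /nrm normr0. Qed.

Lemma nrm_eq0 (V : normedZmodType (complex R)) (x : V) : nrm x = 0 -> x = 0.
Proof. by move=> h; apply/normr0_eq0; rewrite nrmE h. Qed.

Lemma nrm_le0 (V : normedZmodType (complex R)) (x : V) : nrm x <= 0 -> x = 0.
Proof. by move=> h; apply: nrm_eq0; apply/eqP; rewrite eq_le h nrm_ge0. Qed.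

Lemma nrmZ V (z : complex R) (x : V) : nrm (z *: x) = nrm z * nrm x.
Proof. by have := normrZ z x; rewrite !nrmE -rcM => -[]. Qed.

Lemma nrm_mul (z w : complex R) : nrm (z * w) = nrm z * nrm w.
Proof. by have := normrM z w; rewrite !nrmE -rcM => -[]. Qed.

Lemma nrm_rc r : nrm (rc r) = `|r|.
Proof. by rewrite /nrm rcE normc_def /= expr0n addr0 sqrtr_sqr. Qed.

Lemma nrm_sum (V : normedZmodType (complex R)) (I : Type) (s : seq I)
    (P : pred I) (F : I -> V) :
  nrm (\sum_(i <- s | P i) F i) <= \sum_(i <- s | P i) nrm (F i).
Proof.
elim/big_ind2: _ => //; first by rewrite nrm0.
by move=> x a y b xa yb; apply: le_trans (nrmD _ _) _; exact: lerD.
Qed.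

Lemma cvg_nrmP {I} (F : set_system I) {FF : Filter F} V (u : I -> V) l :
  u @ F --> l <-> forall e : R, 0 < e -> \forall x \near F, nrm (u x - l) < e.
Proof.
split.
- move=> /cvgrPdist_lt h e e0.
  have e0' : 0 < rc e by rewrite -rc0 lt_rc.
  by near=> x; rewrite nrmBC -lt_rc -nrmE; near: x; exact: h.
- move=> h; apply/cvgrPdist_lt => e e0.
  have eE : e = rc (complex.Re e).
    by move: e0; rewrite ltcE /= => /andP[/eqP h0 _]; case: e h0 => a b /= ->.
  near=> x; rewrite distrC nrmE eE lt_rc; near: x; apply: h.
  by rewrite -lt_rc -eE.
Unshelve. all: by end_near.
Qed.

End RealNorm.

Section CStarNorm.
Context {R : realType}.
Implicit Types A B C : cstarAlgType R.

Lemma cmulBl A (x y z : A) : (x - y) ** z = x ** z - y ** z.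
Proof. by rewrite cmulDl cmulNl. Qed.
Lemma cmulBr A (x y z : A) : z ** (x - y) = z ** x - z ** y.
Proof. by rewrite cmulDr cmulNr. Qed.
Lemma cstarB A (x y : A) : cstar (x - y) = cstar x - cstar y.
Proof. by rewrite cstarD cstarN. Qed.
Lemma cmul_suml A (I : Type) (s : seq I) (P : pred I) (F : I -> A) z :
  (\sum_(i <- s | P i) F i) ** z = \sum_(i <- s | P i) F i ** z.
Proof. by apply: (big_morph (fun x => x ** z)) => [x y|]; rewrite ?cmulDl ?cmul0l. Qed.
Lemma cmul_sumr A (I : Type) (s : seq I) (P : pred I) (F : I -> A) z :
  z ** (\sum_(i <- s | P i) F i) = \sum_(i <- s | P i) z ** F i.
Proof. by apply: (big_morph (fun x => z ** x)) => [x y|]; rewrite ?cmulDr ?cmul0r. Qed.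
Lemma cstar_sum A (I : Type) (s : seq I) (P : pred I) (F : I -> A) :
  cstar (\sum_(i <- s | P i) F i) = \sum_(i <- s | P i) cstar (F i).
Proof. by apply: (big_morph cstar) => [x y|]; rewrite ?cstarD ?cstar0. Qed.

Lemma nrmM A (x y : A) : nrm (x ** y) <= nrm x * nrm y.
Proof. by rewrite -le_rc rcM -!nrmE cnormM. Qed.

Lemma nrm_starM A (x : A) : nrm (cstar x ** x) = nrm x ^+ 2.
Proof. by have := cnorm_star x; rewrite !nrmE expr2 -rcM -expr2 => -[]. Qed.

Lemma nrm_star A (x : A) : nrm (cstar x) = nrm x.
Proof.
suff h (y : A) : nrm y <= nrm (cstar y).
  by apply/eqP; rewrite eq_le h -{2}[x]cstarK h.
have [->|y0] := eqVneq (nrm y) 0; first exact: nrm_ge0.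
have yp : 0 < nrm y by rewrite lt_def y0 nrm_ge0.
by rewrite -(ler_pM2r yp) -expr2 -nrm_starM nrmM.
Qed.

Lemma nrm_Mstar A (x : A) : nrm (x ** cstar x) = nrm x ^+ 2.
Proof. by rewrite -{1}[x]cstarK nrm_starM nrm_star. Qed.

(** Tested on y = x^*, the bound becomes |x|^2 <= c |x| by the C*-identity. Left multiplication is
    thus isometric, which stands in for a unit. *)
Lemma nrm_lmul A (x : A) c : 0 <= c ->
  (forall y, nrm (x ** y) <= c * nrm y) -> nrm x <= c.
Proof.
move=> c0 h; have [->//|x0] := eqVneq (nrm x) 0.
have xp : 0 < nrm x by rewrite lt_def x0 nrm_ge0.
by rewrite -(ler_pM2r xp) -expr2 -nrm_Mstar -(nrm_star x) h.
Qed.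

Lemma cmul_ext A (x y : A) : (forall z, x ** z = y ** z) -> x = y.
Proof.
move=> xy; apply/eqP; rewrite -subr_eq0; apply/eqP/nrm_le0.
by apply: nrm_lmul => // z; rewrite cmulBl xy subrr nrm0 mul0r.
Qed.

Lemma nrm_proj A (e : A) : projection e -> nrm e <= 1.
Proof.
case=> eS ee; have := nrm_starM e; rewrite eS ee => h.
have [->//|e0] := eqVneq (nrm e) 0.
have /(ler_pM2r) <- : 0 < nrm e by rewrite lt_def e0 nrm_ge0.
by rewrite -expr2 -h mul1r.
Qed.

Lemma proj_small A (e : A) : projection e -> nrm e < 1 -> e = 0.
Proof.
case=> eS ee; have := nrm_starM e; rewrite eS ee => h e1.
have [/nrm_eq0//|e0] := eqVneq (nrm e) 0.
have ep : 0 < nrm e by rewrite lt_def e0 nrm_ge0.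
by move: e1; rewrite -(ltr_pM2r ep) -expr2 -h mul1r ltxx.
Qed.

Lemma nrm_unitary A (e u : A) : projection e -> unitaries e u -> nrm u <= 1.
Proof.
move=> pe [_ _ uu _]; have := nrm_starM u; rewrite uu => h.
by rewrite -(ler_pXn2r (n := 2)) ?nnegrE ?nrm_ge0// -h expr1n nrm_proj.
Qed.

End CStarNorm.

(** * The ring of multipliers, and identities in algebras without unit *)

Section MultRing.
Context {R : realType} {C : cstarAlgType R}.
Local Notation M := (multiplier C).

(** The map determines its adjoint because the products w^* x separate the points of [C]. *)
Lemma mult_ext (m n : M) : (forall x, m x = n x) -> m = n.
Proof.
move=> h; have hf : mult_fun m = mult_fun n by apply/funext.
have ha : mult_adj m = mult_adj n.
  apply/funext => x; apply: cstar_mul_inj => w.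
  by rewrite -!mult_adjP h.
case: m n hf ha {h} => f f' p [g g' q] /= ff gg.
by case: _ / ff q; case: _ / gg => q; congr Multiplier; exact: Prop_irrelevance.
Qed.

HB.instance Definition _ := gen_eqMixin M.
HB.instance Definition _ := gen_choiceMixin M.

Lemma mzero_subproof (x y : C) : cstar (0 : C) ** y = cstar x ** 0.
Proof. by rewrite cstar0 cmul0l cmul0r. Qed.
Definition mzero : M := @Multiplier R C (fun=> 0) (fun=> 0) mzero_subproof.

Lemma madd_subproof (m n : M) (x y : C) :
  cstar (m x + n x) ** y = cstar x ** (mult_adj m y + mult_adj n y).
Proof. by rewrite cstarD cmulDl cmulDr !mult_adjP. Qed.
Definition madd (m n : M) : M :=
  @Multiplier R C (fun x => m x + n x) (fun x => mult_adj m x + mult_adj n x)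
    (madd_subproof m n).

Lemma mopp_subproof (m : M) (x y : C) :
  cstar (- m x) ** y = cstar x ** (- mult_adj m y).
Proof. by rewrite cstarN cmulNl cmulNr !mult_adjP. Qed.
Definition mopp (m : M) : M :=
  @Multiplier R C (fun x => - m x) (fun x => - mult_adj m x) (mopp_subproof m).

Lemma mmul_subproof (m n : M) (x y : C) :
  cstar (m (n x)) ** y = cstar x ** (mult_adj n (mult_adj m y)).
Proof. by rewrite !mult_adjP. Qed.
Definition mmul (m n : M) : M :=
  @Multiplier R C (fun x => m (n x)) (fun x => mult_adj n (mult_adj m x))
    (mmul_subproof m n).

Lemma mone_subproof (x y : C) : cstar x ** y = cstar x ** y.
Proof. by []. Qed.
Definition mone : M := @Multiplier R C id id mone_subproof.

Lemma maddA : associative madd.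
Proof. by move=> x y z; apply: mult_ext => c /=; rewrite addrA. Qed.
Lemma maddC : commutative madd.
Proof. by move=> x y; apply: mult_ext => c /=; rewrite addrC. Qed.
Lemma madd0 : left_id mzero madd.
Proof. by move=> x; apply: mult_ext => c /=; rewrite add0r. Qed.
Lemma maddN : left_inverse mzero mopp madd.
Proof. by move=> x; apply: mult_ext => c /=; rewrite addNr. Qed.
HB.instance Definition _ := GRing.isZmodule.Build M maddA maddC madd0 maddN.

Lemma mmulA : associative mmul.
Proof. by move=> x y z; apply: mult_ext. Qed.
Lemma mmul1 : left_id mone mmul.
Proof. by move=> x; apply: mult_ext. Qed.
Lemma mmulr1 : right_id mone mmul.
Proof. by move=> x; apply: mult_ext. Qed.
Lemma mmulDl : left_distributive mmul madd.
Proof. by move=> x y z; apply: mult_ext. Qed.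
Lemma mmulDr : right_distributive mmul madd.
Proof. by move=> x y z; apply: mult_ext => c /=; rewrite mult_add. Qed.
HB.instance Definition _ := GRing.Zmodule_isPzRing.Build M
  mmulA mmul1 mmulr1 mmulDl mmulDr.

Lemma mult_addE (m n : M) x : (m + n) x = m x + n x. Proof. by []. Qed.
Lemma mult_oppE (m : M) x : (- m) x = - m x. Proof. by []. Qed.
Lemma mult_mulE (m n : M) x : (m * n) x = m (n x). Proof. by []. Qed.
Lemma mult_oneE x : (1 : M) x = x. Proof. by []. Qed.
Lemma mult_zeroE x : (0 : M) x = 0. Proof. by []. Qed.
Definition multE := (mult_addE, mult_oppE, mult_mulE, mult_oneE, mult_zeroE).

Lemma msc_subproof (z : complex R) (x y : C) :
  cstar (z *: x) ** y = cstar x ** (z^* *: y).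
Proof. by rewrite cstarZ cmulZl cmulZr. Qed.
Definition msc (z : complex R) : M :=
  @Multiplier R C (fun x => z *: x) (fun x => z^* *: x) (msc_subproof z).

Definition mstar (m : M) : M := mult_swap m.

Lemma ml_subproof (c : C) (x y : C) :
  cstar (c ** x) ** y = cstar x ** (cstar c ** y).
Proof. by rewrite cstarM cmulA. Qed.
Definition ml (c : C) : M :=
  @Multiplier R C (fun x => c ** x) (fun x => cstar c ** x) (ml_subproof c).

End MultRing.

Section MlTheory.
Context {R : realType} {C : cstarAlgType R}.
Implicit Types (x y : C) (m n : multiplier C).

Lemma ml_inj : injective (@ml R C).
Proof. by move=> x y h; apply: cmul_ext => z; exact: (congr1 (fun m : multiplier C => m z) h). Qed.
Lemma mlD x y : ml (x + y) = ml x + ml y.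
Proof. by apply: mult_ext => c; rewrite /= cmulDl. Qed.
Lemma mlN x : ml (- x) = - ml x.
Proof. by apply: mult_ext => c; rewrite /= cmulNl. Qed.
Lemma mlM x y : ml (x ** y) = ml x * ml y.
Proof. by apply: mult_ext => c; rewrite /= -cmulA. Qed.
Lemma ml0 : ml 0 = 0 :> multiplier C.
Proof. by apply: mult_ext => c; rewrite /= cmul0l. Qed.

End MlTheory.

(** [C] has no unit, so its identities are decided in the ring of multipliers, into which it embeds
    by [ml]. *)
Ltac cring := apply: ml_inj; rewrite ?(mlD, mlN, mlM, ml0); ncr.


(** * Limits in norm and the contraction principle *)

Section Limits.
Context {R : realType}.
Implicit Types A B C : cstarAlgType R.
Implicit Types V : normedModType (complex R).

Lemma cvg_cmul A I (F : set_system I) {FF : Filter F} (u v : I -> A) a b :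
  u @ F --> a -> v @ F --> b -> (fun x => u x ** v x) @ F --> a ** b.
Proof.
move=> /cvg_nrmP ua /cvg_nrmP vb; apply/cvg_nrmP => e e0.
pose M := nrm a + nrm b + 1; have M0 : 0 < M.
  by rewrite /M; have := nrm_ge0 a; have := nrm_ge0 b; lra.
pose d := Num.min 1 (e / (2 * M)); have d0 : 0 < d.
  by rewrite /d lt_min ltr01 divr_gt0 ?mulr_gt0.
have dM : d * M <= e / 2.
  have : d <= e / (2 * M) by rewrite /d ge_min lexx orbT.
  by rewrite ler_pdivlMr ?mulr_gt0//; lra.
have d1 : d <= 1 by rewrite /d ge_min lexx.
near=> x.
have h1 : nrm (u x - a) < d by near: x; exact: ua.
have h2 : nrm (v x - b) < d by near: x; exact: vb.
have -> : u x ** v x - a ** b = (u x - a) ** (v x - b) + (a ** (v x - b) + (u x - a) ** b).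
  by cring.
apply: le_lt_trans (nrmD _ _) _.
have := nrmM (u x - a) (v x - b).
have := nrmD (a ** (v x - b)) ((u x - a) ** b).
have := nrmM a (v x - b); have := nrmM (u x - a) b.
have := nrm_ge0 a; have := nrm_ge0 b; have := nrm_ge0 (u x - a); have := nrm_ge0 (v x - b).
set p := nrm (u x - a) in h1 *; set q := nrm (v x - b) in h2 *.
rewrite /M in dM; move: (nrm a) (nrm b) dM => na nb dM q0 p0 b0 a0 *.
have : p * q <= d by nra. have : na * q <= na * d by nra. have : p * nb <= d * nb by nra.
nra.
Unshelve. all: by end_near.
Qed.




Lemma cvg_cstar A I (F : set_system I) {FF : Filter F} (u : I -> A) a :
  u @ F --> a -> (fun x => cstar (u x)) @ F --> cstar a.
Proof.
move=> /cvg_nrmP ua; apply/cvg_nrmP => e e0; near=> x.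
by rewrite -cstarB nrm_star; near: x; exact: ua.
Unshelve. all: by end_near.
Qed.

Lemma cvg_nrm_le V I (F : set_system I) {FF : ProperFilter F} (u : I -> V) (l : V) c :
  u @ F --> l -> (\forall x \near F, nrm (u x) <= c) -> nrm l <= c.
Proof.
move=> /cvg_nrmP ul h; rewrite leNgt; apply/negP => cl.
have e0 : 0 < nrm l - c by lra.
have : \forall x \near F, False.
  near=> x; have : nrm (u x) <= c by near: x.
  have : nrm (u x - l) < nrm l - c by near: x; exact: ul.
  by have := nrm_tri (u x) l 0; rewrite !subr0 nrmBC => ? ? ?; lra.
by move=> /filter_ex[].
Unshelve. all: by end_near.
Qed.

Lemma cvg_eq0 V I (F : set_system I) {FF : ProperFilter F} (u v : I -> V) (a b : V) :
  u @ F --> a -> v @ F --> b -> (\forall x \near F, u x = v x) -> a = b.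
Proof.
move=> ua vb uv; apply/eqP; rewrite -subr_eq0; apply/eqP/nrm_le0.
apply: (@cvg_nrm_le _ _ F _ (u \- v)); first exact: cvgB.
by near=> x; rewrite /= (_ : u x = v x) ?subrr ?nrm0//; near: x.
Unshelve. all: by end_near.
Qed.

Lemma cauchy_nrm (V : completeNormedModType (complex R)) (u : nat -> V) :
  (forall e : R, 0 < e -> exists N, forall m n, (N <= m)%N -> (N <= n)%N ->
    nrm (u m - u n) < e) -> exists l : V, u @ \oo --> l.
Proof.
move=> h; suff : cvg (u @ \oo) by move=> ?; exists (lim (u @ \oo)).
apply: cauchy_cvg; apply: cauchy_exP => e e0.
have eE : e = rc (complex.Re e).
  by move: e0; rewrite ltcE /= => /andP[/eqP h0 _]; case: e h0 => a b /= ->.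
have [|N hN] := h (complex.Re e); first by rewrite -lt_rc -eE.
exists (u N); exists N => // n /= Nn.
by rewrite -ball_normE /ball_ /= nrmE eE lt_rc; apply: hN.
Qed.

Lemma geo_small (c e : R) : 0 <= c < 1 -> 0 < e -> exists N, c ^+ N < e.
Proof.
move=> /andP[c0 c1] e0.
have : (fun n => c ^+ n) @ \oo --> (0 : R) by apply: cvg_expr; rewrite ger0_norm.
move=> /cvgrPdist_lt /(_ _ e0) [N _ /(_ N (leqnn N))].
by rewrite /= sub0r normrN ger0_norm ?exprn_ge0// => ?; exists N.
Qed.

Definition seq_closed (T : topologicalType) (P : set T) :=
  forall (u : nat -> T) (l : T), (forall n, P (u n)) -> u @ \oo --> l -> P l.

(** The last clause does the work of functional calculus: a closed condition that holds at 0 and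
    survives the iteration, such as self-adjointness, commutation or lying in a corner, holds at the
    fixed point. *)
Lemma contraction_fixpoint_nrm (V : completeNormedModType (complex R)) (F : V -> V) (r c : R) :
  0 <= r -> 0 <= c < 1 ->
  (forall x, nrm x <= r -> nrm (F x) <= r) ->
  (forall x y, nrm x <= r -> nrm y <= r ->
     nrm (F x - F y) <= c * nrm (x - y)) ->
  exists y, [/\ nrm y <= r, F y = y
    & forall P : set V, seq_closed P -> P 0 ->
        (forall x, nrm x <= r -> P x -> P (F x)) -> P y].
Proof.
move=> r0 /andP[c0 c1] Fr Fc.
pose u n := iter n F 0.
have ur n : nrm (u n) <= r by elim: n => [|n ih]; rewrite /= ?nrm0 ?Fr.
have uc n m : nrm (u (n + m)%N - u n) <= c ^+ n * (2 * r).
  elim: n => [|n ih].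
    rewrite expr0 mul1r; apply: le_trans (nrmB _ _) _.
    by have := ur (0 + m)%N; have := ur 0%N; lra.
  rewrite addSn /= exprS -mulrA.
  by apply: le_trans (Fc _ _ (ur _) (ur _)) _; rewrite ler_wpM2l.
have [l ul] : exists l : V, u @ \oo --> l.
  apply: cauchy_nrm => e e0.
  have [||N hN] := @geo_small c (e / 2 / (2 * r + 1)); first by rewrite c0.
    by apply: divr_gt0; lra.
  have hN' : c ^+ N * (2 * r) < e / 2.
    have : c ^+ N * (2 * r + 1) < e / 2 by rewrite -ltr_pdivlMr//; lra.
    by have := exprn_ge0 N c0; lra.
  exists N => m n Nm Nn.
  have := uc N (m - N)%N; have := uc N (n - N)%N; rewrite !subnKC//.
  by have := nrm_tri (u N) (u m) (u n); rewrite (nrmBC (u N)); lra.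
have lr : nrm l <= r by apply: (cvg_nrm_le ul); near=> n.
have ul' : (fun n => u n.+1) @ \oo --> l by rewrite (cvg_shiftS u).
have Ful : (fun n => u n.+1) @ \oo --> F l.
  apply/cvg_nrmP => e e0; move/cvg_nrmP: ul => /(_ _ e0) h.
  near=> n; apply: le_lt_trans (Fc _ _ (ur _) lr) _.
  have h1 : nrm (u n - l) < e by near: n.
  by have := nrm_ge0 (u n - l); nra.
exists l; split=> //; first by apply: (cvg_eq0 Ful ul'); near=> n.
move=> P Pc P0 PF; apply: (Pc u) ul => n.
by elim: n => //= n ih; apply: PF.
Unshelve. all: by end_near.
Qed.

End Limits.

(** * Square roots and faithful representations *)

Section Halving.
Context {R : realType}.
Implicit Types V : normedModType (complex R).

Definition hf {V : lmodType (complex R)} (x : V) : V := rc 2^-1 *: x.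

Lemma hfD (V : lmodType (complex R)) (x : V) : hf x + hf x = x.
Proof.
rewrite /hf -scalerDl -rcD (_ : 2^-1 + 2^-1 = 1); last by field.
by rewrite rc1 scale1r.
Qed.

Lemma hf_add (V : lmodType (complex R)) (x : V) : hf (x + x) = x.
Proof. by rewrite /hf scalerDr hfD. Qed.

Lemma hfB (V : lmodType (complex R)) (x y : V) : hf (x - y) = hf x - hf y.
Proof. by rewrite /hf scalerBr. Qed.

Lemma nrm_hf V (x : V) : nrm (hf x) = nrm x / 2.
Proof. by rewrite /hf nrmZ nrm_rc ger0_norm ?invr_ge0// mulrC. Qed.

Lemma cvg_hf V I (F : set_system I) {FF : Filter F} (u : I -> V) a :
  u @ F --> a -> (fun x => hf (u x)) @ F --> hf a.
Proof. by move=> h; apply: cvgZl_tmp. Qed.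

End Halving.

Section MultTheory.
Context {R : realType} {C : cstarAlgType R}.
Implicit Types (m n : multiplier C) (x y : C).

Lemma mscC z m : msc z * m = m * msc z.
Proof. by apply: mult_ext => c; rewrite /= mult_scale. Qed.
Lemma mscM z w : msc (z * w) = msc z * msc w :> multiplier C.
Proof. by apply: mult_ext => c; rewrite /= scalerA. Qed.
Lemma mscD z w : msc (z + w) = msc z + msc w :> multiplier C.
Proof. by apply: mult_ext => c; rewrite /= scalerDl. Qed.
Lemma mscN z : msc (- z) = - msc z :> multiplier C.
Proof. by apply: mult_ext => c; rewrite /= scaleNr. Qed.
Lemma msc1 : msc 1 = 1 :> multiplier C.
Proof. by apply: mult_ext => c; rewrite /= scale1r. Qed.
Lemma msc0 : msc 0 = 0 :> multiplier C.
Proof. by apply: mult_ext => c; rewrite /= scale0r. Qed.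
Lemma mlZ z x : ml (z *: x) = msc z * ml x.
Proof. by apply: mult_ext => c; rewrite /= cmulZl. Qed.
Lemma mstar_msc z : mstar (msc z) = msc z^* :> multiplier C.
Proof. by apply: mult_ext. Qed.
Lemma mstar_ml x : mstar (ml x) = ml (cstar x).
Proof. by apply: mult_ext. Qed.
Lemma mstarK m : mstar (mstar m) = m. Proof. exact: mult_ext. Qed.
Lemma mstarM m n : mstar (m * n) = mstar n * mstar m. Proof. exact: mult_ext. Qed.
Lemma mstarD m n : mstar (m + n) = mstar m + mstar n. Proof. exact: mult_ext. Qed.
Lemma mstarN m : mstar (- m) = - mstar m. Proof. exact: mult_ext. Qed.
Lemma mstar1 : mstar 1 = 1 :> multiplier C. Proof. exact: mult_ext. Qed.
Lemma mstar0 : mstar 0 = 0 :> multiplier C. Proof. exact: mult_ext. Qed.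
Lemma mult_starl m x y : cstar (m x) ** y = cstar x ** mstar m y.
Proof. exact: mult_adjP. Qed.
Lemma mult_starr m x y : cstar x ** m y = cstar (mstar m x) ** y.
Proof. by rewrite mult_starl mstarK. Qed.
Lemma mult_sub m x y : m (x - y) = m x - m y.
Proof. by rewrite mult_add multN. Qed.

Lemma nrm_isometry m x : mstar m * m = 1 -> nrm (m x) = nrm x.
Proof.
move=> h; apply/eqP; rewrite -(eqrXn2 (n := 2)) ?nrm_ge0// -!nrm_starM.
by rewrite mult_starl -mult_mulE h.
Qed.

Definition mhalf : multiplier C := msc (rc 2^-1).
Lemma ml_hf x : ml (hf x) = mhalf * ml x. Proof. exact: mlZ. Qed.

End MultTheory.

(** * Square roots inside the unit ball *)

Section SquareRoots.
Context {R : realType}.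
Implicit Types A : cstarAlgType R.

(** The fixed point is y = 1 - (1 - k)^(1/2): the equation is (1 - y)^2 = 1 - k, written without a
    unit. *)
Lemma sqrt_contraction A (k : A) : nrm k < 1 -> exists y : A,
  y + y = k + y ** y /\
  forall P : set A, seq_closed P -> P 0 ->
     (forall x, P x -> P (hf (k + x ** x))) -> P y.
Proof.
move=> k1; have k0 := nrm_ge0 k.
have [||x xk|x y xk yk|y [yk yE yP]] :=
  @contraction_fixpoint_nrm _ A (fun y => hf (k + y ** y)) (nrm k) (nrm k) => //.
- by rewrite k0.
- rewrite nrm_hf; have := nrmD k (x ** x); have := nrmM x x.
  have := nrm_ge0 x; nra.
- rewrite -hfB nrm_hf.
  have -> : k + x ** x - (k + y ** y) = (x - y) ** x + y ** (x - y) by cring.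
  have := nrmD ((x - y) ** x) (y ** (x - y)).
  have := nrmM (x - y) x; have := nrmM y (x - y); have := nrm_ge0 (x - y).
  nra.
exists y; split; first by rewrite -{1 2}yE hfD.
by move=> P Pc P0 PF; apply: yP => // x _; exact: PF.
Qed.

Lemma seq_closed_and (T : topologicalType) (P Q : set T) :
  seq_closed P -> seq_closed Q -> seq_closed (P `&` Q).
Proof.
move=> Pc Qc u l uPQ ul; split; [apply: (Pc u)|apply: (Qc u)] => // n.
  by case: (uPQ n).
by case: (uPQ n).
Qed.

Lemma seq_closed_star A : seq_closed [set y : A | cstar y = y].
Proof.
move=> u l us ul; apply: (@cvg_eq0 _ _ _ \oo _ (cstar \o u) u) => //.
  exact: cvg_cstar.
by near=> n; rewrite /= us.
Unshelve. all: by end_near.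
Qed.

Lemma seq_closed_comm A (h : A) : seq_closed [set y : A | h ** y = y ** h].
Proof.
move=> u l us ul; apply: (@cvg_eq0 _ _ _ \oo _ (fun n => h ** u n) (fun n => u n ** h)).
- by apply: cvg_cmul => //; exact: cvg_cst.
- by apply: cvg_cmul => //; exact: cvg_cst.
- by near=> n; rewrite us.
Unshelve. all: by end_near.
Qed.

Lemma hf_star A (x : A) : cstar (hf x) = hf (cstar x).
Proof. by rewrite /hf cstarZ rc_conj. Qed.
Lemma hf_mull A (x y : A) : x ** hf y = hf (x ** y).
Proof. exact: cmulZr. Qed.
Lemma hf_mulr A (x y : A) : hf x ** y = hf (x ** y).
Proof. exact: cmulZl. Qed.

Lemma comm_sq A (h x : A) : h ** x = x ** h -> h ** (x ** x) = x ** x ** h.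
Proof. by move=> hx; rewrite cmulA hx -cmulA hx cmulA. Qed.

Lemma sqrt_contraction_sa A (k h : A) : nrm k < 1 -> cstar k = k ->
  h ** k = k ** h ->
  exists y : A, [/\ y + y = k + y ** y, cstar y = y & h ** y = y ** h].
Proof.
move=> k1 ks hk; have [y [yE yP]] := sqrt_contraction k1; exists y; split=> //.
- apply: (yP [set y | cstar y = y]) => [||x /= xs].
  + exact: seq_closed_star.
  + exact: cstar0.
  + by rewrite hf_star cstarD cstarM ks xs.
- apply: (yP [set y | h ** y = y ** h]) => [||x /= xs].
  + exact: seq_closed_comm.
  + by rewrite /= cmul0l cmul0r.
  + by rewrite hf_mull hf_mulr cmulDl cmulDr hk comm_sq.
Qed.

(* [1 - z] has norm at most 1 as a multiplier. *)
Definition subunit A (z : A) := forall a, nrm (a - z ** a) <= nrm a.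

(* Writing [q = sin], [1 - y = cos], the multiplier [cos + i sin] is unitary,
   and [1 - 2 sin^2] is the real part of its square. *)
Lemma subunit_square A (q : A) : cstar q = q -> nrm q < 1 -> subunit (q ** q).
Proof.
move=> qs q1.
have k1 : nrm (q ** q) < 1.
  by rewrite -{1}qs nrm_starM expr_lt1// nrm_ge0.
have [||y [yE ys qy]] := @sqrt_contraction_sa A (q ** q) q k1.
- by rewrite cstarM qs.
- by rewrite cmulA.
pose I : multiplier A := msc 'i%C.
pose U : multiplier A := 1 - ml y + I * ml q.
pose U' : multiplier A := 1 - ml y - I * ml q.
have II : I * I = -1 by rewrite -mscM -expr2 sqr_i mscN msc1.
have IC m : I * m = m * I by exact: mscC.
have YQ : ml q * ml y = ml y * ml q by rewrite -!mlM qy.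
have YY : ml y * ml y = ml y + ml y - ml q * ml q.
  by rewrite -mlD yE mlD !mlM; ncr.
have US : mstar U = U'.
  rewrite /U /U' !(mstarD, mstarN, mstar1, mstar_ml, mstarM) mstar_msc.
  rewrite ys qs (_ : 'i%C^* = - 'i%C); last by rewrite conjCi.
  by rewrite mscN -/I mulrN -IC.
have US' : mstar U' = U by rewrite -US mstarK.
have UU : U' * U = 1.
  have -> : U' * U = 1 - ml y - ml y + ml y * ml y + I * ml q - ml y * (I * ml q)
     - I * ml q + I * (ml q * ml y) - I * ml q * (I * ml q) by rewrite /U /U'; ncr.
  rewrite YQ YY -[I * ml q * _]mulrA [ml q * (I * _)]mulrA -IC -[I * _ * ml q]mulrA.
  rewrite [I * (I * _)]mulrA II [ml y * (I * _)]mulrA -IC -[I * _ * ml q]mulrA; ncr.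
have UU' : U * U' = 1.
  have -> : U * U' = 1 - ml y - ml y + ml y * ml y - I * ml q + ml y * (I * ml q)
     + I * ml q - I * (ml q * ml y) - I * ml q * (I * ml q) by rewrite /U /U'; ncr.
  rewrite YQ YY -[I * ml q * _]mulrA [ml q * (I * _)]mulrA -IC -[I * _ * ml q]mulrA.
  rewrite [I * (I * _)]mulrA II [ml y * (I * _)]mulrA -IC -[I * _ * ml q]mulrA; ncr.
have nU v : nrm (U v) = nrm v by apply: nrm_isometry; rewrite US.
have nU' v : nrm (U' v) = nrm v by apply: nrm_isometry; rewrite US'.
have key : U * U + U' * U' = 1 + 1 - (ml q * ml q + ml q * ml q)
   - (ml q * ml q + ml q * ml q).
  have -> : U * U + U' * U' = 1 + 1 - (ml y + ml y) - (ml y + ml y)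
     + (ml y * ml y + ml y * ml y) + (I * ml q * (I * ml q) + I * ml q * (I * ml q)).
    by rewrite /U /U'; ncr.
  rewrite YY -[I * ml q * _]mulrA [ml q * (I * _)]mulrA -IC -[I * _ * ml q]mulrA.
  by rewrite [I * (I * _)]mulrA II; ncr.
move=> a; have : a - q ** q ** a = hf (a + hf (U (U a) + U' (U' a))).
  have -> : U (U a) + U' (U' a) = (U * U + U' * U') a by [].
  rewrite key !multE /= -[LHS]hf_add; congr hf.
  have -> : a + a - (q ** (q ** a) + q ** (q ** a)) - (q ** (q ** a) + q ** (q ** a))
    = (a - q ** (q ** a) - q ** (q ** a)) + (a - q ** (q ** a) - q ** (q ** a)) by cring.
  by rewrite hf_add -cmulA; cring.
move=> ->; rewrite nrm_hf.
have := nrmD a (hf (U (U a) + U' (U' a))); rewrite nrm_hf.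
have := nrmD (U (U a)) (U' (U' a)); rewrite !nU !nU'.
by have := nrm_ge0 a; lra.
Qed.

End SquareRoots.

(** * Square roots on the boundary of the unit ball *)

Section BorderlineSquareRoot.
Context {R : realType}.
Implicit Types A : cstarAlgType R.

Lemma cvg_rcZ (V : normedModType (complex R)) I (F : set_system I) {FF : Filter F}
    (r : I -> R) (s : R) (u : I -> V) (a : V) :
  r @ F --> s -> u @ F --> a -> (fun x => rc (r x) *: u x) @ F --> rc s *: a.
Proof.
move=> /cvgrPdist_lt rs /cvg_nrmP ua; apply/cvg_nrmP => e e0.
pose M := `|s| + nrm a + 1; have M0 : 0 < M.
  by rewrite /M; have := nrm_ge0 a; have := normr_ge0 s; lra.
pose d := Num.min 1 (e / (2 * M)); have d0 : 0 < d.
  by rewrite /d lt_min ltr01 divr_gt0 ?mulr_gt0.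
have dM : d * M <= e / 2.
  have : d <= e / (2 * M) by rewrite /d ge_min lexx orbT.
  by rewrite ler_pdivlMr ?mulr_gt0//; lra.
have d1 : d <= 1 by rewrite /d ge_min lexx.
near=> x.
have h1 : `|s - r x| < d by near: x; exact: rs.
have h2 : nrm (u x - a) < d by near: x; exact: ua.
have -> : rc (r x) *: u x - rc s *: a = rc (r x - s) *: (u x - a) +
    (rc (r x - s) *: a + rc s *: (u x - a)).
  by rewrite rcD rcN !scalerBl !scalerBr; zmod.
apply: le_lt_trans (nrmD _ _) _.
have := nrmD (rc (r x - s) *: a) (rc s *: (u x - a)); rewrite !nrmZ !nrm_rc distrC.
have := nrm_ge0 a; have := nrm_ge0 (u x - a); have := normr_ge0 s.
have := normr_ge0 (s - r x).
move: `|s - r x| (nrm (u x - a)) h1 h2 => p q h1 h2 p0 s0 q0 a0 h.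
have : p * q <= d * 1 by apply: ler_pM; lra.
have : p * nrm a <= d * nrm a by apply: ler_wpM2r; lra.
have : `|s| * q <= `|s| * d by apply: ler_wpM2l; lra.
by rewrite /M in dM; lra.
Unshelve. all: by end_near.
Qed.

(** The scalar iterates of t |-> (1 + t^2) / 2, which increase to the double fixed point 1. They
    majorise the operator iterates below. *)
Fixpoint sqm (n : nat) : R :=
  if n is n'.+1 then (1 + sqm n' ^+ 2) / 2 else 0.

Lemma sqm_bounds n : 0 <= sqm n <= sqm n.+1 /\ sqm n <= 1.
Proof.
elim: n => [|n [/andP[h0 h1] h2]] /=; first by rewrite expr0n /=; split; lra.
have h3 : 0 <= (sqm n - 1) ^+ 2 by exact: sqr_ge0.
split; last by nra.
by apply/andP; split; [nra|rewrite ler_pM2r ?invr_gt0// lerD2l ler_sqr ?nnegrE //; nra].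
Qed.

Lemma sqm_ge0 n : 0 <= sqm n. Proof. by have [/andP[]] := sqm_bounds n. Qed.
Lemma sqm_le1 n : sqm n <= 1. Proof. by have [] := sqm_bounds n. Qed.
Lemma sqm_incr n : sqm n <= sqm n.+1.
Proof. by have [/andP[]] := sqm_bounds n. Qed.
Lemma sqm_mono m n : (m <= n)%N -> sqm m <= sqm n.
Proof. by move=> /subnK <-; elim: (n - m)%N => //= k ih; apply: le_trans (sqm_incr _). Qed.

Lemma sqm_cvg : sqm @ \oo --> (1 : R).
Proof.
have /cvg_ex[/= l hl] : cvgn sqm.
  apply: nondecreasing_is_cvgn; first by move=> m n; exact: sqm_mono.
  by exists 1 => _ [n _ <-]; exact: sqm_le1.
have h2 : (fun n => sqm n.+1) @ \oo --> (1 + l ^+ 2) / 2.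
  by apply: cvgMl; apply: cvgD; [exact: cvg_cst|rewrite expr2; apply: cvgM].
have h1 : (fun n => sqm n.+1) @ \oo --> l by rewrite (cvg_shiftS sqm).
suff <- : l = 1 by [].
have : l = (1 + l ^+ 2) / 2 by apply: (cvg_unique _ h1 h2).
by move=> h; apply/eqP; rewrite -subr_eq0 -sqrf_eq0; apply/eqP; nra.
Qed.

(* The iterates are polynomials without constant term in [z]; with
   [k = 1 - z] they are [t_n - y_n(k)], where [y_n] has nonnegative
   coefficients and [y_n(1) = t_n]. *)
Fixpoint sqw A (z : A) (n : nat) : A :=
  if n is n'.+1 then
    let w := sqw z n' in hf (z + rc (sqm n') *: (w + w) - w ** w)
  else 0.

(** With |1 - z| <= 1 the iteration of [sqrt_contraction] is no longer a strict contraction.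
    Convergence comes from domination instead: the iterates y_n of 1 - z satisfy |y_m - y_n| <= t_m
    - t_n, and the scalar sequence t_n converges. *)
Lemma sqrt_subunit A (z : A) : subunit z -> exists w : A,
  [/\ w ** w = z, subunit w
    & forall P : set A, seq_closed P -> P 0 ->
      (forall t x, P x -> P (hf (z + rc t *: (x + x) - x ** x))) -> P w].
Proof.
move=> zs.
pose y n : multiplier A := msc (rc (sqm n)) - ml (sqw z n).
have yS n : y n.+1 = mhalf * ((1 - ml z) + y n * y n).
  rewrite /y /=; set t := sqm n; set w := sqw z n.
  have -> : msc (rc ((1 + t ^+ 2) / 2)) =
     mhalf * (1 + msc (rc t) * msc (rc t)) :> multiplier A.
    by rewrite mulrC rcM mscM rcD mscD rc1 msc1 expr2 rcM mscM.
  rewrite ml_hf !(mlD, mlN, mlZ, mlM).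
  have tC : ml w * msc (rc t) = msc (rc t) * ml w by rewrite mscC.
  rewrite -mulrBr; congr (_ * _).
  transitivity (1 - ml z + (msc (rc t) * msc (rc t) - msc (rc t) * ml w
    - ml w * msc (rc t) + ml w * ml w)); last by ncr.
  by rewrite tC; ncr.
have mh (a : A) : nrm (mhalf a) = nrm a / 2 by exact: nrm_hf.
have yb n a : nrm (y n a) <= sqm n * nrm a.
  elim: n a => [|n ih] a.
    by rewrite /y /= rc0 scale0r cmul0l subrr nrm0 mul0r.
  have -> : y n.+1 a = mhalf ((a - z ** a) + y n (y n a)) by rewrite yS.
  rewrite mh.
  have := nrmD (a - z ** a) (y n (y n a)); have := zs a; have := ih a.
  have := ih (y n a); have := ler_wpM2l (sqm_ge0 n) (ih a).
  by rewrite /= mulrA -expr2; lra.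
(* By induction: y_(n+2) - y_(n+1) is half the difference of two squares, which splits as (y_(n+1) -
   y_n) y_(n+1) + y_n (y_(n+1) - y_n), exactly as for the scalars t_n. *)
have yd n a : nrm (y n.+1 a - y n a) <= (sqm n.+1 - sqm n) * nrm a.
  elim: n a => [|n ih] a.
    have -> : y 0%N a = 0 by rewrite /y /= rc0 scale0r cmul0l subrr.
    by rewrite subr0 /= subr0; exact: (yb 1%N).
  have -> : y n.+2 a - y n.+1 a =
      mhalf ((y n.+1 - y n) (y n.+1 a) + y n ((y n.+1 - y n) a)).
    transitivity ((y n.+2 - y n.+1) a) => //.
    have -> : y n.+2 - y n.+1 = mhalf * (1 - ml z + y n.+1 * y n.+1)
        - mhalf * (1 - ml z + y n * y n) by rewrite -!yS.
    rewrite -mulrBr mult_mulE; congr (mhalf _).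
    transitivity (((y n.+1 - y n) * y n.+1 + y n * (y n.+1 - y n)) a) => //.
    by congr (mult_fun _ a); ncr.
  rewrite mh; have := nrmD ((y n.+1 - y n) (y n.+1 a)) (y n ((y n.+1 - y n) a)).
  have := yb n ((y n.+1 - y n) a); have := ih (y n.+1 a); have := ih a.
  have := yb n.+1 a.
  have eB b : (y n.+1 - y n) b = y n.+1 b - y n b by [].
  rewrite !eB.
  have := sqm_ge0 n; have := sqm_incr n; have := nrm_ge0 a; have := nrm_ge0 (y n.+1 a).
  have -> : sqm n.+2 - sqm n.+1 = (sqm n.+1 - sqm n) * (sqm n.+1 + sqm n) / 2.
    by rewrite /=; field.
  move: (sqm n.+1) (sqm n) => t' t h1 h2 h3 h4 h5 h6 h7 h8 h9.
  have : (t' - t) * nrm (y n.+1 a) <= (t' - t) * (t' * nrm a).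
    by apply: ler_wpM2l; lra.
  have : t * nrm (y n.+1 a - y n a) <= t * ((t' - t) * nrm a) by apply: ler_wpM2l; lra.
  by nra.
have yd' m n a : (n <= m)%N -> nrm (y m a - y n a) <= (sqm m - sqm n) * nrm a.
  move=> /subnK <-; elim: (m - n)%N => [|k ih]; first by rewrite add0n !subrr nrm0 mul0r.
  have := nrm_tri (y (k + n)%N a) (y (k.+1 + n)%N a) (y n a).
  by have := yd (k + n)%N a; rewrite !addSn; lra.
have wd m n : (n <= m)%N ->
    nrm (sqw z m - sqw z n) <= 2 * (sqm m - sqm n).
  move=> nm; have tt := sqm_mono nm.
  apply: nrm_lmul => [|a]; first by lra.
  have -> : (sqw z m - sqw z n) ** a =
    rc (sqm m - sqm n) *: a - (y m a - y n a).
    rewrite rcD rcN scalerBl cmulBl /y !(mult_addE, mult_oppE) /=.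
    by rewrite !opprD !opprK !addrA; cring.
  have := nrmB (rc (sqm m - sqm n) *: a) (y m a - y n a).
  have := yd' _ _ a nm; rewrite nrmZ nrm_rc ger0_norm ?subr_ge0//.
  by lra.
have [w hw] : exists w : A, sqw z @ \oo --> w.
  apply: cauchy_nrm => e e0.
  have : \forall n \near \oo, 1 - sqm n < e / 4.
    move/cvgrPdist_lt : sqm_cvg => /(_ (e / 4)) h; near=> n.
    have : `|1 - sqm n| < e / 4 by near: n; apply: h; lra.
    by rewrite ger0_norm// subr_ge0 sqm_le1.
  move=> [N _ hN]; exists N => m n Nm Nn.
  have h1 := hN _ (leqnn N).
  have := wd _ _ Nm; have := wd _ _ Nn; have := sqm_le1 m; have := sqm_le1 n.
  have := nrm_tri (sqw z N) (sqw z m) (sqw z n); rewrite (nrmBC (sqw z N)).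
  by move: h1 => /=; lra.
have hw' : (fun n => sqw z n.+1) @ \oo --> w by rewrite (cvg_shiftS (sqw z)).
have hS : (fun n => sqw z n.+1) @ \oo --> hf (z + rc 1 *: (w + w) - w ** w).
  apply: cvg_hf; apply: cvgB; last exact: cvg_cmul.
  apply: cvgD; first exact: cvg_cst.
  by apply: cvg_rcZ; [exact: sqm_cvg|exact: cvgD].
exists w; split.
- have := cvg_unique (@norm_hausdorff _ _) hw' hS; rewrite rc1 scale1r => h.
  have : w + w = z + (w + w) - w ** w by rewrite {1 2}h hfD.
  move=> /(congr1 (fun x => x - (w + w) + w ** w)).
  by rewrite subrr add0r addrAC subrK addrK.
- move=> a.
  apply: (@cvg_nrm_le _ _ _ \oo _ (fun n => a - sqw z n ** a)).
    apply: cvgB; first exact: cvg_cst.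
    by apply: cvg_cmul => //; exact: cvg_cst.
  near=> n; have -> : a - sqw z n ** a = rc (1 - sqm n) *: a + y n a.
    rewrite rcD rcN scalerBl scale1r /y mult_addE mult_oppE /=.
    by rewrite addrA subrK.
  have := nrmD (rc (1 - sqm n) *: a) (y n a); have := yb n a.
  by rewrite nrmZ nrm_rc ger0_norm ?subr_ge0 ?sqm_le1//; lra.
- move=> P Pc P0 PS; apply: (Pc (sqw z)) hw => n.
  by elim: n => //= n ih; exact: PS.
Unshelve. all: by end_near.
Qed.

Lemma sqrt_subunit_sa A (z h : A) : subunit z -> cstar z = z -> h ** z = z ** h ->
  exists w : A, [/\ w ** w = z, subunit w, cstar w = w & h ** w = w ** h].
Proof.
move=> zs sz hz; have [w [wE ws wP]] := sqrt_subunit zs; exists w; split=> //.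
- apply: (wP [set y | cstar y = y]) => [||t x /= xs].
  + exact: seq_closed_star.
  + exact: cstar0.
  + by rewrite hf_star cstarB cstarD cstarZ rc_conj cstarD cstarM sz xs.
- apply: (wP [set y | h ** y = y ** h]) => [||t x /= xs].
  + exact: seq_closed_comm.
  + by rewrite /= cmul0l cmul0r.
  + rewrite hf_mull hf_mulr cmulBl cmulBr cmulDl cmulDr cmulZl cmulZr cmulDl cmulDr.
    by rewrite hz xs comm_sq.
Qed.

(** The element h + i s is normal with U^* U = h^2 + s^2, and h is its real part, so |h| <= |U|. *)
Lemma nrm_sum_squares A (h s : A) : cstar h = h -> cstar s = s ->
  h ** s = s ** h -> nrm (h ** h) <= nrm (h ** h + s ** s).
Proof.
move=> hs ss hsC; pose U := h + 'i%C *: s; pose U' := h - 'i%C *: s.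
have US : cstar U = U'.
  by rewrite cstarD cstarZ hs ss (_ : 'i%C^* = - 'i%C) ?scaleNr//; exact: conjCi.
have UU : U' ** U = h ** h + s ** s.
  rewrite /U' /U cmulBl !cmulDr !cmulZl !cmulZr scalerA -expr2 sqr_i scaleN1r hsC.
  by rewrite opprD opprK addrA addrK.
have : h = hf (U + U') by rewrite /U /U' addrACA subrr addr0 hf_add.
move=> /(congr1 nrm); rewrite nrm_hf => hU.
have := nrmD U U'; rewrite -US nrm_star => hn.
have hU2 : nrm h <= nrm U by move: hU; rewrite -US; lra.
rewrite -UU -US nrm_starM; apply: le_trans (nrmM _ _) _.
by rewrite -expr2 ler_sqr ?nnegrE ?nrm_ge0.
Qed.

End BorderlineSquareRoot.

(** * Semi-inner product spaces; faithful representations are isometric *)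

Section PreHilbert.
Context {R : realType}.
Local Notation K := (complex R).

Lemma cjD (a b : K) : (a + b)^* = a^* + b^*. Proof. exact: rmorphD. Qed.
Lemma cjM (a b : K) : (a * b)^* = a^* * b^*. Proof. exact: rmorphM. Qed.
Lemma cjN (a : K) : (- a)^* = - a^*. Proof. exact: rmorphN. Qed.
Lemma cj0 : (0 : K)^* = 0. Proof. exact: rmorph0. Qed.

(** The form may be degenerate and the space incomplete. Direct sums, Gram forms and vector forms
    can then carry representations as they are, without passing to quotients or completions. *)
Record preHilbert := PreHilbert {
  phV :> lmodType K;
  ip : phV -> phV -> K;
  ip_linear : forall y z x x', ip (z *: x + x') y = z * ip x y + ip x' y;
  ip_conj : forall x y, ip y x = (ip x y)^*;
  ip_ge0 : forall x, 0 <= ip x x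
}.

Implicit Types V : preHilbert.

Definition sqn V (x : V) : R := complex.Re (ip x x).

Lemma ipDl V (x x' y : V) : ip (x + x') y = ip x y + ip x' y.
Proof. by have := ip_linear y 1 x x'; rewrite scale1r mul1r. Qed.
Lemma ip0l V (y : V) : ip 0 y = 0.
Proof. by apply: (addrI (ip (0 : V) y)); rewrite -ipDl !addr0. Qed.
Lemma ipZl V z (x y : V) : ip (z *: x) y = z * ip x y.
Proof. by have := ip_linear y z x 0; rewrite ip0l !addr0. Qed.
Lemma ipDr V (x y y' : V) : ip x (y + y') = ip x y + ip x y'.
Proof. by rewrite ip_conj ipDl cjD (ip_conj y) (ip_conj y'). Qed.
Lemma ip0r V (y : V) : ip y 0 = 0.
Proof. by rewrite ip_conj ip0l cj0. Qed.
Lemma ipZr V z (x y : V) : ip x (z *: y) = z^* * ip x y.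
Proof. by rewrite ip_conj ipZl cjM (ip_conj y). Qed.
Lemma ipNl V (x y : V) : ip (- x) y = - ip x y.
Proof. by rewrite -scaleN1r ipZl mulN1r. Qed.
Lemma ipNr V (x y : V) : ip x (- y) = - ip x y.
Proof. by rewrite ip_conj ipNl cjN (ip_conj y). Qed.
Lemma ipBl V (x x' y : V) : ip (x - x') y = ip x y - ip x' y.
Proof. by rewrite ipDl ipNl. Qed.
Lemma ip_suml V (I : Type) (s : seq I) (P : pred I) (F : I -> V) y :
  ip (\sum_(i <- s | P i) F i) y = \sum_(i <- s | P i) ip (F i) y.
Proof. by apply: (big_morph (fun x => ip x y)) => [u v|]; rewrite ?ipDl ?ip0l. Qed.
Lemma ip_sumr V (I : Type) (s : seq I) (P : pred I) (F : I -> V) y :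
  ip y (\sum_(i <- s | P i) F i) = \sum_(i <- s | P i) ip y (F i).
Proof. by apply: (big_morph (ip y)) => [u v|]; rewrite ?ipDr ?ip0r. Qed.

Lemma ip_sqn V (x : V) : ip x x = rc (sqn x).
Proof.
rewrite /sqn /rc; have := ip_ge0 x; rewrite lecE /= => /andP[/eqP].
by case: (ip x x) => a b /= ->.
Qed.

Lemma sqn_ge0 V (x : V) : 0 <= sqn x.
Proof. by rewrite -le_rc -ip_sqn ip_ge0. Qed.

Lemma sqnZ V z (x : V) : sqn (z *: x) = nrm z ^+ 2 * sqn x.
Proof.
have : rc (sqn (z *: x)) = rc (nrm z ^+ 2 * sqn x).
  rewrite -ip_sqn ipZl ipZr mulrA -normCK nrmE ip_sqn !rcM.
  by rewrite expr2.
by case.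
Qed.

Lemma sqn_rcZ V (r : R) (x : V) : sqn (rc r *: x) = r ^+ 2 * sqn x.
Proof. by rewrite sqnZ nrm_rc real_normK// num_real. Qed.

Lemma ReD (a b : K) : complex.Re (a + b) = complex.Re a + complex.Re b.
Proof. by case: a b => ? ? []. Qed.
Lemma ReN (a : K) : complex.Re (- a) = - complex.Re a.
Proof. by case: a. Qed.
Lemma Re_conj (a : K) : complex.Re a^* = complex.Re a.
Proof. by case: a. Qed.
Lemma Re_rcM r (a : K) : complex.Re (rc r * a) = r * complex.Re a.
Proof. by case: a => ? ? /=; rewrite mul0r subr0. Qed.
Lemma Re_sum (I : Type) (s : seq I) (P : pred I) (F : I -> K) :
  complex.Re (\sum_(i <- s | P i) F i) = \sum_(i <- s | P i) complex.Re (F i).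
Proof. by apply: (big_morph _ ReD). Qed.
Lemma Re_le_nrm (a : K) : complex.Re a <= nrm a.
Proof.
rewrite /nrm normc_def /=; case: a => x y /=.
apply: le_trans (ler_norm x) _; rewrite -sqrtr_sqr ler_wsqrtr//.
by rewrite lerDl sqr_ge0.
Qed.

Lemma sqnD V (x y : V) :
  sqn (x + y) = sqn x + sqn y + 2 * complex.Re (ip x y).
Proof.
rewrite /sqn ipDl !ipDr !ReD (ip_conj x y) Re_conj; ring.
Qed.

Lemma sqnB V (x y : V) :
  sqn (x - y) = sqn x + sqn y - 2 * complex.Re (ip x y).
Proof.
rewrite sqnD ipNr ReN /sqn ipNl ipNr opprK; ring.
Qed.

Lemma sqn0 V : sqn (0 : V) = 0. Proof. by rewrite /sqn ip0l. Qed.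

Lemma cauchy_schwarz V (x y : V) : nrm (ip x y) ^+ 2 <= sqn x * sqn y.
Proof.
have key t : 0 <= sqn x - 2 * t * nrm (ip x y) ^+ 2
    + t ^+ 2 * nrm (ip x y) ^+ 2 * sqn y.
  have E : complex.Re ((rc t * ip x y)^* * ip x y) = t * nrm (ip x y) ^+ 2.
    rewrite cjM rc_conj -(mulrA (rc t)) (mulrC (_^*)) -normCK nrmE expr2 -rcM -expr2.
    by rewrite Re_rcM.
  have := sqn_ge0 (x - (rc t * ip x y) *: y).
  rewrite sqnB sqnZ nrm_mul nrm_rc ipZr E exprMn real_normK ?num_real// => h; lra.
have n0 : 0 <= nrm (ip x y) ^+ 2 by exact: sqr_ge0.
have x0 := sqn_ge0 x; have y0 := sqn_ge0 y.
move: (nrm (ip x y) ^+ 2) n0 key => n n0 key.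
have [yz|yp] := eqVneq (sqn y) 0.
  (* Here y is a null vector and the quadratic in t becomes affine: the value t = (|x|^2 + 1) / n
     makes it negative unless n = 0. *)
  rewrite yz mulr0; rewrite yz in key; rewrite leNgt; apply/negP => np.
  have := key ((sqn x + 1) / n).
  have : (sqn x + 1) / n * n = sqn x + 1 by rewrite mulfVK// gt_eqF.
  move: ((sqn x + 1) / n) => t; nra.
have yp' : 0 < sqn y by rewrite lt_def yp.
have := key (sqn y)^-1.
have : (sqn y)^-1 * sqn y = 1 by rewrite mulVf.
move: (sqn y)^-1 => t ty h.
have : 0 <= (sqn x - 2 * t * n + t ^+ 2 * n * sqn y) * sqn y by apply: mulr_ge0.
have -> : (sqn x - 2 * t * n + t ^+ 2 * n * sqn y) * sqn y =
  sqn x * sqn y - 2 * (t * sqn y) * n + (t * sqn y) ^+ 2 * n by ring.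
by rewrite ty; lra.
Qed.

Lemma Re_cauchy_schwarz V (x y : V) :
  complex.Re (ip x y) ^+ 2 <= sqn x * sqn y.
Proof.
apply: le_trans (cauchy_schwarz x y); rewrite -real_normK ?num_real//.
rewrite ler_sqr ?nnegrE ?nrm_ge0// ler_norml Re_le_nrm andbT.
by rewrite lerNl -ReN -nrmN Re_le_nrm.
Qed.

Record starRep (A : cstarAlgType R) V := StarRep {
  sr_fun :> A -> V -> V;
  sr_linear : forall a, linear (sr_fun a);
  sr_linear_alg : forall v, linear (sr_fun^~ v);
  sr_mul : forall a b v, sr_fun (a ** b) v = sr_fun a (sr_fun b v);
  sr_star : forall a v w, ip (sr_fun a v) w = ip v (sr_fun (cstar a) w)
}.

Section Rep.
Context (A : cstarAlgType R) V (r : starRep A V).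

Lemma srDl a b v : r (a + b) v = r a v + r b v.
Proof. by have := sr_linear_alg r v 1 a b; rewrite !scale1r. Qed.
Lemma sr0l v : r 0 v = 0.
Proof. by apply: (addrI (r 0 v)); rewrite -srDl !addr0. Qed.
Lemma srZl z a v : r (z *: a) v = z *: r a v.
Proof. by have := sr_linear_alg r v z a 0; rewrite sr0l !addr0. Qed.
Lemma srNl a v : r (- a) v = - r a v.
Proof. by rewrite -(scaleN1r a) srZl scaleN1r. Qed.
Lemma srBl a b v : r (a - b) v = r a v - r b v.
Proof. by rewrite srDl srNl. Qed.
Lemma srDr a v w : r a (v + w) = r a v + r a w.
Proof. by have := sr_linear r a 1 v w; rewrite !scale1r. Qed.
Lemma sr0r a : r a 0 = 0.
Proof. by apply: (addrI (r a 0)); rewrite -srDr !addr0. Qed.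
Lemma srZr z a v : r a (z *: v) = z *: r a v.
Proof. by have := sr_linear r a z v 0; rewrite sr0r !addr0. Qed.
Lemma sr_suml (I : Type) (s : seq I) (P : pred I) (F : I -> A) v :
  r (\sum_(i <- s | P i) F i) v = \sum_(i <- s | P i) r (F i) v.
Proof. by apply: (big_morph (r^~ v)) => [a b|]; rewrite ?srDl ?sr0l. Qed.
Lemma sr_sumr (I : Type) (s : seq I) (P : pred I) (F : I -> V) a :
  r a (\sum_(i <- s | P i) F i) = \sum_(i <- s | P i) r a (F i).
Proof. by apply: (big_morph (r a)) => [v w|]; rewrite ?srDr ?sr0r. Qed.
Lemma sr_star_sqn a v : sqn (r a v) = complex.Re (ip (r (cstar a ** a) v) v).
Proof. by rewrite /sqn sr_mul [in RHS]sr_star cstarK. Qed.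

Lemma le_of_scale (x n b : R) : 0 <= n -> 0 <= b ->
  (forall c, n < c -> x <= c ^+ 2 * b) -> x <= n ^+ 2 * b.
Proof.
move=> n0 b0 h; rewrite leNgt; apply/negP => lt.
pose M := (2 * n + 1) * b + 1.
have M0 : 0 < M by rewrite /M; nra.
pose d := Num.min 1 ((x - n ^+ 2 * b) / (2 * M)).
have d0 : 0 < d by rewrite /d lt_min ltr01 divr_gt0 ?mulr_gt0// subr_gt0.
have d1 : d <= 1 by rewrite /d ge_min lexx.
have dM : d * (2 * M) <= x - n ^+ 2 * b.
  by rewrite -ler_pdivlMr ?mulr_gt0// /d ge_min lexx orbT.
have := h (n + d); rewrite ltrDl d0 => /(_ isT).
have : d ^+ 2 * b <= d * b by apply: ler_wpM2r => //; rewrite expr2; nra.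
have -> : (n + d) ^+ 2 * b = n ^+ 2 * b + 2 * n * d * b + d ^+ 2 * b by ring.
rewrite /M in dM; nra.
Qed.

(** For |b| < 1 write 1 - b^* b = (1 - y)^2 with y self-adjoint; then |v|^2 - |b v|^2 = |(1 - y)
    v|^2. The general case follows by scaling. *)
Lemma sqn_rep_le a v : sqn (r a v) <= nrm a ^+ 2 * sqn v.
Proof.
have h1 b : nrm b < 1 -> sqn (r b v) <= sqn v.
  move=> b1; have k1 : nrm (cstar b ** b) < 1.
    by rewrite nrm_starM expr_lt1// nrm_ge0.
  have [||y [yE ys _]] := @sqrt_contraction_sa _ A (cstar b ** b) 0 k1.
  - by rewrite cstarM cstarK.
  - by rewrite cmul0l cmul0r.
  have kE : cstar b ** b = y + y - y ** y by rewrite yE addrK.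
  rewrite sr_star_sqn kE srBl srDl ipBl ipDl ReD ReN ReD.
  rewrite -{3}ys -sr_star_sqn.
  by have := sqn_ge0 (v - r y v); rewrite sqnB ip_conj Re_conj; lra.
apply: le_of_scale; rewrite ?nrm_ge0 ?sqn_ge0// => c ac.
have c0 : 0 < c by apply: le_lt_trans ac; exact: nrm_ge0.
have hn : nrm (rc c^-1 *: a) < 1.
  by rewrite nrmZ nrm_rc ger0_norm ?invr_ge0 1?ltW// mulrC ltr_pdivrMr// mul1r.
have := h1 _ hn; rewrite srZl sqn_rcZ.
by rewrite exprVn mulrC ler_pdivrMr ?exprn_gt0// mulrC.
Qed.

End Rep.

Definition hilbertPre (H : hilbertType R) : preHilbert.
Proof.
refine (@PreHilbert H (@inner R H) _ _ _).
- exact: inner_linear.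
- exact: inner_conj.
- by move=> x; rewrite inner_norm exprn_ge0.
Defined.

Lemma sqn_nrm (H : hilbertType R) (x : H) : sqn (x : hilbertPre H) = nrm x ^+ 2.
Proof.
have : rc (sqn (x : hilbertPre H)) = rc (nrm x ^+ 2).
  by rewrite -ip_sqn /= inner_norm nrmE !expr2 rcM.
by case.
Qed.

Definition faithful_starRep A H (p : @faithfulRep R A H) : starRep A (hilbertPre H) :=
  @StarRep A (hilbertPre H) p (rep_linear p) (rep_linear_alg p) (rep_mul p)
    (rep_star p).

(** With h = a^* a, the bound makes c^2 h - h^2 positive as an operator. The positive part of its
    opposite is constructed in the algebra, is killed by the representation and so vanishes; hence a
    multiple of c^2 h - h^2 is a square s^2 of a self-adjoint s commuting with h, and
    [nrm_sum_squares] gives |h|^2 <= c^2 |h|. *)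
Lemma faithful_isometric A H (p : @faithfulRep R A H) a c : 0 <= c ->
  (forall v, nrm (p a v) <= c * nrm v) -> nrm a <= c.
Proof.
move=> c0 pa; pose r := faithful_starRep p.
have ra v : sqn (r a v) <= c ^+ 2 * sqn v.
  rewrite !sqn_nrm -exprMn ler_sqr ?nnegrE ?mulr_ge0 ?nrm_ge0//; exact: pa.
have null (x : hilbertPre H) : sqn x = 0 -> x = 0.
  move=> x0; apply: (@nrm_eq0 _ H); apply/eqP; rewrite -sqrf_eq0; apply/eqP.
  by rewrite -sqn_nrm.
have ra' v : sqn (r (cstar a) v) <= c ^+ 2 * sqn v.
  have := Re_cauchy_schwarz (r a (r (cstar a) v)) v; rewrite sr_star -/(sqn _).
  have := ra (r (cstar a) v); have := sqn_ge0 (r a (r (cstar a) v)).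
  have := sqn_ge0 (r (cstar a) v); have := sqn_ge0 v.
  move: (sqn (r (cstar a) v)) (sqn (r a _)) (sqn v) => y z x x0 y0 z0 zy yzx.
  have [->|yp] := eqVneq y 0; first by rewrite mulr_ge0 ?sqr_ge0.
  have yp' : 0 < y by rewrite lt_def yp.
  rewrite -(ler_pM2l yp') -expr2; apply: le_trans yzx _.
  by rewrite mulrA; apply: ler_wpM2r => //; rewrite mulrC.
pose h := cstar a ** a.
have hs : cstar h = h by rewrite /h cstarM cstarK.
have nh : nrm h = nrm a ^+ 2 by exact: nrm_starM.
pose q0 := h ** h - rc (c ^+ 2) *: h.
have q0s : cstar q0 = q0 by rewrite cstarB cstarM cstarZ rc_conj !hs.
(* The scaling by mu^2 puts q in the open unit ball, so that q^2 has a square root w, the absolute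
   value of q, and w in turn a square root s. *)
pose mu := (nrm q0 + 1)^-1.
have mu0 : 0 < mu by rewrite invr_gt0; have := nrm_ge0 q0; lra.
pose q := rc (mu ^+ 2) *: q0.
have qs : cstar q = q by rewrite cstarZ rc_conj q0s.
have hq : h ** q = q ** h.
  by rewrite cmulZr cmulZl cmulBl cmulBr cmulZl cmulZr cmulA.
have q1 : nrm q < 1.
  rewrite nrmZ nrm_rc ger0_norm ?sqr_ge0// expr2.
  have mq : mu * (nrm q0 + 1) = 1 by rewrite mulVf// gt_eqF//; have := nrm_ge0 q0; lra.
  have m1 : mu <= 1 by have := nrm_ge0 q0; nra.
  have := nrm_ge0 q0; move: (nrm q0) mq => n mq n0; nra.
have sz := subunit_square qs q1.
have [||w [wE sw ws hw]] := @sqrt_subunit_sa _ A (q ** q) h sz.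
- by rewrite cstarM qs.
- by rewrite comm_sq.
have [||s [sE _ ss hsC]] := @sqrt_subunit_sa _ A w h sw => //.
have qw : q ** w = w ** q.
  by rewrite cmulZr cmulZl cmulBl cmulBr cmulZl cmulZr hw comm_sq.
have qneg v : complex.Re (ip (r q v) v) <= 0.
  rewrite srZl ipZl Re_rcM pmulr_rle0 ?exprn_gt0//.
  rewrite srBl srZl ipBl ipZl ReD ReN Re_rcM.
  have -> : complex.Re (ip (r (h ** h) v) v) = sqn (r h v).
    by rewrite sr_star_sqn hs.
  rewrite -sr_star_sqn {1}/h sr_mul.
  by have := ra' (r a v); lra.
have wpos v : complex.Re (ip (r w v) v) = sqn (r s v).
  by rewrite sr_star_sqn ss sE.
(* Since w^2 = q^2, the vector u = (w + q) v satisfies w u = q u. The form of w is nonnegative and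
   that of q nonpositive, so w u = q u = 0, and then |u|^2 = 0. *)
have wq0 v : r (w + q) v = 0.
  set u := r (w + q) v.
  have wu : r w u = r q u.
    apply/eqP; rewrite -subr_eq0 -srBl /u -sr_mul; apply/eqP.
    rewrite cmulBl !cmulDr qw wE.
    have -> : q ** q + w ** q - (w ** q + q ** q) = 0 by cring.
    by rewrite sr0l.
  have su : sqn (r s u) = 0.
    have := qneg u; rewrite -wu wpos; have := sqn_ge0 (r s u).
    by move=> ? ?; apply/eqP; rewrite eq_le; apply/andP.
  have wu0 : r w u = 0 by rewrite -sE sr_mul (null _ su) sr0r.
  apply: null; rewrite /sqn {1}/u sr_star cstarD ws qs srDl -wu wu0 addr0.
  by rewrite ip0r.
have wq : w + q = 0 by apply: (rep_inj (f := p)) => v; exact: wq0.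
pose h1 := rc mu *: h.
have h1s : cstar h1 = h1 by rewrite cstarZ rc_conj hs.
have h1C : h1 ** s = s ** h1 by rewrite cmulZl cmulZr hsC.
have hh : h1 ** h1 = rc (mu ^+ 2) *: (h ** h).
  by rewrite cmulZl cmulZr scalerA expr2 rcM.
have := nrm_sum_squares h1s ss h1C.
have -> : h1 ** h1 + s ** s = rc (mu ^+ 2 * c ^+ 2) *: h.
  move/eqP: wq; rewrite addr_eq0 => /eqP wq; rewrite sE wq hh /q /q0.
  by rewrite scalerBr opprB scalerA -rcM addrC subrK.
rewrite hh !nrmZ !nrm_rc !ger0_norm ?mulr_ge0 ?sqr_ge0 ?(ltW mu0)//.
have -> : nrm (h ** h) = nrm h ^+ 2 by rewrite -{1}hs nrm_starM.
rewrite nh -(mulrA (mu ^+ 2)) (ler_pM2l (exprn_gt0 2 mu0)) (expr2 (nrm a ^+ 2)).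
have [->|a0] := eqVneq (nrm a) 0; first by [].
have ap : 0 < nrm a by rewrite lt_def a0 nrm_ge0.
by rewrite ler_pM2r ?exprn_gt0// ler_sqr ?nnegrE ?nrm_ge0.
Qed.

End PreHilbert.

(** * Paths of projections and unitaries *)

Section Clamp.
Context {R : realType}.

(** Paths are defined on the whole line and constant outside the unit interval, so that continuity
    never has to be relative to a subset. *)
Definition clamp (t : R) : R := Num.max 0 (Num.min 1 t).

Lemma clamp_ge0 t : 0 <= clamp t. Proof. by rewrite /clamp le_max lexx. Qed.
Lemma clamp_le1 t : clamp t <= 1.
Proof. by rewrite /clamp ge_max ler01 ge_min lexx. Qed.
Lemma clamp_id t : 0 <= t <= 1 -> clamp t = t.
Proof. by move=> /andP[t0 t1]; rewrite /clamp (min_idPr t1) (max_idPr t0). Qed.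
Lemma clamp_le0 t : t <= 0 -> clamp t = 0.
Proof.
by move=> t0; rewrite /clamp (min_idPr (le_trans t0 ler01)) (max_idPl t0).
Qed.
Lemma clamp_ge1 t : 1 <= t -> clamp t = 1.
Proof. by move=> t1; rewrite /clamp (min_idPl t1) (max_idPr ler01). Qed.
Lemma clamp0 : clamp 0 = 0. Proof. exact: clamp_le0. Qed.
Lemma clamp1 : clamp 1 = 1. Proof. exact: clamp_ge1. Qed.

Lemma clamp_lip s t : `|clamp s - clamp t| <= `|s - t|.
Proof.
wlog st : s t / s <= t.
  by move=> h; have [|/ltW] := leP s t; [|rewrite distrC (distrC s)]; exact: h.
have [s0|s0] := leP s 0; have [t1|t1] := leP 1 t.
- by rewrite (clamp_le0 s0) (clamp_ge1 t1) sub0r normrN normr1 ler0_norm; lra.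
- rewrite (clamp_le0 s0); have [t0|t0] := leP t 0.
    by rewrite clamp_le0// subrr normr0.
  have -> : clamp t = t by apply: clamp_id; apply/andP; split; lra.
  by rewrite sub0r normrN gtr0_norm// ler0_norm; lra.
- rewrite (clamp_ge1 t1); have [s1|s1] := leP 1 s.
    by rewrite clamp_ge1// subrr normr0.
  have -> : clamp s = s by apply: clamp_id; apply/andP; split; lra.
  by rewrite !ler0_norm; lra.
- have -> : clamp s = s by apply: clamp_id; apply/andP; split; lra.
  by have -> : clamp t = t by apply: clamp_id; apply/andP; split; lra.
Qed.

Lemma continuous_clamp : continuous clamp.
Proof.
move=> t; apply/cvgrPdist_le => e e0; near=> s.
apply: le_trans (clamp_lip _ _) _; near: s.
by have /cvgrPdist_le/(_ _ e0) := @cvg_id _ (nbhs t).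
Unshelve. all: by end_near.
Qed.

End Clamp.

Section ContinuousPaths.
Context {R : realType}.
Implicit Types A : cstarAlgType R.
Implicit Types V : normedModType (complex R).

Lemma cont_cmul A (T : topologicalType) (u v : T -> A) : continuous u -> continuous v ->
  continuous (fun t => u t ** v t).
Proof. by move=> uc vc t; apply: cvg_cmul; [exact: uc|exact: vc]. Qed.
Lemma cont_cstar A (T : topologicalType) (u : T -> A) : continuous u ->
  continuous (fun t => cstar (u t)).
Proof. by move=> uc t; apply: cvg_cstar; exact: uc. Qed.
Lemma cont_add V (T : topologicalType) (u v : T -> V) : continuous u -> continuous v ->
  continuous (fun t => u t + v t).
Proof. by move=> uc vc t; apply: cvgD; [exact: uc|exact: vc]. Qed.
Lemma cont_sub V (T : topologicalType) (u v : T -> V) : continuous u -> continuous v ->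
  continuous (fun t => u t - v t).
Proof. by move=> uc vc t; apply: cvgB; [exact: uc|exact: vc]. Qed.
Lemma cont_cst (V T : topologicalType) (v : V) : continuous (fun _ : T => v).
Proof. by move=> t; exact: cvg_cst. Qed.
Lemma cont_rcZ V (T : topologicalType) (r : T -> R) (u : T -> V) :
  continuous r -> continuous u -> continuous (fun t => rc (r t) *: u t).
Proof. by move=> rc' uc t; apply: cvg_rcZ; [exact: rc'|exact: uc]. Qed.
Lemma cont_comp (X Y Z : topologicalType) (f : X -> Y) (g : Y -> Z) :
  continuous f -> continuous g -> continuous (fun t => g (f t)).
Proof. by move=> fc gc t; apply: continuous_comp; [exact: fc|exact: gc]. Qed.
Lemma cont_lip V (T : topologicalType) (W : normedModType (complex R)) (u : T -> V)
    (f : V -> W) (P : set V) (k : R) :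
  (forall x y, P x -> P y -> nrm (f x - f y) <= k * nrm (x - y)) ->
  (forall t, P (u t)) -> continuous u -> continuous (fun t => f (u t)).
Proof.
move=> fk Pu uc t; apply/cvg_nrmP => e e0.
have k0 : 0 < `|k| + 1 by have := normr_ge0 k; lra.
have /cvg_nrmP/(_ _ (divr_gt0 e0 k0)) h := uc t.
near=> s; apply: le_lt_trans (fk _ _ (Pu _) (Pu _)) _.
have : nrm (u s - u t) < e / (`|k| + 1) by near: s.
rewrite ltr_pdivlMr// => h'; apply: le_lt_trans h'; rewrite mulrC.
by apply: ler_wpM2l; [exact: nrm_ge0|have := ler_norm k; lra].
Unshelve. all: by end_near.
Qed.

End ContinuousPaths.

(** * Inverse square roots near the unit *)

Section InverseSquareRoot.
Context {R : realType} {A : cstarAlgType R}.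
Implicit Types k g : A.

(** This is (1 + g)^2 (1 - k) = 1 expanded and solved for its term 2 g. On |g| <= 1/2 with |k| <=
    1/4 the Lipschitz constant is (1/2 + 1/4 + 1) / 2 = 7/8. *)
Definition isqF k g : A := hf (k + (g ** k + g ** k) + g ** (g ** k) - g ** g).

Lemma isqF_lip k g g' : nrm k <= 4^-1 -> nrm g <= 2^-1 -> nrm g' <= 2^-1 ->
  nrm (isqF k g - isqF k g') <= 7 / 8 * nrm (g - g').
Proof.
move=> k4 g2 g2'; rewrite -hfB nrm_hf.
have -> : k + (g ** k + g ** k) + g ** (g ** k) - g ** g -
   (k + (g' ** k + g' ** k) + g' ** (g' ** k) - g' ** g') =
   ((g - g') ** k + (g - g') ** k) + (((g - g') ** g + g' ** (g - g')) ** k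
    - ((g - g') ** g + g' ** (g - g'))) by cring.
set d := g - g'; set z := d ** g + g' ** d.
have := nrmD (d ** k + d ** k) (z ** k - z); have := nrmD (d ** k) (d ** k).
have := nrmB (z ** k) z; have := nrmM z k; have := nrmM d k.
have := nrmD (d ** g) (g' ** d); rewrite -/z; have := nrmM d g; have := nrmM g' d.
have d0 := nrm_ge0 d; have z0 := nrm_ge0 z.
move=> h1 h2 h3 h4 h5 h6 h7 h8.
have := ler_wpM2l d0 k4; have := ler_wpM2l z0 k4; have := ler_wpM2l d0 g2.
have := ler_wpM2r d0 g2'; lra.
Qed.

Lemma isq_ex k : nrm k <= 4^-1 -> exists g, [/\ nrm g <= 2^-1, isqF k g = g
  & forall P : set A, seq_closed P -> P 0 -> (forall x, P x -> P (isqF k x)) -> P g].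
Proof.
move=> k4.
have [|| |x y x2 y2|g [g2 gE gP]] :=
  @contraction_fixpoint_nrm _ A (isqF k) 2^-1 (7/8).
- by rewrite invr_ge0.
- by apply/andP; split; lra.
- move=> x x2; rewrite nrm_hf.
  have := nrmB (k + (x ** k + x ** k) + x ** (x ** k)) (x ** x).
  have := nrmD (k + (x ** k + x ** k)) (x ** (x ** k)).
  have := nrmD k (x ** k + x ** k); have := nrmD (x ** k) (x ** k).
  have := nrmM x k; have := nrmM x x; have := nrmM x (x ** k).
  have x0 := nrm_ge0 x; have k0 := nrm_ge0 k; have xk0 := nrm_ge0 (x ** k).
  move=> h1 h2 h3 h4 h5 h6 h7.
  have := ler_wpM2l x0 k4; have := ler_wpM2l x0 x2; have := ler_wpM2r xk0 x2.
  by lra.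
- exact: isqF_lip.
exists g; split=> // P Pc P0 PF; apply: gP => // x _; exact: PF.
Qed.

End InverseSquareRoot.

Section InverseSquareRootFunction.
Context {R : realType} {A : cstarAlgType R}.
Implicit Types (k g : A) (m : multiplier A).

(* [(1 + isq k)^2 (1 - k) = 1] for [|k| <= 1/4]; junk value [0] elsewhere. *)
Definition isq k : A :=
  if pselect (nrm k <= 4^-1) is left h then projT1 (cid (isq_ex h)) else 0.

Lemma isqP k : nrm k <= 4^-1 -> [/\ nrm (isq k) <= 2^-1, isqF k (isq k) = isq k
  & forall P : set A, seq_closed P -> P 0 -> (forall x, P x -> P (isqF k x)) ->
     P (isq k)].
Proof. by move=> k4; rewrite /isq; case: pselect => // h; case: cid. Qed.

Lemma isq_eq k : nrm k <= 4^-1 -> isq k + isq k =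
  k + (isq k ** k + isq k ** k) + isq k ** (isq k ** k) - isq k ** isq k.
Proof. by move=> /isqP[_ h _]; rewrite -{1 2}h /isqF hfD. Qed.

Lemma isq_le k : nrm k <= 4^-1 -> nrm (isq k) <= 3 / 2 * nrm k.
Proof.
move=> k4; have [g2 _ _] := isqP k4.
have := congr1 nrm (isq_eq k4); move: (isq k) g2 => g g2.
have -> : g + g = rc 2 *: g by rewrite (_ : 2 = 1 + 1)// rcD scalerDl rc1 scale1r.
rewrite nrmZ nrm_rc ger0_norm// => h.
have := nrmB (k + (g ** k + g ** k) + g ** (g ** k)) (g ** g).
have := nrmD (k + (g ** k + g ** k)) (g ** (g ** k)).
have := nrmD k (g ** k + g ** k); have := nrmD (g ** k) (g ** k).
have := nrmM g k; have := nrmM g g; have := nrmM g (g ** k).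
have g0 := nrm_ge0 g; have k0 := nrm_ge0 k; have gk0 := nrm_ge0 (g ** k).
move=> h1 h2 h3 h4 h5 h6 h7.
have := ler_wpM2l g0 g2; have := ler_wpM2r gk0 g2; have := ler_wpM2r k0 g2.
by lra.
Qed.

Lemma isq_lip k k' : nrm k <= 4^-1 -> nrm k' <= 4^-1 ->
  nrm (isq k - isq k') <= 9 * nrm (k - k').
Proof.
move=> k4 k4'; have [g2 gE _] := isqP k4; have [g2' gE' _] := isqP k4'.
move: (isq k) (isq k') g2 gE g2' gE' => g g' g2 gE g2' gE'.
have h1 := isqF_lip k4 g2 g2'.
have : isqF k g' - isqF k' g' = hf ((k - k') + (g' ** (k - k') + g' ** (k - k'))
   + g' ** (g' ** (k - k'))) by rewrite -hfB; congr hf; cring.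
move=> /(congr1 nrm); rewrite nrm_hf; set d := k - k' => h2.
have := nrm_tri (isqF k g') (isqF k g) (isqF k' g'); rewrite gE gE' => h3.
have := nrmD (d + (g' ** d + g' ** d)) (g' ** (g' ** d)).
have := nrmD d (g' ** d + g' ** d); have := nrmD (g' ** d) (g' ** d).
have := nrmM g' d; have := nrmM g' (g' ** d).
rewrite gE in h1; rewrite gE' in h2; have d0 := nrm_ge0 d; have gd0 := nrm_ge0 (g' ** d).
move=> h4 h5 h6 h7 h8.
have := ler_wpM2r d0 g2'; have := ler_wpM2r gd0 g2'; lra.
Qed.

(** Continuity of [m] is bypassed by moving it to the other side of the inner product x^* y. *)
Lemma seq_closed_mcomm m : seq_closed [set y : A | forall c, m (y ** c) = y ** m c].
Proof.
move=> u l um ul c; apply: cstar_mul_inj => w.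
rewrite mult_starr; apply: (@cvg_eq0 _ _ _ \oo _
  (fun n => cstar (mstar m w) ** (u n ** c)) (fun n => cstar w ** (u n ** m c))).
- by apply: cvg_cmul; [exact: cvg_cst|apply: cvg_cmul => //; exact: cvg_cst].
- by apply: cvg_cmul; [exact: cvg_cst|apply: cvg_cmul => //; exact: cvg_cst].
- by near=> n; rewrite -mult_starr um.
Unshelve. all: by end_near.
Qed.

Lemma isq_mcomm k m : nrm k <= 4^-1 -> (forall c, m (k ** c) = k ** m c) ->
  forall c, m (isq k ** c) = isq k ** m c.
Proof.
move=> k4 mk; have [_ _ P] := isqP k4.
apply: (P [set y | forall c, m (y ** c) = y ** m c]).
- exact: seq_closed_mcomm.
- by move=> c; rewrite !cmul0l mult0.
- move=> x /= xm c; rewrite /isqF /hf !cmulZl mult_scale; congr (_ *: _).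
  rewrite !(cmulDl, cmulNl) !(mult_add, multN).
  by rewrite mk -!cmulA !xm !mk.
Qed.

Lemma isq_commr k : nrm k <= 4^-1 -> k ** isq k = isq k ** k.
Proof.
move=> k4; apply: cmul_ext => c; rewrite -cmulA.
have := @isq_mcomm k (ml k) k4 (fun c => erefl) c.
by move=> /= ->; rewrite cmulA.
Qed.

Lemma isq_star k : nrm k <= 4^-1 -> cstar k = k -> cstar (isq k) = isq k.
Proof.
move=> k4 ks; have [_ _ P] := isqP k4.
have := P [set y | cstar y = y /\ k ** y = y ** k]; case.
- apply: seq_closed_and; first exact: seq_closed_star.
  exact: seq_closed_comm.
- by split; [exact: cstar0|rewrite cmul0l cmul0r].
- move=> x [xs kx]; split.
    rewrite /isqF hf_star !(cstarB, cstarD, cstarM) ks xs; congr hf.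
    by rewrite !kx -!cmulA kx.
  rewrite /isqF hf_mull hf_mulr; congr hf.
  have c1 : k ** (x ** k) = x ** k ** k by rewrite cmulA kx.
  have c2 : k ** (x ** (x ** k)) = x ** (x ** k) ** k by rewrite cmulA kx -cmulA c1 !cmulA.
  by rewrite !(cmulBl, cmulBr, cmulDl, cmulDr) c1 c2 (comm_sq kx).
by [].
Qed.

Lemma isq_corner k e : nrm k <= 4^-1 -> e ** k = k -> e ** isq k = isq k.
Proof.
move=> k4 ek; have [_ _ P] := isqP k4.
apply: (P [set y | e ** y = y]).
- move=> u l us ul; apply: (@cvg_eq0 _ _ _ \oo _ (fun n => e ** u n) u) => //.
    by apply: cvg_cmul => //; exact: cvg_cst.
  by near=> n; rewrite us.
- exact: cmul0r.
- move=> x /= xe; rewrite /isqF hf_mull; congr hf.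
  by rewrite !(cmulBr, cmulDr) !cmulA ek xe.
Unshelve. all: by end_near.
Qed.

Lemma isq_mul k : nrm k <= 4^-1 ->
  (1 + ml (isq k)) * (1 - ml k) * (1 + ml (isq k)) = 1.
Proof.
move=> k4; have := congr1 (@ml R A) (isq_eq k4).
have := congr1 (@ml R A) (isq_commr k4).
rewrite !(mlD, mlN, mlM); move: (ml (isq k)) (ml k) => g x xg h.
transitivity (1 + (g + g) + g * g - x - x * g - g * x - g * (x * g)); first by ncr.
by rewrite h xg; ncr.
Qed.

End InverseSquareRootFunction.

(** * Polar decomposition near a projection *)

Section Polar.
Context {R : realType} {A : cstarAlgType R}.
Implicit Types (e f x : A).

(** In the corner of [e], the factor e + isq (e - x^* x) is the inverse square root of x^* x, so
    this is the partial isometry in the polar decomposition of [x]. *)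
Definition polar e x : A := x + x ** isq (e - cstar x ** x).

Lemma polarP e f x : projection e -> projection f ->
  f ** x = x -> x ** e = x ->
  nrm (e - cstar x ** x) <= 16^-1 -> nrm (f - x ** cstar x) <= 16^-1 ->
  let v := polar e x in
  [/\ cstar v ** v = e, v ** cstar v = f, f ** v = v, v ** e = v
    & nrm (v - x) <= 2 * nrm x * nrm (e - cstar x ** x)].
Proof.
move=> [es ee] [fs ff] fx xe hk hk'; cbv zeta; rewrite /polar.
set k := e - cstar x ** x in hk *; set g := isq k; set v := x + x ** g.
have k4 : nrm k <= 4^-1 by lra.
have exs : e ** cstar x = cstar x by rewrite -{1}es -cstarM xe.
have ek : e ** k = k by rewrite /k cmulBr ee cmulA exs.
have ke : k ** e = k by rewrite /k cmulBl ee -cmulA xe.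
have ks : cstar k = k by rewrite /k cstarB cstarM cstarK es.
have eg : e ** g = g by exact: isq_corner.
have gs : cstar g = g by exact: isq_star.
have ge : g ** e = g by rewrite -gs -{1}es -cstarM eg.
have ve : v ** e = v by rewrite cmulDl xe -cmulA ge.
have fv : f ** v = v by rewrite cmulDr cmulA fx.
have xx : cstar x ** x = e - k by rewrite /k opprB addrC subrK.
clearbody k.
have vv : cstar v ** v = e.
  apply: ml_inj.
  have -> : cstar v ** v = (cstar x ** x) + g ** (cstar x ** x) +
     (cstar x ** x) ** g + g ** (cstar x ** x) ** g.
    by rewrite /v cstarD cstarM gs; cring.
  rewrite xx !(mlD, mlN, mlM).
  have EG : ml e * ml g = ml g by rewrite -mlM eg.
  have GE : ml g * ml e = ml g by rewrite -mlM ge.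
  have EK : ml e * ml k = ml k by rewrite -mlM ek.
  transitivity (ml e * ((1 + ml g) * (1 - ml k) * (1 + ml g))); last first.
    by rewrite isq_mul// mulr1.
  transitivity (ml e + ml e * ml g - ml e * ml k - ml e * ml k * ml g
    + ml e * ml g - ml e * ml g * ml k + ml e * ml g * ml g
    - ml e * ml g * ml k * ml g); last by ncr.
  by rewrite EG EK !(mulrBr, mulrBl) GE EG; ncr.
have hg : nrm g <= 3 / 2 * nrm k by exact: isq_le.
have x0 := nrm_ge0 x; have g0 := nrm_ge0 g; have k0 := nrm_ge0 k.
have vx : nrm (v - x) <= 2 * nrm x * nrm k.
  rewrite /v addrC addrA addNr add0r.
  have := nrmM x g; have := ler_wpM2l x0 hg; have := mulr_ge0 x0 k0; lra.
have x2 : nrm x ^+ 2 <= 17 / 16.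
  have [f1 _] : nrm f <= 1 /\ True by split=> //; exact: nrm_proj.
  rewrite -nrm_Mstar; have := nrm_tri 0 (x ** cstar x) 0.
  have := nrmB f (f - x ** cstar x); rewrite opprB addrC subrK; lra.
split=> //.
pose r := v ** cstar v.
have rr : r ** r = r.
  by rewrite /r -cmulA (cmulA (cstar v)) vv cmulA ve.
have rs : cstar r = r by rewrite /r cstarM cstarK.
have fr : f ** r = r by rewrite /r cmulA fv.
have rf : r ** f = r by rewrite -rs -{1}fs -cstarM fr.
(* The final projection r lies under [f]. The difference is a projection, so it vanishes as soon as
   its norm is less than 1. *)
suff : f - r = 0 by move/eqP; rewrite subr_eq0 => /eqP.
apply: proj_small.
  split; first by rewrite cstarB fs rs.
  by rewrite cmulBl !cmulBr ff fr rf rr subrr subr0.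
have E : r = x ** cstar x + (x ** (g ** cstar x) + x ** (g ** cstar x))
   + x ** (g ** (g ** cstar x)).
  by rewrite /r /v cstarD cstarM gs; cring.
have -> : f - r = (f - x ** cstar x) - ((x ** (g ** cstar x) + x ** (g ** cstar x))
   + x ** (g ** (g ** cstar x))) by rewrite E; zmod.
set a := x ** (g ** cstar x); set b := x ** (g ** (g ** cstar x)).
have := nrmB (f - x ** cstar x) (a + a + b); have := nrmD (a + a) b; have := nrmD a a.
have g1 : nrm g <= 3 / 32 by lra.
have ha : nrm a <= nrm x ^+ 2 * nrm g.
  have := nrmM x (g ** cstar x); have := ler_wpM2l x0 (nrmM g (cstar x)).
  rewrite nrm_star expr2 -/a; lra.
have hb : nrm b <= nrm x ^+ 2 * (nrm g * nrm g).
  have := nrmM x (g ** (g ** cstar x)); have := ler_wpM2l x0 (nrmM g (g ** cstar x)).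
  have := ler_wpM2l x0 (ler_wpM2l g0 (nrmM g (cstar x))).
  rewrite nrm_star expr2 -/b; lra.
have := ler_wpM2l g0 g1; have := ler_wpM2r g0 x2.
have := ler_wpM2r (mulr_ge0 g0 g0) x2.
by lra.
Qed.


Lemma cont_polar e (u : R -> A) : continuous u ->
  (forall t, nrm (e - cstar (u t) ** u t) <= 4^-1) ->
  continuous (fun t => polar e (u t)).
Proof.
move=> uc ub; apply: cont_add => //; apply: cont_cmul => //.
apply: (@cont_lip _ _ _ _ _ isq [set k | nrm k <= 4^-1] 9) => //.
  by move=> x y xk yk; exact: isq_lip.
apply: cont_sub; first exact: cont_cst.
by apply: cont_cmul => //; exact: cont_cstar.
Qed.

Lemma isq0 : isq (0 : A) = 0.
Proof.
by apply: nrm_le0; have := @isq_le _ A 0; rewrite nrm0 mulr0; apply; rewrite invr_ge0.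
Qed.

(** The partial isometry is the polar part of f e. *)
Lemma close_projections e f : projection e -> projection f -> nrm (e - f) <= 16^-1 ->
  exists s, [/\ cstar s ** s = e, s ** cstar s = f, f ** s = s, s ** e = s
    & nrm (s - e) <= 4 * nrm (e - f)].
Proof.
move=> pe pf ef; have [es ee] := pe; have [fs ff] := pf.
have e1 := nrm_proj pe; have f1 := nrm_proj pf.
have h1 : nrm (e - cstar (f ** e) ** (f ** e)) <= nrm (e - f).
  have -> : e - cstar (f ** e) ** (f ** e) = e ** (e - f) ** e.
    rewrite cstarM es fs -cmulA (cmulA f f) ff cmulBr cmulBl !ee.
    by rewrite !cmulA.
  have := nrmM (e ** (e - f)) e; have := nrmM e (e - f).
  have := nrm_ge0 (e - f); have := nrm_ge0 e; have := nrm_ge0 (e ** (e - f)).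
  move: (nrm (e ** (e - f))) (nrm (e ** (e - f) ** e)) => p q.
  move=> p0 n0 d0 h1 h2; have := ler_wpM2r d0 e1; have := ler_wpM2l p0 e1; lra.
have h2 : nrm (f - (f ** e) ** cstar (f ** e)) <= nrm (e - f).
  have -> : f - (f ** e) ** cstar (f ** e) = f ** (f - e) ** f.
    rewrite cstarM es fs cmulA -(cmulA f e e) ee cmulBr cmulBl !ff.
    by [].
  have := nrmM (f ** (f - e)) f; have := nrmM f (f - e); rewrite (nrmBC f e).
  have := nrm_ge0 (e - f); have := nrm_ge0 f; have := nrm_ge0 (f ** (f - e)).
  move: (nrm (f ** (f - e))) (nrm (f ** (f - e) ** f)) => p q.
  move=> p0 n0 d0 h2 h3; have := ler_wpM2r d0 f1; have := ler_wpM2l p0 f1; lra.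
have [||||v1 v2 v3 v4 v5] := polarP pe pf (x := f ** e).
- by rewrite cmulA ff.
- by rewrite -cmulA ee.
- lra.
- lra.
exists (polar e (f ** e)); split=> //.
have fe1 : nrm (f ** e) <= 1.
  by apply: le_trans (nrmM _ _) _; have := nrm_ge0 e; have := nrm_ge0 f; nra.
have h3 : nrm (f ** e - e) <= nrm (e - f).
  have -> : f ** e - e = (f - e) ** e by rewrite cmulBl ee.
  have := nrmM (f - e) e; rewrite (nrmBC f e).
  have := ler_wpM2l (nrm_ge0 (e - f)) e1; lra.
have := nrm_tri (f ** e) (polar e (f ** e)) e.
have := nrm_ge0 (e - f); have := nrm_ge0 (f ** e).
move: v5 h1; set p := nrm (e - cstar _ ** _) => v5 h1.
have p0 : 0 <= p by exact: nrm_ge0.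
have := ler_wpM2r p0 fe1; lra.
Qed.

(** The segment from [e] to [u], made unitary by [polar], which fixes its two ends. *)
Lemma near_unitary_path e u : projection e -> unitaries e u -> nrm (u - e) <= 64^-1 ->
  exists w : R -> A, [/\ continuous w, w 0 = e, w 1 = u,
    forall t, unitaries e (w t) & forall t, nrm (w t - e) <= 8 * nrm (u - e)].
Proof.
move=> pe [eu ue uu uu'] ule; have [es ee] := pe.
pose x t := e + rc (clamp t) *: (u - e).
have xc : continuous x.
  apply: cont_add; first exact: cont_cst.
  by apply: cont_rcZ; [exact: continuous_clamp|exact: cont_cst].
have ex t : e ** x t = x t by rewrite /x cmulDr ee cmulZr cmulBr eu ee.
have xe t : x t ** e = x t by rewrite /x cmulDl ee cmulZl cmulBl ue ee.
set d := nrm (u - e) in ule *; have d0 : 0 <= d by exact: nrm_ge0.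
have xd t : nrm (x t - e) <= d.
  rewrite /x addrC addrA addNr add0r nrmZ nrm_rc ger0_norm ?clamp_ge0//.
  by rewrite -/d; have := ler_wpM2r d0 (clamp_le1 t); lra.
have bnd y : e ** y = y -> y ** e = y -> nrm (y - e) <= d ->
    nrm (e - cstar y ** y) <= 3 * d.
  move=> ey ye yd; set b := y - e in yd.
  have bs : e ** b = b by rewrite /b cmulBr ey ee.
  have be : cstar b ** e = cstar b by rewrite -{1}es -cstarM bs.
  have yE : y = e + b by rewrite /b addrC subrK.
  clearbody b.
  have -> : e - cstar y ** y = - (b + cstar b + cstar b ** b).
    by rewrite yE cstarD es cmulDl !cmulDr ee bs be; zmod.
  rewrite nrmN; have := nrmD (b + cstar b) (cstar b ** b); have := nrmD b (cstar b).
  have := nrmM (cstar b) b; rewrite !nrm_star; have b0 := nrm_ge0 b.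
  have := ler_wpM2l b0 yd; have : d * nrm b <= 64^-1 * nrm b by apply: ler_wpM2r.
  lra.
have h1 t : nrm (e - cstar (x t) ** x t) <= 3 * d.
  exact: (bnd _ (ex t) (xe t) (xd t)).
have h2 t : nrm (e - x t ** cstar (x t)) <= 3 * d.
  rewrite -{1}(cstarK (x t)); apply: bnd.
  - by rewrite -{1}es -cstarM xe.
  - by rewrite -{1}es -cstarM ex.
  - by rewrite -{1}es -cstarB nrm_star.
have pol t := polarP pe pe (ex t) (xe t) (le_trans (h1 t) _) (le_trans (h2 t) _).
(* The radius 1/64 makes the defect 3 d of the segment meet the bound 1/16 of [polarP]. *)
have d16 : 3 * d <= 16^-1 by lra.
exists (fun t => polar e (x t)); split.
- by apply: cont_polar => // t; have := h1 t; lra.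
- rewrite /x clamp0 rc0 scale0r addr0 /polar es ee subrr isq0 cmul0r addr0//.
- by rewrite /x clamp1 rc1 scale1r addrC subrK /polar uu subrr isq0 cmul0r addr0.
- by move=> t; have [] := pol d16 d16 t.
- move=> t; have [_ _ _ _] := pol d16 d16 t.
  have := nrm_tri (x t) (polar e (x t)) e; have := xd t; have := h1 t.
  have : nrm (x t) <= 1 + d.
    have := nrm_tri e (x t) 0; rewrite !subr0; have := nrm_proj pe; have := xd t; lra.
  set p := nrm (e - _) ; have p0 : 0 <= p by exact: nrm_ge0.
  set n := nrm (x t) => n1 pd xd' tr v.
  have : n * p <= (1 + d) * (3 * d) by apply: ler_pM => //; exact: nrm_ge0.
  have : d * d <= 64^-1 * d by apply: ler_wpM2r.
  lra.
Qed.

End Polar.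

(** * Norms of operator matrices and spatial tensor products *)

Section DirectSum.
Context {R : realType}.
Local Notation K := (complex R).
Implicit Types V : @preHilbert R.

Lemma adjoint_bound V (T T' : V -> V) (k : R) : 0 <= k ->
  (forall v w, ip (T v) w = ip v (T' w)) ->
  (forall v, sqn (T v) <= k * sqn v) -> forall v, sqn (T' v) <= k * sqn v.
Proof.
move=> k0 TT Tk v.
have TT' u w : ip (T' u) w = ip u (T w) by rewrite ip_conj -TT -ip_conj.
have := Re_cauchy_schwarz (T (T' v)) v; rewrite TT -/(sqn _).
have := Tk (T' v); have := sqn_ge0 (T (T' v)).
have := sqn_ge0 (T' v); have := sqn_ge0 v.
move: (sqn (T' v)) (sqn (T _)) (sqn v) => y z x x0 y0 z0 zy yzx.
have [->|yp] := eqVneq y 0; first by rewrite mulr_ge0.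
have yp' : 0 < y by rewrite lt_def yp.
rewrite -(ler_pM2l yp') -expr2; apply: le_trans yzx _.
by rewrite mulrA; apply: ler_wpM2r => //; rewrite mulrC.
Qed.

Lemma sqn_sum_le V m (v : 'I_m -> V) :
  sqn (\sum_i v i) <= m%:R * \sum_i sqn (v i).
Proof.
have -> : sqn (\sum_i v i) = \sum_i \sum_j complex.Re (ip (v i) (v j)).
  rewrite /sqn ip_suml Re_sum; apply: eq_bigr => i _.
  by rewrite ip_sumr Re_sum.
have h i j : complex.Re (ip (v i) (v j)) <= (sqn (v i) + sqn (v j)) / 2.
  by have := sqn_ge0 (v i - v j); rewrite sqnB; lra.
apply: (@le_trans _ _ (\sum_i \sum_j (sqn (v i) + sqn (v j)) / 2)).
  by apply: ler_sum => i _; apply: ler_sum => j _.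
under eq_bigr do rewrite -mulr_suml big_split /= sumr_const card_ord.
rewrite -mulr_suml big_split /= sumrMnl sumr_const card_ord mulr_natl; lra.
Qed.

Section Dsum.
Context (V : @preHilbert R) (m : nat).

Definition dsum_ip (v w : {ffun 'I_m -> V}) : K := \sum_i ip (v i) (w i).

Definition dsum : @preHilbert R.
Proof.
refine (@PreHilbert R {ffun 'I_m -> V} dsum_ip _ _ _).
- move=> y z x x'; rewrite /dsum_ip mulr_sumr -big_split; apply: eq_bigr => i _ /=.
  by rewrite !ffunE ipDl ipZl.
- move=> x y; rewrite /dsum_ip [in RHS]rmorph_sum; apply: eq_bigr => i _.
  exact: ip_conj.
- by move=> x; rewrite /dsum_ip sumr_ge0// => i _; exact: ip_ge0.
Defined.

Lemma sqn_dsum (v : dsum) : sqn v = \sum_i sqn ((v : {ffun 'I_m -> V}) i).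
Proof. by rewrite /sqn /= /dsum_ip Re_sum. Qed.

End Dsum.

Section MatrixAction.
Context {B : cstarAlgType R} {V : @preHilbert R} (r : starRep B V) (m : nat).
Implicit Types X Y : 'I_m -> 'I_m -> B.

Definition mact X (w : dsum V m) : dsum V m :=
  [ffun k => \sum_l r (X k l) ((w : {ffun _ -> _}) l)].
Definition xmul X Y : 'I_m -> 'I_m -> B := fun i j => \sum_k X i k ** Y k j.
Definition xstar X : 'I_m -> 'I_m -> B := fun i j => cstar (X j i).

Lemma mactM X Y w : mact (xmul X Y) w = mact X (mact Y w).
Proof.
apply/ffunP => k; rewrite !ffunE.
under eq_bigr do rewrite sr_suml.
rewrite exchange_big; apply: eq_bigr => j _; rewrite ffunE sr_sumr.
by apply: eq_bigr => l _; rewrite sr_mul.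
Qed.

Lemma mact_star X (v w : dsum V m) : ip (mact X v) w = ip v (mact (xstar X) w).
Proof.
rewrite /= /dsum_ip.
under eq_bigr do rewrite ffunE ip_suml.
under [RHS]eq_bigr do rewrite ffunE ip_sumr.
rewrite exchange_big; apply: eq_bigr => i _; apply: eq_bigr => j _.
by rewrite /xstar sr_star.
Qed.

Lemma xstarM X Y : xstar (xmul X Y) = xmul (xstar Y) (xstar X).
Proof.
apply/funext => i; apply/funext => j; rewrite /xstar /xmul cstar_sum.
by apply: eq_bigr => k _; rewrite cstarM.
Qed.
Lemma xstarK X : xstar (xstar X) = X.
Proof. by apply/funext => i; apply/funext => j; rewrite /xstar cstarK. Qed.

Fixpoint xpow X (j : nat) : 'I_m -> 'I_m -> B :=
  if j is j'.+1 then xmul (xpow X j') (xpow X j') else xmul (xstar X) X.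

Lemma xpowS X j : xpow X j.+1 = xmul (xpow X j) (xpow X j). Proof. by []. Qed.
Lemma xpow0 X : xpow X 0 = xmul (xstar X) X. Proof. by []. Qed.

Lemma xpow_star X j : xstar (xpow X j) = xpow X j.
Proof. by elim: j => [|j ih] /=; rewrite xstarM ?xstarK// ih. Qed.

Lemma mact_xpowS X j w : ip (mact (xpow X j) w) (mact (xpow X j) w) =
  ip (mact (xpow X j.+1) w) w.
Proof. by rewrite xpowS mactM [in RHS]mact_star xpow_star. Qed.

Lemma sqn_mact X w : sqn (mact X w) = complex.Re (ip (mact (xpow X 0) w) w).
Proof. by rewrite /sqn xpow0 mactM [in RHS]mact_star xstarK. Qed.

Lemma mact_crude X (k : R) w : 0 <= k -> (forall i j, nrm (X i j) ^+ 2 <= k) ->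
  sqn (mact X w) <= m%:R * m%:R * k * sqn w.
Proof.
move=> k0 Xk; rewrite sqn_dsum.
apply: (@le_trans _ _ (\sum_(i < m) m%:R * k * sqn w)).
  apply: ler_sum => i _; rewrite ffunE; apply: le_trans (sqn_sum_le _) _.
  rewrite -mulrA; apply: ler_wpM2l => //.
  rewrite sqn_dsum mulr_sumr; apply: ler_sum => l _.
  apply: le_trans (sqn_rep_le _ _ _) _; apply: ler_wpM2r => //; exact: sqn_ge0.
by rewrite sumr_const card_ord -[leLHS]mulr_natl !mulrA.
Qed.

End MatrixAction.

Lemma power_trick (x y M : R) : 0 <= x -> 0 <= y ->
  (forall j, x ^+ (2 ^ j) <= M * y ^+ (2 ^ j)) -> x <= y.
Proof.
move=> x0 y0 h; rewrite leNgt; apply/negP => yx.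
have xp : 0 < x by apply: le_lt_trans yx.
have [||N hN] := @geo_small R (y / x) (`|M| + 1)^-1.
- by rewrite divr_ge0//= ltr_pdivrMr// mul1r.
- by rewrite invr_gt0; have := normr_ge0 M; lra.
have c0 : 0 <= y / x <= 1 by rewrite divr_ge0//= ler_pdivrMr// mul1r ltW.
have : (y / x) ^+ (2 ^ N) <= (y / x) ^+ N.
  by rewrite ler_wiXn2l ?(ltW (ltn_expl _ _))//; [case/andP: c0|case/andP: c0|exact/ltnW/ltn_expl].
move=> h1; have := le_lt_trans h1 hN; rewrite expr_div_n ltr_pdivrMr ?exprn_gt0//.
move=> h2; have := h N; have M0 : 0 < `|M| + 1 by have := normr_ge0 M; lra.
have y2 : 0 <= y ^+ (2 ^ N) by rewrite exprn_ge0.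
have : M * y ^+ (2 ^ N) <= (`|M| + 1) * y ^+ (2 ^ N).
  by apply: ler_wpM2r => //; have := ler_norm M; lra.
have : (`|M| + 1) * y ^+ (2 ^ N) < x ^+ (2 ^ N) by rewrite mulrC -ltr_pdivlMr// mulrC.
lra.
Qed.

(* The norm of a matrix over [B] does not depend on the faithful
   representation: the powers of a self-adjoint matrix have comparable norms in
   two representations, with a constant depending only on the size. *)
Lemma matrix_bound (B : cstarAlgType R) (H : hilbertType R) (p : faithfulRep B H)
    m (X : 'I_m -> 'I_m -> B) (c : R) : 0 <= c ->
  (forall w, sqn (mact (faithful_starRep p) X w) <= c ^+ 2 * sqn w) ->
  forall V (r : starRep B V) w, sqn (mact r X w) <= c ^+ 2 * sqn w.
Proof.
move=> c0 Xc V r w; set pi := faithful_starRep p in Xc.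
pose t := (c ^+ 2) ^+ 2; have t0 : 0 <= t by rewrite sqr_ge0.
have Yj j u : sqn (mact pi (xpow X j) u) <= t ^+ (2 ^ j) * sqn u.
  elim: j u => [|j ih] u.
    rewrite expn0 expr1 /t expr2 -mulrA xpow0 mactM.
    apply: le_trans (_ : c ^+ 2 * sqn (mact pi X u) <= _).
      apply: (adjoint_bound (T := mact pi X)); first exact: sqr_ge0.
        exact: mact_star.
      exact: Xc.
    by apply: ler_wpM2l; [exact: sqr_ge0|exact: Xc].
  rewrite xpowS mactM; apply: le_trans (ih _) _.
  rewrite expnS mul2n -addnn exprD -mulrA; apply: ler_wpM2l; last exact: ih.
  exact: exprn_ge0.
(* Each entry is seen by applying the matrix to a vector with one nonzero coordinate. As [p] is
   isometric, this bounds the entries in [B] itself, hence in every other representation. *)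
have Ye j k l : nrm (xpow X j k l) ^+ 2 <= t ^+ (2 ^ j).
  rewrite /t exprAC ler_sqr ?nnegrE ?nrm_ge0 ?exprn_ge0 ?sqr_ge0//.
  apply: (faithful_isometric (p := p)); first by rewrite exprn_ge0 ?sqr_ge0.
  move=> v; rewrite -ler_sqr ?nnegrE ?mulr_ge0 ?nrm_ge0 ?exprn_ge0 ?sqr_ge0//.
  rewrite exprMn (exprAC (c ^+ 2) (2 ^ j)) -/t -!sqn_nrm.
  pose u : dsum (hilbertPre H) m := [ffun i => if i == l then v else 0].
  have := Yj j u.
  have -> : sqn u = sqn (v : hilbertPre H).
    rewrite sqn_dsum (bigD1 l)//= ffunE eqxx big1 ?addr0// => i il.
    by rewrite ffunE (negbTE il) sqn0.
  move=> hY; apply: le_trans hY; rewrite sqn_dsum (bigD1 k)//= ffunE (bigD1 l)//= ffunE eqxx.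
  rewrite big1 ?addr0; last first.
    by move=> i il; rewrite ffunE (negbTE il); exact: (sr0r pi).
  by rewrite lerDl sumr_ge0// => i _; exact: sqn_ge0.
pose M : R := m%:R * m%:R.
have Vj j : sqn (mact r (xpow X j) w) <= M * t ^+ (2 ^ j) * sqn w.
  by apply: mact_crude; rewrite ?exprn_ge0.
have VS j : sqn (mact r (xpow X j) w) ^+ 2 <= sqn (mact r (xpow X j.+1) w) * sqn w.
  by rewrite {1}/sqn mact_xpowS; exact: Re_cauchy_schwarz.
have b0 := sqn_ge0 w.
(* Repeated Cauchy-Schwarz. With the crude bound [Vj], which loses only the factor M = m^2, the
   exponents 2^j go to infinity and [power_trick] removes M. *)
have VP j : sqn (mact r (xpow X 0) w) ^+ (2 ^ j) * sqn w <=
    sqn (mact r (xpow X j) w) * sqn w ^+ (2 ^ j).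
  elim: j => [|j ih]; first by rewrite expn0 !expr1.
  have [->|bn] := eqVneq (sqn w) 0; first by rewrite mulr0 expr0n expn_eq0 /= mulr0.
  have bp : 0 < sqn w by rewrite lt_def bn.
  have e1 (x : R) : x ^+ (2 ^ j.+1) = (x ^+ (2 ^ j)) ^+ 2 by rewrite expnS mulnC exprM.
  rewrite !e1 -(ler_pM2r bp).
  have := VS j; move: (sqn (mact r (xpow X j.+1) w)) => Q' hQ.
  have B0 : 0 <= (sqn w ^+ (2 ^ j)) ^+ 2 by exact: sqr_ge0.
  have := ler_wpM2r B0 hQ.
  have : (sqn (mact r (xpow X 0) w) ^+ (2 ^ j) * sqn w) ^+ 2 <=
     (sqn (mact r (xpow X j) w) * sqn w ^+ (2 ^ j)) ^+ 2.
    by rewrite ler_sqr ?nnegrE ?mulr_ge0 ?exprn_ge0 ?sqn_ge0.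
  move: (_ ^+ (2 ^ j)) (sqn w ^+ (2 ^ j)) (sqn (mact r (xpow X j) w)) (sqn w).
  by move=> a b q s; rewrite !exprMn !expr2; lra.
have [b00|bn] := eqVneq (sqn w) 0.
  rewrite b00 mulr0 sqn_mact.
  have := Re_cauchy_schwarz (mact r (xpow X 0) w) w; rewrite b00 mulr0.
  by move=> h; rewrite (_ : complex.Re _ = 0)//; apply/eqP; rewrite -sqrf_eq0 eq_le h sqr_ge0.
have bp : 0 < sqn w by rewrite lt_def bn.
have Q0 : sqn (mact r (xpow X 0) w) <= t * sqn w.
  apply: (@power_trick _ _ M); rewrite ?sqn_ge0 ?mulr_ge0// => j.
  rewrite -(ler_pM2r bp); apply: le_trans (VP j) _.
  rewrite exprMn !mulrA mulrAC; apply: ler_wpM2r; first by rewrite exprn_ge0.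
  exact: Vj.
have := Re_cauchy_schwarz (mact r (xpow X 0) w) w; rewrite -sqn_mact => h.
rewrite -ler_sqr ?nnegrE ?mulr_ge0 ?sqr_ge0 ?sqn_ge0//.
apply: le_trans h _; apply: le_trans (_ : t * sqn w * sqn w <= _).
  exact: ler_wpM2r.
by rewrite exprMn /t -mulrA expr2.
Qed.

End DirectSum.

(** * Gram-Schmidt orthonormalisation *)

Section GramSchmidt.
Context {R : realType} {H : hilbertType R}.
Local Notation K := (complex R).
Implicit Types (f : seq H) (x y : H).
Local Notation HP := (hilbertPre H).

Lemma innerDl x x' y : inner (x + x') y = inner x y + inner x' y.
Proof. exact: (ipDl (V := HP)). Qed.
Lemma innerBl x x' y : inner (x - x') y = inner x y - inner x' y.
Proof. exact: (ipBl (V := HP)). Qed.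
Lemma inner_suml (I : Type) (s : seq I) (P : pred I) (F : I -> H) y :
  inner (\sum_(i <- s | P i) F i) y = \sum_(i <- s | P i) inner (F i) y.
Proof. exact: (ip_suml (V := HP)). Qed.
Lemma inner_sumr (I : Type) (s : seq I) (P : pred I) (F : I -> H) y :
  inner y (\sum_(i <- s | P i) F i) = \sum_(i <- s | P i) inner y (F i).
Proof. exact: (ip_sumr (V := HP)). Qed.
Lemma inner_sqr x : inner x x = rc (nrm x ^+ 2).
Proof. by have := ip_sqn (x : HP); rewrite sqn_nrm. Qed.

Definition ons f := [/\ uniq f, {in f, forall g, inner g g = 1}
  & {in f &, forall g g', g != g' -> inner g g' = 0}].

Definition hproj f x : H := \sum_(g <- f) inner x g *: g.

Lemma inner_hproj f x g : ons f -> g \in f -> inner (hproj f x) g = inner x g.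
Proof.
move=> [fu f1 f0] gf; rewrite /hproj inner_suml.
rewrite (bigD1_seq g)//= innerZl (f1 g)// mulr1 big_seq_cond big1 ?addr0//.
by move=> i /andP[fi ig]; rewrite innerZl (f0 i g)// mulr0.
Qed.

Lemma inner_residual f x g : ons f -> g \in f -> inner (x - hproj f x) g = 0.
Proof. by move=> fo gf; rewrite innerBl inner_hproj// subrr. Qed.

Lemma inner_residual_r f x g : ons f -> g \in f -> inner g (x - hproj f x) = 0.
Proof. by move=> fo gf; rewrite inner_conj inner_residual// cj0. Qed.

Definition normalize x : H := rc (nrm x)^-1 *: x.

Lemma inner_normalize x : x != 0 -> inner (normalize x) (normalize x) = 1.
Proof.
move=> x0; have n0 : nrm x != 0 by apply: contra_neq x0; exact: nrm_eq0.
rewrite inner_sqr.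
rewrite /normalize nrmZ nrm_rc ger0_norm ?invr_ge0 ?nrm_ge0//.
by rewrite mulVf// expr1n rc1.
Qed.

Definition gs_next f x := rcons f (normalize (x - hproj f x)).

Lemma ons_next f x : ons f -> x != hproj f x -> ons (gs_next f x).
Proof.
move=> fo xf; have [fu f1 f0] := fo.
have r0 : x - hproj f x != 0 by rewrite subr_eq0.
set r := normalize (x - hproj f x).
have r1 : inner r r = 1 by exact: inner_normalize.
have rf g : g \in f -> inner r g = 0.
  by move=> gf; rewrite /r /normalize innerZl inner_residual// mulr0.
have fr g : g \in f -> inner g r = 0.
  by move=> gf; rewrite inner_conj rf// cj0.
have rnf : r \notin f.
  by apply/negP => /rf; rewrite r1 => /eqP; rewrite oner_eq0.
split.
- by rewrite /gs_next rcons_uniq rnf.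
- by move=> g; rewrite mem_rcons inE => /orP[/eqP->//|/f1].
- move=> g g'; rewrite !mem_rcons !inE => /orP[/eqP->|gf] /orP[/eqP->|gf'] gg'.
  + by rewrite eqxx in gg'.
  + exact: rf.
  + exact: fr.
  + exact: f0.
Qed.

Lemma hproj_next f x y : hproj f y = y -> inner y (normalize (x - hproj f x)) = 0 ->
  hproj (gs_next f x) y = y.
Proof.
by move=> fy y0; rewrite /hproj /gs_next big_rcons/= -/(hproj f y) fy y0 scale0r addr0.
Qed.

Lemma inner_fixed f x y : ons f -> hproj f y = y ->
  inner y (normalize (x - hproj f x)) = 0.
Proof.
move=> fo <-; rewrite {1}/hproj inner_suml big_seq big1//= => g gf.
rewrite innerZl /normalize innerZr.
by rewrite inner_residual_r// !mulr0.
Qed.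

Lemma hproj_next_self f x : ons f -> hproj (gs_next f x) x = x.
Proof.
move=> fo; have [xf|xf] := eqVneq x (hproj f x).
  by rewrite {2}xf hproj_next// ?inner_fixed// -xf.
rewrite /hproj /gs_next big_rcons/= -/(hproj f x) addrC.
set r := x - hproj f x.
have r0 : r != 0 by rewrite subr_eq0.
have n0 : nrm r != 0 by apply: contra_neq r0; exact: nrm_eq0.
have -> : inner x (normalize r) = rc (nrm r).
  have -> : x = hproj f x + r by rewrite /r addrC subrK.
  rewrite innerDl.
  have -> : inner (hproj f x) (normalize r) = 0.
    rewrite {1}/hproj inner_suml big_seq big1//= => g gf.
    rewrite innerZl /normalize innerZr.
    by rewrite /r inner_residual_r// !mulr0.
  rewrite add0r /normalize innerZr rc_conj inner_sqr.
  by rewrite -rcM expr2 mulrA mulVf// mul1r.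
by rewrite /normalize scalerA -rcM divff// scale1r /r subrK.
Qed.

Lemma gram_schmidt (s : seq H) : exists2 f, ons f & {in s, forall x, hproj f x = x}.
Proof.
elim: s => [|x s [f fo fs]]; first by exists [::].
have [xf|xf] := eqVneq x (hproj f x).
  by exists f => // y; rewrite inE => /orP[/eqP->|/fs//].
exists (gs_next f x); first exact: ons_next.
move=> y; rewrite inE => /orP[/eqP->|ys]; first exact: hproj_next_self.
by rewrite hproj_next// ?inner_fixed// fs.
Qed.

End GramSchmidt.

(** * The spatial norm does not depend on the representations *)

Section SpatialBound.
Context {R : realType}.
Local Notation K := (complex R).
Implicit Types V : @preHilbert R.

(** The matrix coefficient of T1 (x) T2 between the sums of x_l (x) y_l and of x'_k (x) y'_k. It
    makes sense for any two spaces, so bounds can be compared without constructing a tensor product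
    of the spaces. *)
Definition sform V1 V2 (T1 : V1 -> V1) (T2 : V2 -> V2) n n' (x : 'I_n -> V1)
    (y : 'I_n -> V2) (x' : 'I_n' -> V1) (y' : 'I_n' -> V2) : K :=
  \sum_l \sum_k ip (T1 (x l)) (x' k) * ip (T2 (y l)) (y' k).

Definition gram V1 V2 n (x : 'I_n -> V1) (y : 'I_n -> V2) : R :=
  complex.Re (sform id id x y x y).

Lemma sform_move V1 V2 (T1 : V1 -> V1) (T2 : V2 -> V2) n n' m
    (f : 'I_m -> V1) (c : 'I_n -> 'I_m -> K) (c' : 'I_n' -> 'I_m -> K)
    (y : 'I_n -> V2) (y' : 'I_n' -> V2) : linear T1 -> linear T2 ->
  sform T1 T2 (fun l => \sum_j c l j *: f j) y (fun k => \sum_j c' k j *: f j) y' =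
  sform T1 T2 f (fun j => \sum_l c l j *: y l) f (fun j => \sum_k c' k j *: y' k).
Proof.
move=> T1l T2l; rewrite /sform.
have T0 V (T : V -> V) : linear T -> T 0 = 0.
  move=> Tl; apply: (addrI (T 0)); have := Tl 1 0 0.
  by rewrite !scale1r !addr0 => <-.
have TS V (T : V -> V) I (s : seq I) (z : I -> K) (v : I -> V) : linear T ->
    T (\sum_(i <- s) z i *: v i) = \sum_(i <- s) z i *: T (v i).
  move=> Tl; elim: s => [|i s ih]; first by rewrite !big_nil T0.
  by rewrite !big_cons Tl ih.
transitivity (\sum_l \sum_k \sum_j \sum_j' c l j * (c' k j')^* *
    (ip (T1 (f j)) (f j') * ip (T2 (y l)) (y' k))).
  apply: eq_bigr => l _; apply: eq_bigr => k _.
  rewrite TS// ip_suml mulr_suml; apply: eq_bigr => j _.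
  rewrite ip_sumr mulr_suml; apply: eq_bigr => j' _.
  by rewrite ipZl ipZr; ring.
transitivity (\sum_j \sum_j' \sum_l \sum_k c l j * (c' k j')^* *
    (ip (T1 (f j)) (f j') * ip (T2 (y l)) (y' k))).
  under eq_bigr do rewrite exchange_big.
  rewrite exchange_big; apply: eq_bigr => j _ /=.
  under eq_bigr do rewrite exchange_big.
  by rewrite exchange_big.
apply: eq_bigr => j _; apply: eq_bigr => j' _.
rewrite TS// ip_suml mulr_sumr; apply: eq_bigr => l _.
rewrite ip_sumr mulr_sumr; apply: eq_bigr => k _.
by rewrite ipZl ipZr; ring.
Qed.

Lemma orthonormal_family (H1 : hilbertType R) n n' (x : 'I_n -> H1) (x' : 'I_n' -> H1) :
  exists m (F : 'I_m -> hilbertPre H1) (c : 'I_n -> 'I_m -> K) (c' : 'I_n' -> 'I_m -> K),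
    [/\ forall j j', ip (F j) (F j') = (j == j')%:R,
        x = (fun l => \sum_j c l j *: F j)
      & x' = (fun l => \sum_j c' l j *: F j)].
Proof.
have [f fo fs] := @gram_schmidt R H1 ([seq x l | l <- enum 'I_n] ++
   [seq x' l | l <- enum 'I_n']).
have [fu f1 f0] := fo.
exists (size f), (fun j => f`_j), (fun l j => inner (x l) f`_j),
  (fun l j => inner (x' l) f`_j).
have FE (z : H1) : hproj f z = z -> z = \sum_(j < size f) inner z f`_j *: f`_j.
  by move=> h; rewrite -{1}h /hproj (big_nth 0) big_mkord.
split.
- move=> j j'; have [->|jj'] := eqVneq j j'; first by apply: f1; exact: mem_nth.
  by apply: f0; rewrite ?mem_nth// nth_uniq.
- apply/funext => l; apply: FE; apply: fs; rewrite mem_cat; apply/orP; left.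
  by apply: map_f; rewrite mem_enum.
- apply/funext => l; apply: FE; apply: fs; rewrite mem_cat; apply/orP; right.
  by apply: map_f; rewrite mem_enum.
Qed.

Lemma gram_orthonormal V (W : @preHilbert R) m (F : 'I_m -> V) (u : 'I_m -> W) :
  (forall j j', ip (F j) (F j') = (j == j')%:R) ->
  gram F u = sqn ([ffun j => u j] : dsum W m).
Proof.
move=> FF; rewrite /gram sqn_dsum /sform Re_sum; apply: eq_bigr => j _; rewrite ffunE.
rewrite (bigD1 j)//= FF eqxx mul1r big1 ?addr0// => j' jj'.
by rewrite FF eq_sym (negbTE jj') mul0r.
Qed.

Lemma gram_ge0 (H1 : hilbertType R) (W : @preHilbert R) n (x : 'I_n -> hilbertPre H1) (y : 'I_n -> W) :
  0 <= gram x y.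
Proof.
have [m [F [c [c' [FF -> _]]]]] := orthonormal_family x x.
by rewrite /gram sform_move// -/(gram _ _) gram_orthonormal// sqn_ge0.
Qed.

Section Data.
Context {A B : cstarAlgType R} (p : nat) (a : 'I_p -> A) (b : 'I_p -> B).

Definition spatial_bound V1 V2 (r1 : starRep A V1) (r2 : starRep B V2) (N : R) :=
  forall n n' (x : 'I_n -> V1) (y : 'I_n -> V2) (x' : 'I_n' -> V1) (y' : 'I_n' -> V2),
    nrm (\sum_i sform (r1 (a i)) (r2 (b i)) x y x' y') ^+ 2 <=
    N ^+ 2 * gram x y * gram x' y'.

(** Once the vectors of the first leg are expanded in an orthonormal family, the operator is a
    matrix over [B] acting on the second leg, and [matrix_bound] passes from the faithful
    representation to an arbitrary one. *)
Lemma spatial_bound_rep (H1 H2 : hilbertType R) (r1 : starRep A (hilbertPre H1))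
    (p2 : faithfulRep B H2) N : 0 <= N ->
  spatial_bound r1 (faithful_starRep p2) N ->
  forall V (r : starRep B V), spatial_bound r1 r N.
Proof.
move=> N0 hN V r n n' x y x' y'.
have [m [F [c [c' [FF -> ->]]]]] := orthonormal_family x x'.
have idl (W : @preHilbert R) : linear (id : W -> W) by [].
rewrite /gram !sform_move//.
under eq_bigr => i _ do rewrite (sform_move _ _ _ _ _ (sr_linear r1 (a i)) (sr_linear r (b i))).
move: (fun j => \sum_l c l j *: y l) (fun j => \sum_l c' l j *: y' l) => w w'.
pose X (j' j : 'I_m) : B := \sum_i ip (r1 (a i) (F j)) (F j') *: b i.
have Xform W (q : starRep B W) (u u' : 'I_m -> W) :
    \sum_i sform (r1 (a i)) (q (b i)) F u F u' =
    ip (mact q X [ffun j => u j]) ([ffun j => u' j] : dsum W m).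
  rewrite /= /dsum_ip /sform.
  rewrite exchange_big /=.
  under [RHS]eq_bigr do rewrite !ffunE ip_suml.
  rewrite [RHS]exchange_big; apply: eq_bigr => j _.
  rewrite exchange_big; apply: eq_bigr => j' _ /=.
  rewrite ffunE sr_suml ip_suml; apply: eq_bigr => i _.
  by rewrite srZl ipZl.
have Gform (W : @preHilbert R) (u : 'I_m -> W) :
    complex.Re (sform id id F u F u) = sqn ([ffun j => u j] : dsum W m).
  exact: gram_orthonormal.
rewrite Xform !Gform.
(* The bound on the form is tested on the pair (u, X u). *)
have Xb : forall u, sqn (mact (faithful_starRep p2) X u) <= N ^+ 2 * sqn u.
  move=> u; have := hN _ _ F u F (mact (faithful_starRep p2) X u).
  rewrite Xform /gram !Gform.
  have ue (z : dsum (hilbertPre H2) m) : [ffun j => (z : {ffun _ -> _}) j] = z.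
    by apply/ffunP => j; rewrite ffunE.
  rewrite !ue ip_sqn nrm_rc ger0_norm ?sqn_ge0// expr2.
  set q := sqn (mact _ _ _) => h; have [->|q0] := eqVneq q 0.
    by rewrite mulr_ge0 ?sqr_ge0 ?sqn_ge0.
  by rewrite -(ler_pM2r (_ : 0 < q))// lt_def q0 sqn_ge0.
apply: le_trans (cauchy_schwarz _ _) _; apply: ler_wpM2r; first exact: sqn_ge0.
exact: (matrix_bound N0 Xb).
Qed.

End Data.

Lemma sform_swap V1 V2 (T1 : V1 -> V1) (T2 : V2 -> V2) n n' (x : 'I_n -> V1)
    (y : 'I_n -> V2) (x' : 'I_n' -> V1) (y' : 'I_n' -> V2) :
  sform T1 T2 x y x' y' = sform T2 T1 y x y' x'.
Proof. by apply: eq_bigr => l _; apply: eq_bigr => k _; rewrite mulrC. Qed.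

Lemma spatial_bound_swap (A B : cstarAlgType R) p (a : 'I_p -> A) (b : 'I_p -> B) V1 V2
    (r1 : starRep A V1) (r2 : starRep B V2) N :
  spatial_bound a b r1 r2 N -> spatial_bound b a r2 r1 N.
Proof.
move=> h n n' x y x' y'; have := h _ _ y x y' x'; rewrite /gram.
by rewrite (sform_swap _ _ y) (sform_swap _ _ y'); under eq_bigr do rewrite sform_swap.
Qed.

End SpatialBound.

Section Dense.
Context {R : realType}.
Implicit Types V W : normedModType (complex R).

Lemma dense_nrm V (S : set V) : dense S -> forall x (e : R), 0 < e ->
  exists2 s, S s & nrm (x - s) < e.
Proof.
move=> Sd x e e0.
have [||s [sb Ss]] := Sd (ball x (rc e)).
- by exists x; apply: ballxx; rewrite -rc0 lt_rc.
- by apply: ball_open; rewrite -rc0 lt_rc.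
exists s => //; move: sb; rewrite -ball_normE /ball_ /= => h.
by rewrite -lt_rc -nrmE.
Qed.

End Dense.

Lemma le_eps {R : realType} (a b k : R) : 0 <= k -> (forall e, 0 < e -> a <= b + e * k) -> a <= b.
Proof.
move=> k0 h; rewrite leNgt; apply/negP => ba.
have k1 : 0 < 2 * (k + 1) by lra.
have e0 : 0 < (a - b) / (2 * (k + 1)) by rewrite divr_gt0// subr_gt0.
have := h _ e0; have : (a - b) / (2 * (k + 1)) * (2 * (k + 1)) = a - b.
  by rewrite mulfVK// gt_eqF.
move: ((a - b) / _) e0 => e e0; nra.
Qed.

(** * Norms on spatial tensor products *)

Section Tensor.
Context {R : realType}.
Local Notation K := (complex R).
Implicit Types A B C T : cstarAlgType R.

(** A faithful representation of the target is what makes a *-homomorphism contractive. The factors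
    of a spatial tensor product and the product itself have one by [tens_spatial]. *)
Definition representable A : Prop :=
  exists H : hilbertType R, inhabited (faithfulRep A H).

Definition rep_comp A B V (r : starRep B V) (f : starHom A B) : starRep A V.
Proof.
refine (@StarRep R A V (fun a => r (f a)) _ _ _ _).
- by move=> a; exact: sr_linear.
- by move=> v z a b; rewrite sh_linear srDl srZl.
- by move=> a b v; rewrite sh_mul sr_mul.
- by move=> a v w; rewrite sr_star sh_star.
Defined.

Lemma faithful_le A (H : hilbertType R) (p : faithfulRep A H) a v :
  nrm (p a v) <= nrm a * nrm v.
Proof.
rewrite -ler_sqr ?nnegrE ?mulr_ge0 ?nrm_ge0// exprMn -!sqn_nrm.
exact: (sqn_rep_le (faithful_starRep p)).
Qed.

Lemma frep_suml A (H : hilbertType R) (p : faithfulRep A H) (I : Type) (s : seq I)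
    (P : pred I) (F : I -> A) v :
  p (\sum_(i <- s | P i) F i) v = \sum_(i <- s | P i) p (F i) v.
Proof. exact: (sr_suml (faithful_starRep p)). Qed.
Lemma frep_sumr A (H : hilbertType R) (p : faithfulRep A H) (I : Type) (s : seq I)
    (P : pred I) (F : I -> H) a :
  p a (\sum_(i <- s | P i) F i) = \sum_(i <- s | P i) p a (F i).
Proof. exact: (sr_sumr (faithful_starRep p)). Qed.
Lemma frepB A (H : hilbertType R) (p : faithfulRep A H) a v w :
  p a (v - w) = p a v - p a w.
Proof.
have := sr_linear (faithful_starRep p) a (-1) w v; rewrite /= !scaleN1r.
by rewrite (addrC (- w)) (addrC (- p a w)).
Qed.
Lemma inner_le (H : hilbertType R) (x y : H) : nrm (inner x y) <= nrm x * nrm y.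
Proof.
rewrite -ler_sqr ?nnegrE ?mulr_ge0 ?nrm_ge0// exprMn -!sqn_nrm.
exact: (@cauchy_schwarz R (hilbertPre H) x y).
Qed.

Lemma starHom_nrm A B (f : starHom A B) a : representable B -> nrm (f a) <= nrm a.
Proof.
move=> [H [p]]; apply: (faithful_isometric (p := p)); first exact: nrm_ge0.
move=> v; rewrite -ler_sqr ?nnegrE ?mulr_ge0 ?nrm_ge0// exprMn -!sqn_nrm.
exact: (sqn_rep_le (rep_comp (faithful_starRep p) f)).
Qed.

Section StarHomAlg.
Context {A B} (f : starHom A B).
Lemma shD x y : f (x + y) = f x + f y.
Proof. by have := sh_linear f 1 x y; rewrite !scale1r. Qed.
Lemma sh0 : f 0 = 0.
Proof. by apply: (addrI (f 0)); rewrite -shD !addr0. Qed.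
Lemma shZ z x : f (z *: x) = z *: f x.
Proof. by have := sh_linear f z x 0; rewrite sh0 !addr0. Qed.
Lemma shN x : f (- x) = - f x.
Proof. by rewrite -(scaleN1r x) shZ scaleN1r. Qed.
Lemma shB x y : f (x - y) = f x - f y.
Proof. by rewrite shD shN. Qed.
Lemma sh_sum (I : Type) (s : seq I) (P : pred I) (F : I -> A) :
  f (\sum_(i <- s | P i) F i) = \sum_(i <- s | P i) f (F i).
Proof. by apply: (big_morph f) => [x y|]; rewrite ?shD ?sh0. Qed.
Lemma sh_projection e : projection e -> projection (f e).
Proof. by case=> es ee; split; rewrite -?sh_star -?sh_mul ?es ?ee. Qed.
Lemma sh_unitaries e u : unitaries e u -> unitaries (f e) (f u).
Proof. by case=> h1 h2 h3 h4; split; rewrite -?sh_star -!sh_mul ?h1 ?h2 ?h3 ?h4. Qed.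
Lemma sh_continuous : representable B -> continuous f.
Proof.
move=> rB x; apply/cvg_nrmP => e e0.
have /cvg_nrmP/(_ _ e0) h := @cvg_id A (nbhs x).
near=> y; rewrite -shB; apply: le_lt_trans (starHom_nrm _ _ rB) _.
by near: y.
Unshelve. all: by end_near.
Qed.
End StarHomAlg.

Section TensorAlg.
Context {A B T} (t : cstarTensor A B T).
Lemma tensDl a a' b : t (a + a') b = t a b + t a' b.
Proof. by have := tens_linear_l t b 1 a a'; rewrite !scale1r. Qed.
Lemma tensDr a b b' : t a (b + b') = t a b + t a b'.
Proof. by have := tens_linear_r t a 1 b b'; rewrite !scale1r. Qed.
Lemma tens0l b : t 0 b = 0.
Proof. by apply: (addrI (t 0 b)); rewrite -tensDl !addr0. Qed.
Lemma tens0r a : t a 0 = 0.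
Proof. by apply: (addrI (t a 0)); rewrite -tensDr !addr0. Qed.
Lemma tensZl z a b : t (z *: a) b = z *: t a b.
Proof. by have := tens_linear_l t b z a 0; rewrite tens0l !addr0. Qed.
Lemma tensZr z a b : t a (z *: b) = z *: t a b.
Proof. by have := tens_linear_r t a z b 0; rewrite tens0r !addr0. Qed.
Lemma tensNl a b : t (- a) b = - t a b.
Proof. by rewrite -(scaleN1r a) tensZl scaleN1r. Qed.
Lemma tensNr a b : t a (- b) = - t a b.
Proof. by rewrite -(scaleN1r b) tensZr scaleN1r. Qed.
Lemma tensBl a a' b : t (a - a') b = t a b - t a' b.
Proof. by rewrite tensDl tensNl. Qed.
Lemma tensBr a b b' : t a (b - b') = t a b - t a b'.
Proof. by rewrite tensDr tensNr. Qed.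

Lemma tens_rep1 : representable A.
Proof. by have [H1 [H2 [H [h [p1 [p2 [p _]]]]]]] := tens_spatial t; exists H1. Qed.
Lemma tens_rep : representable T.
Proof. by have [H1 [H2 [H [h [p1 [p2 [p _]]]]]]] := tens_spatial t; exists H. Qed.

Lemma tens_approx x (e : R) : 0 < e -> exists n (a : 'I_n -> A) (b : 'I_n -> B),
  nrm (x - \sum_i t (a i) (b i)) < e.
Proof. by move=> e0; have [_ [n [a [b ->]]] h] := dense_nrm (tens_dense t) x e0; exists n, a, b. Qed.

End TensorAlg.

Section Spatial.
Context {A B T} (t : cstarTensor A B T).
Context (H1 H2 H : hilbertType R) (h : hilbertTensor H1 H2 H).
Context (p1 : faithfulRep A H1) (p2 : faithfulRep B H2) (pT : faithfulRep T H).
Hypothesis pE : forall a b x y, pT (t a b) (h x y) = h (p1 a x) (p2 b y).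
Local Notation r1 := (faithful_starRep p1).
Local Notation r2 := (faithful_starRep p2).
Local Notation rT := (faithful_starRep pT).

Definition hvec n (x : 'I_n -> H1) (y : 'I_n -> H2) : H := \sum_l h (x l) (y l).

Lemma inner_hvec n n' (x : 'I_n -> H1) y (x' : 'I_n' -> H1) y' :
  inner (hvec x y) (hvec x' y') =
  sform (V1 := hilbertPre H1) (V2 := hilbertPre H2) id id x y x' y'.
Proof.
rewrite /hvec inner_suml /sform; apply: eq_bigr => l _.
rewrite inner_sumr; apply: eq_bigr => k _; exact: htens_inner.
Qed.

Lemma gram_hvec n (x : 'I_n -> H1) y :
  gram (V1 := hilbertPre H1) (V2 := hilbertPre H2) x y = nrm (hvec x y) ^+ 2.
Proof. by rewrite /gram -inner_hvec inner_sqr. Qed.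

Lemma hvec_approx z (e : R) : 0 < e -> exists n (x : 'I_n -> H1) (y : 'I_n -> H2),
  nrm (z - hvec x y) < e.
Proof. by move=> e0; have [_ [n [x [y ->]]] hh] := dense_nrm (htens_dense h) z e0; exists n, x, y. Qed.

Lemma rep_hvec p (a : 'I_p -> A) (b : 'I_p -> B) n n' (x : 'I_n -> H1) y
    (x' : 'I_n' -> H1) y' :
  inner (pT (\sum_i t (a i) (b i)) (hvec x y)) (hvec x' y') =
  \sum_i sform (r1 (a i)) (r2 (b i)) x y x' y'.
Proof.
rewrite frep_suml inner_suml; apply: eq_bigr => i _.
rewrite /hvec frep_sumr inner_suml; apply: eq_bigr => l _.
rewrite inner_sumr; apply: eq_bigr => k _ /=.
by rewrite pE htens_inner.
Qed.

Lemma spatial_bound_tens p (a : 'I_p -> A) (b : 'I_p -> B) :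
  spatial_bound a b r1 r2 (nrm (\sum_i t (a i) (b i))).
Proof.
move=> n n' x y x' y'; rewrite -rep_hvec !gram_hvec.
rewrite -!exprMn ler_sqr ?nnegrE ?mulr_ge0 ?nrm_ge0//.
apply: le_trans (inner_le _ _) _; apply: ler_wpM2r; first exact: nrm_ge0.
exact: faithful_le.
Qed.

Lemma rep_dense_le z (N : R) : 0 <= N ->
  (forall n (x : 'I_n -> H1) y n' (x' : 'I_n' -> H1) y',
     nrm (inner (pT z (hvec x y)) (hvec x' y')) <= N * nrm (hvec x y) * nrm (hvec x' y')) ->
  nrm z <= N.
Proof.
move=> N0 hb; apply: (faithful_isometric (p := pT)) => // v.
have key n (x : 'I_n -> H1) y : nrm (pT z (hvec x y)) <= N * nrm (hvec x y).
  set M := N * nrm (hvec x y); set u := pT z (hvec x y).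
  have M0 : 0 <= M by rewrite mulr_ge0 ?nrm_ge0.
  have u0 := nrm_ge0 u.
  have : nrm u ^+ 2 <= M * nrm u.
    apply: (@le_eps _ _ _ (M + nrm u)); first by rewrite addr_ge0.
    move=> e e0; have [n' [x' [y' hw]]] := hvec_approx u e0.
    set w := hvec x' y' in hw.
    have : rc (nrm u ^+ 2) = inner u w + inner u (u - w).
      by rewrite -inner_sqr -(ipDr (V := hilbertPre H)) addrC subrK.
    move=> /(congr1 nrm); rewrite nrm_rc ger0_norm ?sqr_ge0// => ->.
    have := nrmD (inner u w) (inner u (u - w)).
    have := inner_le u (u - w); have := hb _ x y _ x' y'; rewrite -/u -/w -/M.
    have : nrm w <= nrm u + e.
      have := nrm_tri u w 0; rewrite !subr0 (nrmBC w); lra.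
    move=> h1 h2 h3 h4.
    have := ler_wpM2l M0 h1; have : nrm u * nrm (u - w) <= nrm u * e.
      by apply: ler_wpM2l => //; exact: ltW.
    lra.
  have [->//|un] := eqVneq (nrm u) 0.
  have up : 0 < nrm u by rewrite lt_def un.
  by rewrite expr2 ler_pM2r.
apply: (@le_eps _ _ _ (N + nrm z)); first by rewrite addr_ge0 ?nrm_ge0.
move=> e e0; have [n [x [y hv]]] := hvec_approx v e0.
set w := hvec x y in hv; have := key _ x y; rewrite -/w.
have := nrmD (pT z w) (pT z (v - w)); rewrite frepB addrC subrK.
have := faithful_le pT z (v - w); rewrite frepB.
have : nrm w <= nrm v + e by have := nrm_tri v w 0; rewrite !subr0 (nrmBC w); lra.
move=> h1 h2 h3 h4; have := ler_wpM2l N0 h1.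
have : nrm z * nrm (v - w) <= nrm z * e.
  by apply: ler_wpM2l; [exact: nrm_ge0|exact: ltW].
lra.
Qed.

(** With [spatial_bound_tens], this says that the norm of a sum of elementary tensors is the least
    bound of its forms, which [spatial_bound_rep] can then transfer. *)
Lemma tens_spatial_bound p (a : 'I_p -> A) (b : 'I_p -> B) N : 0 <= N ->
  spatial_bound a b r1 r2 N -> nrm (\sum_i t (a i) (b i)) <= N.
Proof.
move=> N0 hb; apply: rep_dense_le => // n x y n' x' y'; rewrite rep_hvec.
rewrite -ler_sqr ?nnegrE ?mulr_ge0 ?nrm_ge0// !exprMn -!gram_hvec.
exact: hb.
Qed.

(* The Gram matrix of [x] defines a pre-Hilbert space of families in the second
   space, on which [B] acts diagonally. *)
Lemma hvec_act2 n (x : 'I_n -> H1) (y : 'I_n -> H2) b :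
  nrm (hvec x (fun l => p2 b (y l))) <= nrm b * nrm (hvec x y).
Proof.
pose ip0 (u v : {ffun 'I_n -> H2}) : K := inner (hvec x u) (hvec x v).
have ip0E u v : ip0 u v = \sum_l \sum_k inner (x l) (x k) * inner (u l) (v k).
  exact: inner_hvec.
have ipl y0 z u u' : ip0 (z *: u + u') y0 = z * ip0 u y0 + ip0 u' y0.
  rewrite !ip0E mulr_sumr -big_split; apply: eq_bigr => l _ /=.
  rewrite mulr_sumr -big_split; apply: eq_bigr => k _ /=.
  by rewrite !ffunE innerDl innerZl; ring.
pose V := @PreHilbert R {ffun 'I_n -> H2} ip0 ipl (fun u v => inner_conj _ _)
  (fun u => @ip_ge0 R (hilbertPre H) _).
pose act (c : B) (u : {ffun 'I_n -> H2}) : {ffun 'I_n -> H2} := [ffun l => p2 c (u l)].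
have act1 c : linear (act c : V -> V).
  by move=> z u v; apply/ffunP => l; rewrite !ffunE rep_linear.
have act2 (u : V) : linear (fun c => act c u : V).
  by move=> z c d; apply/ffunP => l; rewrite !ffunE (rep_linear_alg p2).
have act3 c d (u : V) : act (c ** d) u = act c (act d u) :> V.
  by apply/ffunP => l; rewrite !ffunE rep_mul.
have act4 c (u v : V) : ip (act c u : V) v = ip u (act (cstar c) v : V).
  rewrite /= !ip0E; apply: eq_bigr => l _; apply: eq_bigr => k _.
  by rewrite !ffunE rep_star.
pose r := @StarRep R B V act act1 act2 act3 act4.
have := sqn_rep_le r b [ffun l => y l].
have sE (u : V) : sqn u = nrm (hvec x u) ^+ 2.
  by rewrite /sqn /= /ip0 inner_sqr.
rewrite !sE -exprMn ler_sqr ?nnegrE ?mulr_ge0 ?nrm_ge0//.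
have -> : hvec x [ffun l => y l] = hvec x y.
  by apply: eq_bigr => l _; rewrite ffunE.
have -> : hvec x (r b [ffun l => y l]) = hvec x (fun l => p2 b (y l)) => //.
by apply: eq_bigr => l _; rewrite !ffunE.
Qed.

End Spatial.
End Tensor.

Section CrossNorm.
Context {R : realType}.
Implicit Types A B C T : cstarAlgType R.

Lemma htens_swap (H1 H2 H : hilbertType R) (h : hilbertTensor H1 H2 H) :
  hilbertTensor H2 H1 H.
Proof.
refine (@HilbertTensor R H2 H1 H (fun y x => h x y) _ _).
- by move=> *; rewrite htens_inner mulrC.
- have := htens_dense h; congr dense; apply/seteqP; split=> z [n [x [y ->]]];
  by exists n, y, x.
Defined.

(** Each leg acts with at most its own norm, by [hvec_act2] applied on both sides. *)
Lemma nrm_tens A B T (t : cstarTensor A B T) a b : nrm (t a b) <= nrm a * nrm b.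
Proof.
have [H1 [H2 [H [h [p1 [p2 [pT pE]]]]]]] := tens_spatial t.
have ab0 : 0 <= nrm a * nrm b by rewrite mulr_ge0 ?nrm_ge0.
apply: (rep_dense_le (h := h) (pT := pT)) => // n x y n' x' y'.
apply: le_trans (inner_le _ _) _; apply: ler_wpM2r; first exact: nrm_ge0.
have -> : pT (t a b) (hvec h x y) = hvec h (fun l => p1 a (x l)) (fun l => p2 b (y l)).
  by rewrite /hvec frep_sumr; apply: eq_bigr => l _; rewrite pE.
have h1 := hvec_act2 h p2 (fun l => p1 a (x l)) y b.
have h2 := hvec_act2 (htens_swap h) p1 y x a.
have := ler_wpM2l (nrm_ge0 b) h2; move: h1; rewrite /hvec /=; lra.
Qed.

End CrossNorm.

(** * Extension by continuity, and homomorphisms on tensor products *)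

Section Extension.
Context {R : realType}.
Local Notation K := (complex R).

Lemma invSn_small (e : R) : 0 < e -> exists N, forall n, (N <= n)%N -> n.+1%:R^-1 < e.
Proof.
move=> e0; exists (Num.truncn e^-1) => n Nn.
rewrite -ltf_pV2 ?posrE ?invr_gt0// invrK; apply: lt_le_trans (truncnS_gt _) _.
by rewrite ler_nat.
Qed.

Lemma cvg_lipschitz (V W : normedModType K) I (F : set_system I) {FF : Filter F}
    (f : V -> W) (M : R) (u : I -> V) x :
  (forall x y, nrm (f x - f y) <= M * nrm (x - y)) ->
  u @ F --> x -> (fun i => f (u i)) @ F --> f x.
Proof.
move=> fM /cvg_nrmP ux; apply/cvg_nrmP => e e0.
have M0 : 0 < `|M| + 1 by have := normr_ge0 M; lra.
have h := ux _ (divr_gt0 e0 M0); near=> i.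
apply: le_lt_trans (fM _ _) _.
have : nrm (u i - x) < e / (`|M| + 1) by near: i.
rewrite ltr_pdivlMr// => h'; apply: le_lt_trans h'; rewrite mulrC.
by apply: ler_wpM2l; [exact: nrm_ge0|have := ler_norm M; lra].
Unshelve. all: by end_near.
Qed.

(** [P] is a relation because its uses pair a finite sum with the image of that sum: the Lipschitz
    estimate gives both that the image is well defined and that it extends. The last clause lets
    algebraic identities pass to the limit. *)
Lemma extend_lipschitz (V : normedModType K) (W : completeNormedModType K)
    (P : V -> W -> Prop) (M : R) : 0 <= M ->
  (forall x y x' y', P x y -> P x' y' -> nrm (y - y') <= M * nrm (x - x')) ->
  (forall x (e : R), 0 < e -> exists x' y', P x' y' /\ nrm (x - x') < e) ->
  exists F : V -> W, [/\ forall x x', nrm (F x - F x') <= M * nrm (x - x'),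
    forall x y, P x y -> F x = y
    & forall x : V, exists u : nat -> V, (forall n, P (u n) (F (u n))) /\ u @ \oo --> x].
Proof.
move=> M0 PM Pd.
have seqs x : exists uv : (nat -> V) * (nat -> W),
    (forall n, P (uv.1 n) (uv.2 n)) /\ forall n, nrm (x - uv.1 n) < n.+1%:R^-1.
  have h n : exists q : V * W, P q.1 q.2 /\ nrm (x - q.1) < n.+1%:R^-1.
    have [|x' [y' [h1 h2]]] := Pd x n.+1%:R^-1; first by rewrite invr_gt0.
    by exists (x', y').
  have [f hf] := choice h; exists (fun n => (f n).1, fun n => (f n).2).
  by split=> n /=; have [] := hf n.
have [uv huv] := choice seqs.
have ux x : (uv x).1 @ \oo --> x.
  apply/cvg_nrmP => e e0; have [N hN] := invSn_small e0; exists N => // n Nn.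
  by rewrite nrmBC; apply: lt_trans (hN _ Nn); exact: (huv x).2.
have lims x : exists y : W, (uv x).2 @ \oo --> y.
  apply: cauchy_nrm => e e0; pose d := e / (2 * (M + 1)).
  have d0 : 0 < d by apply: divr_gt0 => //; lra.
  have dM : d * (2 * (M + 1)) = e by rewrite /d mulfVK//; apply/eqP; lra.
  clearbody d; have [N hN] := invSn_small d0; exists N => m n Nm Nn.
  have [hP hd] := huv x; apply: le_lt_trans (PM _ _ _ _ (hP m) (hP n)) _.
  have := nrm_tri x ((uv x).1 m) ((uv x).1 n); rewrite (nrmBC _ x).
  have := lt_trans (hd m) (hN _ Nm); have := lt_trans (hd n) (hN _ Nn).
  move=> h3 h4 h5.
  have : M * nrm ((uv x).1 m - (uv x).1 n) <= M * (2 * d) by apply: ler_wpM2l => //; lra.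
  lra.
have [F hF] := choice lims.
have FL x x' : nrm (F x - F x') <= M * nrm (x - x').
  apply: (@le_eps _ _ _ (2 + 2 * M)); first by lra.
  move=> e e0.
  have /cvg_nrmP/(_ _ e0) h1 := hF x; have /cvg_nrmP/(_ _ e0) h2 := hF x'.
  have /cvg_nrmP/(_ _ e0) h3 := ux x; have /cvg_nrmP/(_ _ e0) h4 := ux x'.
  have [n [[[g1 g2] g3] g4]] := filter_ex (filterI (filterI (filterI h1 h2) h3) h4).
  have := PM _ _ _ _ ((huv x).1 n) ((huv x').1 n).
  move: g1 g2 g3 g4; rewrite /=; move: ((uv x).1 n) ((uv x).2 n) => a b.
  move: ((uv x').1 n) ((uv x').2 n) => a' b' g1 g2 g3 g4 h.
  have := nrm_tri b (F x) (F x'); have := nrm_tri b' b (F x').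
  have := nrm_tri x a a'; have := nrm_tri x' x a'.
  rewrite (nrmBC (F x) b) (nrmBC x' a') => h5 h6 h7 h8.
  have : M * nrm (a - a') <= M * (nrm (x - x') + 2 * e) by apply: ler_wpM2l => //; lra.
  lra.
have FP x y : P x y -> F x = y.
  move=> Pxy; apply/eqP; rewrite -subr_eq0; apply/eqP/nrm_le0.
  apply: (@le_eps _ _ _ (1 + M)); first by lra.
  move=> e e0; have /cvg_nrmP/(_ _ e0) h1 := hF x.
  have /cvg_nrmP/(_ _ e0) h2 := ux x.
  have [n [g1 g2]] := filter_ex (filterI h1 h2).
  have := PM _ _ _ _ ((huv x).1 n) Pxy; have := nrm_tri ((uv x).2 n) (F x) y.
  rewrite (nrmBC (F x) ((uv x).2 n)) => h3 h4.
  have : M * nrm ((uv x).1 n - x) <= M * e by apply: ler_wpM2l => //; exact: ltW.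
  move: g1; rewrite /=; lra.
exists F; split=> // x; exists (uv x).1; split=> // n.
by have hP := (huv x).1 n; rewrite (FP _ _ hP).
Qed.


Section TensorHom.
Context {A B T C : cstarAlgType R} (t : cstarTensor A B T) (b : A -> B -> C).

Definition tsum (s : seq (A * B)) : T := \sum_(x <- s) t x.1 x.2.
Definition bsum (s : seq (A * B)) : C := \sum_(x <- s) b x.1 x.2.

Lemma tens_dense_seq x (e : R) : 0 < e -> exists s, nrm (x - tsum s) < e.
Proof.
move=> e0; have [n [a [c h]]] := tens_approx t x e0.
by exists [seq (a i, c i) | i <- index_enum 'I_n]; rewrite /tsum big_map.
Qed.

Hypothesis b_linl : forall y, linear (b^~ y).
Hypothesis b_mul : forall a a' c c', b (a ** a') (c ** c') = b a c ** b a' c'.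
Hypothesis b_star : forall a c, b (cstar a) (cstar c) = cstar (b a c).
Hypothesis b_bound : forall p (x : 'I_p -> A) (y : 'I_p -> B),
  nrm (\sum_i b (x i) (y i)) <= nrm (\sum_i t (x i) (y i)).

Lemma bsum_bound s : nrm (bsum s) <= nrm (tsum s).
Proof.
rewrite /bsum /tsum !(big_nth (0, 0)) !big_mkord.
exact: (b_bound (fun i => (nth (0, 0) s i).1) (fun i => (nth (0, 0) s i).2)).
Qed.

Lemma tens_hom : exists F : starHom T C, forall x y, F (t x y) = b x y.
Proof.
pose P x y := exists s, x = tsum s /\ y = bsum s.
have bZ z x y : b (z *: x) y = z *: b x y.
  have b0 : b 0 y = 0.
    by apply: (addrI (b 0 y)); have := b_linl y 1 0 0; rewrite !scale1r !addr0 => <-.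
  by have := b_linl y z x 0; rewrite b0 !addr0.
have Plin z x y x' y' : P x y -> P x' y' -> P (z *: x + x') (z *: y + y').
  move=> [s [-> ->]] [s' [-> ->]]; exists ([seq (z *: u.1, u.2) | u <- s] ++ s').
  rewrite /tsum /bsum !big_cat !big_map /= !scaler_sumr.
  by split; congr (_ + _); apply: eq_bigr => i _; rewrite ?tensZl ?bZ.
have Pmul x y x' y' : P x y -> P x' y' -> P (x ** x') (y ** y').
  move=> [s [-> ->]] [s' [-> ->]].
  exists [seq (u.1 ** u'.1, u.2 ** u'.2) | u <- s, u' <- s'].
  rewrite /tsum /bsum !big_allpairs_dep !cmul_suml /=.
  split; apply: eq_bigr => i _; rewrite cmul_sumr; apply: eq_bigr => j _.
    by rewrite tens_mul.
  by rewrite b_mul.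
have Pstar x y : P x y -> P (cstar x) (cstar y).
  move=> [s [-> ->]]; exists [seq (cstar u.1, cstar u.2) | u <- s].
  rewrite /tsum /bsum !big_map !cstar_sum /=.
  by split; apply: eq_bigr => i _; rewrite ?tens_star ?b_star.
have [|x y x' y' Pxy Pxy'|x e e0|F [FL FP Fd]] := @extend_lipschitz T C P 1.
- exact: ler01.
- have := Plin (-1) _ _ _ _ Pxy' Pxy; rewrite !scaleN1r !(addrC (- _)) mul1r.
  by move=> [s [-> ->]]; exact: bsum_bound.
- by have [s hs] := tens_dense_seq x e0; exists (tsum s), (bsum s); split=> //; exists s.
have Fc (u : nat -> T) x : u @ \oo --> x -> (fun n => F (u n)) @ \oo --> F x.
  by move=> ux; apply: cvg_lipschitz ux; exact: FL.
have Fl : linear F.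
  move=> z x y; have [u [Pu ux]] := Fd x; have [v [Pv vy]] := Fd y.
  apply: (@cvg_eq0 _ _ _ \oo _ (fun n => F (z *: u n + v n))
     (fun n => z *: F (u n) + F (v n))).
  + by apply: Fc; apply: cvgD => //; exact: cvgZl_tmp.
  + by apply: cvgD; [apply: cvgZl_tmp|]; exact: Fc.
  + by near=> n; apply: FP; exact: Plin.
have Fm : {morph F : x y / x ** y}.
  move=> x y; have [u [Pu ux]] := Fd x; have [v [Pv vy]] := Fd y.
  apply: (@cvg_eq0 _ _ _ \oo _ (fun n => F (u n ** v n)) (fun n => F (u n) ** F (v n))).
  + by apply: Fc; exact: cvg_cmul.
  + by apply: cvg_cmul; exact: Fc.
  + by near=> n; apply: FP; exact: Pmul.
have Fs : {morph F : x / cstar x}.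
  move=> x; have [u [Pu ux]] := Fd x.
  apply: (@cvg_eq0 _ _ _ \oo _ (fun n => F (cstar (u n))) (fun n => cstar (F (u n)))).
  + by apply: Fc; exact: cvg_cstar.
  + by apply: cvg_cstar; exact: Fc.
  + by near=> n; apply: FP; exact: Pstar.
exists (StarHom Fl Fm Fs) => x y /=; apply: FP; exists [:: (x, y)].
by rewrite /tsum /bsum !big_seq1.
Unshelve. all: by end_near.
Qed.

End TensorHom.

Section TensorMaps.
Context {A B T : cstarAlgType R} (t : cstarTensor A B T).

(** Composing the second representation with [k] may destroy faithfulness, which the target of
    [spatial_bound_rep] does not require. *)
Lemma tens_map2_bound (k : starHom B B) p (x : 'I_p -> A) (y : 'I_p -> B) :
  nrm (\sum_i t (x i) (k (y i))) <= nrm (\sum_i t (x i) (y i)).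
Proof.
have [H1 [H2 [H [h [p1 [p2 [pT pE]]]]]]] := tens_spatial t.
apply: (tens_spatial_bound pE); first exact: nrm_ge0.
exact: (spatial_bound_rep (nrm_ge0 _) (spatial_bound_tens pE x y)
  (rep_comp (faithful_starRep p2) k)).
Qed.

Lemma tens_map2 (k : starHom B B) :
  exists F : starHom T T, forall x y, F (t x y) = t x (k y).
Proof.
apply: (tens_hom (t := t) (b := fun x y => t x (k y))).
- by move=> y; exact: tens_linear_l.
- by move=> *; rewrite sh_mul tens_mul.
- by move=> *; rewrite sh_star tens_star.
- exact: tens_map2_bound.
Qed.

End TensorMaps.

Section TensorFlip.
Context {D T : cstarAlgType R} (t : cstarTensor D D T).

(** As both factors are [D], the second leg can be moved from [p2] to [p1]; the two legs are then
    exchanged, and the second one is moved back to [p2]. *)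
Lemma tens_flip_bound p (x y : 'I_p -> D) :
  nrm (\sum_i t (y i) (x i)) <= nrm (\sum_i t (x i) (y i)).
Proof.
have [H1 [H2 [H [h [p1 [p2 [pT pE]]]]]]] := tens_spatial t.
apply: (tens_spatial_bound pE); first exact: nrm_ge0.
set N := nrm _; have N0 : 0 <= N by exact: nrm_ge0.
have h1 := spatial_bound_tens pE x y.
have h2 := spatial_bound_rep N0 h1 (faithful_starRep p1).
exact: (spatial_bound_rep N0 (spatial_bound_swap h2) (faithful_starRep p2)).
Qed.

Lemma tens_flip : exists F : starHom T T, forall x y, F (t x y) = t y x.
Proof.
apply: (tens_hom (t := t) (b := fun x y => t y x)).
- by move=> y; exact: tens_linear_r.
- by move=> *; rewrite tens_mul.
- by move=> *; rewrite tens_star.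
- by move=> *; exact: tens_flip_bound.
Qed.

End TensorFlip.

End Extension.

(** * Unital endomorphisms of a strongly self-absorbing algebra *)

Section Unitaries.
Context {R : realType}.
Implicit Types A B C : cstarAlgType R.

Lemma unitaries_id B (e : B) : projection e -> unitaries e e.
Proof. by case=> es ee; split; rewrite ?es. Qed.
Lemma unitaries_mul B (e u v : B) : unitaries e u -> unitaries e v ->
  unitaries e (u ** v).
Proof.
move=> [h1 h2 h3 h4] [g1 g2 g3 g4]; split.
- by rewrite cmulA h1.
- by rewrite -cmulA g2.
- by rewrite cstarM -cmulA (cmulA (cstar u)) h3 g1 g3.
- by rewrite cstarM -cmulA (cmulA v) g4 cmulA h2 h4.
Qed.
Lemma unitaries_star B (e u : B) : projection e -> unitaries e u ->
  unitaries e (cstar u).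
Proof.
move=> [es ee] [h1 h2 h3 h4]; split; rewrite ?cstarK//.
  by rewrite -{1}es -cstarM h2.
by rewrite -{1}es -cstarM h1.
Qed.

Lemma nrm_conj_le B (u x : B) : nrm u <= 1 -> nrm (u ** x ** cstar u) <= nrm x.
Proof.
move=> u1; have := nrmM (u ** x) (cstar u); have := nrmM u x; rewrite nrm_star.
have := nrm_ge0 x; have := nrm_ge0 u; have := nrm_ge0 (u ** x) => h1 h2 h3 h4 h5.
have := ler_wpM2l h1 u1; have := ler_wpM2r h3 u1; lra.
Qed.

(* Approximate unitary equivalence, tested on finite sets. *)
Definition aue (A : choiceType) B (e : B) (f g : A -> B) := forall (s : seq A) (eps : R), 0 < eps ->
  exists u, unitaries e u /\ forall a, a \in s ->
    nrm (u ** f a ** cstar u - g a) < eps.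

Lemma approx_unitarily_aue (A : choiceType) B (e : B) (f g : A -> B) :
  (exists u : nat -> B, (forall n, unitaries e (u n)) /\
    forall c, (fun n => u n ** f c ** cstar (u n)) @ \oo --> g c) -> aue e f g.
Proof.
move=> [u [hu hc]] s eps e0.
have : \forall n \near \oo, forall a, a \in s ->
    nrm (u n ** f a ** cstar (u n) - g a) < eps.
  elim: s => [|a s ih]; first by near=> n.
  have /cvg_nrmP/(_ _ e0) h := hc a; near=> n.
  move=> b; rewrite inE => /orP[/eqP->|]; first by near: n.
  by move: b; near: n.
by move=> /filter_ex[n hn]; exists (u n).
Unshelve. all: by end_near.
Qed.

Lemma aue_sym (A : choiceType) B (e : B) (f g : A -> B) : projection e ->
  (forall a, e ** f a ** e = f a) -> aue e f g -> aue e g f.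
Proof.
move=> pe fe fg s eps e0; have [u [uu hu]] := fg s eps e0.
have uu' := unitaries_star pe uu.
exists (cstar u); split=> // a /hu h; rewrite nrmBC.
apply: le_lt_trans h.
have -> : f a - cstar u ** g a ** cstar (cstar u) =
    cstar u ** (u ** f a ** cstar u - g a) ** cstar (cstar u).
  rewrite cmulBr cmulBl cstarK; congr (_ - _).
  have [_ _ h1 _] := uu; rewrite !cmulA h1 -!cmulA h1.
  by rewrite cmulA fe.
by apply: nrm_conj_le; exact: (nrm_unitary pe).
Qed.

Lemma aue_trans (A : choiceType) B (e : B) (f g h : A -> B) : projection e ->
  aue e f g -> aue e g h -> aue e f h.
Proof.
move=> pe fg gh s eps e0; have e2 : 0 < eps / 2 by rewrite divr_gt0.
have [u [uu hu]] := fg s _ e2; have [v [vv hv]] := gh s _ e2.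
exists (v ** u); split; first exact: unitaries_mul.
move=> a sa; have := hu a sa; have := hv a sa.
have := nrm_tri (v ** g a ** cstar v) (v ** u ** f a ** cstar (v ** u)) (h a).
have -> : v ** u ** f a ** cstar (v ** u) - v ** g a ** cstar v =
    v ** (u ** f a ** cstar u - g a) ** cstar v by rewrite cstarM; cring.
have := nrm_conj_le (u ** f a ** cstar u - g a) (nrm_unitary pe vv); lra.
Qed.

Lemma aue_map (A : choiceType) B C (e : B) (f g : A -> B) (h : starHom B C) : representable C ->
  aue e f g -> aue (h e) (fun a => h (f a)) (fun a => h (g a)).
Proof.
move=> rC fg s eps e0; have [u [uu hu]] := fg s eps e0.
exists (h u); split; first exact: sh_unitaries.
move=> a /hu; rewrite -sh_star -!sh_mul -shB => hh.
exact: le_lt_trans (starHom_nrm _ _ rC) hh.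
Qed.

Lemma aue_pre (A A' : choiceType) B (e : B) (f g : A -> B) (k : A' -> A) :
  aue e f g -> aue e (fun a => f (k a)) (fun a => g (k a)).
Proof.
move=> fg s eps e0; have [u [uu hu]] := fg (map k s) eps e0.
by exists u; split=> // a sa; apply: hu; exact: map_f.
Qed.

Lemma tens_ext0 A B T (t : cstarTensor A B T) (V : normedModType (complex R))
    (F : T -> V) M : 0 <= M -> {morph F : x y / x + y} ->
  (forall x, nrm (F x) <= M * nrm x) ->
  (forall a b, F (t a b) = 0) -> forall x, F x = 0.
Proof.
move=> M0 FD FM F0 x.
have F00 : F 0 = 0 by apply: (addrI (F 0)); rewrite -FD !addr0.
apply: nrm_le0; apply: (@le_eps _ _ _ M) => // e e0.
have [n [a [b h]]] := tens_approx t x e0.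
have -> : F x = F (x - \sum_i t (a i) (b i)).
  have FS : F (\sum_i t (a i) (b i)) = 0.
    transitivity (\sum_i F (t (a i) (b i))); first exact: (big_morph F FD F00).
    by rewrite big1// => i _; exact: F0.
  transitivity (F (x - \sum_i t (a i) (b i) + \sum_i t (a i) (b i))).
    by rewrite subrK.
  by rewrite (FD (x - \sum_i t (a i) (b i))) FS addr0.
rewrite add0r mulrC; apply: le_trans (FM _) _.
by apply: ler_wpM2l => //; exact: ltW.
Qed.

Lemma tens_one (A B : unitalCstarAlgType R) T (t : cstarTensor A B T) x :
  t (cone A) (cone B) ** x = x /\ x ** t (cone A) (cone B) = x.
Proof.
set e := t _ _; have M0 : 0 <= nrm e + 1 by have := nrm_ge0 e; lra.
split; apply/eqP; rewrite -subr_eq0; apply/eqP.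
- apply: (tens_ext0 (t := t) M0 (F := fun x => e ** x - x)) x => [x y|x|a b].
  + by rewrite cmulDr; zmod.
  + have := nrmB (e ** x) x; have := nrmM e x; lra.
  + by rewrite -tens_mul !cmul1l subrr.
- apply: (tens_ext0 (t := t) M0 (F := fun x => x ** e - x)) x => [x y|x|a b].
  + by rewrite cmulDl; zmod.
  + have := nrmB (x ** e) x; have := nrmM x e; lra.
  + by rewrite -tens_mul !cmul1r subrr.
Qed.

Lemma tens_projection A B T (t : cstarTensor A B T) e f : projection e -> projection f ->
  projection (t e f).
Proof. by case=> es ee [fs ff]; split; rewrite -?tens_star -?tens_mul ?es ?ee ?fs ?ff. Qed.

Definition tens_projl A B T (t : cstarTensor A B T) (e : B) (he : projection e) : starHom A T.
Proof.
refine (@StarHom R A T (fun a => t a e) _ _ _).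
- exact: tens_linear_l.
- by move=> x y; rewrite -tens_mul (proj2 he).
- by move=> x; rewrite -tens_star (proj1 he).
Defined.

Definition sh_inv A B (f : starHom A B) (g : B -> A) (fK : cancel f g) (gK : cancel g f) :
  starHom B A.
Proof.
refine (@StarHom R B A g _ _ _).
- by move=> z x y; apply: (can_inj fK); rewrite sh_linear !gK.
- by move=> x y; apply: (can_inj fK); rewrite sh_mul !gK.
- by move=> x; apply: (can_inj fK); rewrite sh_star !gK.
Defined.

End Unitaries.

(** * Approximately inner endomorphisms and the half flip *)

Section TomsWinter.
Context {R : realType} {D : unitalCstarAlgType R} {T : cstarAlgType R}.
Context (t : cstarTensor D D T) (phi : starHom D T) (theta : starHom T D).
Hypothesis phiK : cancel phi theta.
Hypothesis thetaK : cancel theta phi.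
Hypothesis phi_aue : aue (t (cone D) (cone D)) phi (fun d => t d (cone D)).
Local Notation "1D" := (cone D).
Local Notation e := (t 1D 1D).
Implicit Types k : starHom D D.

Let pe : projection e. Proof. by apply: tens_projection; exact: projection_one. Qed.
Let e1 x : e ** x = x. Proof. by have [] := tens_one t x. Qed.
Let e2 x : x ** e = x. Proof. by have [] := tens_one t x. Qed.
Let ecor x : e ** x ** e = x. Proof. by rewrite e1 e2. Qed.

Lemma phi_one : phi 1D = e.
Proof. by rewrite -[LHS]e2 -(thetaK e) -sh_mul cmul1l. Qed.
Lemma theta_one : theta e = 1D. Proof. by rewrite -phi_one phiK. Qed.

(* Every unital endomorphism of [D] is approximately inner: [id (x) k] is
   approximately inner on [D (x) D] because [phi] is close to both
   [id (x) 1] and [(id (x) k) phi]; flipping moves this to the first factor. *)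
Lemma unital_endo_aue k : k 1D = 1D -> aue 1D k id.
Proof.
move=> k1; have rT : representable T by exact: (tens_rep t).
have rD : representable D by exact: (tens_rep1 t).
have [I hI] := tens_map2 t k; have [S hS] := tens_flip t.
have Ie : I e = e by rewrite hI k1.
have Se : S e = e by rewrite hS.
have h1 : aue e (fun d => I (phi d)) phi.
  apply: (aue_trans pe (g := fun d => t d 1D)).
    have := aue_map I rT phi_aue; rewrite Ie.
    by move=> h s eps e0; have [u [uu hu]] := h s eps e0; exists u; split=> // a /hu; rewrite hI k1.
  by apply: aue_sym => //.
have h2 : aue e (fun d => S (I (t 1D d))) (fun d => S (t 1D d)).
  have := aue_map S rT (aue_pre (fun d => theta (t 1D d)) h1); rewrite Se.
  by move=> h s eps e0; have [u [uu hu]] := h s eps e0; exists u; split=> // a /hu; rewrite !thetaK.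
have h3 : aue e (fun d => t (k d) 1D) (fun d => t d 1D).
  by move=> s eps e0; have [u [uu hu]] := h2 s eps e0; exists u; split=> // a /hu; rewrite hI !hS.
have h4 : aue e (fun d => phi (k d)) phi.
  apply: (aue_trans pe (aue_pre k phi_aue)); apply: (aue_trans pe h3).
  exact: aue_sym.
have := aue_map theta rD h4; rewrite theta_one.
move=> h s eps e0; have [u [uu hu]] := h s eps e0; exists u; split=> // a /hu.
by rewrite !phiK.
Qed.

Definition gam : starHom D D := star_comp theta (tens_projl t (projection_one D)).
Definition bet : starHom D D := star_comp theta (tens_proj t (projection_one D)).

Lemma gam_one : gam 1D = 1D. Proof. exact: theta_one. Qed.
Lemma bet_one : bet 1D = 1D. Proof. exact: theta_one. Qed.
Lemma gam_bet a b : gam a ** bet b = theta (t a b).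
Proof. by rewrite /= -sh_mul -tens_mul cmul1l cmul1r. Qed.
Lemma bet_gam a b : bet b ** gam a = theta (t a b).
Proof. by rewrite /= -sh_mul -tens_mul cmul1l cmul1r. Qed.

Lemma aue_unital_endo k k' : k 1D = 1D -> k' 1D = 1D -> aue 1D k k'.
Proof.
move=> k1 k1'; have p1 := projection_one D.
apply: (aue_trans p1 (unital_endo_aue k1)); apply: aue_sym => //.
  by move=> a; rewrite cmul1l cmul1r.
exact: unital_endo_aue.
Qed.

(** [gam] and [bet] are unital endomorphisms, hence approximately unitarily equivalent to each
    other; [phi] carries them back to the two factor embeddings. *)
Lemma half_flip : aue e (fun d => t d 1D) (fun d => t 1D d).
Proof.
have rT : representable T by exact: (tens_rep t).
have := aue_map phi rT (aue_unital_endo gam_one bet_one); rewrite phi_one.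
move=> h s eps e0; have [u [uu hu]] := h s eps e0; exists u; split=> // a /hu.
by rewrite /= !thetaK.
Qed.

End TomsWinter.

(** * Nuclearity: commuting representations *)

Section HalfNorm.
Context {R : realType}.
Implicit Types V : @preHilbert R.

Definition hn V (v : V) : R := Num.sqrt (sqn v).

Lemma hn_ge0 V (v : V) : 0 <= hn v. Proof. exact: sqrtr_ge0. Qed.
Lemma hn_sqr V (v : V) : hn v ^+ 2 = sqn v. Proof. by rewrite sqr_sqrtr// sqn_ge0. Qed.
Lemma ip_hn V (v w : V) : nrm (ip v w) <= hn v * hn w.
Proof.
rewrite -ler_sqr ?nnegrE ?mulr_ge0 ?nrm_ge0 ?hn_ge0// exprMn !hn_sqr.
exact: cauchy_schwarz.
Qed.
Lemma hn_rep V A (r : starRep A V) a v : hn (r a v) <= nrm a * hn v.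
Proof.
rewrite -ler_sqr ?nnegrE ?mulr_ge0 ?nrm_ge0 ?hn_ge0// exprMn !hn_sqr.
exact: sqn_rep_le.
Qed.

Lemma frepZ A (H : hilbertType R) (p : faithfulRep A H) a z v :
  p a (z *: v) = z *: p a v.
Proof. exact: (srZr (faithful_starRep p)). Qed.

End HalfNorm.

(** * Slice maps *)

Section Slices.
Context {R : realType} {A B T : cstarAlgType R} (t : cstarTensor A B T).
Context (H1 H2 H : hilbertType R) (h : hilbertTensor H1 H2 H).
Context (p1 : faithfulRep A H1) (p2 : faithfulRep B H2) (pT : faithfulRep T H).
Hypothesis pE : forall a b x y, pT (t a b) (h x y) = h (p1 a x) (p2 b y).

(** The slice by the vector state of [x] is contractive: if z is the slice, the spatial bound is
    tested on x (x) v and x (x) z v. *)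
Lemma slice_bound (s : seq (A * B)) (x : H1) : nrm x = 1 ->
  nrm (\sum_(u <- s) inner (p1 u.1 x) x *: u.2) <= nrm (tsum t s).
Proof.
move=> x1; set z := \sum_(u <- s) _; have N0 := nrm_ge0 (tsum t s).
apply: (faithful_isometric (p := p2)) => // v.
set w := p2 z v.
have := spatial_bound_tens pE (fun i : 'I_(size s) => (nth (0, 0) s i).1)
  (fun i => (nth (0, 0) s i).2) (fun _ : 'I_1 => x) (fun _ : 'I_1 => v)
  (fun _ : 'I_1 => x) (fun _ : 'I_1 => w).
have -> : \sum_(i < size s) t (nth (0, 0) s i).1 (nth (0, 0) s i).2 = tsum t s.
  by rewrite /tsum (big_nth (0, 0)) big_mkord.
have gE u : gram (V1 := hilbertPre H1) (V2 := hilbertPre H2)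
    (fun _ : 'I_1 => x) (fun _ : 'I_1 => u) = nrm u ^+ 2.
  by rewrite /gram /sform !big_ord1 /= !inner_sqr x1 expr1n rc1 mul1r.
rewrite !gE.
have -> : \sum_(i < size s) sform ((faithful_starRep p1) (nth (0, 0) s i).1)
    ((faithful_starRep p2) (nth (0, 0) s i).2) (fun _ : 'I_1 => x)
    (fun _ : 'I_1 => v) (fun _ : 'I_1 => x) (fun _ : 'I_1 => w) = inner w w.
  rewrite -[RHS]/(inner (p2 z v) w) /z frep_suml inner_suml (big_nth (0, 0)) big_mkord.
  apply: eq_bigr => i _; rewrite /sform !big_ord1 /=.
  have -> : p2 (inner (p1 (nth (0, 0) s i).1 x) x *: (nth (0, 0) s i).2) v =
     inner (p1 (nth (0, 0) s i).1 x) x *: p2 (nth (0, 0) s i).2 v.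
    exact: (srZl (faithful_starRep p2)).
  by rewrite innerZl.
rewrite inner_sqr nrm_rc ger0_norm ?sqr_ge0// -!exprMn.
rewrite ler_sqr ?nnegrE ?mulr_ge0 ?sqr_ge0 ?nrm_ge0// ?expr2.
have [->|w0] := eqVneq (nrm w) 0; first by rewrite mulr_ge0 ?nrm_ge0.
by rewrite ler_pM2r// lt_def w0 nrm_ge0.
Qed.

End Slices.

(** * Commuting representations are bounded by the spatial norm *)

Section CommutingReps.
Context {R : realType} {D : unitalCstarAlgType R} {T : cstarAlgType R}.
Context (t : cstarTensor D D T).
Local Notation "1D" := (cone D).
Hypothesis flip : aue (t 1D 1D) (fun d => t d 1D) (fun d => t 1D d).

(* The approximation [d ~ sum_jk <d x_k, x_j> y_j^* y_k] of the identity of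
   [D] by maps of finite rank, which makes [D] nuclear. *)
Lemma finite_rank_approx (H1 H2 H : hilbertType R) (h : hilbertTensor H1 H2 H)
    (p1 : faithfulRep D H1) (p2 : faithfulRep D H2) (pT : faithfulRep T H)
    (pE : forall a b x y, pT (t a b) (h x y) = h (p1 a x) (p2 b y)) (x0 : H1) :
  nrm x0 = 1 -> p1 1D x0 = x0 -> forall (s : seq D) (eps : R), 0 < eps ->
  exists n (x : 'I_n -> H1) (y : 'I_n -> D), forall d, d \in s ->
    nrm (\sum_l \sum_k inner (p1 d (x l)) (x k) *: (cstar (y k) ** y l) - d) < eps.
Proof.
move=> x01 px0 s eps e0.
have pe : projection (t 1D 1D) by apply: tens_projection; exact: projection_one.
have e2 : 0 < eps / 2 by rewrite divr_gt0.
have [w [uw hw]] := flip s e2.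
pose M : R := \sum_(d <- s) nrm d.
have Md d : d \in s -> nrm d <= M.
  move=> ds; rewrite /M (big_rem d)//= lerDl sumr_ge0// => i _; exact: nrm_ge0.
have M0 : 0 <= M by rewrite sumr_ge0// => i _; exact: nrm_ge0.
pose dl := Num.min 1 (eps / (8 * (M + 1))).
have M8 : 0 < 8 * (M + 1) by lra.
have dl0 : 0 < dl by rewrite /dl lt_min ltr01 divr_gt0.
have dl1 : dl <= 1 by rewrite /dl ge_min lexx.
have dlM : dl * (8 * (M + 1)) <= eps.
  by rewrite -ler_pdivlMr// /dl ge_min lexx orbT.
(* The unitary w carries d (x) 1 close to 1 (x) d. Replacing w^* by a finite sum q and slicing the
   first leg of q^* (d (x) 1) q by the state of x0 gives the finite rank expression, while 1 (x) d
   slices to d. The list [sq] below ends with -1 (x) d, to slice the difference. *)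
have [n [a [b hab]]] := tens_approx t (cstar w) dl0.
set q := \sum_i t (a i) (b i) in hab.
exists n, (fun l => p1 (a l) x0), b => d ds.
have w1 := nrm_unitary pe uw.
have nd1 : nrm (t d 1D) <= nrm d.
  have := nrm_tens t d 1D; have := nrm_proj (projection_one D); have := nrm_ge0 d.
  move=> h1 h2; have := ler_wpM2l h1 h2; lra.
pose sq := [seq (cstar (a u.1) ** d ** a u.2, cstar (b u.1) ** b u.2) |
   u <- index_enum ('I_n * 'I_n)%type].
have := slice_bound pE (rcons sq (- 1D, d)) x01.
rewrite /tsum !big_rcons/= !big_map /=.
have -> : p1 (- 1D) x0 = - x0.
  by rewrite -[RHS](congr1 -%R px0); exact: (srNl (faithful_starRep p1)).
have -> : inner (- x0) x0 = -1.
  by have := ipNl (x0 : hilbertPre H1) x0; rewrite /= inner_sqr x01 expr1n rc1.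
rewrite scaleN1r.
have -> : \sum_(u : 'I_n * 'I_n) inner (p1 (cstar (a u.1) ** d ** a u.2) x0) x0 *:
      (cstar (b u.1) ** b u.2) =
   \sum_l \sum_k inner (p1 d (p1 (a l) x0)) (p1 (a k) x0) *: (cstar (b k) ** b l).
  rewrite exchange_big pair_big; apply: eq_bigr => -[j k] _ /=.
  by rewrite !rep_mul rep_star cstarK.
move=> /le_lt_trans; apply.
have -> : \sum_(u : 'I_n * 'I_n) t (cstar (a u.1) ** d ** a u.2) (cstar (b u.1) ** b u.2) =
    cstar q ** t d 1D ** q.
  rewrite /q cstar_sum !cmul_suml.
  under [RHS]eq_bigr do rewrite cmul_sumr.
  rewrite pair_big /=; apply: eq_bigr => -[j k] _ /=.
  by rewrite -tens_star -!tens_mul cmul1r.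
rewrite tensNl.
have q2 : nrm q <= 2.
  have := nrm_tri (cstar w) q 0; rewrite !subr0 nrm_star nrmBC; lra.
have hq : nrm (cstar q - w) < dl by rewrite -{1}(cstarK w) -cstarB nrm_star nrmBC.
have hqE : cstar q ** t d 1D ** q - t 1D d = (cstar q - w) ** t d 1D ** q +
   (- (w ** t d 1D ** (cstar w - q)) + (w ** t d 1D ** cstar w - t 1D d)) by cring.
rewrite hqE; have hd := hw _ ds.
apply: le_lt_trans (nrmD _ _) _; have := nrmD (- (w ** t d 1D ** (cstar w - q)))
   (w ** t d 1D ** cstar w - t 1D d); rewrite nrmN.
have XM : nrm (t d 1D) <= M by apply: le_trans nd1 (Md _ ds).
have b1 : nrm ((cstar q - w) ** t d 1D) <= dl * M.
  apply: le_trans (nrmM _ _) _; apply: ler_pM; rewrite ?nrm_ge0//; exact: ltW.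
have a1 : nrm ((cstar q - w) ** t d 1D ** q) <= dl * M * 2.
  by apply: le_trans (nrmM _ _) _; apply: ler_pM; rewrite ?nrm_ge0.
have d1 : nrm (w ** t d 1D) <= 1 * M.
  by apply: le_trans (nrmM _ _) _; apply: ler_pM; rewrite ?nrm_ge0.
have c1 : nrm (w ** t d 1D ** (cstar w - q)) <= 1 * M * dl.
  by apply: le_trans (nrmM _ _) _; apply: ler_pM; rewrite ?nrm_ge0//; exact: ltW.
lra.
Qed.

Context {V : @preHilbert R} (f g : starRep D V).
Hypothesis fg : forall a b v, f a (g b v) = g b (f a v).

(** When f(a) is replaced by its finite rank approximation, commutation moves the coefficients
    f(y_l) onto the vectors. What remains is a form of a_i (x) b_i in the representations p1 and g,
    which the spatial norm bounds. *)
Lemma commuting_reps_bound p (a b : 'I_p -> D) v :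
  hn (\sum_i f (a i) (g (b i) v)) <= nrm (\sum_i t (a i) (b i)) * hn v.
Proof.
set Z := \sum_i f _ _; set N := nrm _.
have N0 : 0 <= N by exact: nrm_ge0.
have [H1 [H2 [H [h [p1 [p2 [pT pE]]]]]]] := tens_spatial t.
(* A representation may be degenerate, so a unit vector fixed by p1 1 is wanted. If there is none,
   p1 1 = 0 and [D] is zero. *)
have [[x0 [x01 px0]]|noX] := pselect (exists x0 : H1, nrm x0 = 1 /\ p1 1D x0 = x0); last first.
  have D0 (d : D) : d = 0.
    apply: (rep_inj (f := p1)) => x; rewrite -(cmul1r d) rep_mul.
    have [->|y0] := eqVneq (p1 1D x) 0; first exact: (sr0r (faithful_starRep p1)).
    exfalso; apply: noX; exists (normalize (p1 1D x)); split.
      rewrite /normalize nrmZ nrm_rc ger0_norm ?invr_ge0 ?nrm_ge0//.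
      by rewrite mulVf//; apply: contra_neq y0; exact: nrm_eq0.
    by rewrite /normalize frepZ -rep_mul cmul1r.
  have -> : Z = 0 by rewrite /Z big1// => i _; rewrite (D0 (a i)) sr0l.
  by rewrite /hn sqn0 sqrtr0 mulr_ge0// sqrtr_ge0.
have SB := spatial_bound_rep N0 (spatial_bound_tens pE a b) g.
pose Cb := \sum_i nrm (b i).
have Cb0 : 0 <= Cb by rewrite sumr_ge0// => i _; exact: nrm_ge0.
have key : hn Z ^+ 2 <= N * hn v * hn Z.
  have v0 := hn_ge0 v; have z0 := hn_ge0 Z.
  apply: (@le_eps _ _ _ ((N + Cb) * hn v * hn Z)).
    by rewrite !mulr_ge0// addr_ge0.
  move=> e e0.
  have [n [x [y hxy]]] := finite_rank_approx pE x01 px0 (1D :: [seq a i | i <- enum 'I_p]) e0.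
  pose Tf d := \sum_l \sum_k inner (p1 d (x l)) (x k) *: (cstar (y k) ** y l).
  have hT1 : nrm (Tf 1D - 1D) < e by apply: hxy; rewrite inE eqxx.
  have hTa i : nrm (Tf (a i) - a i) < e.
    by apply: hxy; rewrite inE; apply/orP; right; apply: map_f; rewrite mem_enum.
  have px l : p1 1D (p1 1D (x l)) = p1 1D (x l) by rewrite -rep_mul cmul1r.
  have TfE d (r : starRep D V) u u' : ip (r (Tf d) u) u' =
      \sum_l \sum_k inner (p1 d (x l)) (x k) * ip (r (y l) u) (r (y k) u').
    rewrite /Tf sr_suml ip_suml; apply: eq_bigr => l _.
    rewrite sr_suml ip_suml; apply: eq_bigr => k _.
    by rewrite srZl ipZl sr_mul sr_star cstarK.
  (* The Gram norm of the vectors attached to u is the form of f at the approximation of 1, whose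
     norm is at most 1 + e. *)
  have gr u : gram (V1 := hilbertPre H1) (V2 := V) (fun l => p1 1D (x l)) (fun l => f (y l) u)
      <= (1 + e) * hn u ^+ 2.
    have -> : gram (V1 := hilbertPre H1) (V2 := V) (fun l => p1 1D (x l)) (fun l => f (y l) u) =
       complex.Re (ip (f (Tf 1D) u) u).
      rewrite /gram TfE; congr complex.Re; apply: eq_bigr => l _; apply: eq_bigr => k _ /=.
      have -> : p1 1D (x k) = p1 (cstar 1D) (x k) by rewrite (proj1 (projection_one D)).
      by rewrite -rep_star px.
    apply: le_trans (Re_le_nrm _) _; apply: le_trans (ip_hn _ _) _.
    have := hn_rep f (Tf 1D) u; have : nrm (Tf 1D) <= 1 + e.
      have := nrm_tri 1D (Tf 1D) 0; rewrite !subr0.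
      have := nrm_proj (projection_one D); lra.
    have u0 := hn_ge0 u => h1 h2; rewrite expr2 mulrA; apply: ler_wpM2r => //.
    by apply: le_trans h2 _; apply: ler_wpM2r.
  pose m1 := \sum_i ip (f (Tf (a i)) (g (b i) v)) Z.
  have m1E : m1 = \sum_i sform ((faithful_starRep p1) (a i)) (g (b i))
      (fun l => p1 1D (x l)) (fun l => f (y l) v) (fun l => p1 1D (x l)) (fun l => f (y l) Z).
    apply: eq_bigr => i _; rewrite TfE; apply: eq_bigr => l _; apply: eq_bigr => k _ /=.
    rewrite -fg; congr (_ * _).
    have -> : p1 1D (x k) = p1 (cstar 1D) (x k) by rewrite (proj1 (projection_one D)).
    by rewrite -rep_star -!rep_mul cmul1r cmul1l.
  have m1b : nrm m1 <= N * (1 + e) * hn v * hn Z.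
    have := SB _ _ (fun l => p1 1D (x l)) (fun l => f (y l) v)
       (fun l => p1 1D (x l)) (fun l => f (y l) Z); rewrite -m1E -/N => hm.
    have e1 : 0 <= 1 + e by lra.
    rewrite -ler_sqr ?nnegrE ?mulr_ge0 ?nrm_ge0//; apply: le_trans hm _.
    have -> : (N * (1 + e) * hn v * hn Z) ^+ 2 =
       N ^+ 2 * ((1 + e) * hn v ^+ 2) * ((1 + e) * hn Z ^+ 2) by ring.
    have g0 u : 0 <= gram (V1 := hilbertPre H1) (V2 := V) (fun l => p1 1D (x l)) (fun l => f (y l) u).
      exact: gram_ge0.
    apply: ler_pM => //; first by rewrite mulr_ge0 ?sqr_ge0.
    by apply: ler_wpM2l => //; exact: sqr_ge0.
  have err : nrm (ip Z Z - m1) <= e * Cb * hn v * hn Z.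
    have -> : ip Z Z - m1 = \sum_i ip (f (a i - Tf (a i)) (g (b i) v)) Z.
      rewrite {1}/Z ip_suml /m1 -sumrB; apply: eq_bigr => i _.
      by rewrite srBl ipBl.
    apply: le_trans (nrm_sum _ _ _) _; rewrite /Cb mulr_sumr !mulr_suml.
    apply: ler_sum => i _; apply: le_trans (ip_hn _ _) _.
    apply: ler_wpM2r => //; apply: le_trans (hn_rep _ _ _) _.
    rewrite -mulrA; apply: ler_pM; rewrite ?nrm_ge0 ?hn_ge0//.
      by rewrite nrmBC ltW.
    exact: hn_rep.
  have : nrm (ip Z Z) = hn Z ^+ 2 by rewrite ip_sqn nrm_rc ger0_norm ?sqn_ge0// hn_sqr.
  have := nrmD (ip Z Z - m1) m1; rewrite subrK; lra.
have [->|Z0] := eqVneq (hn Z) 0; first by rewrite mulr_ge0// hn_ge0.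
by move: key; rewrite expr2 ler_pM2r// lt_def Z0 hn_ge0.
Qed.

End CommutingReps.

(** * Representations by multipliers *)

Section MultReps.
Context {R : realType}.
Implicit Types A B C D : cstarAlgType R.

Definition mm D C (r : multRep D C) (a : D) : multiplier C :=
  @Multiplier R C (r a) (r (cstar a)) (mrep_star r a).

Lemma mrep_ext D C (r s : multRep D C) : (forall a x, r a x = s a x) -> r = s.
Proof.
move=> rs; have : mrep_fun r = mrep_fun s.
  by apply/funext => a; apply/funext => x; exact: rs.
case: r s {rs} => f p1 p2 p3 [g q1 q2 q3] /= fg.
case: _ / fg q1 q2 q3 => q1 q2 q3.
by congr MultRep; exact: Prop_irrelevance.
Qed.

Section MM.
Context {D C : cstarAlgType R} (r : multRep D C).
Lemma mmE a x : mm r a x = r a x. Proof. by []. Qed.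
Lemma mm_star a : mstar (mm r a) = mm r (cstar a).
Proof. exact: mult_ext. Qed.
Lemma mmM a b : mm r (a ** b) = mm r a * mm r b.
Proof. by apply: mult_ext => x; rewrite /= mrep_mul. Qed.
Lemma mmD a b : mm r (a + b) = mm r a + mm r b.
Proof.
by apply: mult_ext => x; have := mrep_linear r x 1 a b; rewrite !scale1r.
Qed.
Lemma mm0 : mm r 0 = 0.
Proof. by apply: (addrI (mm r 0)); rewrite -mmD !addr0. Qed.
Lemma mmZ z a : mm r (z *: a) = msc z * mm r a.
Proof.
apply: mult_ext => x; have := mrep_linear r x z a 0; rewrite !addr0 /= => ->.
by have /(congr1 (fun m : multiplier C => m x)) /= -> := mm0; rewrite addr0.
Qed.
Lemma mmN a : mm r (- a) = - mm r a.
Proof. by rewrite -(scaleN1r a) mmZ mscN msc1 mulN1r. Qed.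
Lemma mmB a b : mm r (a - b) = mm r a - mm r b.
Proof. by rewrite mmD mmN. Qed.
Lemma mrepDr a x y : r a (x + y) = r a x + r a y. Proof. exact: (mult_add (mm r a)). Qed.
Lemma mrepBr a x y : r a (x - y) = r a x - r a y. Proof. exact: (mult_sub (mm r a)). Qed.
Lemma mrepBl a b x : r (a - b) x = r a x - r b x.
Proof. by rewrite -mmE mmB. Qed.
Lemma mrepZr a z x : r a (z *: x) = z *: r a x. Proof. exact: (mult_scale (mm r a)). Qed.
Lemma mrep0r a : r a 0 = 0. Proof. exact: (mult0 (mm r a)). Qed.
Lemma mrepM a x y : r a (x ** y) = r a x ** y. Proof. exact: (mult_mul (mm r a)). Qed.
End MM.

Definition mrep_comp A D C (r : multRep D C) (f : starHom A D) : multRep A C.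
Proof.
refine (@MultRep R A C (fun a => r (f a)) _ _ _).
- by move=> x z a b; rewrite sh_linear mrep_linear.
- by move=> a b x; rewrite sh_mul mrep_mul.
- by move=> a x y; rewrite mrep_star sh_star.
Defined.

Section VectorForm.
Context {C : cstarAlgType R} {H : hilbertType R} (p : faithfulRep C H) (xi : H).

Lemma vip_linear (y : C) z (x x' : C) :
  inner (p (z *: x + x') xi) (p y xi) =
  z * inner (p x xi) (p y xi) + inner (p x' xi) (p y xi).
Proof. by rewrite (rep_linear_alg p) innerDl innerZl. Qed.

(** Multipliers have adjoints for this form on [C] itself. They therefore act on a semi-inner
    product space without extending the representation of [C] to M(C). *)
Definition vectorPre : @preHilbert R :=
  @PreHilbert R C (fun x y => inner (p x xi) (p y xi)) vip_linear
    (fun x y => inner_conj _ _) (fun x => @ip_ge0 R (hilbertPre H) _).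

Lemma hn_vector (x : C) : hn (x : vectorPre) = nrm (p x xi).
Proof. by rewrite /hn /sqn /= inner_sqr /= sqrtr_sqr ger0_norm// nrm_ge0. Qed.

Definition vectorRep D (r : multRep D C) : starRep D vectorPre.
Proof.
refine (@StarRep R D vectorPre (mrep_fun r) _ _ _ _).
- by move=> a z x y; rewrite mrepDr mrepZr.
- exact: mrep_linear.
- exact: mrep_mul.
- move=> a x y /=.
  have h u v : inner (p u xi) (p v xi) = inner (p (cstar v ** u) xi) xi.
    by rewrite [in RHS]rep_mul [in RHS]rep_star cstarK.
  by rewrite !h mrep_star cstarK.
Defined.

End VectorForm.

Lemma mrep_nrm D C (r : multRep D C) a c : representable C ->
  nrm (r a c) <= nrm a * nrm c.
Proof.
move=> [H [p]]; apply: (faithful_isometric (p := p)).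
  by rewrite mulr_ge0 ?nrm_ge0.
move=> xi; rewrite -!hn_vector; apply: le_trans (hn_rep (vectorRep p xi r) a c) _.
rewrite -mulrA; apply: ler_wpM2l; first exact: nrm_ge0.
by rewrite hn_vector faithful_le.
Qed.


Section CommutingMultReps.
Context {D : unitalCstarAlgType R} {T C : cstarAlgType R} (t : cstarTensor D D T).
Local Notation "1D" := (cone D).
Hypothesis flip : aue (t 1D 1D) (fun d => t d 1D) (fun d => t 1D d).
Hypothesis rC : representable C.
Context (f g : multRep D C).
Hypothesis fg : forall a b x, f a (g b x) = g b (f a x).

Definition fgsum (s : seq (D * D)) (x : C) : C := \sum_(u <- s) f u.1 (g u.2 x).

Lemma fgsum_bound s x : nrm (fgsum s x) <= nrm (tsum t s) * nrm x.
Proof.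
have [H [p]] := rC; apply: (faithful_isometric (p := p)).
  by rewrite mulr_ge0 ?nrm_ge0.
move=> xi; have := @commuting_reps_bound R D T t flip _ (vectorRep p xi f) (vectorRep p xi g)
  fg (size s) (fun i => (nth (0, 0) s i).1) (fun i => (nth (0, 0) s i).2) x.
rewrite !hn_vector => h; rewrite /fgsum /tsum !(big_nth (0, 0)) !big_mkord.
apply: le_trans; first exact: h.
by rewrite -mulrA; apply: ler_wpM2l; [exact: nrm_ge0|exact: faithful_le].
Qed.

(** For each c the assignment a (x) b |-> f a (g b c) extends to the tensor product with Lipschitz
    constant |c|. The extensions are made separately and reassembled into one representation. *)
Lemma commuting_mrep : exists F : multRep T C, forall a b x, F (t a b) x = f a (g b x).
Proof.
pose P c x y := exists s, x = tsum t s /\ y = fgsum s c.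
have Plin c z x y x' y' : P c x y -> P c x' y' -> P c (z *: x + x') (z *: y + y').
  move=> [s [-> ->]] [s' [-> ->]]; exists ([seq (z *: u.1, u.2) | u <- s] ++ s').
  rewrite /tsum /fgsum !big_cat !big_map /= !scaler_sumr.
  split; congr (_ + _); apply: eq_bigr => i _; rewrite ?tensZl//.
  by rewrite -!mmE mmZ.
have ex c : exists F : T -> C, [/\ forall x x', nrm (F x - F x') <= nrm c * nrm (x - x'),
    forall x y, P c x y -> F x = y
    & forall x : T, exists u : nat -> T, (forall n, P c (u n) (F (u n))) /\ u @ \oo --> x].
  apply: extend_lipschitz; first exact: nrm_ge0.
    move=> x y x' y' Pxy Pxy'.
    have := Plin _ (-1) _ _ _ _ Pxy' Pxy; rewrite !scaleN1r !(addrC (- _)).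
    by move=> [s [-> ->]]; rewrite mulrC; exact: fgsum_bound.
  by move=> x e e0; have [s hs] := tens_dense_seq t x e0;
    exists (tsum t s), (fgsum s c); split=> //; exists s.
have [F hF] := choice ex.
have FE c s : F c (tsum t s) = fgsum s c.
  by have [_ FP _] := hF c; apply: FP; exists s.
have Fd (x : T) : exists s : nat -> seq (D * D), (fun n => tsum t (s n)) @ \oo --> x.
  have [_ _ /(_ x) [u [Pu ux]]] := hF 0.
  have h n : exists s, u n = tsum t s by have [s [us _]] := Pu n; exists s.
  have [s hs] := choice h; exists s.
  by rewrite (_ : (fun n => _) = u)//; apply/funext => n; rewrite hs.
have Fc c (u : nat -> T) (x : T) : u @ \oo --> x -> (fun n => F c (u n)) @ \oo --> F c x.
  by move=> ux; apply: cvg_lipschitz ux; have [] := hF c.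
have FcE c (s : nat -> seq (D * D)) (x : T) : (fun n => tsum t (s n)) @ \oo --> x ->
    (fun n => fgsum (s n) c) @ \oo --> F c x.
  move=> /(Fc c); rewrite (_ : (fun n => F c _) = (fun n => fgsum (s n) c))//.
  by apply/funext => n; rewrite FE.
have Fl c : linear (F c).
  move=> z x y; have [u ux] := Fd x; have [v vy] := Fd y.
  apply: (@cvg_eq0 _ _ _ \oo _ (fun n => F c (z *: tsum t (u n) + tsum t (v n)))
     (fun n => z *: F c (tsum t (u n)) + F c (tsum t (v n)))).
  + by apply: Fc; apply: cvgD => //; exact: cvgZl_tmp.
  + by apply: cvgD; [apply: cvgZl_tmp|]; exact: Fc.
  + near=> n; have [_ FP _] := hF c; apply: FP; rewrite !FE.
    by apply: Plin; [exists (u n)|exists (v n)].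
have fgM s s' c : fgsum [seq (u.1 ** u'.1, u.2 ** u'.2) | u <- s, u' <- s'] c =
   fgsum s (fgsum s' c).
  rewrite /fgsum big_allpairs_dep /=; apply: eq_bigr => u _.
  rewrite -!mmE -mult_mulE (big_morph _ (mult_add (mm f u.1 * mm g u.2)) (mult0 _)).
  by apply: eq_bigr => u' _; rewrite /= !mrep_mul fg.
have tM s s' : tsum t [seq (u.1 ** u'.1, u.2 ** u'.2) | u <- s, u' <- s'] =
   tsum t s ** tsum t s'.
  rewrite /tsum big_allpairs_dep /= cmul_suml; apply: eq_bigr => u _.
  by rewrite cmul_sumr; apply: eq_bigr => u' _; rewrite tens_mul.
have FL c c' x : nrm (F c x - F c' x) <= nrm x * nrm (c - c').
  have [u ux] := Fd x.
  have h1 : (fun n => fgsum (u n) c - fgsum (u n) c') @ \oo --> F c x - F c' x.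
    by apply: cvgB; exact: FcE.
  have h2 n : fgsum (u n) c - fgsum (u n) c' = fgsum (u n) (c - c').
    rewrite /fgsum -sumrB; apply: eq_bigr => i _.
    by rewrite mrepBr mrepBr.
  apply: (@le_eps _ _ _ (nrm (c - c'))); first exact: nrm_ge0.
  move=> e e0; move/cvg_nrmP: ux => /(_ _ e0) hx.
  rewrite -mulrDl; apply: (cvg_nrm_le h1); near=> n.
  rewrite h2; apply: le_trans (fgsum_bound _ _) _; apply: ler_wpM2r; first exact: nrm_ge0.
  have hn : nrm (tsum t (u n) - x) < e by near: n.
  by have := nrm_tri x (tsum t (u n)) 0; rewrite !subr0; lra.
have Fm a b c : F c (a ** b) = F (F c b) a.
  have [u ua] := Fd a; have [v vb] := Fd b.
  apply: (@cvg_eq0 _ _ _ \oo _ (fun n => F c (tsum t (u n) ** tsum t (v n)))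
     (fun n => fgsum (u n) (fgsum (v n) c))).
  + by apply: Fc; exact: cvg_cmul.
  + apply/cvg_nrmP => e e0.
    have e2 : 0 < e / 2 by rewrite divr_gt0.
    have /cvg_nrmP/(_ _ e2) h1 := FcE (F c b) _ _ ua.
    have a1 : 0 < nrm a + 1 by have := nrm_ge0 a; lra.
    have /cvg_nrmP/(_ _ (divr_gt0 e2 a1)) h2 := FcE c _ _ vb.
    have /cvg_nrmP/(_ _ ltr01) h3 := ua.
    near=> n.
    have g1 : nrm (fgsum (u n) (F c b) - F (F c b) a) < e / 2 by near: n.
    have g2 : nrm (fgsum (v n) c - F c b) < e / 2 / (nrm a + 1) by near: n.
    have g3 : nrm (tsum t (u n) - a) < 1 by near: n.
    have := nrm_tri (fgsum (u n) (F c b)) (fgsum (u n) (fgsum (v n) c)) (F (F c b) a).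
    have -> : fgsum (u n) (fgsum (v n) c) - fgsum (u n) (F c b) =
       fgsum (u n) (fgsum (v n) c - F c b).
      rewrite /fgsum -sumrB; apply: eq_bigr => i _; by rewrite !mrepBr.
    have := fgsum_bound (u n) (fgsum (v n) c - F c b).
    have h4 : nrm (tsum t (u n)) <= nrm a + 1.
      by have := nrm_tri a (tsum t (u n)) 0; rewrite !subr0; lra.
    rewrite ltr_pdivlMr// in g2.
    have := ler_wpM2r (nrm_ge0 (fgsum (v n) c - F c b)) h4; lra.
  + by near=> n; rewrite -tM FE fgM.
have Fs a c c' : cstar (F c a) ** c' = cstar c ** F c' (cstar a).
  have [u ua] := Fd a.
  have us : (fun n => tsum t [seq (cstar w.1, cstar w.2) | w <- u n]) @ \oo --> cstar a.
    rewrite (_ : (fun n => _) = (fun n => cstar (tsum t (u n)))); first exact: cvg_cstar.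
    apply/funext => n; rewrite /tsum big_map cstar_sum; apply: eq_bigr => i _.
    by rewrite tens_star.
  apply: (@cvg_eq0 _ _ _ \oo _ (fun n => cstar (fgsum (u n) c) ** c')
    (fun n => cstar c ** fgsum [seq (cstar w.1, cstar w.2) | w <- u n] c')).
  + apply: cvg_cmul; last exact: cvg_cst.
    by apply: cvg_cstar; exact: FcE.
  + by apply: cvg_cmul; [exact: cvg_cst|exact: FcE].
  + near=> n; rewrite /fgsum big_map cstar_sum cmul_suml cmul_sumr.
    by apply: eq_bigr => i _ /=; rewrite !mrep_star fg.
exists (@MultRep R T C (fun a c => F c a) Fl Fm Fs) => a b x /=.
have := FE x [:: (a, b)]; rewrite /tsum /fgsum !big_seq1 //.
Unshelve. all: by end_near.
Qed.

End CommutingMultReps.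

End MultReps.

(** * K_1-injectivity *)

Section PathComponent.
Context {R : realType}.
Implicit Types B C : cstarAlgType R.

(** Paths replace the connected component because they can be mapped, multiplied and concatenated;
    [component_U0] links the two. *)
Definition U0 B (e u : B) := exists w : R -> B,
  [/\ continuous w, w 0 = e, w 1 = u & forall t, unitaries e (w t)].

Lemma U0_unitaries B (e u : B) : U0 e u -> unitaries e u.
Proof. by move=> [w [_ _ <- h]]. Qed.
Lemma U0_id B (e : B) : projection e -> U0 e e.
Proof.
move=> pe; exists (fun=> e); split=> // [|t]; first exact: cont_cst.
exact: unitaries_id.
Qed.
Lemma U0_mul B (e u v : B) : projection e -> U0 e u -> U0 e v -> U0 e (u ** v).
Proof.
move=> pe [w [wc w0 w1 wu]] [w' [wc' w0' w1' wu']].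
exists (fun t => w t ** w' t); split.
- exact: cont_cmul.
- by rewrite w0 w0' (proj2 pe).
- by rewrite w1 w1'.
- by move=> t; exact: unitaries_mul.
Qed.
Lemma U0_star B (e u : B) : projection e -> U0 e u -> U0 e (cstar u).
Proof.
move=> pe [w [wc w0 w1 wu]]; exists (fun t => cstar (w t)); split.
- exact: cont_cstar.
- by rewrite w0 (proj1 pe).
- by rewrite w1.
- by move=> t; exact: unitaries_star.
Qed.
Lemma U0_near B (e u : B) : projection e -> unitaries e u -> nrm (u - e) <= 64^-1 ->
  U0 e u.
Proof.
move=> pe uu h; have [w [wc w0 w1 wu _]] := near_unitary_path pe uu h.
by exists w.
Qed.
Lemma U0_close B (e u v : B) : projection e -> U0 e v -> unitaries e u ->
  nrm (u - v) <= 64^-1 -> U0 e u.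
Proof.
move=> pe v0 uu uv; have vv := U0_unitaries v0.
have [_ ue _ _] := uu; have [ve ve' v1 v2] := vv.
have -> : u = (u ** cstar v) ** v by rewrite -cmulA v1 ue.
apply: U0_mul => //; apply: U0_near => //.
  by apply: unitaries_mul => //; exact: unitaries_star.
have -> : u ** cstar v - e = (u - v) ** cstar v by rewrite cmulBl v2.
have := nrmM (u - v) (cstar v); rewrite nrm_star.
have := nrm_unitary pe vv; have := nrm_ge0 (u - v) => h1 h2 h3.
have := ler_wpM2l h1 h2; lra.
Qed.
Lemma U0_map B C (f : starHom B C) (e u : B) : representable C -> U0 e u -> U0 (f e) (f u).
Proof.
move=> rC [w [wc w0 w1 wu]]; exists (fun t => f (w t)); split.
- by apply: cont_comp => //; exact: sh_continuous.
- by rewrite w0.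
- by rewrite w1.
- by move=> t; exact: sh_unitaries.
Qed.

Lemma nrm_ball_open (V : normedModType (complex R)) (v : V) (r : R) :
  open [set x | nrm (x - v) < r].
Proof.
have [r0|r0] := leP r 0.
  suff -> : [set x | nrm (x - v) < r] = set0 by exact: open0.
  by apply/seteqP; split=> x //= h; have := nrm_ge0 (x - v); lra.
suff -> : [set x | nrm (x - v) < r] = ball v (rc r).
  by apply: ball_open; rewrite -rc0 lt_rc.
by apply/seteqP; split=> x; rewrite -ball_normE /ball_ /= nrmE lt_rc nrmBC.
Qed.

(** Unitaries at distance at most 1/64 are joined by a path, so the path component is open and
    closed in the unitary group. *)
Lemma component_U0 B (e u : B) : projection e ->
  connected_component (unitaries e) e u -> U0 e u.
Proof.
move=> pe [C [Ce CU Cc] Cu].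
have r64 : (64^-1 : R) >= 0 by rewrite invr_ge0.
suff h : C `&` U0 e = C by have [] : (C `&` U0 e) u by rewrite h.
pose O := \bigcup_(v in U0 e) [set x | nrm (x - v) < 64^-1].
pose Z := \bigcup_(v in unitaries e `\` U0 e) [set x | nrm (x - v) < 64^-1].
apply: Cc.
- by exists e; split=> //; exact: U0_id.
- exists O; first by apply: bigcup_open => v _; exact: nrm_ball_open.
  apply/seteqP; split=> x [Cx hx]; split=> //.
    by exists x => //=; rewrite subrr nrm0 invr_gt0.
  by case: hx => v v0 /= /ltW xv; apply: U0_close v0 _ xv => //; exact: CU.
- exists (~` Z).
    by apply: open_closedC; apply: bigcup_open => v _; exact: nrm_ball_open.
  apply/seteqP; split=> x [Cx hx]; split=> //.
    case=> v [vu vn] /= /ltW xv; apply: vn; apply: (U0_close pe hx vu).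
    by rewrite nrmBC.
  apply: contrapT => xn; apply: hx; exists x => //=; last by rewrite subrr nrm0 invr_gt0.
  by split=> //; exact: CU.
Qed.

End PathComponent.

(** * Matrix unitaries and the Whitehead lemma *)

Section MatrixUnitaries.
Context {R : realType} {D : unitalCstarAlgType R}.
Local Notation "1D" := (cone D).

Lemma cstar1 : cstar 1D = 1D. Proof. by have [] := projection_one D. Qed.

Lemma cont_mx (X : topologicalType) m n (F : X -> 'M[D]_(m, n)) :
  (forall i j, continuous (fun x => F x i j)) -> continuous F.
Proof.
move=> Fc x A [P hP PA].
have : \forall y \near x, forall i, forall j, P i j (F y i j).
  apply: filter_forall => i; apply: filter_forall => j.
  exact: (Fc i j x _ (hP i j)).
by apply: filterS => y h; exact: PA.
Qed.

Lemma mx_entry_cont m n (i : 'I_m) (j : 'I_n) :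
  continuous (fun M : 'M[D]_(m, n) => M i j).
Proof.
move=> M B hB; exists (fun i' j' => if (i' == i) && (j' == j) then B else setT).
  move=> i' j'; case: ifP => [/andP[/eqP-> /eqP->]//|_]; exact: filterT.
by move=> N /(_ i j); rewrite !eqxx.
Qed.

Lemma cont_sum (X : topologicalType) (V : normedModType (complex R)) (I : Type)
    (s : seq I) (F : I -> X -> V) :
  (forall i, continuous (F i)) -> continuous (fun x => \sum_(i <- s) F i x).
Proof.
move=> Fc; elim: s => [|i s ih].
  by rewrite (_ : (fun x => _) = (fun=> 0)); [exact: cont_cst|apply/funext => x; rewrite big_nil].
rewrite (_ : (fun x => _) = (fun x => F i x + \sum_(i <- s) F i x)).
  exact: cont_add.
by apply/funext => x; rewrite big_cons.
Qed.

Lemma mxcmulA n (X Y Z : 'M[D]_n) : mxcmul X (mxcmul Y Z) = mxcmul (mxcmul X Y) Z.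
Proof.
apply/matrixP => i j; rewrite !mxE.
under eq_bigr do rewrite mxE cmul_sumr.
under [RHS]eq_bigr do rewrite mxE cmul_suml.
rewrite exchange_big; apply: eq_bigr => k _; apply: eq_bigr => l _.
by rewrite cmulA.
Qed.
Lemma mxcmul1 n (X : 'M[D]_n) : mxcmul (mxcone D n) X = X.
Proof.
apply/matrixP => i j; rewrite !mxE (bigD1 i)//= mxE eqxx cmul1l big1 ?addr0//.
by move=> k; rewrite mxE eq_sym => /negbTE->; rewrite cmul0l.
Qed.
Lemma mxcmulr1 n (X : 'M[D]_n) : mxcmul X (mxcone D n) = X.
Proof.
apply/matrixP => i j; rewrite !mxE (bigD1 j)//= mxE eqxx cmul1r big1 ?addr0//.
by move=> k; rewrite mxE => /negbTE->; rewrite cmul0r.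
Qed.
Lemma mxcstarM n (X Y : 'M[D]_n) : mxcstar (mxcmul X Y) = mxcmul (mxcstar Y) (mxcstar X).
Proof.
apply/matrixP => i j; rewrite !mxE cstar_sum; apply: eq_bigr => k _.
by rewrite !mxE cstarM.
Qed.
Lemma mxcstarK n (X : 'M[D]_n) : mxcstar (mxcstar X) = X.
Proof. by apply/matrixP => i j; rewrite !mxE cstarK. Qed.

Lemma mxunitaries_mul n (X Y : 'M[D]_n) : mxunitaries X -> mxunitaries Y ->
  mxunitaries (mxcmul X Y).
Proof.
move=> [x1 x2] [y1 y2]; rewrite /mxunitaries /= mxcstarM; split.
  by rewrite mxcmulA -(mxcmulA (mxcstar Y)) x1 mxcmulr1.
by rewrite mxcmulA -(mxcmulA X) y2 mxcmulr1.
Qed.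
Lemma mxunitaries_star n (X : 'M[D]_n) : mxunitaries X -> mxunitaries (mxcstar X).
Proof. by move=> [x1 x2]; rewrite /mxunitaries /= mxcstarK. Qed.

Lemma cont_mxcmul (X : topologicalType) n (F G : X -> 'M[D]_n) :
  continuous F -> continuous G -> continuous (fun x => mxcmul (F x) (G x)).
Proof.
move=> Fc Gc; apply: cont_mx => i j.
rewrite (_ : (fun x => _) = (fun x => \sum_(k < n) F x i k ** G x k j)).
  apply: cont_sum => k; apply: cont_cmul.
    exact: (cont_comp Fc (@mx_entry_cont _ _ i k)).
  exact: (cont_comp Gc (@mx_entry_cont _ _ k j)).
by apply/funext => x; rewrite mxE.
Qed.

Section Padding.
Context (n m : nat) (nm : (n <= m)%N).

Lemma mxpad_in (U : 'M[D]_n) (i j : 'I_n) :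
  mxpad m U (widen_ord nm i) (widen_ord nm j) = U i j.
Proof.
rewrite mxE; case: insubP => [i' _ /= /val_inj ->|]; last by rewrite /= ltn_ord.
by case: insubP => [j' _ /= /val_inj ->|]; last by rewrite /= ltn_ord.
Qed.
Lemma mxpad_outl (U : 'M[D]_n) (i j : 'I_m) : (n <= i)%N ->
  mxpad m U i j = if i == j then 1D else 0.
Proof. by move=> ni; rewrite mxE insubN// -leqNgt. Qed.
Lemma mxpad_outr (U : 'M[D]_n) (i j : 'I_m) : (n <= j)%N ->
  mxpad m U i j = if i == j then 1D else 0.
Proof. by move=> ni; rewrite mxE (@insubN _ _ _ (j : nat)) -?leqNgt//; case: insub. Qed.

Lemma ord_split (i : 'I_m) : (exists i', i = widen_ord nm i') \/ (n <= i)%N.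
Proof.
have [h|h] := ltnP i n; last by right.
by left; exists (Ordinal h); apply: val_inj.
Qed.

Lemma mxpad_mul (U V : 'M[D]_n) :
  mxpad m (mxcmul U V) = mxcmul (mxpad m U) (mxpad m V).
Proof.
apply/matrixP => i j; rewrite [RHS]mxE.
have [[i' iE]|ni] := ord_split i; last first.
  rewrite mxpad_outl// (bigD1 i)//= mxpad_outl// eqxx cmul1l mxpad_outl//.
  rewrite big1 ?addr0// => k ki; rewrite mxpad_outl// eq_sym (negbTE ki).
  by rewrite cmul0l.
have [[j' jE]|nj] := ord_split j; last first.
  rewrite mxpad_outr// (bigD1 j)//= [mxpad m V _ _]mxpad_outr// eqxx cmul1r mxpad_outr//.
  rewrite big1 ?addr0// => k ki; rewrite [mxpad m V _ _]mxpad_outr// (negbTE ki).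
  by rewrite cmul0r.
rewrite iE jE mxpad_in mxE (bigID (fun k : 'I_m => (k < n)%N)) /=.
rewrite [X in _ = _ + X]big1 ?addr0; last first.
  move=> k; rewrite -leqNgt => nk; rewrite mxpad_outr//.
  case: eqP => [ik|_]; last by rewrite cmul0l.
  by move: nk; rewrite -ik /= leqNgt ltn_ord.
rewrite (big_ord_narrow nm); apply: eq_bigr => k _.
by rewrite !mxpad_in.
Qed.

Lemma mxpad_star (U : 'M[D]_n) : mxpad m (mxcstar U) = mxcstar (mxpad m U).
Proof.
apply/matrixP => i j; rewrite [RHS]mxE.
have [[i' ->]|ni] := ord_split i; last first.
  by rewrite mxpad_outl// mxpad_outr// eq_sym; case: eqP; rewrite ?cstar1 ?cstar0.
have [[j' ->]|nj] := ord_split j; last first.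
  by rewrite mxpad_outr// mxpad_outl// eq_sym; case: eqP; rewrite ?cstar1 ?cstar0.
by rewrite !mxpad_in mxE.
Qed.

Lemma mxpad_one : mxpad m (mxcone D n) = mxcone D m.
Proof.
apply/matrixP => i j; rewrite [RHS]mxE.
have [[i' ->]|ni] := ord_split i; last by rewrite mxpad_outl.
have [[j' ->]|nj] := ord_split j; last by rewrite mxpad_outr.
by rewrite mxpad_in mxE; congr (if _ then _ else _).
Qed.

Lemma mxpad_unitaries (U : 'M[D]_n) : mxunitaries U -> mxunitaries (mxpad m U).
Proof. by move=> [u1 u2]; rewrite /mxunitaries /= -mxpad_star -!mxpad_mul u1 u2 mxpad_one. Qed.

Lemma mxpad_cont : continuous (@mxpad _ D n m).
Proof.
apply: cont_mx => i j.
have [[i' ->]|ni] := ord_split i; last first.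
  by rewrite (_ : (fun x => _) = (fun=> if i == j then 1D else 0)); [exact: cont_cst|
    apply/funext => x; rewrite mxpad_outl].
have [[j' ->]|nj] := ord_split j; last first.
  by rewrite (_ : (fun x => _) = (fun=> if widen_ord nm i' == j then 1D else 0)); [exact: cont_cst|
    apply/funext => x; rewrite mxpad_outr].
rewrite (_ : (fun x => _) = (fun U : 'M[D]_n => U i' j')); first exact: mx_entry_cont.
by apply/funext => U; rewrite mxpad_in.
Qed.

Lemma mxpad_component (U V : 'M[D]_n) : connected_component (@mxunitaries _ D n) U V ->
  connected_component (@mxunitaries _ D m) (mxpad m U) (mxpad m V).
Proof.
move=> [C [CU Cu Cc] CV]; exists (mxpad m @` C); last by exists V.
split; first by exists U.
  by move=> _ [X CX <-]; apply: mxpad_unitaries; exact: Cu.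
apply: connected_continuous_connected => //.
exact: continuous_subspaceT mxpad_cont.
Qed.

End Padding.

Lemma mxpad_pad n m k (nm : (n <= m)%N) (mk : (m <= k)%N) (U : 'M[D]_n) :
  mxpad k (mxpad m U) = mxpad k U.
Proof.
have nk := leq_trans nm mk; apply/matrixP => i j.
have [[i' ->]|ni] := ord_split mk i; last first.
  by rewrite !mxpad_outl//; exact: leq_trans ni.
have [[j' ->]|nj] := ord_split mk j; last first.
  by rewrite !mxpad_outr//; exact: leq_trans nj.
rewrite mxpad_in.
have [[i2 ->]|ni] := ord_split nm i'; last by rewrite !mxpad_outl.
have [[j2 ->]|nj] := ord_split nm j'; last by rewrite !mxpad_outr.
rewrite mxpad_in -(mxpad_in nk U); congr (mxpad k U _ _); exact: val_inj.
Qed.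

Definition mx2 (a b c d : D) : 'M[D]_2 :=
  \matrix_(i, j) (if i == 0 then if j == 0 then a else b else if j == 0 then c else d).

Lemma mx2M a b c d a' b' c' d' : mxcmul (mx2 a b c d) (mx2 a' b' c' d') =
  mx2 (a ** a' + b ** c') (a ** b' + b ** d') (c ** a' + d ** c') (c ** b' + d ** d').
Proof.
apply/matrixP => i j; rewrite !mxE big_ord_recl big_ord1 !mxE /=.
by case: i j => [[|[|]]]//= ? [[|[|]]].
Qed.
Lemma mx2S a b c d : mxcstar (mx2 a b c d) = mx2 (cstar a) (cstar c) (cstar b) (cstar d).
Proof. by apply/matrixP => i j; rewrite !mxE; case: i j => [[|[|]]]//= ? [[|[|]]]. Qed.
Lemma mx2_one : mxcone D 2 = mx2 1D 0 0 1D.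
Proof. by apply/matrixP => i j; rewrite !mxE; case: i j => [[|[|]]]//= ? [[|[|]]]. Qed.
Lemma mx2_cont (X : topologicalType) (a b c d : X -> D) : continuous a -> continuous b ->
  continuous c -> continuous d -> continuous (fun x => mx2 (a x) (b x) (c x) (d x)).
Proof.
move=> ac bc cc dc; apply: cont_mx => i j.
rewrite (_ : (fun x => _) = (fun x => if i == 0 then if j == 0 then a x else b x
  else if j == 0 then c x else d x)); last by apply/funext => x; rewrite mxE.
by case: (i == 0); case: (j == 0).
Qed.
Lemma mx2_unitaries a d : unitaries 1D a -> unitaries 1D d -> mxunitaries (mx2 a 0 0 d).
Proof.
move=> [_ _ a1 a2] [_ _ d1 d2]; rewrite /mxunitaries /= mx2S !mx2M.
by rewrite !cstar0 !cmul0l !cmul0r !addr0 !add0r a1 a2 d1 d2 mx2_one.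
Qed.

Definition rot2 (t : R) : 'M[D]_2 := mx2 (rc (cos t) *: 1D) (- (rc (sin t) *: 1D))
  (rc (sin t) *: 1D) (rc (cos t) *: 1D).

Lemma rot2_unitaries t : mxunitaries (rot2 t).
Proof.
rewrite /mxunitaries /= /rot2 mx2S !mx2M !(cstarN, cstarZ, rc_conj, cstar1).
rewrite !(cmulNl, cmulNr, opprK, cmulZl, cmulZr, cmul1l, scalerA) -!rcM -!scalerDl -!rcD.
rewrite -!scalerBl -!rcN -!rcD -!expr2 cos2Dsin2 (addrC (sin t ^+ 2)) cos2Dsin2.
rewrite (mulrC (sin t)) addNr addrN rc0 rc1 scale0r scale1r mx2_one.
by [].
Qed.

Lemma rot2_cont : continuous rot2.
Proof.
have cc : continuous (fun t : R => rc (cos t) *: 1D).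
  by apply: cont_rcZ; [exact: continuous_cos|exact: cont_cst].
have sc : continuous (fun t : R => rc (sin t) *: 1D).
  by apply: cont_rcZ; [exact: continuous_sin|exact: cont_cst].
apply: mx2_cont => // t; apply: cvgN; exact: sc.
Qed.

(* Conjugating [diag(x, 1)] by rotations joins [diag(x, x^* )] to the unit. *)
Definition whitehead (x : D) (t : R) : 'M[D]_2 :=
  mxcmul (mxcmul (mxcmul (rot2 t) (mx2 x 0 0 1D)) (mxcstar (rot2 t))) (mx2 1D 0 0 (cstar x)).

Lemma whitehead_unitaries x t : unitaries 1D x -> mxunitaries (whitehead x t).
Proof.
move=> xu; have p1 := projection_one D; have u1 := unitaries_id p1.
apply: mxunitaries_mul; last by apply: mx2_unitaries => //; exact: unitaries_star.
apply: mxunitaries_mul; last by apply: mxunitaries_star; exact: rot2_unitaries.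
by apply: mxunitaries_mul; [exact: rot2_unitaries|exact: mx2_unitaries].
Qed.
Lemma whitehead0 x : whitehead x 0 = mx2 x 0 0 (cstar x).
Proof.
rewrite /whitehead /rot2 cos0 sin0 rc0 rc1 scale0r scale1r oppr0 mx2S !mx2M.
by rewrite cstar0 cstar1 !(cmul0l, cmul0r, addr0, add0r, cmul1l, cmul1r).
Qed.
Lemma whitehead_pihalf x : unitaries 1D x -> whitehead x (pi / 2) = mxcone D 2.
Proof.
move=> [_ _ _ xx]; rewrite /whitehead /rot2 cos_pihalf sin_pihalf rc0 rc1 scale0r scale1r mx2S !mx2M.
rewrite cstarN cstar0 cstar1 !(cmul0l, cmul0r, addr0, add0r, cmul1l, cmul1r, cmulNl, cmulNr, opprK, oppr0).
by rewrite xx mx2_one.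
Qed.
Lemma whitehead_cont x : continuous (whitehead x).
Proof.
have c := @rot2_cont.
apply: cont_mxcmul; last exact: cont_cst.
apply: cont_mxcmul; first by apply: cont_mxcmul => //; exact: cont_cst.
apply: cont_mx => i j.
rewrite (_ : (fun t => _) = (fun t => cstar (rot2 t j i))); last by apply/funext => t; rewrite mxE.
by apply: cont_cstar; exact: (cont_comp c (@mx_entry_cont _ _ j i)).
Qed.

(** The product of diag(v, v^* ), diag(z, z^* ) and diag(v^* z^*, z v) is diag(v z v^* z^*, 1), and
    the Whitehead paths join each factor to 1. *)
Lemma commutator_component v z : unitaries 1D v -> unitaries 1D z ->
  connected_component (@mxunitaries _ D 2)
    (mx2 (v ** z ** cstar v ** cstar z) 0 0 1D) (mxcone D 2).
Proof.
move=> vu zu; have p1 := projection_one D.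
have yu : unitaries 1D (cstar v ** cstar z).
  by apply: unitaries_mul; exact: unitaries_star.
pose W t := mxcmul (mxcmul (whitehead v t) (whitehead z t)) (whitehead (cstar v ** cstar z) t).
have Wc : continuous W.
  by apply: cont_mxcmul; [apply: cont_mxcmul|]; exact: whitehead_cont.
have [_ _ v1 v2] := vu; have [_ _ z1 z2] := zu.
exists (W @` `[0, pi / 2]).
  split.
  - exists 0; first by rewrite /= in_itv /= lexx /= divr_ge0// pi_ge0.
    rewrite /W !whitehead0 !mx2M !(cmul0l, cmul0r, addr0, add0r) !cmulA; congr mx2.
    by rewrite cstarM !cstarK -cmulA (cmulA (cstar z)) z1 cmul1l v1.
  - move=> _ [t _ <-]; apply: mxunitaries_mul; last exact: whitehead_unitaries.
    by apply: mxunitaries_mul; exact: whitehead_unitaries.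
  - apply: connected_continuous_connected; first exact: segment_connected.
    exact: continuous_subspaceT.
exists (pi / 2); first by rewrite /= in_itv /= lexx andbT divr_ge0// pi_ge0.
by rewrite /W !whitehead_pihalf// !mxcmul1.
Qed.

Lemma mxpad2 (c : D) : mxpad 2 (const_mx c : 'M[D]_1) = mx2 c 0 0 1D.
Proof.
have h : (1 <= 2)%N by [].
apply/matrixP => i j; rewrite [RHS]mxE.
have [[i' ->]|ni] := ord_split h i; last first.
  rewrite mxpad_outl//; case: i j ni => [[|[|]]]//= ? [[|[|]]]//.
have [[j' ->]|nj] := ord_split h j; last first.
  by rewrite mxpad_outr//; case: j i' nj => [[|[|]]]//= ? [[|]].
by rewrite mxpad_in mxE; case: i' j' => [[|]]//= ? [[|]].
Qed.

Lemma commutator_U0 v z : K1_injective D -> unitaries 1D v -> unitaries 1D z ->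
  U0 1D (v ** z ** cstar v ** cstar z).
Proof.
move=> K1 vu zu; have p1 := projection_one D; set c := v ** z ** _ ** _.
have cu : unitaries 1D c.
  by do !apply: unitaries_mul => //; exact: unitaries_star.
have pad1 k : (1 <= k)%N -> mxpad k (const_mx 1D : 'M[D]_1) = mxcone D k.
  move=> k1; rewrite -(mxpad_one k1); congr mxpad; apply/matrixP => i j.
  by rewrite !mxE !ord1 eqxx.
have conn k : (2 <= k)%N -> connected_component (@mxunitaries _ D k)
    (mxpad k (const_mx c : 'M[D]_1)) (mxpad k (const_mx 1D : 'M[D]_1)).
  move=> k2; have := mxpad_component k2 (commutator_component vu zu).
  rewrite -/c -mxpad2 (mxpad_pad _ k2)// mxpad_one// pad1//; exact: leq_trans k2.
have K1E m (V : 'M[D]_m) : K1_equiv (const_mx c : 'M[D]_1) V <->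
    K1_equiv (const_mx 1D : 'M[D]_1) V.
  (* An equality in K_1 may be witnessed in size 1, where nothing is known about the commutator; one
     more padding brings the size to at least 2. *)
  have up u k (hk : (1 <= k)%N) (mk : (m <= k)%N) :
      connected_component (@mxunitaries _ D k) (mxpad k (const_mx u : 'M[D]_1)) (mxpad k V) ->
      connected_component (@mxunitaries _ D k.+1) (mxpad k.+1 (const_mx u : 'M[D]_1)) (mxpad k.+1 V).
    by move=> /(mxpad_component (leqnSn k)); rewrite !mxpad_pad.
  split=> -[k [k1 mk /(up _ _ k1 mk) h]]; exists k.+1; split=> //; try exact: leqW.
    by apply: connected_component_trans h; apply: connected_component_sym; exact: conn.
  by apply: connected_component_trans h; exact: conn.
have := K1 c 1D cu (unitaries_id p1).
have -> : K1_class (const_mx c : 'M[D]_1) = K1_class (const_mx 1D : 'M[D]_1).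
  by apply/seteqP; split=> V [h1 h2]; split=> //; exact/K1E.
move=> /(_ erefl) h; apply: component_U0 => //.
have : U0_coset c c.
  exists 1D; last by rewrite cmul1r.
  by apply: connected_component_refl; exact: unitaries_id.
by rewrite h => -[w hw]; rewrite cmul1l => <-.
Qed.

End MatrixUnitaries.

(** * Absorbing algebras and approximate uniqueness of homomorphisms *)

Section SsaPair.
Context {R : realType} {D : unitalCstarAlgType R}.
Local Notation "1D" := (cone D).

(* [D] is generated by commuting copies [gam D] and [bet D] of itself, as
   [D (x) 1] and [1 (x) D] in [D (x) D]. *)
Record ssa_pair (gam bet : starHom D D) : Prop := SsaPair {
  sp_rep : representable D;
  sp_gam1 : gam 1D = 1D;
  sp_bet1 : bet 1D = 1D;
  sp_comm : forall a b, gam a ** bet b = bet b ** gam a;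
  sp_gam_aue : aue 1D id gam;
  sp_flip : forall (s : seq D) (eps : R), 0 < eps ->
    exists w, U0 1D w /\ forall a, a \in s -> nrm (w ** gam a ** cstar w - bet a) < eps;
  sp_univ : forall (C : cstarAlgType R) (f g : multRep D C), representable C ->
    (forall a b x, f a (g b x) = g b (f a x)) ->
    exists F : multRep D C, forall a b x, F (gam a ** bet b) x = f a (g b x);
  sp_dense : forall d (eps : R), 0 < eps -> exists s : seq (D * D),
    nrm (d - \sum_(u <- s) gam u.1 ** bet u.2) < eps
}.

Lemma strongly_self_absorbing_pair : strongly_self_absorbing D -> K1_injective D ->
  exists gam bet, ssa_pair gam bet.
Proof.
move=> [_ _ [T [t [phi [[theta phiK thetaK] hphi]]]]] K1.
pose th := sh_inv phiK thetaK.
have pa := approx_unitarily_aue hphi.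
have thK : cancel phi th := phiK; have thK' : cancel th phi := thetaK.
have rT : representable T := tens_rep t; have rD : representable D := tens_rep1 t.
have p1 := projection_one D.
pose ga := gam t th; pose be := bet t th.
have ga1 : ga 1D = 1D := gam_one t thK thK'.
have be1 : be 1D = 1D := bet_one t thK thK'.
have gb a b : ga a ** be b = th (t a b) by exact: gam_bet.
have bg a b : be b ** ga a = th (t a b) by exact: bet_gam.
have comm a b : ga a ** be b = be b ** ga a by rewrite gb bg.
have au (k k' : starHom D D) : k 1D = 1D -> k' 1D = 1D -> aue 1D k k'.
  by move=> h h'; exact: (aue_unital_endo thK thK' pa h h').
have cor (x : D) : 1D ** x ** 1D = x by rewrite cmul1l cmul1r.
exists ga, be; split=> //.
- by apply: aue_sym => //; exact: (unital_endo_aue thK thK' pa).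
- move=> s eps e0.
  have [v [vu hv]] := au ga be ga1 be1 s eps e0.
  have e64 : (0 : R) < 64^-1 by rewrite invr_gt0.
  have [z [zu hz]] := aue_sym p1 (fun a => cor _) (unital_endo_aue thK thK' pa be1) [:: v] e64.
  have bv : unitaries 1D (be v) by rewrite -be1; exact: sh_unitaries.
  (* The factor bet(v)^* commutes with gam(D), so v bet(v)^* conjugates gam to bet as v does. Since
     z v z^* is close to bet(v), it is also close to the commutator v z v^* z^*. *)
  exists (v ** cstar (be v)); split.
    apply: (U0_close p1 (commutator_U0 K1 vu zu)).
      by apply: unitaries_mul => //; exact: unitaries_star.
    have -> : v ** cstar (be v) - v ** z ** cstar v ** cstar z =
      - (v ** cstar (z ** v ** cstar z - be v)).
      by rewrite cstarB !cstarM cstarK; cring.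
    rewrite nrmN; have := hz v; rewrite inE eqxx => /(_ isT) h.
    have := nrmM v (cstar (z ** v ** cstar z - be v)); rewrite nrm_star.
    have := nrm_unitary p1 vu; have := nrm_ge0 (z ** v ** cstar z - be v) => h1 h2 h3.
    have := ler_wpM2r h1 h2; rewrite /= in h *; lra.
  move=> a /hv; rewrite cstarM cstarK.
  have -> : v ** cstar (be v) ** ga a ** (be v ** cstar v) =
      v ** (cstar (be v) ** (ga a ** be v)) ** cstar v by cring.
  rewrite comm (cmulA (cstar (be v))); have [_ _ -> _] := bv.
  by rewrite cmul1l.
- move=> C f g rC fg.
  have fl := half_flip thK thK' pa.
  have [F hF] := commuting_mrep fl rC fg.
  exists (mrep_comp F phi) => a b x.
  by rewrite /= gb thK' hF.
- move=> d eps e0; have [s hs] := tens_dense_seq t (phi d) e0; exists s.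
  have := starHom_nrm th (phi d - tsum t s) rD; rewrite shB thK /tsum sh_sum.
  move=> h; apply: le_lt_trans hs; rewrite /tsum.
  by under eq_bigr do rewrite gb.
Qed.

End SsaPair.

Section LimitMaps.
Context {R : realType}.

Lemma dense_limits (V W : completeNormedModType (complex R)) (F : nat -> V -> W) x :
  (forall n x y, nrm (F n x - F n y) <= nrm (x - y)) ->
  (forall e : R, 0 < e -> exists2 y, nrm (x - y) < e & exists l : W, F^~ y @ \oo --> l) ->
  exists l : W, F^~ x @ \oo --> l.
Proof.
move=> Fn Fd; apply: cauchy_nrm => e e0.
have e4 : 0 < e / 4 by rewrite divr_gt0.
have [y xy [l /cvg_nrmP/(_ _ e4) [N _ hN]]] := Fd _ e4.
exists N => m n Nm Nn.
have := hN m Nm; have := hN n Nn; have := Fn m x y; have := Fn n x y => /=.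
have := nrm_tri (F m y) (F m x) (F n x); have := nrm_tri l (F m y) (F n x).
have := nrm_tri (F n y) l (F n x).
rewrite (nrmBC (F n y) (F n x)) (nrmBC l (F n y)); lra.
Qed.

Lemma dense_limit_filter (V W : normedModType (complex R)) I (G : set_system I)
    {FG : ProperFilter G} (F : I -> V -> W) (L : V -> W) x :
  (forall n x y, nrm (F n x - F n y) <= nrm (x - y)) ->
  (forall x y, nrm (L x - L y) <= nrm (x - y)) ->
  (forall e : R, 0 < e -> exists2 y, nrm (x - y) < e & F^~ y @ G --> L y) ->
  F^~ x @ G --> L x.
Proof.
move=> Fn Ln Fd; apply/cvg_nrmP => e e0.
have e4 : 0 < e / 4 by rewrite divr_gt0.
have [y xy /cvg_nrmP/(_ _ e4) h] := Fd _ e4.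
near=> i.
have : nrm (F i y - L y) < e / 4 by near: i.
have := Fn i x y; have := Ln x y.
have := nrm_tri (F i y) (F i x) (L x); have := nrm_tri (L y) (F i y) (L x).
rewrite (nrmBC (L y) (L x)); lra.
Unshelve. all: by end_near.
Qed.

Lemma separable_seq (V : normedModType (complex R)) : separable V ->
  exists d : nat -> V, forall x (e : R), 0 < e -> exists n, nrm (x - d n) < e.
Proof.
move=> [S Sc Sd]; have /countable_injP[f finj] := Sc.
have h n : exists x, forall s, S s -> f s = n -> x = s.
  have [[s [Ss fs]]|no] := pselect (exists s, S s /\ f s = n).
    by exists s => s' Ss' fs'; apply: finj; rewrite ?inE// fs fs'.
  by exists 0 => s Ss fs; exfalso; apply: no; exists s.
have [d hd] := choice h; exists d => x e e0.
have [s Ss xs] := dense_nrm Sd x e0.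
by exists (f s); rewrite (hd _ s Ss erefl).
Qed.

End LimitMaps.

Section Conj.
Context {R : realType}.
Implicit Types C D : cstarAlgType R.

Lemma ml_conj C (m : multiplier C) k : ml (mult_conj m k) = m * ml k * mstar m.
Proof. by apply: mult_ext => x; exact: mult_conjE. Qed.

Lemma mult_conjD C (m : multiplier C) x y :
  mult_conj m (x + y) = mult_conj m x + mult_conj m y.
Proof. by rewrite /mult_conj mult_add cstarD mult_add cstarD. Qed.
Lemma mult_conjZ C (m : multiplier C) z x : mult_conj m (z *: x) = z *: mult_conj m x.
Proof. by rewrite /mult_conj mult_scale cstarZ mult_scale cstarZ conjCK. Qed.
Lemma mult_conj_star C (m : multiplier C) x :
  mult_conj m (cstar x) = cstar (mult_conj m x).
Proof.
by apply: ml_inj; rewrite -mstar_ml !ml_conj -mstar_ml !mstarM mstarK mulrA.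
Qed.
Lemma mult_conjM C (m : multiplier C) x y : mstar m * m = 1 ->
  mult_conj m (x ** y) = mult_conj m x ** mult_conj m y.
Proof.
move=> mm1; apply: ml_inj; rewrite mlM !ml_conj mlM.
by rewrite !mulrA -(mulrA _ (mstar m) m) mm1 mulr1.
Qed.

Variables (D : unitalCstarAlgType R) (C : cstarAlgType R) (al : multRep D C).
Local Notation "1D" := (cone D).
Hypothesis rC : representable C.
Hypothesis al1 : forall x, al 1D x = x.
Definition cj (v : D) (x : C) : C := mult_conj (mm al v) x.

Lemma mm_one : mm al 1D = 1. Proof. exact: mult_ext. Qed.
Lemma mm_uniK v : unitaries 1D v -> mstar (mm al v) * mm al v = 1.
Proof. by case=> _ _ h _; rewrite mm_star -mmM h mm_one. Qed.
Lemma cjB v x y : cj v (x - y) = cj v x - cj v y.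
Proof. by rewrite /cj mult_conjD -[in LHS]scaleN1r mult_conjZ scaleN1r. Qed.
Lemma cj_nrm v x : unitaries 1D v -> nrm (cj v x) <= nrm x.
Proof.
move=> vu; rewrite /cj /mult_conj nrm_star; have p1 := projection_one D.
have v1 := nrm_unitary p1 vu; have v0 := nrm_ge0 v.
have := mrep_nrm al v (cstar (al v x)) rC; have := mrep_nrm al v x rC; rewrite !nrm_star.
have := ler_wpM2r (nrm_ge0 x) v1; have := ler_wpM2r (nrm_ge0 (al v x)) v1; lra.
Qed.
Lemma cj_lip v x y : unitaries 1D v -> nrm (cj v x - cj v y) <= nrm (x - y).
Proof. by move=> vu; rewrite -cjB; exact: cj_nrm. Qed.
Lemma cj_mul v x y : unitaries 1D v -> cj v (x ** y) = cj v x ** cj v y.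
Proof. by move=> vu; apply: mult_conjM; exact: mm_uniK. Qed.
Lemma cj_starK v x : unitaries 1D v -> cj (cstar v) (cj v x) = x.
Proof.
move=> vu; have vu' := unitaries_star (projection_one D) vu.
apply: ml_inj; rewrite !ml_conj !mm_star cstarK -!mulrA -mmM !mulrA -mmM.
by have [_ _ -> _] := vu; rewrite mm_one mul1r mulr1.
Qed.
Lemma cj_proj v e : unitaries 1D v -> projection e -> projection (cj v e).
Proof. by move=> vu [es ee]; split; rewrite -?cj_mul ?ee// /cj -mult_conj_star es. Qed.

End Conj.

(** * The absorbing endomorphism *)

Section Absorbing.
Context {R : realType} {D : unitalCstarAlgType R}.
Local Notation "1D" := (cone D).

(* For [C = K (x) A (x) D], [al d] is [1 (x) 1 (x) d] and [J] consists of the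
   maps [d |-> k (x) a (x) d]. *)
Record absorbing (C : cstarAlgType R) (al : multRep D C) (J : set (D -> C)) : Prop :=
  Absorbing {
  ab_rep : representable C;
  ab_one : forall x, al 1D x = x;
  ab_lip : forall j, J j ->
    exists2 M : R, 0 <= M & forall x y, nrm (j x - j y) <= M * nrm (x - y);
  ab_l : forall j b d, J j -> al b (j d) = j (b ** d);
  ab_r : forall j b d x, J j -> j d ** al b x = j (d ** b) ** x;
  ab_ind : forall P : C -> Prop, (forall x y, P x -> P y -> P (x + y)) ->
    (forall j d, J j -> P (j d)) ->
    (forall x, (forall e : R, 0 < e -> exists2 y, nrm (x - y) < e & P y) -> P x) ->
    forall x, P x
}.

(** With C = D, the uniqueness theorem applies to unital endomorphisms of [D]. It yields continuous
    paths of unitaries of [D] that conjugate the identity to gam and gam to bet in the limit. *)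
Lemma absorbing_self : representable D ->
  absorbing (mrep_hom (StarHom (sh_fun := @id D) (fun _ _ _ => erefl) (fun _ _ => erefl)
    (fun _ => erefl))) [set @id D].
Proof.
move=> rD; split=> //= [x|j ->|j b d ->|j b d x ->|P _ PJ _ x]; rewrite ?cmul1l//.
- by exists 1 => // x y; rewrite mul1r.
- by rewrite /= cmulA.
- exact: (PJ id).
Qed.

Lemma aue_limit (C : choiceType) (B : cstarAlgType R) (e : B) (f g : C -> B) (d : nat -> C) :
  aue e f g -> exists v : nat -> B, (forall n, unitaries e (v n)) /\
    forall k, (fun n => v n ** f (d k) ** cstar (v n)) @ \oo --> g (d k).
Proof.
move=> fg; have h n : exists u, unitaries e u /\ forall a, a \in map d (iota 0 n) ->
    nrm (u ** f a ** cstar u - g a) < n.+1%:R^-1 by apply: fg; rewrite invr_gt0 ltr0n.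
have [v hv] := choice h; exists v; split=> [n|k]; first by have [] := hv n.
apply/cvg_nrmP => eps eps0; near=> n.
have [_ /(_ (d k))] := hv n; rewrite map_f; last first.
  by rewrite mem_iota add0n /=; near: n; exists k.+1.
move=> /(_ isT) /lt_trans; apply.
by near: n; have [N hN] := invSn_small eps0; exists N.
Unshelve. all: by end_near.
Qed.

Variables (C : cstarAlgType R) (al : multRep D C) (J : set (D -> C)).
Hypothesis ab : absorbing al J.
Let rC := ab_rep ab.
Let al1 := ab_one ab.

Lemma cj_J v j d : J j -> cj al v (j d) = j (v ** d ** cstar v).
Proof.
move=> Jj; apply: cmul_ext => x.
rewrite /cj mult_conjE /=.
by rewrite (ab_r ab)// mrepM (ab_l ab)// cmulA.
Qed.

Lemma cvg_lipschitz_map (V W : normedModType (complex R)) I (G : set_system I) {FG : Filter G}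
  (f : V -> W) (M : R) (u : I -> V) l : 0 <= M ->
  (forall x y, nrm (f x - f y) <= M * nrm (x - y)) -> u @ G --> l ->
  (fun i => f (u i)) @ G --> f l.
Proof.
move=> M0 fM /cvg_nrmP ul; apply/cvg_nrmP => e e0.
have d0 : 0 < e / (M + 1) by apply: divr_gt0; lra.
near=> i; have : nrm (u i - l) < e / (M + 1) by near: i; exact: ul.
rewrite ltr_pdivlMr; last by lra.
have := fM (u i) l; have := nrm_ge0 (u i - l); nra.
Unshelve. all: by end_near.
Qed.

Variables gam bet : starHom D D.
Hypothesis sp : ssa_pair gam bet.

Lemma absorbing_endo : separable D -> exists g : starHom C C,
  (forall b c, mm al (bet b) * ml (g c) = ml (g c) * mm al (bet b)) /\
  (forall I (G : set_system I), ProperFilter G -> forall v : I -> D,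
    (forall i, unitaries 1D (v i)) ->
    (forall d, (fun i => v i ** d ** cstar (v i)) @ G --> gam d) ->
    forall c, (fun i => cj al (v i) c) @ G --> g c) /\
  exists v : nat -> D, (forall n, unitaries 1D (v n)) /\
    forall c, (fun n => cj al (v n) c) @ \oo --> g c.
Proof.
move=> sD; have [d0 d0P] := separable_seq sD.
have p1 := projection_one D; have rD := sp_rep sp.
have [v [vu vd]] := aue_limit d0 (sp_gam_aue sp).
have vgam d : (fun n => v n ** d ** cstar (v n)) @ \oo --> gam d.
  apply: (dense_limit_filter (F := fun n d => v n ** d ** cstar (v n))).
  - move=> n x y; rewrite -cmulBl -cmulBr; apply: nrm_conj_le.
    exact: nrm_unitary (vu n).
  - by move=> x y; rewrite -shB; exact: starHom_nrm.
  - by move=> e e0; have [n hn] := d0P d e e0; exists (d0 n).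
have lim c : exists l : C, (fun n => cj al (v n) c) @ \oo --> l.
  move: c; apply: (ab_ind ab) => [x y [l xl] [l' yl]|j d Jj|x hx].
  - exists (l + l').
    rewrite (_ : (fun n => _) = (fun n => cj al (v n) x + cj al (v n) y)).
      exact: cvgD.
    by apply/funext => n; exact: mult_conjD.
  - exists (j (gam d)); have [M M0 hM] := ab_lip ab Jj.
    rewrite (_ : (fun n => _) = (fun n => j (v n ** d ** cstar (v n)))).
      exact: (cvg_lipschitz_map M0 hM).
    by apply/funext => n; exact: cj_J.
  - apply: (dense_limits (F := fun n x => cj al (v n) x)) => // n y z.
    exact: cj_lip.
have [g hg] := choice lim.
have uniq c l : (fun n => cj al (v n) c) @ \oo --> l -> g c = l.
  by move=> h; exact: (cvg_unique (@norm_hausdorff _ _) (hg c) h).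
have glin : linear g.
  move=> z x y; apply: uniq.
  rewrite (_ : (fun n => _) = (fun n => z *: cj al (v n) x + cj al (v n) y)).
    by apply: cvgD => //; apply: cvgZr.
  by apply/funext => n; rewrite /cj mult_conjD mult_conjZ.
have gM : {morph g : x y / x ** y}.
  move=> x y; apply: uniq.
  rewrite (_ : (fun n => _) = (fun n => cj al (v n) x ** cj al (v n) y)).
    exact: cvg_cmul.
  by apply/funext => n; rewrite cj_mul.
have gS : {morph g : x / cstar x}.
  move=> x; apply: uniq.
  rewrite (_ : (fun n => _) = (fun n => cstar (cj al (v n) x))).
    exact: cvg_cstar.
  by apply/funext => n; rewrite /cj mult_conj_star.
pose gh := StarHom glin gM gS.
have gJ j d : J j -> g (j d) = j (gam d).
  move=> Jj; apply: uniq; have [M M0 hM] := ab_lip ab Jj.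
  rewrite (_ : (fun n => _) = (fun n => j (v n ** d ** cstar (v n)))).
    exact: (cvg_lipschitz_map M0 hM).
  by apply/funext => n; exact: cj_J.
exists gh; split=> [b c|]; last split=> [I G FG w wu wgam c|].
- apply: mult_ext => x /=; move: c.
  apply: (ab_ind ab) => [c c' h h'|j d Jj|c hc].
  + have /= := shD gh c c'; move=> ->; rewrite !cmulDl mrepDr h h'//.
  + by rewrite gJ// mrepM (ab_l ab)// (ab_r ab)// (sp_comm sp).
  + apply/eqP; rewrite -subr_eq0; apply/eqP/nrm_le0.
    have k0 : 0 <= (2 * nrm b * nrm x).
      by rewrite !mulr_ge0 ?nrm_ge0.
    apply: (le_eps k0) => e e0; have [c' cc' hc'] := hc e e0.
    have -> : al (bet b) (g c ** x) - g c ** al (bet b) x =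
      al (bet b) (g (c - c') ** x) - g (c - c') ** al (bet b) x.
      have /= -> := shB gh c c'; rewrite !cmulBl mrepBr hc'; zmod.
    have gn : nrm (g (c - c')) <= nrm (c - c') := starHom_nrm gh (c - c') rC.
    have bn := starHom_nrm bet b rD.
    have := nrmB (al (bet b) (g (c - c') ** x)) (g (c - c') ** al (bet b) x).
    have := mrep_nrm al (bet b) (g (c - c') ** x) rC.
    have := nrmM (g (c - c')) x; have := nrmM (g (c - c')) (al (bet b) x).
    have := mrep_nrm al (bet b) x rC.
    have := nrm_ge0 x; have := nrm_ge0 (g (c - c')); have := nrm_ge0 (bet b).
    move: (nrm (g _)) (nrm (bet b)) (nrm x) (nrm b) (nrm (c - c')) gn bn cc'.
    move=> p q r s t pt qs te q0 p0 r0 h1 h2 h3 h4.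
    have : p * r <= e * r by apply: ler_wpM2r; lra.
    have : q * r <= s * r by apply: ler_wpM2r; lra.
    have : p * nrm (al (bet b) x) <= p * (q * r) by apply: ler_wpM2l.
    have : q * nrm (g (c - c') ** x) <= q * (p * r) by apply: ler_wpM2l.
    have : p * q <= e * s by apply: ler_pM => //; lra.
    move=> k1; have := ler_wpM2r r0 k1.
    have -> : e * s * r = e * (2 * s * r) / 2 by field.
    have -> : q * (p * r) = p * q * r by ring.
    have -> : p * (q * r) = p * q * r by ring.
    lra.
- move: c; apply: (ab_ind ab) => [x y hx hy|j d Jj|x hx].
  + rewrite (_ : (fun n => _) = (fun n => cj al (w n) x + cj al (w n) y)).
      by rewrite shD; exact: cvgD.
    by apply/funext => n; exact: mult_conjD.
  + have [M M0 hM] := ab_lip ab Jj; rewrite /= gJ//.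
    rewrite (_ : (fun n => _) = (fun n => j (w n ** d ** cstar (w n)))).
      exact: (cvg_lipschitz_map M0 hM).
    by apply/funext => n; exact: cj_J.
  + apply: (dense_limit_filter (F := fun n x => cj al (w n) x)) => //.
      by move=> n y z; apply: cj_lip.
    by move=> y z; rewrite -shB; exact: starHom_nrm.
- by exists v; split.
Qed.

End Absorbing.

(** * Maps between corners *)

Section CornerMaps.
Context {R : realType}.
Implicit Types B C : cstarAlgType R.

Lemma nrm_mul1l B (u x : B) : nrm u <= 1 -> nrm (u ** x) <= nrm x.
Proof.
move=> u1; apply: le_trans (nrmM u x) _.
by have := ler_wpM2r (nrm_ge0 x) u1; rewrite mul1r.
Qed.
Lemma nrm_mul1r B (u x : B) : nrm u <= 1 -> nrm (x ** u) <= nrm x.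
Proof.
move=> u1; apply: le_trans (nrmM x u) _.
by have := ler_wpM2l (nrm_ge0 x) u1; rewrite mulr1.
Qed.

(** The intended map is y |-> s (w y w^* ) s^*, with s a partial isometry that starts at the image
    of [e]. It is multiplicative only where the left factor is absorbed by [e], which suffices on
    the corner. *)
Record corner_map B C (e : B) (f : C) (T : B -> C) : Prop := CornerMap {
  cm_sub : forall x y, T (x - y) = T x - T y;
  cm_nrm : forall x, nrm (T x) <= nrm x;
  cm_unit : T e = f;
  cm_mul : forall x y, x ** e = x -> T (x ** y) = T x ** T y;
  cm_star : forall x, T (cstar x) = cstar (T x)
}.

Lemma cm_unitaries B C (e : B) (f : C) T u : projection e -> corner_map e f T ->
  unitaries e u -> unitaries f (T u).
Proof.
move=> pe cT uu; have [eu ue u1 u2] := uu; have [es ee] := pe.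
have [_ ue' _ _] := unitaries_star pe uu.
split; rewrite -?(cm_star cT) -?(cm_unit cT).
- by rewrite -(cm_mul cT)// eu.
- by rewrite -(cm_mul cT)// ue.
- by rewrite -(cm_mul cT)// u1.
- by rewrite -(cm_mul cT)// u2.
Qed.
Lemma cm_lip B C (e : B) (f : C) T x y : corner_map e f T ->
  nrm (T x - T y) <= nrm (x - y).
Proof. by move=> cT; rewrite -(cm_sub cT); exact: (cm_nrm cT). Qed.
Lemma cm_cont B C (X : topologicalType) (e : B) (f : C) T (u : X -> B) : corner_map e f T ->
  continuous u -> continuous (fun t => T (u t)).
Proof.
move=> cT uc; apply: (cont_lip (P := setT) (k := 1)) => // x y _ _.
by rewrite mul1r; exact: (cm_lip _ _ cT).
Qed.
Lemma cm_U0 B C (e : B) (f : C) T u : projection e -> corner_map e f T ->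
  U0 e u -> U0 f (T u).
Proof.
move=> pe cT [w [wc w0 w1 wu]]; exists (fun t => T (w t)); split.
- exact: cm_cont cT wc.
- by rewrite w0 (cm_unit cT).
- by rewrite w1.
- by move=> t; exact: cm_unitaries cT (wu t).
Qed.

Lemma near_seq (V : normedModType (complex R)) (T : eqType) I (G : set_system I)
    {FG : Filter G} (F : I -> T -> V)
    (L : T -> V) (s : seq T) (e : R) : 0 < e ->
  (forall c, F^~ c @ G --> L c) ->
  \forall i \near G, forall c, c \in s -> nrm (F i c - L c) < e.
Proof.
move=> e0 FL; elim: s => [|a s ih]; first by near=> n.
have /cvg_nrmP/(_ _ e0) h := FL a; near=> n.
move=> c; rewrite inE => /orP[/eqP->|]; first by near: n.
by move: c; near: n.
Unshelve. all: by end_near.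
Qed.

Lemma seq_bound (V : normedModType (complex R)) (s : seq V) :
  exists2 M : R, 0 <= M & forall c, c \in s -> nrm c <= M.
Proof.
elim: s => [|a s [M M0 hM]]; first by exists 0.
exists (nrm a + M) => [|c]; first by rewrite addr_ge0 ?nrm_ge0.
rewrite inE => /orP[/eqP->|/hM]; first by lra.
by have := nrm_ge0 a; lra.
Qed.

End CornerMaps.

Section Absorption.
Context {R : realType} {D : unitalCstarAlgType R}.
Local Notation "1D" := (cone D).
Variables gam bet : starHom D D.
Hypothesis sp : ssa_pair gam bet.
Variables (C : cstarAlgType R) (al : multRep D C).
Hypothesis rC : representable C.
Hypothesis al1 : forall x, al 1D x = x.
Variable g : starHom C C.
Hypothesis gcomm : forall b c, mm al (bet b) * ml (g c) = ml (g c) * mm al (bet b).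
Variable v : nat -> D.
Hypothesis vu : forall n, unitaries 1D (v n).
Hypothesis vg : forall c, (fun n => cj al (v n) c) @ \oo --> g c.

Lemma absorbed_hom (s : starHom D C) : exists Ps : starHom D C,
  forall a b, ml (Ps (gam a ** bet b)) = mm al (bet b) * ml (g (s a)).
Proof.
have comm a b x : mrep_hom (star_comp g s) a (mrep_comp al bet b x) =
    mrep_comp al bet b (mrep_hom (star_comp g s) a x).
  by have /(congr1 (fun m : multiplier C => m x)) /= := gcomm b (s a).
have [F hF] := sp_univ sp rC comm.
(* F takes its values in M(C). As the unit of [D] acts by g(s 1), one has F x = F x g(s 1), which
   lies in [C]. *)
pose f x := F x (g (s 1D)).
have fE x : ml (f x) = mm F x.
  apply: mult_ext => y /=; rewrite /f -mrepM.
  have -> : g (s 1D) ** y = F (gam 1D ** bet 1D) y by rewrite hF /= (sp_bet1 sp) al1.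
  by rewrite -mrep_mul (sp_gam1 sp) (sp_bet1 sp) !cmul1r.
have flin : linear f by move=> z x y; exact: mrep_linear.
have fM : {morph f : x y / x ** y}.
  by move=> x y; apply: ml_inj; rewrite mlM !fE mmM.
have fS : {morph f : x / cstar x}.
  by move=> x; apply: ml_inj; rewrite -mstar_ml !fE mm_star.
exists (StarHom flin fM fS) => a b; rewrite [LHS]fE.
by apply: mult_ext => x; rewrite mmE hF; exact: comm.
Qed.

(** [g] is close to conjugation by some v_n on finitely many elements. Conjugating back by v_n^*
    nearly restores them and sends [g e] to a projection near [e], which the partial isometry of
    [close_projections] rotates onto [e]. *)
Lemma transport e (l : seq C) (eps : R) : projection e -> (forall c, c \in l -> corner e c) ->
  0 < eps -> exists T, corner_map (g e) e T /\ forall c, c \in l -> nrm (T (g c) - c) < eps.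
Proof.
move=> pe lc e0; have [M M0 hM] := seq_bound l.
(* The partial isometry s is within 5 d of [e], so the total error is at most d + 2 (5 d) M; the
   bound 1/16 is that of [close_projections]. *)
pose d := Num.min 16^-1 (eps / (1 + 10 * M)).
have M1 : 0 < 1 + 10 * M by lra.
have d0 : 0 < d by rewrite lt_min divr_gt0// andbT invr_gt0.
have d16 : d <= 16^-1 by rewrite ge_min lexx.
have de : d * (1 + 10 * M) <= eps.
  by rewrite -ler_pdivlMr// ge_min lexx orbT.
have [n] : exists n, forall c, c \in e :: l -> nrm (cj al (v n) c - g c) < d.
  have [N _ /(_ N (leqnn _)) hN] := near_seq (e :: l) d0 vg.
  by exists N.
set w := cstar (v n) => hn.
have wu : unitaries 1D w by exact: unitaries_star (projection_one D) (vu n).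
have hw c : c \in e :: l -> nrm (cj al w (g c) - c) < d.
  move=> /hn; apply: le_lt_trans; rewrite nrmBC -{1}(cj_starK al1 c (vu n)).
  exact: cj_lip.
pose p := cj al w (g e); have pg := sh_projection g pe.
have pp : projection p by exact: cj_proj.
have pe' : nrm (p - e) < d by apply: hw; rewrite inE eqxx.
have [|s [s1 s2 s3 s4 s5]] := close_projections pp pe; first lra.
have sn : nrm s <= 1.
  rewrite -(ler_pXn2r (n := 2)) ?nnegrE ?nrm_ge0// -nrm_starM s1 expr1n.
  exact: nrm_proj.
exists (fun y => s ** cj al w y ** cstar s); split; first split.
- by move=> x y; rewrite cjB cmulBr cmulBl.
- move=> x; apply: le_trans (nrm_conj_le _ sn) _; exact: cj_nrm.
- by rewrite -/p s4.
- move=> x y xe; have xp : cj al w x ** p = cj al w x by rewrite -cj_mul// xe.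
  rewrite cj_mul// -{1}xp -s1; cring.
- by move=> x; rewrite /cj mult_conj_star !cstarM cstarK cmulA.
- move=> c cl; have hc : nrm (cj al w (g c) - c) < d by apply: hw; rewrite inE cl orbT.
  have cE := lc c cl; have [es _] := pe.
  have ec : e ** c = c.
    by rewrite -{1}cE !cmulA (proj2 pe) cE.
  have ce : c ** e = c by rewrite -{1}cE -!cmulA (proj2 pe) cmulA cE.
  have -> : s ** cj al w (g c) ** cstar s - c =
    s ** (cj al w (g c) - c) ** cstar s + ((s - e) ** c ** cstar s + c ** cstar (s - e)).
    rewrite cstarB es cmulBr cmulBl (cmulBl s e) ec (cmulBl (s ** c)) cmulBr ce; zmod.
  have h1 := nrmD (s ** (cj al w (g c) - c) ** cstar s) ((s - e) ** c ** cstar s + c ** cstar (s - e)).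
  have h2 := nrmD ((s - e) ** c ** cstar s) (c ** cstar (s - e)).
  have h3 := nrm_conj_le (cj al w (g c) - c) sn.
  have sn' : nrm (cstar s) <= 1 by rewrite nrm_star.
  have h4 := nrm_mul1r ((s - e) ** c) sn'; have h5 := nrmM (s - e) c.
  have := nrmM c (cstar (s - e)); rewrite nrm_star => h6.
  have := nrm_tri p s e; have := hM _ cl; have := nrm_ge0 c; have := nrm_ge0 (s - e).
  move=> q0 c0 cM q1; have qd : nrm (s - e) <= 5 * d by lra.
  have q2 : nrm (s - e) * nrm c <= 5 * d * M by apply: ler_pM.
  apply: lt_le_trans de; lra.
Qed.

End Absorption.

(** * Approximate uniqueness, and paths in approximate commutants *)

Section Uniqueness.
Context {R : realType} {D : unitalCstarAlgType R}.
Local Notation "1D" := (cone D).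
Variables gam bet : starHom D D.
Hypothesis sp : ssa_pair gam bet.
Variables (C : cstarAlgType R) (al : multRep D C).
Hypothesis rC : representable C.
Hypothesis al1 : forall x, al 1D x = x.
Variable g : starHom C C.
Hypothesis gcomm : forall b c, mm al (bet b) * ml (g c) = ml (g c) * mm al (bet b).
Variable v : nat -> D.
Hypothesis vu : forall n, unitaries 1D (v n).
Hypothesis vg : forall c, (fun n => cj al (v n) c) @ \oo --> g c.

Section AbsorbedHom.
Variables (e : C) (s : starHom D C) (Ps : starHom D C).
Hypothesis s1 : s 1D = e.
Hypothesis PsE : forall a b, ml (Ps (gam a ** bet b)) = mm al (bet b) * ml (g (s a)).

Lemma hom_corner d : corner e (s d).
Proof. by rewrite /corner /= -s1 -!sh_mul cmul1l cmul1r. Qed.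
Lemma absorbed_gam a : Ps (gam a) = g (s a).
Proof.
apply: ml_inj; rewrite -[gam a]cmul1r -(sp_bet1 sp) PsE (sp_bet1 sp).
by rewrite (mm_one al1) mul1r.
Qed.
Lemma absorbed_bet b : ml (Ps (bet b)) = mm al (bet b) * ml (g e).
Proof. by rewrite -[bet b]cmul1l -(sp_gam1 sp) PsE s1 (sp_gam1 sp) cmul1l. Qed.
Lemma absorbed_one : Ps 1D = g e.
Proof. by rewrite -s1 -absorbed_gam (sp_gam1 sp). Qed.
Lemma absorbed_unitaries u : unitaries 1D u -> unitaries (g e) (Ps u).
Proof. by rewrite -absorbed_one; exact: sh_unitaries. Qed.
Lemma absorbed_U0 u : U0 1D u -> U0 (g e) (Ps u).
Proof. by rewrite -absorbed_one; exact: U0_map. Qed.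
End AbsorbedHom.

Variable e : C.
Hypothesis pe : projection e.
Let pg : projection (g e) := sh_projection g pe.

Lemma unitary_conjugacy (s t : starHom D C) (l : seq D) (eps : R) :
  s 1D = e -> t 1D = e -> 0 < eps -> exists u, U0 e u /\
    forall a, a \in l -> nrm (u ** s a ** cstar u - t a) < eps.
Proof.
move=> s1 t1 e0; have e4 : 0 < eps / 4 by rewrite divr_gt0.
have [w [w0 hw]] := sp_flip sp l e4.
have [Ps hPs] := absorbed_hom sp rC al1 gcomm s; have [Pt hPt] := absorbed_hom sp rC al1 gcomm t.
have wu := U0_unitaries w0.
(* Conjugation by Ps(w) takes g(s a) = Ps(gam a) near Ps(bet a), which is Pt(bet a); conjugation by
   Pt(w)^* then takes this near Pt(gam a) = g(t a). *)
pose W := cstar (Pt w) ** Ps w.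
have W0 : U0 (g e) W.
  apply: U0_mul => //; first apply: U0_star => //.
    exact: (absorbed_U0 t1 hPt).
  exact: (absorbed_U0 s1 hPs).
have [_ We _ _] := U0_unitaries W0.
have Wg a : a \in l -> nrm (W ** g (s a) ** cstar W - g (t a)) < eps / 2.
  move=> /hw h.
  have -> : W ** g (s a) ** cstar W - g (t a) =
    cstar (Pt w) ** (Ps (w ** gam a ** cstar w - bet a)
      - Pt (w ** gam a ** cstar w - bet a)) ** Pt w.
    have -> : Ps (w ** gam a ** cstar w - bet a) - Pt (w ** gam a ** cstar w - bet a) =
      Ps (w ** gam a ** cstar w) - Pt (w ** gam a ** cstar w).
      rewrite !shB (_ : Pt (bet a) = Ps (bet a)); first by zmod.
      by apply: ml_inj; rewrite (absorbed_bet s1 hPs) (absorbed_bet t1 hPt).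
    rewrite /W cmulBr cmulBl !sh_mul !sh_star (absorbed_gam hPs) cstarM cstarK.
    have -> : cstar (Pt w) ** (Pt w ** Pt (gam a) ** cstar (Pt w)) ** Pt w = g (t a).
      rewrite -!sh_star -!sh_mul -(absorbed_gam hPt); congr (Pt _).
      have [_ _ u1 _] := wu; rewrite -!cmulA u1 !cmulA u1 cmul1l cmul1r//.
    by rewrite !cmulA.
  have wn : nrm (cstar (Pt w)) <= 1.
    rewrite nrm_star; apply: nrm_unitary pg _; exact: (absorbed_unitaries t1 hPt).
  have h1 := starHom_nrm Ps (w ** gam a ** cstar w - bet a) rC.
  have h2 := starHom_nrm Pt (w ** gam a ** cstar w - bet a) rC.
  rewrite -[X in _ ** X](cstarK (Pt w)); apply: le_lt_trans (nrm_conj_le _ wn) _.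
  apply: le_lt_trans (nrmB _ _) _; lra.
clearbody W.
have [|T [cT hT]] := transport rC al1 vu vg (l := map s l ++ map t l) pe _ e4.
  by move=> c; rewrite mem_cat => /orP[] /mapP[a _ ->]; exact: hom_corner.
exists (T W); split; first exact: (cm_U0 pg cT).
move=> a al'; have TW := cm_unitaries pg cT (U0_unitaries W0).
have TWn := nrm_unitary pe TW.
have h1 : nrm (T (g (s a)) - s a) < eps / 4.
  by apply: hT; rewrite mem_cat map_f.
have h2 : nrm (T (g (t a)) - t a) < eps / 4.
  by apply: hT; rewrite mem_cat orbC map_f.
have h3 := Wg a al'.
have -> : T W ** s a ** cstar (T W) - t a = - (T W ** (T (g (s a)) - s a) ** cstar (T W)) +
   (T (W ** g (s a) ** cstar W - g (t a)) + (T (g (t a)) - t a)).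
  have gse : g (s a) ** g e = g (s a) by rewrite -sh_mul -s1 -sh_mul cmul1r.
  rewrite (cm_sub cT) !(cm_mul cT) ?(cm_star cT)//; last by rewrite -cmulA gse.
  by cring.
have h4 := nrm_conj_le (T (g (s a)) - s a) TWn.
have h5 := cm_nrm cT (W ** g (s a) ** cstar W - g (t a)).
apply: le_lt_trans (nrmD _ _) _; rewrite nrmN.
have := nrmD (T (W ** g (s a) ** cstar W - g (t a))) (T (g (t a)) - t a); lra.
Qed.

(** Any path p from [e] to u in the unitaries is corrected. The values g(p x) commute with Pt(bet
    D), so after conjugation by Pt(w)^* they nearly commute with Pt(gam D), that is with g(t D). The
    start is not disturbed, and the end is still close to g(u). *)
Lemma commutant_path (t : starHom D C) (l : seq D) (eps : R) : t 1D = e -> 0 < eps ->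
  exists (l' : seq D) (del : R), 0 < del /\ forall u, U0 e u ->
    (forall a, a \in l' -> nrm (u ** t a - t a ** u) < del) ->
    exists r : R -> C, [/\ continuous r, r 0 = e, r 1 = u, (forall x, unitaries e (r x)) &
      forall x a, a \in l -> nrm (r x ** t a - t a ** r x) < eps].
Proof.
move=> t1 e0; have e8 : 0 < eps / 8 by rewrite divr_gt0.
have [w [w0 hw]] := sp_flip sp l e8; have wu := U0_unitaries w0.
have [Pt hPt] := absorbed_hom sp rC al1 gcomm t.
have [M M0 hM] := seq_bound l.
pose k := Num.min (1 / 64) (eps / (32 * (M + 1))).
have k0 : 0 < k by rewrite lt_min !divr_gt0//; lra.
have k64 : k <= 1 / 64 by rewrite ge_min lexx.
have ke : k * (32 * (M + 1)) <= eps by rewrite -ler_pdivlMr ?ge_min ?lexx ?orbT//; lra.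
have k4 : 0 < k / 4 by rewrite divr_gt0.
(* [w] is approximated by a finite sum of gam(a) bet(b). The elements a form the finite set that u
   must almost commute with, and del divides the tolerance by the size of the sum and a bound N on
   the b. *)
have [z hz] := sp_dense sp w k4.
have [N N0 hN] := seq_bound (map snd z).
pose del := k / 4 / (N * (size z)%:R + 1).
have zN : 0 < N * (size z)%:R + 1 by have := mulr_ge0 N0 (ler0n R (size z)); lra.
exists (map fst z), del; split; first by rewrite divr_gt0.
move=> u u0 hu; have uu := U0_unitaries u0.
pose V := Pt w; have Vu : unitaries (g e) V by exact: (absorbed_unitaries t1 hPt).
have Vn := nrm_unitary pg Vu.
have [Ve eV V1 V2] := Vu.
have guu := sh_unitaries g uu.
have gun := nrm_unitary pg guu; have [gu ug _ _] := guu.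
(* g(u) commutes exactly with the action of bet(b) and almost with Pt(gam a) = g(t a), hence almost
   with the finite sum approximating V = Pt(w). *)
have uV : nrm (g u ** V - V ** g u) <= 3 * (k / 4).
  pose y := \sum_(i <- z) gam i.1 ** bet i.2.
  have yw : nrm (Pt (w - y)) <= k / 4.
    by apply: le_trans (starHom_nrm _ _ rC) _; exact: ltW.
  have h1 : nrm (g u ** Pt y - Pt y ** g u) <= k / 4.
    rewrite /y sh_sum cmul_sumr cmul_suml -sumrB.
    apply: (@le_trans _ _ (\sum_(i <- z) del * N)); last first.
      rewrite big_const_seq count_predT iter_addr addr0 -(mulr_natr (_ * _)) /del.
      have q1 : N * (size z)%:R / (N * (size z)%:R + 1) <= 1.
        by rewrite ler_pdivrMr//; lra.
      have := ler_wpM2l (ltW k4) q1; rewrite mulr1 => hh; apply: le_trans hh.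
      by rewrite le_eqVlt; apply/orP; left; apply/eqP; ring.
    rewrite big_seq [X in _ <= X]big_seq.
    apply: le_trans (nrm_sum _ _ _) _; apply: ler_sum => i iz.
    have -> : g u ** Pt (gam i.1 ** bet i.2) - Pt (gam i.1 ** bet i.2) ** g u =
       al (bet i.2) (g (u ** t i.1 - t i.1 ** u)).
      apply: ml_inj; rewrite mlD mlN !mlM hPt.
      have -> : ml (al (bet i.2) (g (u ** t i.1 - t i.1 ** u))) =
         mm al (bet i.2) * ml (g (u ** t i.1 - t i.1 ** u)).
        by apply: mult_ext => x; rewrite /= mrepM.
      by rewrite shB !sh_mul mlD mlN !mlM mulrA -gcomm; ncr.
    apply: le_trans (mrep_nrm _ _ _ rC) _; rewrite mulrC; apply: ler_pM; rewrite ?nrm_ge0//.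
      apply: le_trans (starHom_nrm _ _ rC) _; apply: ltW; apply: hu; exact: map_f.
    apply: le_trans (starHom_nrm _ _ (sp_rep sp)) _; apply: hN; exact: map_f.
  have -> : g u ** V - V ** g u = g u ** Pt (w - y) - Pt (w - y) ** g u
      + (g u ** Pt y - Pt y ** g u).
    by rewrite /V shB cmulBr cmulBl; zmod.
  have := nrmD (g u ** Pt (w - y) - Pt (w - y) ** g u) (g u ** Pt y - Pt y ** g u).
  have := nrmB (g u ** Pt (w - y)) (Pt (w - y) ** g u).
  have := nrm_mul1l (Pt (w - y)) gun; have := nrm_mul1r (Pt (w - y)) gun; lra.
have [p [pc p0 p1 pu]] := u0.
pose X x := cstar V ** g (p x) ** V.
have Xu x : unitaries (g e) (X x).
  apply: unitaries_mul => //; apply: unitaries_mul; first exact: unitaries_star.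
  exact: (sh_unitaries g (pu x)).
have Xc : continuous X.
  apply: cont_cmul; last exact: cont_cst.
  apply: cont_cmul; first exact: cont_cst.
  by apply: cont_comp => //; exact: sh_continuous.
have X0 : X 0 = g e by rewrite /X p0 -cmulA Ve.
have X1 : nrm (X 1 - g u) <= 3 * (k / 4).
  have -> : X 1 - g u = cstar V ** (g u ** V - V ** g u).
    rewrite /X p1 cmulBr (cmulA (cstar V) V) V1 gu; cring.
  by apply: le_trans uV; apply: nrm_mul1l; rewrite nrm_star.
have Xt x a : a \in l -> nrm (X x ** g (t a) - g (t a) ** X x) <= 2 * (eps / 8).
  move=> /hw/ltW h.
  pose q := Pt (w ** gam a ** cstar w - bet a).
  have qn : nrm q <= eps / 8 by apply: le_trans h; exact: starHom_nrm.
  have qE : V ** g (t a) ** cstar V = q + Pt (bet a).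
    by rewrite /q shB !sh_mul sh_star -/V (absorbed_gam hPt); zmod.
  have pb : g (p x) ** Pt (bet a) = Pt (bet a) ** g (p x).
    apply: ml_inj; rewrite !mlM (absorbed_bet t1 hPt) mulrA -gcomm -!mulrA -!mlM.
    have [pe1 pe2 _ _] := sh_unitaries g (pu x); by rewrite pe1 pe2.
  have gte : g (t a) ** g e = g (t a) by rewrite -sh_mul -t1 -sh_mul cmul1r.
  have get : g e ** g (t a) = g (t a) by rewrite -sh_mul -t1 -sh_mul cmul1l.
  have -> : X x ** g (t a) - g (t a) ** X x = cstar V ** (g (p x) ** q - q ** g (p x)) ** V.
    have qE' : q = V ** g (t a) ** cstar V - Pt (bet a) by rewrite qE; zmod.
    rewrite qE' (cmulBr _ _ (g (p x))) (cmulBl _ _ (g (p x))) pb.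
    have -> (x1 x2 x3 : C) : x1 - x3 - (x2 - x3) = x1 - x2 by zmod.
    rewrite cmulBr cmulBl /X.
    have -> : cstar V ** (g (p x) ** (V ** g (t a) ** cstar V)) ** V =
      cstar V ** g (p x) ** V ** (g (t a) ** (cstar V ** V)) by cring.
    have -> : cstar V ** (V ** g (t a) ** cstar V ** g (p x)) ** V =
      ((cstar V ** V) ** g (t a)) ** (cstar V ** g (p x) ** V) by cring.
    by rewrite V1 gte get.
  have pn := nrm_unitary pg (sh_unitaries g (pu x)).
  have Vn' : nrm (cstar V) <= 1 by rewrite nrm_star.
  apply: le_trans (nrm_mul1r _ Vn) _; apply: le_trans (nrm_mul1l _ Vn') _.
  have := nrmB (g (p x) ** q) (q ** g (p x)).
  have := nrm_mul1l q pn; have := nrm_mul1r q pn; lra.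
clearbody X.
have [|T [cT hT]] := transport rC al1 vu vg (l := u :: map t l) pe _ k4.
  move=> c; rewrite inE => /orP[/eqP->|/mapP[a _ ->]]; last exact: hom_corner.
  by have [eu ue _ _] := uu; rewrite /corner /= eu ue.
have Tu x : unitaries e (T (X x)) := cm_unitaries pg cT (Xu x).
(* The transported path ends near u only; the short path from [e] to u' makes up for the difference
   while moving little enough to keep the commutators small. *)
pose u' := u ** cstar (T (X 1)).
have u'u : unitaries e u' by apply: unitaries_mul => //; exact: unitaries_star.
have u'e : nrm (u' - e) <= k.
  have -> : u' - e = (u - T (X 1)) ** cstar (T (X 1)).
    by rewrite cmulBl /u'; have [_ _ _ ->] := Tu 1.
  have Tn : nrm (cstar (T (X 1))) <= 1 by rewrite nrm_star; exact: nrm_unitary pe (Tu 1).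
  apply: le_trans (nrm_mul1r _ Tn) _.
  have := hT u (mem_head _ _); have := cm_lip (X 1) (g u) cT.
  by have := nrm_tri (T (g u)) u (T (X 1)); rewrite (nrmBC u (T (g u))) (nrmBC (T (g u)) (T (X 1))); lra.
have [|y [yc y0 y1 yu yn]] := near_unitary_path pe u'u; first by lra.
exists (fun x => y x ** T (X x)); split.
- apply: cont_cmul => //; exact: cm_cont cT Xc.
- by rewrite y0 X0 (cm_unit cT) (proj2 pe).
- rewrite y1 /u' -cmulA; have [_ _ -> _] := Tu 1; by have [_ -> _ _] := uu.
- by move=> x; exact: unitaries_mul.
- move=> x a al'.
  have te : e ** t a = t a by rewrite -t1 -sh_mul cmul1l.
  have et : t a ** e = t a by rewrite -t1 -sh_mul cmul1r.
  have [Xe eX _ _] := Tu x.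
  have ta : nrm (T (g (t a)) - t a) < k / 4 by apply: hT; rewrite inE map_f ?orbT.
  have gte : g (t a) ** g e = g (t a) by rewrite -sh_mul et.
  have [_ Xge _ _] := Xu x.
  have h1 : nrm (T (X x) ** t a - t a ** T (X x)) <= 2 * (k / 4) + 2 * (eps / 8).
    have -> : T (X x) ** t a - t a ** T (X x) =
       (T (g (t a)) - t a) ** T (X x) - T (X x) ** (T (g (t a)) - t a)
       + T (X x ** g (t a) - g (t a) ** X x).
      by rewrite (cm_sub cT) !(cm_mul cT)// cmulBl cmulBr; zmod.
    have Tn := nrm_unitary pe (Tu x).
    apply: le_trans (nrmD _ _) _.
    have := nrmB ((T (g (t a)) - t a) ** T (X x)) (T (X x) ** (T (g (t a)) - t a)).
    have := nrm_mul1l (T (g (t a)) - t a) Tn; have := nrm_mul1r (T (g (t a)) - t a) Tn.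
    have := cm_nrm cT (X x ** g (t a) - g (t a) ** X x); have := Xt x a al'; lra.
  have -> : y x ** T (X x) ** t a - t a ** (y x ** T (X x)) =
     (T (X x) ** t a - t a ** T (X x)) + ((y x - e) ** T (X x) ** t a - t a ** ((y x - e) ** T (X x))).
    rewrite (_ : (y x - e) ** T (X x) = y x ** T (X x) - T (X x)); last by rewrite cmulBl Xe.
    by cring.
  have Tn := nrm_unitary pe (Tu x).
  have h2 := nrmM ((y x - e) ** T (X x)) (t a); have h3 := nrmM (t a) ((y x - e) ** T (X x)).
  have h4 := nrm_mul1r (y x - e) Tn.
  have h5 : nrm ((y x - e) ** T (X x)) <= 8 * k.
    by apply: le_trans h4 _; apply: le_trans (yn x) _; lra.
  have tn : nrm (t a) <= M by apply: le_trans (starHom_nrm _ _ rC) (hM _ al').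
  have h6 : nrm ((y x - e) ** T (X x)) * nrm (t a) <= 8 * k * M by apply: ler_pM; rewrite ?nrm_ge0.
  apply: le_lt_trans (nrmD _ _) _.
  have := nrmB ((y x - e) ** T (X x) ** t a) (t a ** ((y x - e) ** T (X x))).
  rewrite (mulrC (nrm (t a))) in h3.
  lra.
Qed.

End Uniqueness.

(** * Asymptotic uniqueness of homomorphisms *)

Section InfiniteProduct.
Context {R : realType} {T : Type}.
Variables (F : nat -> R -> T -> T) (x0 : T).

(** An infinite concatenation: the factor of index m acts during [m, m+1], being trivial before and
    constant after. *)
Fixpoint iterprod (n : nat) (t : R) : T :=
  if n is m.+1 then F m (t - m%:R) (iterprod m t) else x0.

Lemma iterprod_const n t t' : (forall m s x, 1 <= s -> F m s x = F m 1 x) ->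
  n%:R <= t -> n%:R <= t' -> iterprod n t = iterprod n t'.
Proof.
move=> F1; elim: n => //= n ih; rewrite -natr1 => h h'.
by rewrite F1 ?[RHS]F1 ?ih//; lra.
Qed.

Variable Q : T -> Prop.
Hypothesis Q0 : Q x0.
Hypothesis QF : forall n s x, Q x -> Q (F n s x).
Hypothesis F0 : forall n s x, Q x -> s <= 0 -> F n s x = x.

Lemma iterprod_inv n t : Q (iterprod n t).
Proof. by elim: n => //= n ih; exact: QF. Qed.

Lemma iterprod_stable n k t : t <= n%:R -> iterprod (k + n) t = iterprod n t.
Proof.
move=> tn; elim: k => //= k ih; rewrite ih F0//; first exact: iterprod_inv.
by rewrite natrD; have := ler0n R k; lra.
Qed.

(** The number of factors exceeds |t|, so those left out have not started. The absolute value covers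
    negative times, at which every factor is trivial. *)
Definition infprod (t : R) : T := iterprod (Num.truncn `|t|).+1 t.

Lemma infprodE n t : t <= n%:R -> infprod t = iterprod n t.
Proof.
move=> tn; rewrite /infprod; set m := (_).+1.
have tm : t <= m%:R by rewrite (le_trans (ler_norm t))// ltW// truncnS_gt.
have [h|h] := leqP m n; first by rewrite -(subnK h) iterprod_stable.
by rewrite -(subnK (ltnW h)) iterprod_stable.
Qed.

Lemma infprod_inv t : Q (infprod t). Proof. exact: iterprod_inv. Qed.

Lemma infprod_le0 t : t <= 0 -> infprod t = x0.
Proof. by move=> t0; rewrite (@infprodE 0). Qed.

Lemma infprod_step n t : (forall m s x, 1 <= s -> F m s x = F m 1 x) ->
  n%:R <= t <= n.+1%:R -> infprod t = F n (t - n%:R) (infprod n%:R).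
Proof.
move=> F1 /andP[nt tn]; rewrite (infprodE tn) (@infprodE n n%:R)//=.
by congr F; exact: iterprod_const.
Qed.

Lemma infprod_continuous (V : normedModType (complex R)) (h : T -> V) :
  (forall n, continuous (fun t => h (iterprod n t))) -> continuous (fun t => h (infprod t)).
Proof.
move=> hc t; pose n := (Num.truncn `|t|).+1.
have tn : t < n%:R by rewrite (le_lt_trans (ler_norm t))// truncnS_gt.
apply/cvg_nrmP => e e0 /=; rewrite (infprodE (ltW tn)).
have /cvg_nrmP/(_ _ e0) hn := hc n t; near=> s.
rewrite (@infprodE n s); first by near: s.
by apply: ltW; near: s; exact: lt_nbhsl.
Unshelve. all: by end_near.
Qed.

End InfiniteProduct.

Section Concatenation.
Context {R : realType} {C : cstarAlgType R}.

Lemma continuous_shift (c : R) : continuous (fun t : R => t - c).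
Proof. by move=> t; apply: cvgB; [exact: cvg_id|exact: cvg_cst]. Qed.

Lemma concat_paths (e : C) (r : nat -> R -> C) : projection e ->
  (forall n, continuous (r n)) -> (forall n, r n 0 = e) ->
  (forall n t, unitaries e (r n t)) ->
  exists U : R -> C, [/\ continuous U, U 0 = e, (forall t, unitaries e (U t)) &
    forall n t, n%:R <= t <= n.+1%:R -> U t = r n (t - n%:R) ** U n%:R].
Proof.
move=> pe rc' r0 ru; pose F n s x := r n (clamp s) ** x.
have Q0 := unitaries_id pe.
have QF n s x : unitaries e x -> unitaries e (F n s x).
  by move=> xu; exact: unitaries_mul.
have F0 n s x : unitaries e x -> s <= 0 -> F n s x = x.
  by move=> [ex _ _ _] s0; rewrite /F clamp_le0// r0.
exists (infprod F e); split.
- apply: (infprod_continuous Q0 QF F0 (h := id)) => n; elim: n => [|n ih] /=.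
    exact: cont_cst.
  apply: cont_cmul => //; apply: (cont_comp _ (rc' n)).
  apply: (cont_comp _ continuous_clamp); exact: continuous_shift.
- exact: (infprod_le0 Q0 QF F0).
- exact: infprod_inv.
- have F1 m s x : 1 <= s -> F m s x = F m 1 x.
    by move=> s1; rewrite /F clamp_ge1// clamp1.
  move=> n t h; rewrite (infprod_step Q0 QF F0 F1 h).
  by rewrite /F clamp_id//; move: h; rewrite -natr1; lra.
Qed.

End Concatenation.

Section AsymptoticUniqueness.
Context {R : realType} {D : unitalCstarAlgType R}.
Local Notation "1D" := (cone D).
Variables gam bet : starHom D D.
Hypothesis sp : ssa_pair gam bet.
Hypothesis sD : separable D.
Variables (C : cstarAlgType R) (al : multRep D C) (J : set (D -> C)).
Hypothesis ab : absorbing al J.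

Lemma cvg_pinfty_nrm (V : normedModType (complex R)) (u : R -> V) l :
  (forall e : R, 0 < e -> exists N : R, forall t, N <= t -> nrm (u t - l) < e) ->
  u @ +oo --> l.
Proof.
move=> h; apply/cvg_nrmP => e /h [N hN]; near=> t; apply: hN; near: t.
by apply: nbhs_pinfty_ge; exact: num_real.
Unshelve. all: by end_near.
Qed.

Theorem asymptotic_uniqueness (e : C) (s t : starHom D C) :
  projection e -> s 1D = e -> t 1D = e -> exists u : R -> C,
  [/\ continuous u, u 0 = e, (forall x, unitaries e (u x)) &
    forall c, (fun x => u x ** s c ** cstar (u x)) @ +oo --> t c].
Proof.
move=> pe s1 t1; have rC := ab_rep ab; have al1 := ab_one ab.
have [g [gcomm [_ [v [vu vg]]]]] := absorbing_endo ab sp sD.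
have [d hd] := separable_seq sD.
pose l n := map d (iota 0 n).
have en n : 0 < n.+1%:R^-1 :> R by rewrite invr_gt0 ltr0n.
have h2 n : exists p : seq D * R, 0 < p.2 /\ forall u, U0 e u ->
    (forall a, a \in p.1 -> nrm (u ** t a - t a ** u) < p.2) ->
    exists r : R -> C, [/\ continuous r, r 0 = e, r 1 = u, (forall x, unitaries e (r x)) &
      forall x a, a \in l n -> nrm (r x ** t a - t a ** r x) < n.+1%:R^-1].
  have [l' [del h]] := commutant_path sp rC al1 gcomm vu vg pe (l n) t1 (en n).
  by exists (l', del).
have [G hG] := choice h2.
(* The step from u n to u n.+1 uses the tolerance of G n, to which both unitaries contribute. Hence
   the halves, and a condition on u n from G n and from G n.-1. *)
pose eta n := Num.min (n.+1%:R^-1) (Num.min ((G n).2 / 2) ((G n.-1).2 / 2)).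
have eta0 n : 0 < eta n.
  by rewrite !lt_min !divr_gt0// ?(proj1 (hG _))//= andbT.
have h1 n : exists u, U0 e u /\ forall a, a \in l n ++ (G n).1 ++ (G n.-1).1 ->
    nrm (u ** s a ** cstar u - t a) < eta n.
  exact: (unitary_conjugacy sp rC al1 gcomm vu vg pe).
have [u hu] := choice h1.
have uu n : unitaries e (u n) by apply: U0_unitaries; exact: (proj1 (hu n)).
have et a : t a ** e = t a by rewrite -t1 -sh_mul cmul1r.
(* The first path must start at [e], so it runs directly to u 1 and u 0 is skipped; no commutation
   is asked of it. *)
pose z n := if n is 0%N then u 1%N else u n.+1 ** cstar (u n).
have zr n : exists r : R -> C, [/\ continuous r, r 0 = e, r 1 = z n, (forall x, unitaries e (r x)) &
      (0 < n)%N -> forall x a, a \in l n -> nrm (r x ** t a - t a ** r x) < n.+1%:R^-1].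
  case: n => [|n] /=; first by have [[r [h3 h4 h5 h6]] _] := hu 1%N; exists r.
  have [dG hGn] := hG n.+1.
  have [||r [h3 h4 h5 h6 h7]] := hGn (z n.+1); last by exists r.
    by apply: U0_mul => //; [|apply: U0_star => //]; exact: (proj1 (hu _)).
  move=> a aG.
  have zu : unitaries e (z n.+1) by apply: unitaries_mul => //; exact: unitaries_star.
  have [ez ze zz zz'] := zu; have zn := nrm_unitary pe zu.
  have aG1 : nrm (u n.+1 ** s a ** cstar (u n.+1) - t a) < (G n.+1).2 / 2.
    apply: lt_le_trans ((proj2 (hu n.+1)) a _) _; first by rewrite !mem_cat aG orbT.
    by rewrite !ge_min lexx !orbT.
  have aG2 : nrm (u n.+2 ** s a ** cstar (u n.+2) - t a) < (G n.+1).2 / 2.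
    apply: lt_le_trans ((proj2 (hu n.+2)) a _) _; first by rewrite !mem_cat aG !orbT.
    by rewrite !ge_min lexx !orbT.
  set x1 := _ ** s a ** _ in aG1; set x2 := _ ** s a ** _ in aG2.
  have zx : z n.+1 ** x1 ** cstar (z n.+1) = x2.
    have [_ _ q1 _] := uu n.+1; have [_ q2 _ _] := uu n.+2.
    rewrite /z /x1 /x2 cstarM cstarK.
    have se : s a ** e = s a by rewrite -s1 -sh_mul cmul1r.
    have es : e ** s a = s a by rewrite -s1 -sh_mul cmul1l.
    have -> : u n.+2 ** cstar (u n.+1) ** (u n.+1 ** s a ** cstar (u n.+1)) **
      (u n.+1 ** cstar (u n.+2)) = u n.+2 ** ((cstar (u n.+1) ** u n.+1) ** s a **
      (cstar (u n.+1) ** u n.+1)) ** cstar (u n.+2) by cring.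
    by rewrite q1 es se.
  clearbody x1 x2; rewrite /z -/(z n.+1).
  have -> : z n.+1 ** t a - t a ** z n.+1 =
     ((x2 - t a) - z n.+1 ** (x1 - t a) ** cstar (z n.+1)) ** z n.+1.
    rewrite -zx; move: (z n.+1) zz ze => y yy ye.
    have -> : (y ** x1 ** cstar y - t a - y ** (x1 - t a) ** cstar y) ** y =
       y ** t a ** (cstar y ** y) - t a ** y by cring.
    by rewrite yy -cmulA et.
  apply: le_lt_trans (nrm_mul1r _ zn) _; apply: le_lt_trans (nrmB _ _) _.
  have := nrm_conj_le (x1 - t a) zn; lra.
have [r hr] := choice zr.
have [|||U [Uc U0 Uu US]] := @concat_paths R C e r pe.
- by move=> n; have [] := hr n.
- by move=> n; have [] := hr n.
- by move=> n; have [] := hr n.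
have Un n : U n.+1%:R = u n.+1.
  have st m : U m.+1%:R = r m 1 ** U m%:R.
    have e1 : m.+1%:R - m%:R = 1 :> R by rewrite -natr1; ring.
    by have := US m m.+1%:R; rewrite e1; apply; rewrite lexx ler_nat leqnSn.
  elim: n => [|n ih]; rewrite st.
    by have [_ _ -> _ _] := hr 0%N; rewrite U0; have [_ -> _ _] := uu 1%N.
  have [_ _ -> _ _] := hr n.+1; rewrite ih /z -cmulA.
  have [_ _ -> _] := uu n.+1; by have [_ -> _ _] := uu n.+2.
exists U; split=> // c.
apply: (dense_limit_filter (F := fun x c => U x ** s c ** cstar (U x))).
- move=> x a b; rewrite -cmulBl -cmulBr -shB.
  apply: le_trans (nrm_conj_le _ (nrm_unitary pe (Uu x))) _; exact: starHom_nrm.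
- by move=> a b; rewrite -shB; exact: starHom_nrm.
- move=> eps e0; have [k hk] := hd c _ e0; exists (d k) => //.
  apply: cvg_pinfty_nrm => ep ep0.
  have ep2 : 0 < ep / 2 by rewrite divr_gt0.
  have [N hN] := invSn_small ep2.
  exists (N + k).+1%:R => x Nx.
  have x0 : 0 <= x by apply: le_trans Nx; exact: ler0n.
  have nk : ((N + k).+1 <= Num.truncn x)%N by rewrite truncn_ge_nat.
  have xn : (Num.truncn x)%:R <= x <= (Num.truncn x).+1%:R.
    by have /andP[-> /ltW ->] := truncn_itv x0.
  move: (Num.truncn x) nk xn => [//|n] nk xn.
  have dl : d k \in l n.+1.
    by apply: map_f; rewrite mem_iota add0n /= (leq_trans _ nk)// ltnS leq_addl.
  rewrite (US _ _ xn) Un; have [_ _ _ ru rl] := hr n.+1.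
  have en1 : n.+2%:R^-1 < ep / 2 by apply: hN; rewrite (leq_trans _ (leq_trans nk _))// leqW ?leq_addr.
  have q1 : nrm (u n.+1 ** s (d k) ** cstar (u n.+1) - t (d k)) < n.+2%:R^-1.
    apply: lt_le_trans ((proj2 (hu n.+1)) (d k) _) _; first by rewrite mem_cat dl.
    by rewrite ge_min lexx.
  have q2 := rl isT (x - n.+1%:R) _ dl.
  have := ru (x - n.+1%:R); move: (r n.+1 _) q2 => y q2 yu.
  have [ey ye _ yy] := yu; have yn := nrm_unitary pe yu.
  move: q1; set w := u n.+1 ** s (d k) ** _ => q1.
  have -> : y ** u n.+1 ** s (d k) ** cstar (y ** u n.+1) - t (d k) =
     y ** (w - t (d k)) ** cstar y + (y ** t (d k) - t (d k) ** y) ** cstar y.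
    have -> : y ** u n.+1 ** s (d k) ** cstar (y ** u n.+1) = y ** w ** cstar y.
      by rewrite /w cstarM; cring.
    rewrite -{1}[t (d k)]et -yy; clearbody w; cring.
  have yn' : nrm (cstar y) <= 1 by rewrite nrm_star.
  have := nrmD (y ** (w - t (d k)) ** cstar y) ((y ** t (d k) - t (d k) ** y) ** cstar y).
  have := nrm_mul1r (y ** t (d k) - t (d k) ** y) yn'.
  have := nrm_conj_le (w - t (d k)) yn.
  move: (n.+2%:R^-1) en1 q1 q2 => q; lra.
Qed.

End AsymptoticUniqueness.

(** * Matrix units and Cuntz isometries *)

Section OrthonormalBasis.
Context {R : realType} {H : hilbertType R}.
Implicit Types f : seq H.

Lemma hproj_lin f z (x y : H) : hproj f (z *: x + y) = z *: hproj f x + hproj f y.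
Proof.
rewrite /hproj scaler_sumr -big_split; apply: eq_bigr => g _.
by rewrite innerDl innerZl scalerDl scalerA.
Qed.
Lemma hprojB f (x y : H) : hproj f (x - y) = hproj f x - hproj f y.
Proof. by rewrite addrC -scaleN1r hproj_lin scaleN1r addrC. Qed.

Lemma hproj_residual f (x : H) : ons f -> nrm (x - hproj f x) <= nrm x.
Proof.
move=> fo; rewrite -ler_sqr ?nnegrE ?nrm_ge0// -!sqn_nrm.
set r := x - hproj f x.
have or : inner (hproj f x) r = 0.
  rewrite /hproj inner_suml big_seq big1// => g gf.
  by rewrite innerZl inner_residual_r// mulr0.
have xE : x = r + hproj f x by rewrite /r subrK.
have := sqnD (r : hilbertPre H) (hproj f x : hilbertPre H).
have or' : inner r (hproj f x) = 0 by rewrite inner_conj or cj0.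
rewrite /= -xE or' => ->; have := sqn_ge0 (hproj f x : hilbertPre H).
by rewrite /=; lra.
Qed.

Lemma hproj_approx f (x y : H) : ons f -> hproj f y = y -> nrm (x - hproj f x) <= nrm (x - y).
Proof.
move=> fo fy; have := hproj_residual (x - y) fo; rewrite hprojB fy.
by have -> : x - y - (hproj f x - y) = x - hproj f x by zmod.
Qed.

(** Gram-Schmidt along a dense sequence. When d n already lies in the span, a vector outside it is
    adjoined instead, which exists in infinite dimension; so every step produces a new basis
    vector. *)
Lemma orthonormal_basis (xi : H) : separable H -> infinite_dimensional H -> nrm xi = 1 ->
  exists e : nat -> H, [/\ e 0%N = xi,
    forall i j, inner (e i) (e j) = (i == j)%:R &
    forall x (eps : R), 0 < eps -> exists N0, forall N, (N0 <= N)%N ->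
      nrm (x - \sum_(0 <= i < N) inner x (e i) *: e i) < eps].
Proof.
move=> sH infH xi1; have [d hd] := separable_seq sH.
have ext f : exists y, y != hproj f y.
  apply: contrapT => no; apply: infH; exists (size f), (fun i => nth 0 f i) => x.
  exists (fun i => inner x (nth 0 f i)).
  have [xf|xf] := eqVneq x (hproj f x); last by exfalso; apply: no; exists x.
  by rewrite {1}xf /hproj (big_nth 0) big_mkord.
have nx n f : exists y, y != hproj f y /\ (d n != hproj f (d n) -> y = d n).
  have [h|h] := boolP (d n != hproj f (d n)); first by exists (d n).
  by have [y hy] := ext f; exists y.
have [X hX] := choice (fun p : nat * seq H => nx p.1 p.2).
pose S := fix S n := if n is m.+1 then gs_next (S m) (X (m, S m)) else [:: xi].
pose e n := last 0 (S n).
have So n : ons (S n).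
  elim: n => [|n ih]; last by apply: ons_next => //; have [] := hX (n, S n).
  split=> // [g|g g']; rewrite !inE => /eqP->; first by rewrite inner_sqr xi1 expr1n rc1.
  by move=> /eqP->; rewrite eqxx.
have SE n : S n = [seq e i | i <- iota 0 n.+1].
  elim: n => [|n ih] //; rewrite -[in iota _ _]addn1 iotaD map_cat -ih /= /gs_next.
  by rewrite add0n -cats1; congr (_ ++ [:: _]); rewrite /e /= /gs_next last_rcons.
have Sfix n y : hproj (S n) y = y -> hproj (S n.+1) y = y.
  by move=> h; rewrite /= hproj_next// inner_fixed.
have Sd n m : (n < m)%N -> hproj (S m) (d n) = d n.
  elim: m => // m ih; rewrite ltnS leq_eqVlt => /orP[/eqP->|/ih]; last exact: Sfix.
  have [h|h] := eqVneq (d m) (hproj (S m) (d m)); first exact: Sfix.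
  have [_ /(_ h) E] := hX (m, S m); rewrite [X in hproj X]/= E.
  exact: hproj_next_self.
exists e; split=> //.
- move=> i j; wlog ij : i j / (i <= j)%N => [h|].
    have [/h//|/ltnW/h hh] := leqP i j.
    by rewrite inner_conj hh eq_sym; case: (_ == _); rewrite ?cj0// conjC1.
  have [su s1 s0] := So j.
  have iS k : (k <= j)%N -> e k \in S j by move=> kj; rewrite SE map_f// mem_iota.
  have [->|nij] := eqVneq i j; first by rewrite s1 ?iS.
  rewrite s0 ?iS//; apply/eqP => eij; move: nij; apply/negP; rewrite negbK.
  have nthE k : (k <= j)%N -> nth 0 (S j) k = e k.
    by move=> kj; rewrite SE (nth_map 0%N) ?size_iota// nth_iota// add0n.
  by rewrite -(nth_uniq 0 _ _ su) ?nthE ?eij// SE size_map size_iota ltnS.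
- move=> x eps /(hd x)[n xn]; exists n.+2 => -[//|N] nN.
  apply: le_lt_trans xn; have dn : hproj (S N) (d n) = d n by apply: Sd.
  have := hproj_approx x (So N) dn; rewrite {1}/hproj SE big_map.
  by rewrite /index_iota subn0.
Qed.

End OrthonormalBasis.

Section MatrixUnits.
Context {R : realType} {B : cstarAlgType R}.
Variable m : nat -> nat -> B.
Hypothesis mM : forall i j k l, m i j ** m k l = if j == k then m i l else 0.
Hypothesis mS : forall i j, cstar (m i j) = m j i.

Definition munit N : B := \sum_(0 <= i < N) m i i.

Lemma munitS N : munit N.+1 = munit N + m N N.
Proof. by rewrite /munit big_nat_recr. Qed.
Lemma munit_l N i j : munit N ** m i j = if (i < N)%N then m i j else 0.
Proof.
elim: N => [|N ih]; first by rewrite /munit big_nil cmul0l.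
rewrite munitS cmulDl ih mM ltnS (eq_sym N).
by case: (ltngtP i N) => [h|h|->]; rewrite ?addr0 ?add0r.
Qed.
Lemma munit_star N : cstar (munit N) = munit N.
Proof. by rewrite /munit cstar_sum; apply: eq_bigr => i _; rewrite mS. Qed.
Lemma munit_r N i j : m i j ** munit N = if (j < N)%N then m i j else 0.
Proof.
rewrite -[LHS]cstarK cstarM munit_star mS munit_l.
by case: ifP; rewrite ?cstar0// mS.
Qed.
Lemma munitM M N : munit M ** munit N = munit (minn M N).
Proof.
elim: N => [|N ih]; first by rewrite minn0 /munit big_nil cmul0r.
rewrite munitS cmulDr ih munit_l; have [NM|MN] := ltnP N M.
  by rewrite (minn_idPr NM) ?(minn_idPr (ltnW NM)) munitS.
by rewrite addr0 ?(minn_idPl MN) (minn_idPl (leqW MN)).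
Qed.
Lemma munit_projection N : projection (munit N).
Proof. by split; rewrite ?munit_star// munitM minnn. Qed.

End MatrixUnits.

(** * Matrix units in the compact operators *)

Section CompactMatrixUnits.
Context {R : realType} {H : hilbertType R} {K : cstarAlgType R}.
Variable piK : compactOperators K H.

Lemma finite_net (Q : set H) (e : R) : compact Q -> 0 < e ->
  exists s : seq H, forall x, Q x -> exists2 y, y \in s & nrm (x - y) < e.
Proof.
rewrite compact_cover => cQ e0.
have [||F _ QF] := cQ H setT (fun y => [set x | nrm (x - y) < e]).
- by move=> y _; exact: nrm_ball_open.
- by move=> x _; exists x => //=; rewrite subrr nrm0.
by exists (finmap.enum_fset F) => x /QF[y /= yF xy]; exists y.
Qed.

(** The image of the unit ball lies in the image of a compact square under the map sending real and
    imaginary parts of the coefficient to a multiple of v. *)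
Lemma rank_one_compact (v w : H) : exists k : K, forall x, piK k x = inner x w *: v.
Proof.
have [|k kE] := (comp_image piK (fun x => inner x w *: v)).1; last first.
  by exists k => x; rewrite kE.
split; first by move=> z x y; rewrite innerDl innerZl scalerDl scalerA.
pose F (p : R * R) := rc p.1 *: v + rc p.2 *: ('i%C *: v) : H.
pose Mx := nrm w.
have Fc : continuous F.
  move=> p; apply: cvgD; apply: cvg_rcZ; try exact: cvg_cst.
    exact: cvg_fst.
  exact: cvg_snd.
have cF : compact (F @` (`[(- Mx), Mx] `*` `[(- Mx), Mx])).
  apply: continuous_compact; first exact: continuous_subspaceT.
  by apply: compact_setX; exact: segment_compact.
apply: (subclosed_compact _ cF); first exact: closed_closure.
rewrite closureE; apply: smallest_sub; first by apply: compact_closed => //; exact: norm_hausdorff.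
move=> _ [x /= x1 <-]; exists (complex.Re (inner x w), complex.Im (inner x w)) => /=.
  have xn : nrm x <= 1 by have := x1; rewrite -rc1 nrmE le_rc.
  have cs : nrm (inner x w) <= Mx.
    have := cauchy_schwarz (x : hilbertPre H) (w : hilbertPre H).
    rewrite !sqn_nrm -exprMn ler_sqr ?nnegrE ?mulr_ge0 ?nrm_ge0// => /= h.
    by apply: le_trans h _; have := ler_wpM2r (nrm_ge0 w) xn; rewrite mul1r.
  have Mx0 : 0 <= Mx by exact: nrm_ge0.
  have h2 : complex.Re (inner x w) ^+ 2 + complex.Im (inner x w) ^+ 2 <= Mx ^+ 2.
    rewrite -ler_sqr ?nnegrE ?nrm_ge0// in cs; apply: le_trans cs.
    by rewrite /nrm normc_def /= sqr_sqrtr// addr_ge0// sqr_ge0.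
  have hRe : `|complex.Re (inner x w)| <= Mx.
    rewrite -ler_sqr ?nnegrE// real_normK ?num_real//.
    by apply: le_trans h2; rewrite lerDl sqr_ge0.
  have hIm : `|complex.Im (inner x w)| <= Mx.
    rewrite -ler_sqr ?nnegrE// real_normK ?num_real//.
    by apply: le_trans h2; rewrite lerDr sqr_ge0.
  by split; rewrite /= in_itv /= -ler_norml.
rewrite /F /= scalerA -scalerDl; congr (_ *: _).
by rewrite [RHS]complexE mulrC.
Qed.

Lemma compact_operator_net (k : K) (e : R) : 0 < e -> exists s : seq H,
  forall x, nrm x <= 1 -> exists2 y, y \in s & nrm (piK k x - y) < e.
Proof.
move=> e0; have [_ cQ] := (comp_image piK (piK k)).2 (ex_intro _ k erefl).
have [s hs] := finite_net cQ e0; exists s => x x1; apply: hs.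
by apply: subset_closure; exists x => //=; rewrite nrmE -rc1 le_rc.
Qed.

Lemma compact_matrix_units (p : K) : separable H -> infinite_dimensional H ->
  rank_one_projection piK p -> exists E : nat -> nat -> K,
  [/\ E 0%N 0%N = p,
    forall i j k l, E i j ** E k l = if j == k then E i l else 0,
    forall i j, cstar (E i j) = E j i &
    forall k (eps : R), 0 < eps -> exists N0, forall N, (N0 <= N)%N ->
      nrm (k - (\sum_(0 <= i < N) E i i) ** k) < eps].
Proof.
move=> sH infH [xi xi1 pE].
have xin : nrm xi = 1 by rewrite /nrm xi1.
have [e [e0 eo et]] := orthonormal_basis sH infH xin.
have [E hE] := choice (fun ij : nat * nat => rank_one_compact (e ij.1) (e ij.2)).
exists (fun i j => E (i, j)); split.
- by apply: (rep_ext (pi := piK)) => x; rewrite hE pE /= e0.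
- move=> i j k l; apply: (rep_ext (pi := piK)) => x.
  rewrite rep_mul !hE /= innerZl eo eq_sym; case: eqP => _.
    by rewrite mulr1 hE.
  by rewrite mulr0 scale0r; exact/esym/(sr0l (faithful_starRep piK) x).
- move=> i j; apply: (rep_ext (pi := piK)) => x; apply: inner_ext => w.
  by rewrite -rep_star !hE /= innerZl innerZr (inner_conj x (e i)) mulrC.
move=> k eps eps0.
pose P N : K := \sum_(0 <= i < N) E (i, i).
have PE N x : piK (P N) x = \sum_(0 <= i < N) inner x (e i) *: e i.
  have r0 : piK 0 x = 0 := sr0l (faithful_starRep piK) x.
  have rD a b : piK (a + b) x = piK a x + piK b x := srDl (faithful_starRep piK) a b x.
  rewrite /P; elim: N => [|N ih]; first by rewrite !big_nil.
  by rewrite !big_nat_recr//= rD ih hE.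
have rB a b x : piK (a - b) x = piK a x - piK b x := srBl (faithful_starRep piK) a b x.
have rX a x y : piK a (x - y) = piK a x - piK a y.
  by rewrite [x - y]addrC -scaleN1r rep_linear scaleN1r addrC.
have PN1 N x : nrm (piK (P N) x) <= nrm x.
  have PP : projection (P N).
    apply: (munit_projection (m := fun i j => E (i, j))) => [i j k' l|i j].
      apply: (rep_ext (pi := piK)) => y.
      rewrite rep_mul !hE /= innerZl eo eq_sym; case: eqP => _.
        by rewrite mulr1 hE.
      by rewrite mulr0 scale0r; exact/esym/(sr0l (faithful_starRep piK) y).
    apply: (rep_ext (pi := piK)) => y; apply: inner_ext => w.
    by rewrite -rep_star !hE /= innerZl innerZr (inner_conj y (e i)) mulrC.
  have := sqn_rep_le (faithful_starRep piK) (P N) x; rewrite !sqn_nrm -exprMn.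
  rewrite ler_sqr ?nnegrE ?mulr_ge0 ?nrm_ge0// => h; apply: le_trans h _.
  by have := ler_wpM2r (nrm_ge0 x) (nrm_proj PP); rewrite mul1r.
have e4 : 0 < eps / 4 by rewrite divr_gt0.
have [s hs] := compact_operator_net k e4.
have [N0 hN] : exists N0, forall N, (N0 <= N)%N -> forall y, y \in s ->
    nrm (y - piK (P N) y) < eps / 4.
  elim: s {hs} => [|a s [N0 ih]]; first by exists 0%N.
  have [N1 h1] := et a _ e4; exists (maxn N0 N1) => N; rewrite geq_max => /andP[n0 n1] y.
  by rewrite inE => /orP[/eqP->|/ih]; [rewrite PE; exact: h1|exact].
exists N0 => N nN; apply: (@le_lt_trans _ _ (3 / 4 * eps)); last by lra.
apply: (faithful_isometric (p := piK)); first by lra.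
have h1 x : nrm x <= 1 -> nrm (piK (k - P N ** k) x) <= 3 / 4 * eps.
  move=> /hs[y ys xy]; rewrite rB rep_mul; have := hN _ nN y ys.
  have := nrm_tri y (piK k x) (piK (P N) (piK k x)).
  have := nrm_tri (piK (P N) y) y (piK (P N) (piK k x)).
  have := PN1 N (y - piK k x); rewrite rX (nrmBC y (piK k x)); lra.
move=> x; have [->|x0] := eqVneq x 0.
  have -> : piK (k - P N ** k) 0 = 0 by have := rX (k - P N ** k) 0 0; rewrite !subrr.
  by rewrite nrm0 mulr0.
have n0 : nrm x != 0 by apply: contra_neq x0; exact: nrm_eq0.
have n0' : 0 < nrm x by rewrite lt_def n0 nrm_ge0.
have -> : x = rc (nrm x) *: (rc (nrm x)^-1 *: x) by rewrite scalerA -rcM divff// rc1 scale1r.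
have rZ z y : piK (k - P N ** k) (z *: y) = z *: piK (k - P N ** k) y.
  exact: (srZr (faithful_starRep piK)).
rewrite rZ !nrmZ !nrm_rc !ger0_norm ?invr_ge0 ?nrm_ge0// mulVf// mulr1 mulrC.
apply: ler_wpM2r; first exact: nrm_ge0.
by apply: h1; rewrite nrmZ nrm_rc ger0_norm ?invr_ge0 ?nrm_ge0// mulVf.
Qed.

End CompactMatrixUnits.

Lemma cvg_eq_near (I : Type) (G : set_system I) {FG : Filter G} (V : topologicalType) (u v : I -> V) (l : V) :
  v @ G --> l -> (\forall i \near G, u i = v i) -> u @ G --> l.
Proof. by move=> vl uv A /vl h; rewrite /= /nbhs /=; move: uv h; apply: filterS2 => i /= ->. Qed.

(** * Isometries of M(C) given by columns *)

Section Columns.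
Context {R : realType} {D : unitalCstarAlgType R} {C : cstarAlgType R}.
Variables (al : multRep D C) (m : nat -> nat -> C).

(** For C = K (x) A (x) D these are E_ij (x) 1 (x) 1, whose partial units q_N form an approximate
    unit that commutes with 1 (x) 1 (x) D. *)
Record stable_units : Prop := StableUnits {
  su_mul : forall i j k l, m i j ** m k l = if j == k then m i l else 0;
  su_star : forall i j, cstar (m i j) = m j i;
  su_comm : forall d i j, mm al d * ml (m i j) = ml (m i j) * mm al d;
  su_unit : forall c (eps : R), 0 < eps -> exists N0, forall N, (N0 <= N)%N ->
    nrm (c - munit m N ** c) < eps
}.
Hypothesis su : stable_units.
Let mM := su_mul su.
Let mS := su_star su.
Local Notation q := (munit m).

Lemma munit_cvg c : (fun N => q N ** c) @ \oo --> c.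
Proof.
apply/cvg_nrmP => e /(su_unit su c) [N hN]; exists N => // n Nn /=.
by rewrite nrmBC; exact: hN.
Qed.

Lemma stable_ext (X Y : multiplier C) :
  (forall n, X * ml (m n n) = Y * ml (m n n)) -> X = Y.
Proof.
move=> XY; have XYq N : X * ml (q N) = Y * ml (q N).
  elim: N => [|N ih]; first by rewrite /munit big_nil ml0 !mulr0.
  by rewrite munitS mlD !mulrDr ih XY.
apply: mult_ext => c; apply: cstar_mul_inj => w; rewrite !mult_starr.
have l Z : (fun n => cstar (mstar Z w) ** (q n ** c)) @ \oo --> cstar (mstar Z w) ** c.
  by apply: cvg_cmul; [exact: cvg_cst|exact: munit_cvg].
apply: (cvg_eq0 (l X) (l Y)); near=> n.
rewrite -!mult_starr; congr (_ ** _).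
exact: (congr1 (fun Z : multiplier C => Z c) (XYq n)).
Unshelve. all: by end_near.
Qed.

Lemma nrm_coisometry (X : multiplier C) c : mstar X * X = 1 -> nrm (mstar X c) <= nrm c.
Proof.
move=> X1; have h := nrm_isometry (mstar X c) X1.
have e1 : cstar (mstar X c) ** mstar X c = cstar c ** X (mstar X c).
  by rewrite mult_starl mstarK.
have := nrm_starM (mstar X c); rewrite e1 => h2.
have := nrmM (cstar c) (X (mstar X c)); rewrite h2 nrm_star h expr2.
have [->|n0] := eqVneq (nrm (mstar X c)) 0; first by rewrite nrm_ge0.
by rewrite ler_pM2r// lt_def n0 nrm_ge0.
Qed.

Section Column.
Variable f : nat -> C.
Hypothesis fr : forall n, f n ** m n n = f n.
Hypothesis fo : forall n k, cstar (f n) ** f k = if n == k then m n n else 0.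
Hypothesis fl : forall l n, (l < n)%N -> m l l ** f n = 0.

Definition colsum N : C := \sum_(0 <= n < N) f n.

Lemma colsumS N : colsum N.+1 = colsum N + f N. Proof. by rewrite /colsum big_nat_recr. Qed.
Lemma colsum_unit N n : colsum N ** m n n = if (n < N)%N then f n else 0.
Proof.
elim: N => [|N ih]; first by rewrite /colsum big_nil cmul0l.
rewrite colsumS cmulDl ih -(fr N) -cmulA mM ltnS (eq_sym N).
by case: (ltngtP n N) => [h|h|->]; rewrite ?cmul0r ?addr0 ?add0r ?fr.
Qed.
Lemma colsum_munit N L : colsum N ** q L = colsum (minn N L).
Proof.
elim: L => [|L ih]; first by rewrite minn0 /munit /colsum !big_nil cmul0r.
rewrite munitS cmulDr ih colsum_unit; have [h|h] := ltnP L N.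
  by rewrite ?(minn_idPr h) ?(minn_idPr (ltnW h)) colsumS.
by rewrite addr0 ?(minn_idPl h) ?(minn_idPl (leqW h)).
Qed.
Lemma colsum_isometry N : cstar (colsum N) ** colsum N = q N.
Proof.
have h M n : cstar (f n) ** colsum M = if (n < M)%N then m n n else 0.
  elim: M => [|M ih]; first by rewrite /colsum big_nil cmul0r.
  rewrite colsumS cmulDr ih fo ltnS.
  by case: (ltngtP n M) => [h|h|->]; rewrite ?addr0 ?add0r.
suff h2 L : (L <= N)%N -> cstar (colsum L) ** colsum N = q L by exact: h2.
elim: L => [|L ih LN]; first by rewrite /munit /colsum !big_nil cstar0 cmul0l.
by rewrite colsumS cstarD cmulDl h LN ih ?munitS// ltnW.
Qed.
Lemma munit_col L n : (L <= n)%N -> q L ** f n = 0.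
Proof.
elim: L => [|L ih Ln]; first by rewrite /munit big_nil cmul0l.
by rewrite munitS cmulDl ih ?fl ?addr0// ltnW.
Qed.
Lemma munit_colsum N L : (L <= N)%N -> q L ** colsum N = q L ** colsum L.
Proof.
elim: N => [|N ih]; first by rewrite leqn0 => /eqP->.
rewrite leq_eqVlt => /orP[/eqP->//|LN].
by rewrite colsumS cmulDr munit_col// addr0 ih.
Qed.
Lemma nrm_colsum N : nrm (colsum N) <= 1.
Proof.
rewrite -(ler_pXn2r (n := 2)) ?nnegrE ?nrm_ge0// expr1n -nrm_starM colsum_isometry.
exact: nrm_proj (munit_projection mM mS N).
Qed.

(** [fo] makes the partial sums of columns isometric on q_N. By [fl], later columns have no
    component in the first L rows, so q_L times the partial sums stabilises and the adjoints
    converge as well. *)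
Lemma column_isometry : exists X : multiplier C, [/\ mstar X * X = 1,
  forall n, X * ml (m n n) = ml (f n),
  (forall c N, X (q N ** c) = colsum N ** c) &
  (forall c N, mstar X (q N ** c) = cstar (q N ** colsum N) ** c)].
Proof.
have approx c (e : R) : 0 < e -> exists L, nrm (c - q L ** c) < e.
  by move=> /(su_unit su c)[N hN]; exists N; exact: hN.
have cN N := nrm_colsum N.
have st L c N : (L <= N)%N -> colsum N ** (q L ** c) = colsum L ** c.
  by move=> LN; rewrite cmulA colsum_munit (minn_idPr LN).
have st' L c N : (L <= N)%N -> cstar (colsum N) ** (q L ** c) = cstar (q L ** colsum L) ** c.
  move=> LN; rewrite -(munit_colsum LN) cstarM (munit_star mS); cring.
have cv L c : (fun N => colsum N ** (q L ** c)) @ \oo --> colsum L ** c.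
  apply: (cvg_eq_near (v := fun=> colsum L ** c)); first exact: cvg_cst.
  by exists L => // N /= LN; rewrite st.
have cv' L c : (fun N => cstar (colsum N) ** (q L ** c)) @ \oo --> cstar (q L ** colsum L) ** c.
  apply: (cvg_eq_near (v := fun=> cstar (q L ** colsum L) ** c)); first exact: cvg_cst.
  by exists L => // N /= LN; rewrite st'.
have lim c : exists l : C, (fun N => colsum N ** c) @ \oo --> l.
  apply: (dense_limits (F := fun N c => colsum N ** c)) => [N x y|e e0].
    by rewrite -cmulBr; exact: nrm_mul1l.
  by have [L hL] := approx c e e0; exists (q L ** c) => //; exists (colsum L ** c).
have lim' c : exists l : C, (fun N => cstar (colsum N) ** c) @ \oo --> l.
  apply: (dense_limits (F := fun N c => cstar (colsum N) ** c)) => [N x y|e e0].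
    by rewrite -cmulBr; apply: nrm_mul1l; rewrite nrm_star.
  have [L hL] := approx c e e0; exists (q L ** c) => //.
  by exists (cstar (q L ** colsum L) ** c).
have [X hX] := choice lim; have [Y hY] := choice lim'.
have XY x y : cstar (X x) ** y = cstar x ** Y y.
  have l1 : (fun n => cstar (colsum n ** x) ** y) @ \oo --> cstar (X x) ** y.
    by apply: cvg_cmul; [exact: cvg_cstar (hX x)|exact: cvg_cst].
  have l2 : (fun n => cstar x ** (cstar (colsum n) ** y)) @ \oo --> cstar x ** Y y.
    by apply: cvg_cmul; [exact: cvg_cst|exact: hY].
  by apply: (cvg_eq0 l1 l2); near=> n; rewrite cstarM cmulA.
pose Xm := Multiplier XY; exists Xm; split.
- apply: mult_ext => c; apply: cstar_mul_inj => w; rewrite multE -mult_starl.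
  have l1 : (fun n => cstar (colsum n ** w) ** (colsum n ** c)) @ \oo --> cstar (X w) ** X c.
    by apply: cvg_cmul; [exact: cvg_cstar (hX w)|exact: hX].
  have l2 : (fun n => cstar w ** (q n ** c)) @ \oo --> cstar w ** c.
    by apply: cvg_cmul; [exact: cvg_cst|exact: munit_cvg].
  apply: (cvg_eq0 l1 l2); near=> n.
  rewrite cstarM -cmulA (cmulA (cstar _) (colsum _)) colsum_isometry; cring.
- move=> n; apply: mult_ext => c /=.
  apply: (cvg_eq0 (hX (m n n ** c)) (cvg_cst (f n ** c))); near=> N.
  rewrite cmulA colsum_unit; case: ltnP => // h; exfalso.
  have : (n < N)%N by near: N; exists n.+1.
  by rewrite ltnNge h.
- by move=> c N; apply: (cvg_unique (@norm_hausdorff _ _) (hX _) (cv _ _)).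
- by move=> c N; apply: (cvg_unique (@norm_hausdorff _ _) (hY _) (cv' _ _)).
Unshelve. all: by end_near.
Qed.

End Column.

End Columns.

(** * Cuntz isometries and a path of isometries starting at 1 *)

Section CuntzSystem.
Context {R : realType} {D : unitalCstarAlgType R} {C : cstarAlgType R}.
Variables (al : multRep D C) (m : nat -> nat -> C).
Hypothesis su : stable_units al m.
Let mM := su_mul su.
Let mS := su_star su.

(** The two isometries send e_n to e_(2n) and to e_(2n+1). The path [U] from 1 to the second one
    makes conjugation by isometries homotopically trivial, and [cs_shift] provides the swindle. *)
Record cuntz_system (S : cuntzIsometries C) (U : R -> multiplier C) : Prop := CuntzSystem {
  cs_U0 : U 0 = 1;
  cs_U1 : U 1 = iso2 S;
  cs_iso : forall t, mstar (U t) * U t = 1;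
  cs_cont : forall c, continuous (fun t => U t c);
  cs_cont_star : forall c, continuous (fun t => mstar (U t) c);
  cs_comm1 : forall d, mm al d * iso1 S = iso1 S * mm al d;
  cs_comm2 : forall d, mm al d * iso2 S = iso2 S * mm al d;
  cs_unit1 : forall n, iso1 S * ml (m n n) = ml (m n.*2 n);
  cs_unit2 : forall n, iso2 S * ml (m n n) = ml (m n.*2.+1 n);
  cs_shift : forall c, (fun n => (mstar (iso2 S) ^+ n) c) @ \oo --> 0
}.

Lemma odd_neq_double n k : (n.*2 == k.*2.+1) = false.
Proof. by apply/eqP => /(congr1 odd); rewrite /= !odd_double. Qed.

(* At time [t] the vectors [e_n] with [n + 2 <= 1 / t] have not moved yet, those
   with [n + 1 >= 1 / t] are already at [e_(2n+1)], so that the images of the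
   basis vectors stay orthogonal. *)
Definition angle (n : nat) (t : R) : R :=
  pi / 2 * clamp (n.+1%:R * (n.+2%:R * t - 1)).

(** The only possible collision is between e_k, on its way to e_(2k+1), and e_(2k+1) itself. The
    latter has completed its move at time 1/(2k+2), which is not later than the start 1/(k+2) of the
    former. *)
Lemma angle_orthogonal k t : cos (angle k.*2.+1 t) * sin (angle k t) = 0.
Proof.
have k0 := ler0n R k; have [h|h] := leP (k.+2%:R * t) 1.
  have hle : k.+1%:R * (k.+2%:R * t - 1) <= 0.
    by apply: mulr_ge0_le0; rewrite ?subr_le0.
  by rewrite [angle k t]/angle clamp_le0// mulr0 sin0 mulr0.
rewrite {1}/angle clamp_ge1 ?mulr1 ?cos_pihalf ?mul0r//.
have -> : k.*2.+1.+1%:R = 2 * k%:R + 2 :> R by rewrite -!natr1 -muln2 natrM; ring.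
have -> : k.*2.+1.+2%:R = 2 * k%:R + 3 :> R by rewrite -!natr1 -muln2 natrM; ring.
move: h; have -> : k.+2%:R = k%:R + 2 :> R by rewrite -!natr1; ring.
move: (k%:R : R) k0 => x x0 h.
have x2 : 0 < x + 2 by lra.
rewrite -(ler_pM2l x2) mulr1.
have : 0 <= ((x + 2) * t - 1) * ((2 * x + 2) * (2 * x + 3)).
  by rewrite !mulr_ge0//; lra.
nra.
Qed.

Lemma angle0 n : angle n 0 = 0.
Proof. by rewrite /angle clamp_le0 ?mulr0// sub0r mulrN1 oppr_le0. Qed.
Lemma angle1 n : angle n 1 = pi / 2.
Proof.
have n0 := ler0n R n.
rewrite /angle clamp_ge1 ?mulr1// -!natr1; move: (n%:R : R) n0 => x x0; nra.
Qed.
Lemma continuous_angle n : continuous (angle n).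
Proof.
move=> t; apply: cvgM; first exact: cvg_cst.
apply: (continuous_comp (f := fun t : R => n.+1%:R * (n.+2%:R * t - 1))); last first.
  exact: continuous_clamp.
apply: cvgM; first exact: cvg_cst.
apply: cvgB; last exact: cvg_cst.
by apply: cvgM; [exact: cvg_cst|exact: cvg_id].
Qed.

Definition rotcol t n : C :=
  rc (cos (angle n t)) *: m n n + rc (sin (angle n t)) *: m n.*2.+1 n.

Lemma rotcol_unit t n : rotcol t n ** m n n = rotcol t n.
Proof. by rewrite /rotcol cmulDl !cmulZl !mM eqxx. Qed.

Lemma rotcol_orth t n k : cstar (rotcol t n) ** rotcol t k = if n == k then m n n else 0.
Proof.
rewrite /rotcol cstarD !cstarZ !rc_conj !mS cmulDl !cmulDr !cmulZl !cmulZr !mM.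
rewrite eqSS (inj_eq double_inj) !scalerA -!rcM.
have [->|nk] := eqVneq n k.
  have kk : (k < k.*2.+1)%N by rewrite ltnS -addnn leq_addr.
  rewrite (ltn_eqF kk) (gtn_eqF kk).
  by rewrite /= !scaler0 addr0 add0r -scalerDl -rcD -!expr2 cos2Dsin2 rc1 scale1r.
rewrite !scaler0 addr0 add0r.
have -> : (if n == k.*2.+1 then m n k else 0) = (n == k.*2.+1)%:R *: m n k.
  by case: eqP; rewrite ?scale1r ?scale0r.
have -> : (if n.*2.+1 == k then m n k else 0) = (n.*2.+1 == k)%:R *: m n k.
  by case: eqP; rewrite ?scale1r ?scale0r.
have h1 : rc (cos (angle n t) * sin (angle k t)) *: ((n == k.*2.+1)%:R *: m n k) = 0.
  case: eqP => [->|_]; last by rewrite scale0r scaler0.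
  by rewrite angle_orthogonal rc0 scale0r.
have h2 : rc (sin (angle n t) * cos (angle k t)) *: ((n.*2.+1 == k)%:R *: m n k) = 0.
  case: eqP => [<-|_]; last by rewrite scale0r scaler0.
  by rewrite mulrC angle_orthogonal rc0 scale0r.
by rewrite h1 h2 addr0.
Qed.

Lemma rotcol_upper t l n : (l < n)%N -> m l l ** rotcol t n = 0.
Proof.
move=> ln; rewrite /rotcol cmulDr !cmulZr !mM (ltn_eqF ln).
rewrite (_ : (l == n.*2.+1) = false) ?scaler0 ?addr0//.
by apply/negbTE; rewrite neq_ltn (leq_trans ln)// -addnn leqW// leq_addr.
Qed.

Lemma rotation_path : exists U : R -> multiplier C, [/\ forall t, mstar (U t) * U t = 1,
  forall t n, U t * ml (m n n) = ml (rotcol t n), forall c, continuous (fun t => U t c) &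
  forall c, continuous (fun t => mstar (U t) c)].
Proof.
have h t := column_isometry su (rotcol_unit t) (rotcol_orth t) (rotcol_upper t).
have [U hU] := choice h.
have rcont n : continuous (fun t => rotcol t n).
  apply: cont_add; apply: cont_rcZ; try exact: cont_cst.
    by apply: (cont_comp (@continuous_angle n)); exact: continuous_cos.
  by apply: (cont_comp (@continuous_angle n)); exact: continuous_sin.
have ccont N : continuous (fun t => colsum (rotcol t) N).
  elim: N => [|N ih].
    rewrite (_ : (fun t => _) = (fun=> 0)); first exact: cont_cst.
    by apply/funext => t; rewrite /colsum big_nil.
  rewrite (_ : (fun t => _) = (fun t => colsum (rotcol t) N + rotcol t N)).
    exact: cont_add.
  by apply/funext => t; rewrite colsumS.
have Ui t : mstar (U t) * U t = 1 by have [] := hU t.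
exists U; split=> //; first by move=> t; have [] := hU t.
- move=> c t; apply: (dense_limit_filter (G := nbhs t) (F := fun s c => U s c)) => [s x y|x y|e e0].
  + by rewrite -mult_sub nrm_isometry.
  + by rewrite -mult_sub nrm_isometry.
  + have [N hN] := su_unit su c e0; exists (munit m N ** c); first exact: hN.
    have [_ _ -> _] := hU t.
    rewrite (_ : (fun s => _) = (fun s => colsum (rotcol s) N ** c)).
      have h2 := cont_cmul (ccont N) (@cont_cst _ _ c); exact: (h2 t).
    by apply/funext => s; have [_ _ -> _] := hU s.
- move=> c t; apply: (dense_limit_filter (G := nbhs t) (F := fun s c => mstar (U s) c)) => [s x y|x y|e e0].
  + by rewrite -mult_sub nrm_coisometry.
  + by rewrite -mult_sub nrm_coisometry.
  + have [N hN] := su_unit su c e0; exists (munit m N ** c); first exact: hN.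
    have [_ _ _ ->] := hU t.
    rewrite (_ : (fun s => _) = (fun s => cstar (munit m N ** colsum (rotcol s) N) ** c)).
      have h2 := cont_cmul (cont_cstar (cont_cmul (@cont_cst _ _ (munit m N)) (ccont N)))
        (@cont_cst _ _ c).
      exact: (h2 t).
    by apply/funext => s; have [_ _ _ ->] := hU s.
Qed.

Lemma cuntz_system_exists : exists S U, cuntz_system S U.
Proof.
have [U [Ui Um Uc Uc']] := rotation_path.
pose X2 := U 1.
have X2m n : X2 * ml (m n n) = ml (m n.*2.+1 n).
  by rewrite Um /rotcol angle1 cos_pihalf sin_pihalf rc0 rc1 scale0r scale1r add0r.
have f1 n : m n.*2 n ** m n n = m n.*2 n by rewrite mM eqxx.
have f2 n k : cstar (m n.*2 n) ** m k.*2 k = if n == k then m n n else 0.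
  by rewrite mS mM (inj_eq double_inj); case: eqP => // ->.
have f3 l n : (l < n)%N -> m l l ** m n.*2 n = 0.
  move=> ln; rewrite mM (_ : (l == n.*2) = false)//.
  by apply/negbTE; rewrite neq_ltn (leq_trans ln)// -addnn leq_addr.
have [X1 [X1i X1m _ _]] := column_isometry su f1 f2 f3.
have X2i : mstar X2 * X2 = 1 := Ui 1.
have mlM' i j k l : ml (m i j) * ml (m k l) = if j == k then ml (m i l) else 0 :> multiplier C.
  by rewrite -mlM mM; case: eqP => // _; rewrite ml0.
have act (X : multiplier C) (h : nat -> nat) : mstar X * X = 1 ->
    (forall n, X * ml (m n n) = ml (m (h n) n)) -> forall n, mstar X * ml (m (h n) (h n)) = ml (m n (h n)).
  move=> Xi Xm n; have -> : ml (m (h n) (h n)) = X * ml (m n n) * ml (m n (h n)).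
    by rewrite Xm mlM' eqxx.
  by rewrite !mulrA Xi mul1r mlM' eqxx.
have orth (X : multiplier C) (h : nat -> nat) i : (forall n, X * ml (m n n) = ml (m (h n) n)) ->
    (forall n, i != h n) -> mstar X * ml (m i i) = 0.
  move=> Xm hi; have : ml (m i i) * X = 0.
    apply: (stable_ext su) => n; rewrite -mulrA Xm mlM' mul0r.
    by rewrite (negbTE (hi n)).
  by move=> /(congr1 (@mstar R C)); rewrite mstarM mstar_ml mS mstar0.
have parity i : exists n, i = n.*2 \/ i = n.*2.+1.
  exists i./2; have := odd_double_half i.
  by case: (odd i); rewrite ?add0n ?add1n => <-; [right|left];
    rewrite ?doubleK ?(half_bit_double _ true).
have s2e n : mstar X2 * ml (m n.*2 n.*2) = 0.
  by apply: orth X2m _ => k; rewrite odd_neq_double.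
have s1o n : mstar X1 * ml (m n.*2.+1 n.*2.+1) = 0.
  by apply: orth X1m _ => k; rewrite eq_sym odd_neq_double.
have X12 : X1 * mstar X1 + X2 * mstar X2 = 1.
  apply: (stable_ext su) => i; rewrite mulrDl mul1r -!mulrA.
  have mE (X : multiplier C) (h : nat -> nat) n : (forall n, X * ml (m n n) = ml (m (h n) n)) ->
      X * ml (m n (h n)) = ml (m (h n) (h n)).
    move=> Xm; have -> : ml (m n (h n)) = ml (m n n) * ml (m n (h n)) by rewrite mlM' eqxx.
    by rewrite mulrA Xm mlM' eqxx.
  have [n [->|->]] := parity i.
    by rewrite s2e mulr0 addr0 (act X1 _ X1i X1m) (mE _ _ _ X1m).
  by rewrite s1o mulr0 add0r (act X2 (fun n => n.*2.+1) X2i X2m) (mE _ (fun n => n.*2.+1) _ X2m).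
have ap (X Y : multiplier C) x : X = Y -> X x = Y x by move=> ->.
pose S := @CuntzIsometries R C X1 X2 (fun x => ap _ _ x X1i) (fun x => ap _ _ x X2i)
  (fun x => ap _ _ x X12).
have comm (X : multiplier C) (h : nat -> nat) : (forall n, X * ml (m n n) = ml (m (h n) n)) ->
    forall d, mm al d * X = X * mm al d.
  move=> Xm d; apply: (stable_ext su) => n.
  by rewrite -!mulrA (su_comm su) !mulrA -(mulrA (mm al d)) !Xm (su_comm su).
exists S, U; split=> //.
- apply: (stable_ext su) => n; rewrite Um /rotcol angle0 cos0 sin0 rc0 rc1.
  by rewrite scale0r scale1r addr0 mul1r.
- exact: comm X1m.
- exact: (comm X2 (fun n => n.*2.+1) X2m).
(* The adjoint of the second isometry kills e_l for even l and sends e_(2k+1) to e_k, whose index is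
   strictly smaller; so l + 1 applications kill e_l. *)
- have Z l : forall n, (l < n)%N -> mstar X2 ^+ n * ml (m l l) = 0.
    elim/ltn_ind: l => l ih [//|n] ln; rewrite exprSr -mulrA.
    have [k [lk|lk]] := parity l; rewrite lk; first by rewrite s2e mulr0.
    rewrite (act X2 (fun n => n.*2.+1) X2i X2m).
    have -> : ml (m k k.*2.+1) = ml (m k k) * ml (m k k.*2.+1) by rewrite mlM' eqxx.
    have kl : (k < l)%N by rewrite lk ltnS -addnn leq_addr.
    by rewrite mulrA ih ?mul0r// (leq_trans kl).
  have Zq N n : (N <= n)%N -> mstar X2 ^+ n * ml (munit m N) = 0.
    elim: N => [|N ih] Nn; first by rewrite /munit big_nil ml0 mulr0.
    by rewrite munitS mlD mulrDr ih ?Z ?addr0// ltnW.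
  have nX n c : nrm ((mstar X2 ^+ n) c) <= nrm c.
    elim: n c => [|n ih] c //; rewrite exprS /=.
    by apply: le_trans (nrm_coisometry _ X2i) _; exact: ih.
  move=> c; apply/cvg_nrmP => e e0; have [N hN] := su_unit su c e0.
  exists N => // n /= Nn; rewrite subr0.
  have -> : (mstar X2 ^+ n) c = (mstar X2 ^+ n) (c - munit m N ** c).
    rewrite mult_sub; have /= -> := ap _ _ c (Zq N n Nn); by rewrite subr0.
  by apply: le_lt_trans (nX n _) _; exact: hN.
Qed.

End CuntzSystem.

(** * Homotopies of Cuntz pairs *)

Section Homotopy.
Context {R : realType} {D C : cstarAlgType R}.
Implicit Types x y z : cuntzPair D C.

Lemma cp_ext x y : (forall a c, cp_pos x a c = cp_pos y a c) ->
  (forall a c, cp_neg x a c = cp_neg y a c) -> x = y.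
Proof.
move=> /mrep_ext p /mrep_ext n.
have d : cp_diff x = cp_diff y.
  by apply/funext => a; apply: cmul_ext => c; rewrite -!cp_diffP p n.
case: x y p n d => p n d h [p' n' d' h'] /= pp nn dd.
by subst p' n' d'; congr CuntzPair; exact: Prop_irrelevance.
Qed.

Definition hpath (h : R -> cuntzPair D C) := [/\
  forall a c, continuous (fun t => cp_pos (h t) a c),
  forall a c, continuous (fun t => cp_neg (h t) a c) &
  forall a, continuous (fun t => cp_diff (h t) a)].

Lemma continuous_itv_clamp (V : normedModType (complex R)) (f : R -> V) :
  {within `[0, 1], continuous f} -> continuous (fun t => f (clamp t)).
Proof.
move=> /subspace_continuousP fc t; apply/cvg_nrmP => e e0.
have c01 (s : R) : `[0, 1]%classic (clamp s) by rewrite /= in_itv /= clamp_ge0 clamp_le1.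
have /cvg_nrmP/(_ _ e0) h := fc (clamp t) (c01 t).
have h' := @continuous_clamp R t _ h; near=> s.
by have /(_ (c01 s)) : `[0, 1]%classic (clamp s) -> nrm (f (clamp s) - f (clamp t)) < e by near: s.
Unshelve. all: by end_near.
Qed.

Lemma homotopicP x y : cp_homotopic x y <-> exists h, [/\ h 0 = x, h 1 = y & hpath h].
Proof.
split=> [[h [h0 h1 hp hn hd]]|[h [h0 h1 [hp hn hd]]]].
  exists (fun t => h (clamp t)); split; rewrite ?clamp0 ?clamp1//.
  split=> [a c|a c|a]; [exact: (continuous_itv_clamp (hp a c))|
    exact: (continuous_itv_clamp (hn a c))|exact: (continuous_itv_clamp (hd a))].
by exists h; split=> // [a c|a c|a]; exact: continuous_subspaceT.
Qed.

Lemma homotopic_refl x : cp_homotopic x x.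
Proof. by apply/homotopicP; exists (fun=> x); split=> //; split=> *; exact: cont_cst. Qed.

Lemma continuous_affine (a b : R) : continuous (fun t : R => a * t + b).
Proof.
move=> t; apply: cvgD; last exact: cvg_cst.
by apply: cvgM; [exact: cvg_cst|exact: cvg_id].
Qed.

Lemma homotopic_sym x y : cp_homotopic x y -> cp_homotopic y x.
Proof.
move=> /homotopicP[h [h0 h1 [hp hn hd]]]; apply/homotopicP.
exists (fun t => h (-1 * t + 1)); split.
- by rewrite mulr0 add0r.
- by rewrite mulr1 addNr.
- split=> [a c|a c|a]; [exact: (cont_comp (@continuous_affine (-1) 1) (hp a c))|
    exact: (cont_comp (@continuous_affine (-1) 1) (hn a c))|
    exact: (cont_comp (@continuous_affine (-1) 1) (hd a))].
Qed.

Lemma homotopic_trans y x z : cp_homotopic x y -> cp_homotopic y z -> cp_homotopic x z.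
Proof.
move=> /homotopicP[h [h0 h1 [hp hn hd]]] /homotopicP[k [k0 k1 [kp kn kd]]].
apply/homotopicP.
exists (fun t : R => if t <= 2^-1 then h (clamp (2 * t)) else k (clamp (2 * t - 1))).
have glue (V : normedModType (complex R)) (F : cuntzPair D C -> V) :
    continuous (fun t : R => F (h t)) -> continuous (fun t : R => F (k t)) ->
    continuous (fun t : R => F (if t <= 2^-1 then h (clamp (2 * t)) else k (clamp (2 * t - 1)))).
  move=> hc kc; rewrite (_ : (fun t => _) =
    (fun t : R => F (h (clamp (2 * t + 0))) + F (k (clamp (2 * t + -1))) - F y)).
    apply: cont_sub; last exact: cont_cst.
    apply: cont_add.
      apply: (cont_comp (f := fun t : R => clamp (2 * t + 0)) _ hc).
      exact: (cont_comp (@continuous_affine 2 0) (@continuous_clamp R)).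
    apply: (cont_comp (f := fun t : R => clamp (2 * t + -1)) _ kc).
    exact: (cont_comp (@continuous_affine 2 (-1)) (@continuous_clamp R)).
  apply/funext => t; rewrite addr0; case: leP => ht.
    by rewrite (@clamp_le0 _ (2 * t + -1)) ?k0; [zmod|lra].
  by rewrite (@clamp_ge1 _ (2 * t)) ?h1; [zmod|lra].
split.
- by rewrite invr_ge0 ler0n mulr0 clamp0.
- rewrite ifF; last by apply/negbTE; rewrite -ltNge; lra.
  by rewrite clamp_ge1//; lra.
- split=> [a c|a c|a]; first exact: (glue _ (fun w => cp_pos w a c)).
    exact: (glue _ (fun w => cp_neg w a c)).
  exact: (glue _ (fun w => cp_diff w a)).
Qed.

Lemma continuous_compactify (V : normedModType (complex R)) (f : R -> V) (l : V) :
  continuous f -> f @ +oo --> l ->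
  continuous (fun s : R => if s < 1 then f (s / (1 - s)) else l).
Proof.
move=> fc fl s; have [s1|s1|->] := ltgtP s 1.
- apply: (cvg_eq_near (v := fun s => f (s / (1 - s)))).
    rewrite s1; have h : (fun s : R => s / (1 - s)) @ s --> s / (1 - s); last exact: (cvg_comp _ _ h (fc _)).
    apply: cvgM; first exact: cvg_id.
    apply: cvgV; first by rewrite subr_eq0 eq_sym (lt_eqF s1).
    by apply: cvgB; [exact: cvg_cst|exact: cvg_id].
  by near=> t; rewrite ifT//; near: t; exact: lt_nbhsl.
- apply: (cvg_eq_near (v := fun=> l)); first by rewrite ltNge (ltW s1); exact: cvg_cst.
  near=> t; rewrite ifF//; apply/negbTE; rewrite -leNgt; apply: ltW; near: t.
  exact: lt_nbhsr.
rewrite /continuous_at ltxx; apply/cvg_nrmP => e e0; have /cvg_nrmP/(_ _ e0) [N [_ hN]] := fl.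
have d0 : 0 < (1 + `|N|)^-1 * 2^-1 :> R by rewrite mulr_gt0// invr_gt0; have := normr_ge0 N; lra.
near=> t; case: ifP => [t1|_]; last by rewrite subrr nrm0.
apply: hN; rewrite ltr_pdivlMr ?subr_gt0//.
have td : 1 - (1 + `|N|)^-1 * 2^-1 < t by near: t; apply: lt_nbhsr; lra.
apply: le_lt_trans (_ : `|N| * (1 - t) < _); first by rewrite ler_wpM2r ?ler_norm// subr_ge0 ltW.
have N1 : 0 < 1 + `|N| by have := normr_ge0 N; lra.
have h : (1 + `|N|) * (1 - t) < 2^-1.
  by rewrite -ltr_pdivlMl//; lra.
have := normr_ge0 N; nra.
Unshelve. all: by end_near.
Qed.

(** The half-line is compactified by s |-> s / (1 - s), so that a path with a limit at infinity
    becomes a homotopy. *)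
Lemma homotopic_infty (h : R -> cuntzPair D C) y : hpath h ->
  (forall a c, (fun t => cp_pos (h t) a c) @ +oo --> cp_pos y a c) ->
  (forall a c, (fun t => cp_neg (h t) a c) @ +oo --> cp_neg y a c) ->
  (forall a, (fun t => cp_diff (h t) a) @ +oo --> cp_diff y a) ->
  cp_homotopic (h 0) y.
Proof.
move=> [hp hn hd] yp yn yd; apply/homotopicP.
exists (fun s => if s < 1 then h (s / (1 - s)) else y); split.
- by rewrite ltr01 mul0r.
- by rewrite ltxx.
- split=> [a c|a c|a].
  + rewrite (_ : (fun t => _) = (fun s : R => if s < 1 then cp_pos (h (s / (1 - s))) a c else cp_pos y a c)).
      exact: (continuous_compactify (hp a c)).
    by apply/funext => t; case: ifP.
  + rewrite (_ : (fun t => _) = (fun s : R => if s < 1 then cp_neg (h (s / (1 - s))) a c else cp_neg y a c)).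
      exact: (continuous_compactify (hn a c)).
    by apply/funext => t; case: ifP.
  + rewrite (_ : (fun t => _) = (fun s : R => if s < 1 then cp_diff (h (s / (1 - s))) a else cp_diff y a)).
      exact: (continuous_compactify (hd a)).
    by apply/funext => t; case: ifP.
Qed.

Lemma kk_class_eq x y : cp_homotopic x y -> kk_class x = kk_class y.
Proof.
move=> xy; apply/seteqP; split=> z; rewrite /kk_class /=; apply: homotopic_trans => //.
exact: homotopic_sym.
Qed.

End Homotopy.

(** * Conjugation by isometries *)

Section Conjugation.
Context {R : realType} {D C : cstarAlgType R}.
Implicit Types (x y z : cuntzPair D C) (r : multRep D C).

Record isom := Isom { iso_m :> multiplier C; isomK : mstar iso_m * iso_m = 1 }.

Lemma nrm_isom (V : isom) c : nrm (V c) = nrm c.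
Proof. exact: nrm_isometry (isomK V). Qed.
Lemma mult_at (X Y : multiplier C) c : X = Y -> X c = Y c. Proof. by move->. Qed.

Lemma cp_act_subproof (X : multiplier C) r : (forall a b, mm r a * (mstar X * X) * mm r b = mm r (a ** b)) ->
  [/\ forall x : C, linear (fun a => X (r a (mstar X x))),
   forall a b (x : C), X (r (a ** b) (mstar X x)) = X (r a (mstar X (X (r b (mstar X x))))) &
   forall a (x y : C), cstar (X (r a (mstar X x))) ** y = cstar x ** X (r (cstar a) (mstar X y))].
Proof.
move=> h; split=> [x z a b|a b x|a x y].
- by rewrite mrep_linear mult_linear.
- by congr (X _); exact: esym (mult_at (mstar X x) (h a b)).
- by rewrite mult_starl mrep_star (mult_starl (mstar X)) mstarK.
Qed.

Lemma mrep_conj_subproof (V : isom) r a b : mm r a * (mstar V * V) * mm r b = mm r (a ** b).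
Proof. by rewrite isomK mulr1 mmM. Qed.

Definition mrep_conj (V : isom) r : multRep D C :=
  let: And3 p q s := cp_act_subproof (mrep_conj_subproof V r) in MultRep p q s.

Lemma mrep_conjE V r a (x : C) : mrep_conj V r a x = V (r a (mstar V x)).
Proof. by rewrite /mrep_conj; case: cp_act_subproof. Qed.

Lemma cp_conj_subproof V z a (x : C) :
  mrep_conj V (cp_pos z) a x - mrep_conj V (cp_neg z) a x = mult_conj V (cp_diff z a) ** x.
Proof. by rewrite !mrep_conjE -mult_sub cp_diffP mult_conjE. Qed.

Definition cp_conj V z : cuntzPair D C := CuntzPair (cp_conj_subproof V z).

Lemma cont_strict (V : R -> multiplier C) (x : R -> C) :
  (forall t c, nrm (V t c) <= nrm c) -> (forall c, continuous (fun t => V t c)) ->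
  continuous x -> continuous (fun t => V t (x t)).
Proof.
move=> V1 Vc xc t; apply/cvg_nrmP => e e0; have e2 : 0 < e / 2 by rewrite divr_gt0.
have /cvg_nrmP/(_ _ e2) h1 := Vc (x t) t; have /cvg_nrmP/(_ _ e2) h2 := xc t.
near=> s; have : nrm (V s (x t) - V t (x t)) < e / 2 by near: s.
have : nrm (x s - x t) < e / 2 by near: s.
have := V1 s (x s - x t); rewrite mult_sub.
have := nrm_tri (V s (x t)) (V s (x s)) (V t (x t)); lra.
Unshelve. all: by end_near.
Qed.

Hypothesis rC : representable C.

Lemma cont_mrep r a (x : R -> C) : continuous x -> continuous (fun t => r a (x t)).
Proof.
apply: (cont_lip (P := setT) (k := nrm a)) => // u v _ _.
by rewrite -mrepBr; exact: mrep_nrm.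
Qed.
Lemma cont_isom (V : isom) (x : R -> C) : continuous x -> continuous (fun t => V (x t)).
Proof.
apply: (cont_lip (P := setT) (k := 1)) => // u v _ _.
by rewrite mul1r -mult_sub nrm_isom.
Qed.
Lemma cont_mult_conj (V : R -> isom) (k : R -> C) : (forall c, continuous (fun t => V t c)) ->
  continuous k -> continuous (fun t => mult_conj (V t) (k t)).
Proof.
move=> Vc kc; have V1 t c : nrm (V t c) <= nrm c by rewrite nrm_isom.
by apply: cont_cstar; apply: (cont_strict V1 Vc); apply: cont_cstar; exact: (cont_strict V1 Vc).
Qed.

Lemma hpath_conj (V : R -> isom) z : (forall c, continuous (fun t => V t c)) ->
  (forall c, continuous (fun t => mstar (V t) c)) -> hpath (fun t => cp_conj (V t) z).
Proof.
move=> Vc Vc'; have V1 t c : nrm (V t c) <= nrm c by rewrite nrm_isom.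
have rc' r a c : continuous (fun t => mrep_conj (V t) r a c).
  rewrite (_ : (fun t => _) = (fun t => V t (r a (mstar (V t) c)))).
    apply: (cont_strict V1 Vc); apply: cont_mrep; exact: Vc'.
  by apply/funext => t; rewrite mrep_conjE.
split=> [a c|a c|a]; [exact: rc'|exact: rc'|].
by apply: cont_mult_conj => //; exact: cont_cst.
Qed.

Lemma homotopic_opp x y : cp_homotopic x y -> cp_homotopic (cp_opp x) (cp_opp y).
Proof.
move=> /homotopicP[h [h0 h1 [hp hn hd]]]; apply/homotopicP.
exists (fun t => cp_opp (h t)); split; rewrite ?h0 ?h1//; split=> // a t.
by apply: cvgN; exact: hd.
Qed.

Section Sum.
Variable S : cuntzIsometries C.

Lemma iso1_isometry : mstar (iso1 S) * iso1 S = 1. Proof. by apply: mult_ext; exact: iso1K. Qed.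
Lemma iso2_isometry : mstar (iso2 S) * iso2 S = 1. Proof. by apply: mult_ext; exact: iso2K. Qed.
Definition isom1 := Isom iso1_isometry.
Definition isom2 := Isom iso2_isometry.

Lemma homotopic_add x x' y y' : cp_homotopic x x' -> cp_homotopic y y' ->
  cp_homotopic (cp_add S x y) (cp_add S x' y').
Proof.
move=> /homotopicP[h [h0 h1 [hp hn hd]]] /homotopicP[k [k0 k1 [kp kn kd]]].
apply/homotopicP; exists (fun t => cp_add S (h t) (k t)).
split; rewrite ?h0 ?h1 ?k0 ?k1//; split=> [a c|a c|a].
- exact: (cont_add (cont_isom (V := isom1) (hp a _)) (cont_isom (V := isom2) (kp a _))).
- exact: (cont_add (cont_isom (V := isom1) (hn a _)) (cont_isom (V := isom2) (kn a _))).
- have cc (V : isom) : forall c, continuous (fun _ : R => V c) by move=> c; exact: cont_cst.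
  exact: (cont_add (cont_mult_conj (V := fun=> isom1) (cc isom1) (hd a))
    (cont_mult_conj (V := fun=> isom2) (cc isom2) (kd a))).
Qed.
End Sum.

Lemma isom_mul_subproof (V W : isom) : mstar (iso_m V * iso_m W) * (iso_m V * iso_m W) = 1.
Proof. by rewrite mstarM mulrA -(mulrA _ (mstar V)) isomK mulr1 isomK. Qed.
Definition isom_mul V W := Isom (isom_mul_subproof V W).

Lemma conj_mul V W z : cp_conj (isom_mul V W) z = cp_conj V (cp_conj W z).
Proof. by apply: cp_ext => a c; rewrite /= !mrep_conjE. Qed.

(** The ranges of V and W are orthogonal, so the cross terms vanish and only a^2 + b^2 remains. *)
Lemma rotation_subproof (V W : isom) (a b : R) : mstar V * iso_m W = 0 -> a ^+ 2 + b ^+ 2 = 1 ->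
  mstar (msc (rc a) * iso_m V + msc (rc b) * iso_m W) * (msc (rc a) * iso_m V + msc (rc b) * iso_m W) = 1.
Proof.
move=> VW ab; have WV : mstar W * iso_m V = 0.
  by rewrite -[RHS](@mstar0 R C) -VW mstarM mstarK.
rewrite mstarD !mstarM !mstar_msc !rc_conj -!mscC !mulrDl !mulrDr.
have e (z w : complex R) (X Y : multiplier C) : msc z * X * (msc w * Y) = msc (z * w) * (X * Y).
  by rewrite mscM mulrA -(mulrA _ X) -(mscC w X) !mulrA.
rewrite !e VW WV !isomK !mulr0 addr0 add0r -mulrDl -mscD mulr1 -!rcM -!rcD -!expr2 ab.
by rewrite rc1 msc1.
Qed.

Lemma rotation_path_isom (V W : isom) : mstar V * iso_m W = 0 -> exists T : R -> isom,
  [/\ T 0 = V :> multiplier C, T 1 = W :> multiplier C,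
   forall c, continuous (fun t => T t c) & forall c, continuous (fun t => mstar (T t) c)].
Proof.
move=> VW; pose A (t : R) := pi / 2 * t.
have sq t : cos (A t) ^+ 2 + sin (A t) ^+ 2 = 1 by exact: cos2Dsin2.
pose T t := Isom (rotation_subproof VW (sq t)).
have A0 : A 0 = 0 by rewrite /A mulr0.
have A1 : A 1 = pi / 2 by rewrite /A mulr1.
have Ac : continuous A by move=> t; apply: cvgM; [exact: cvg_cst|exact: cvg_id].
have cc : continuous (fun t => cos (A t)) by apply: (cont_comp Ac); exact: continuous_cos.
have sc : continuous (fun t => sin (A t)) by apply: (cont_comp Ac); exact: continuous_sin.
have TE' t c : mstar (T t) c = rc (cos (A t)) *: mstar V c + rc (sin (A t)) *: mstar W c.
  change (mstar (msc (rc (cos (A t))) * iso_m V + msc (rc (sin (A t))) * iso_m W) c =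
    rc (cos (A t)) *: mstar V c + rc (sin (A t)) *: mstar W c).
  by rewrite mstarD !mstarM !mstar_msc !rc_conj -!mscC.
exists T; split.
- by rewrite /= A0 cos0 sin0 rc1 rc0 msc1 msc0 mul1r mul0r addr0.
- by rewrite /= A1 cos_pihalf sin_pihalf rc1 rc0 msc1 msc0 mul1r mul0r add0r.
- move=> c; rewrite (_ : (fun t => _) = (fun t => rc (cos (A t)) *: V c + rc (sin (A t)) *: W c))//.
  by apply: cont_add; apply: cont_rcZ => //; exact: cont_cst.
- move=> c.
  rewrite (_ : (fun t => _) = (fun t => rc (cos (A t)) *: mstar V c + rc (sin (A t)) *: mstar W c)).
    by apply: cont_add; apply: cont_rcZ => //; exact: cont_cst.
  by apply/funext => t; exact: TE'.
Qed.

Lemma homotopic_rotation (V W : isom) z : mstar V * iso_m W = 0 ->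
  cp_homotopic (cp_conj V z) (cp_conj W z).
Proof.
move=> /rotation_path_isom[T [T0 T1 Tc Tc']].
apply/homotopicP; exists (fun t => cp_conj (T t) z); split.
- by apply: cp_ext => a c; rewrite /= !mrep_conjE T0.
- by apply: cp_ext => a c; rewrite /= !mrep_conjE T1.
- exact: hpath_conj.
Qed.

End Conjugation.

(** * Sums of classes, degenerate pairs and conjugate homomorphisms *)

Section System.
Context {R : realType} {D : unitalCstarAlgType R} {C : cstarAlgType R}.
Local Notation "1D" := (cone D).
Variables (al : multRep D C) (m : nat -> nat -> C).
Variables (S : cuntzIsometries C) (U : R -> multiplier C).
Hypothesis cs : cuntz_system al m S U.
Hypothesis rC : representable C.
Implicit Types (x y z : cuntzPair D C) (r : multRep D C).
Local Notation s1 := (isom1 S).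
Local Notation s2 := (isom2 S).

Lemma iso_orth (S' : cuntzIsometries C) : mstar (iso1 S') * iso2 S' = 0.
Proof. by apply: mult_ext => c; exact: iso12. Qed.
Lemma iso_orth' (S' : cuntzIsometries C) : mstar (iso2 S') * iso1 S' = 0.
Proof. by apply: mult_ext => c; exact: iso21. Qed.

Definition isomU t : isom := Isom (cs_iso cs t).

Lemma homotopic_shift z : cp_homotopic z (cp_conj s2 z).
Proof.
apply/homotopicP; exists (fun t => cp_conj (isomU t) z); split.
- by apply: cp_ext => a c; rewrite /= !mrep_conjE /= (cs_U0 cs).
- by apply: cp_ext => a c; rewrite /= !mrep_conjE /= (cs_U1 cs).
- by apply: (hpath_conj rC) => c; [exact: (cs_cont cs)|exact: (cs_cont_star cs)].
Qed.

(** In terms of the conjugating isometries: 1 ~ s_2 ~ s_1 V ~ s_2 V ~ V. The outer links use the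
    path [U], the inner ones rotations between orthogonal ranges. *)
Lemma homotopic_isom V z : cp_homotopic z (cp_conj V z).
Proof.
apply: homotopic_trans (homotopic_shift z) _.
apply: (homotopic_trans (y := cp_conj (isom_mul s1 V) z)).
  apply: homotopic_sym; apply: (homotopic_rotation rC).
  by rewrite /= mstarM -mulrA iso_orth mulr0.
rewrite conj_mul; apply: (homotopic_trans (y := cp_conj s2 (cp_conj V z))).
  by apply: (homotopic_rotation rC); exact: iso_orth.
by apply: homotopic_sym; exact: homotopic_shift.
Qed.

(** The two sums are conjugate by the isometry W that carries the first pair of Cuntz isometries to
    the second. *)
Lemma cp_add_indep S' x y : cp_homotopic (cp_add S x y) (cp_add S' x y).
Proof.
pose W := iso1 S' * mstar (iso1 S) + iso2 S' * mstar (iso2 S).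
have a1 := iso1_isometry S'; have a2 := iso2_isometry S'.
have WW : mstar W * W = 1.
  rewrite /W mstarD !mstarM !mstarK mulrDl !mulrDr.
  have -> : iso1 S * mstar (iso1 S') * (iso1 S' * mstar (iso1 S)) =
    iso1 S * (mstar (iso1 S') * iso1 S') * mstar (iso1 S) by rewrite !mulrA.
  have -> : iso1 S * mstar (iso1 S') * (iso2 S' * mstar (iso2 S)) =
    iso1 S * (mstar (iso1 S') * iso2 S') * mstar (iso2 S) by rewrite !mulrA.
  have -> : iso2 S * mstar (iso2 S') * (iso1 S' * mstar (iso1 S)) =
    iso2 S * (mstar (iso2 S') * iso1 S') * mstar (iso1 S) by rewrite !mulrA.
  have -> : iso2 S * mstar (iso2 S') * (iso2 S' * mstar (iso2 S)) =
    iso2 S * (mstar (iso2 S') * iso2 S') * mstar (iso2 S) by rewrite !mulrA.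
  rewrite a1 a2 iso_orth iso_orth' !mulr1 !mulr0 !mul0r addr0 add0r.
  by apply: mult_ext => c; exact: (iso_sum S).
have W1 c : W (iso1 S c) = iso1 S' c.
  rewrite /W !multE (iso1K S c : mstar _ _ = _) (iso21 S c : mstar _ _ = _) mult0 addr0.
  by [].
have W2 c : W (iso2 S c) = iso2 S' c.
  rewrite /W !multE (iso2K S c : mstar _ _ = _) (iso12 S c : mstar _ _ = _) mult0 add0r.
  by [].
have W1' c : mstar (iso1 S) (mstar W c) = mstar (iso1 S') c.
  rewrite -!mult_mulE -!mstarM; congr (mstar _ c); apply: mult_ext => d; exact: W1.
have W2' c : mstar (iso2 S) (mstar W c) = mstar (iso2 S') c.
  rewrite -!mult_mulE -!mstarM; congr (mstar _ c); apply: mult_ext => d; exact: W2.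
have -> : cp_add S' x y = cp_conj (Isom WW) (cp_add S x y).
  have e r r' a c : mrep_add S' r r' a c = mrep_conj (Isom WW) (mrep_add S r r') a c.
    rewrite mrep_conjE; change (mrep_add_fun S' r r' a c =
      W (iso1 S (r a (mstar (iso1 S) (mstar W c))) + iso2 S (r' a (mstar (iso2 S) (mstar W c))))).
    by rewrite mult_add W1 W2 W1' W2'.
  by apply: cp_ext => a c; exact: e.
exact: homotopic_isom.
Qed.

Lemma kk_add_class x y : kk_add (kk_class x) (kk_class y) = kk_class (cp_add S x y).
Proof.
apply/seteqP; split=> z.
  move=> [S' [x' [y' [xx yy h]]]]; apply: homotopic_trans h.
  apply: (homotopic_trans (y := cp_add S x' y')); last exact: cp_add_indep.
  exact: homotopic_add.
by move=> h; exists S, x, y; split=> //; exact: homotopic_refl.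
Qed.

Lemma kk_opp_class x : kk_opp (kk_class x) = kk_class (cp_opp x).
Proof.
apply/seteqP; split=> z.
  by move=> [x' xx h]; apply: homotopic_trans h; exact: homotopic_opp.
by move=> h; exists x => //; exact: homotopic_refl.
Qed.

Lemma cp_deg_subproof r a (c : C) : r a c - r a c = 0 ** c.
Proof. by rewrite subrr cmul0l. Qed.
Definition cp_deg r : cuntzPair D C := CuntzPair (cp_diff := fun=> 0) (cp_deg_subproof r).

Lemma mstarX (X : multiplier C) n : mstar (X ^+ n) = mstar X ^+ n.
Proof. by elim: n => [|n ih]; rewrite ?expr0 ?mstar1// exprS mstarM ih exprSr. Qed.

(** Copies of the path [U] are multiplied on the right, so that the path is s_2^n at time n. Its
    adjoint tends to 0 strictly by [cs_shift]; conjugating a degenerate pair along it ends at 0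
    while the difference stays 0. *)
Lemma swindle_path : exists W : R -> isom, [/\ W 0 = 1 :> multiplier C,
  forall c, continuous (fun t => W t c), forall c, continuous (fun t => mstar (W t) c) &
  forall c, (fun t => mstar (W t) c) @ +oo --> 0].
Proof.
pose F (n : nat) (s : R) (X : multiplier C) := X * U (clamp s).
pose Q (X : multiplier C) := mstar X * X = 1.
have Q0 : Q 1 by rewrite /Q mstar1 mulr1.
have QF n s X : Q X -> Q (F n s X).
  by rewrite /Q /F => h; rewrite mstarM mulrA -(mulrA _ (mstar X)) h mulr1 (cs_iso cs).
have F0 n s X : Q X -> s <= 0 -> F n s X = X.
  by move=> _ s0; rewrite /F clamp_le0// (cs_U0 cs) mulr1.
have F1 n s X : 1 <= s -> F n s X = F n 1 X.
  by move=> s0; rewrite /F clamp_ge1// clamp1.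
pose W t : isom := Isom (infprod_inv Q0 QF t).
have U1 t c : nrm (U t c) <= nrm c by rewrite (nrm_isometry _ (cs_iso cs t)).
have U1' t c : nrm (mstar (U t) c) <= nrm c by exact: nrm_coisometry (cs_iso cs t).
have sh n : continuous (fun t : R => clamp (t - n%:R)).
  exact: (cont_comp (@continuous_shift R n%:R) (@continuous_clamp R)).
have cont1 n (x : R -> C) : continuous x -> continuous (fun t => iterprod F 1 n t (x t)).
  elim: n x => [|n ih] x xc //=; rewrite /F /=.
  apply: (ih (fun t => U (clamp (t - n%:R)) (x t))).
  apply: (cont_strict (V := fun t => U (clamp (t - n%:R)))) => // c.
  exact: (cont_comp (sh n) (cs_cont cs (c := c))).
have cont2 n c : continuous (fun t => mstar (iterprod F 1 n t) c).
  elim: n => [|n ih]; first exact: cont_cst.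
  rewrite (_ : (fun t => _) = (fun t => mstar (U (clamp (t - n%:R))) (mstar (iterprod F 1 n t) c))).
    apply: (cont_strict (V := fun t => mstar (U (clamp (t - n%:R))))) => // c'.
    exact: (cont_comp (sh n) (cs_cont_star cs (c := c'))).
  by [].
have Wn n : W n%:R = iso2 S ^+ n :> multiplier C.
  elim: n => [|n ih]; first by rewrite /= (infprod_le0 Q0 QF F0).
  have h : (n%:R : R) <= (n.+1%:R : R) <= (n.+1%:R : R) by rewrite lexx ler_nat leqnSn.
  rewrite exprSr -ih /= (infprod_step Q0 QF F0 F1 h) /F.
  by rewrite -[n.+1%:R]natr1 addrC addKr clamp1 (cs_U1 cs).
exists W; split.
- by rewrite /= (infprod_le0 Q0 QF F0).
- move=> c; apply: (infprod_continuous Q0 QF F0 (h := fun X => X c)) => n.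
  exact: (cont1 n (fun=> c) (@cont_cst _ _ c)).
- by move=> c; apply: (infprod_continuous Q0 QF F0 (h := fun X => mstar X c)).
- move=> c; apply: cvg_pinfty_nrm => e e0.
  have /cvg_nrmP/(_ _ e0) [N _ hN] := @cs_shift _ _ _ _ _ _ _ cs c.
  exists N%:R => t Nt; rewrite subr0.
  have t0 : 0 <= t by apply: le_trans Nt; exact: ler0n.
  have nt : (N <= Num.truncn t)%N by rewrite truncn_ge_nat.
  have /andP[h1 h2] := truncn_itv t0.
  have h : (Num.truncn t)%:R <= t <= (Num.truncn t).+1%:R by rewrite h1 ltW.
  have -> : iso_m (W t) = iso_m (W (Num.truncn t)%:R) * U (clamp (t - (Num.truncn t)%:R)).
    by rewrite /= (infprod_step Q0 QF F0 F1 h).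
  rewrite Wn mstarM mult_mulE; apply: le_lt_trans (U1' _ _) _.
  by rewrite mstarX; have := hN _ nt; rewrite /= subr0.
Qed.

Lemma homotopic_deg r : cp_homotopic (cp_deg r) cp_zero.
Proof.
have [W [W0 Wc Wc' Wi]] := swindle_path.
have -> : cp_deg r = cp_conj (W 0) (cp_deg r).
  by apply: cp_ext => a c; rewrite /= mrep_conjE W0.
have lim a c : (fun t => W t (r a (mstar (W t) c))) @ +oo --> (0 : C).
  apply/cvg_nrmP => e e0.
  have d0 : 0 < e / (nrm a + 1) by rewrite divr_gt0//; have := nrm_ge0 a; lra.
  have /cvg_nrmP/(_ _ d0) h := Wi c; near=> t; rewrite subr0 nrm_isom.
  have : nrm (mstar (W t) c - 0) < e / (nrm a + 1) by near: t.
  rewrite subr0 ltr_pdivlMr; last by have := nrm_ge0 a; lra.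
  have := mrep_nrm r a (mstar (W t) c) rC; have := nrm_ge0 (mstar (W t) c).
  have := nrm_ge0 a; nra.
apply: (homotopic_infty (h := fun t => cp_conj (W t) (cp_deg r))).
- exact: (hpath_conj rC).
- move=> a c; rewrite (_ : (fun t => _) = (fun t => W t (r a (mstar (W t) c))))//.
  by apply/funext => t; rewrite /= mrep_conjE.
- move=> a c; rewrite (_ : (fun t => _) = (fun t => W t (r a (mstar (W t) c))))//.
  by apply/funext => t; rewrite /= mrep_conjE.
- move=> a; rewrite (_ : (fun t => _) = (fun=> 0)); first exact: cvg_cst.
  by apply/funext => t; rewrite /= /mult_conj mult0 cstar0 mult0 cstar0.
Unshelve. all: by end_near.
Qed.

Lemma cp_add_zero z : cp_conj s1 z = cp_add S z cp_zero.
Proof.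
have e r a c : mrep_conj s1 r a c = mrep_add S r mrep_zero a c.
  by rewrite mrep_conjE /= /mrep_add_fun mult0 addr0.
by apply: cp_ext => a c; exact: e.
Qed.

Lemma homotopic_add_deg z r : cp_homotopic z (cp_add S z (cp_deg r)).
Proof.
apply: homotopic_trans (homotopic_isom s1 z) _; rewrite cp_add_zero.
apply: homotopic_add; first exact: homotopic_refl.
by apply: homotopic_sym; exact: homotopic_deg.
Qed.

Lemma hom_unit_l (s : starHom D C) a : s 1D ** s a = s a. Proof. by rewrite -sh_mul cmul1l. Qed.
Lemma hom_unit_r (s : starHom D C) a : s a ** s 1D = s a. Proof. by rewrite -sh_mul cmul1r. Qed.

Section Ad.
Variables (w : C) (s : starHom D C).
Hypothesis ws : cstar w ** w = s 1D.
Lemma ad_subproof : [/\ linear (fun a => w ** s a ** cstar w),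
  {morph (fun a => w ** s a ** cstar w) : a b / a ** b} &
  {morph (fun a => w ** s a ** cstar w) : a / cstar a}].
Proof.
split=> [z a b|a b|a] /=.
- by rewrite sh_linear cmulDr cmulDl cmulZr cmulZl.
- have -> : w ** s a ** cstar w ** (w ** s b ** cstar w) =
    w ** (s a ** (cstar w ** w) ** s b) ** cstar w by cring.
  by rewrite ws hom_unit_r sh_mul.
- by rewrite !cstarM cstarK sh_star cmulA.
Qed.
Definition ad_hom : starHom D C := let: And3 p q t := ad_subproof in StarHom p q t.
Lemma ad_homE a : ad_hom a = w ** s a ** cstar w.
Proof. by rewrite /ad_hom; case: ad_subproof. Qed.
End Ad.

(** A partial isometry need not be joined to its source inside [C]. In two orthogonal copies it is:
    T t rotates s_1 (s 1) into s_2 w and keeps T^* T = s 1. *)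
Lemma homotopic_ad (w : C) (s : starHom D C) (ws : cstar w ** w = s 1D) :
  cp_homotopic (cp_hom s) (cp_hom (ad_hom ws)).
Proof.
pose A (t : R) := pi / 2 * t.
pose T t : C := rc (cos (A t)) *: iso1 S (s 1D) + rc (sin (A t)) *: iso2 S w.
have [es ee] := sh_projection s (projection_one D).
have st (X Y : multiplier C) u v : cstar (X u) ** Y v = cstar u ** (mstar X * Y) v.
  by rewrite mult_starl.
have TT t : cstar (T t) ** T t = s 1D.
  rewrite /T cstarD !cstarZ !rc_conj cmulDl !cmulDr !cmulZl !cmulZr !st.
  rewrite iso1_isometry iso2_isometry iso_orth iso_orth' !multE !cmul0r !scaler0 addr0 add0r.
  by rewrite es ee ws !scalerA -!rcM -scalerDl -rcD -!expr2 cos2Dsin2 rc1 scale1r.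
have Ac : continuous A by move=> t; apply: cvgM; [exact: cvg_cst|exact: cvg_id].
have Tc : continuous T.
  apply: cont_add; apply: cont_rcZ; try exact: cont_cst.
    by apply: (cont_comp Ac); exact: continuous_cos.
  by apply: (cont_comp Ac); exact: continuous_sin.
have T0 : T 0 = iso1 S (s 1D) by rewrite /T /A mulr0 cos0 sin0 rc1 rc0 scale1r scale0r addr0.
have T1 : T 1 = iso2 S w by rewrite /T /A mulr1 cos_pihalf sin_pihalf rc1 rc0 scale1r scale0r add0r.
have Xw (X : multiplier C) v a c : X v ** s a ** cstar (X v) ** c = X (v ** s a ** cstar v ** mstar X c).
  by rewrite -cmulA mult_starl -!mult_mul !cmulA.
apply: homotopic_trans (homotopic_isom s1 _) _.
apply: homotopic_trans (homotopic_sym (homotopic_isom s2 _)).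
apply/homotopicP; exists (fun t => cp_hom (ad_hom (TT t))); split.
- apply: cp_ext => a c; rewrite /= ?mrep_conjE /= ?mult0// ad_homE T0 Xw.
  by rewrite es hom_unit_l hom_unit_r.
- apply: cp_ext => a c; rewrite /= ?mrep_conjE /= ?mult0// !ad_homE T1 Xw//.
- split=> [a c|a c|a] /=; last 2 first.
  + exact: cont_cst.
  + rewrite (_ : (fun t => _) = (fun t => T t ** s a ** cstar (T t))).
      apply: cont_cmul; last exact: cont_cstar.
      by apply: cont_cmul => //; exact: cont_cst.
    by apply/funext => t; rewrite ad_homE.
  rewrite (_ : (fun t => _) = (fun t => T t ** s a ** cstar (T t) ** c)).
    apply: cont_cmul; last exact: cont_cst.
    apply: cont_cmul; last exact: cont_cstar.
    by apply: cont_cmul => //; exact: cont_cst.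
  by apply/funext => t; rewrite ad_homE.
Qed.

Variables gam bet : starHom D D.
Hypothesis sp : ssa_pair gam bet.
Hypothesis sD : separable D.
Variable (J : set (D -> C)).
Hypothesis ab : absorbing al J.

Lemma homotopic_same_unit (s t : starHom D C) : s 1D = t 1D ->
  cp_homotopic (cp_hom s) (cp_hom t).
Proof.
move=> st; have ps := sh_projection s (projection_one D).
have [u [uc u0 uu ul]] := asymptotic_uniqueness sp sD ab ps erefl (esym st).
have us (x : R) : cstar (u x) ** u x = s 1D by have [] := uu x.
have -> : cp_hom s = cp_hom (ad_hom (us 0)).
  apply: cp_ext => // a c; rewrite /= ad_homE u0 (proj1 ps).
  by rewrite hom_unit_l hom_unit_r.
have adc a : continuous (fun x : R => ad_hom (us x) a).
  rewrite (_ : (fun x : R => _) = (fun x : R => u x ** s a ** cstar (u x))).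
    apply: cont_cmul; last exact: cont_cstar.
    by apply: cont_cmul => //; exact: cont_cst.
  by apply/funext => x; rewrite ad_homE.
have adl a : (fun x : R => ad_hom (us x) a) @ +oo --> t a.
  rewrite (_ : (fun x : R => _) = (fun x : R => u x ** s a ** cstar (u x)))//.
  by apply/funext => x; rewrite ad_homE.
apply: (homotopic_infty (h := fun x : R => cp_hom (ad_hom (us x)))).
- split=> [a c|a c|a] /=; [|exact: cont_cst|exact: adc].
  by apply: cont_cmul; [exact: adc|exact: cont_cst].
- by move=> a c /=; apply: cvg_cmul; [exact: adl|exact: cvg_cst].
- by move=> a c /=; exact: cvg_cst.
- exact: adl.
Qed.

Lemma homotopic_equiv_unit (s t : starHom D C) (w : C) :
  cstar w ** w = s 1D -> w ** cstar w = t 1D -> cp_homotopic (cp_hom s) (cp_hom t).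
Proof.
move=> ws wt; apply: homotopic_trans (homotopic_ad ws) _; apply: homotopic_same_unit.
have [_ tt] := sh_projection t (projection_one D).
by rewrite ad_homE -ws -tt -wt; cring.
Qed.

End System.

(** * Pairs of projections *)

Section Sign.
Context {R : realType} {C : cstarAlgType R}.
Local Notation M := (multiplier C).

Lemma double_inj (x y : M) : x + x = y + y -> x = y.
Proof.
move=> xy; apply: mult_ext => c; rewrite -[x c]hf_add -[y c]hf_add.
by rewrite -!mult_addE xy.
Qed.

Lemma nrm_mproj (P : M) y : mstar P = P -> P * P = P -> nrm (P y) <= nrm y.
Proof.
move=> PS PP; have e1 : cstar (P y) ** P y = cstar y ** P y.
  by rewrite mult_starl PS -mult_mulE PP.
have := nrm_starM (P y); rewrite e1 => h2.
have := nrmM (cstar y) (P y); rewrite h2 nrm_star expr2.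
have [->|n0] := eqVneq (nrm (P y)) 0; first by rewrite nrm_ge0.
by rewrite ler_pM2r// lt_def n0 nrm_ge0.
Qed.

Lemma ml_act (X : M) y : ml (X y) = X * ml y.
Proof. by apply: mult_ext => c; rewrite /= mult_mul. Qed.

Lemma sgn_comm (X G : M) : X * G = G * X -> (1 + G) * (X + X - 1) = (X + X - 1) * (1 + G).
Proof.
move=> XG; have -> : (1 + G) * (X + X - 1) = (X + X - 1) + (G * X + G * X - G) by ncr.
by rewrite -XG; ncr.
Qed.

(* [P + ml (lift P y)] is the spectral projection of [X = P + ml y] onto
   [[1/2, +oo[]: with [Z = 2 X - 1] and [k = 1 - Z ^ 2], the element [isq k] is
   [(1 - k)^(-1/2) - 1], so that [Z (1 + isq k)] is the sign of [Z]. *)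
Definition defect (P : M) (y : C) : C :=
  let b := y - P y - cstar (P y) - y ** y in (b + b) + (b + b).
Definition lift (P : M) (y : C) : C :=
  let g := isq (defect P y) in y + hf ((P g + y ** g) + (P g + y ** g) - g).

Variable P : M.
Hypothesis PS : mstar P = P.
Hypothesis PP : P * P = P.

Lemma ml_defect y : cstar y = y -> let X := P + ml y in
  ml (defect P y) = (X - X * X) + (X - X * X) + ((X - X * X) + (X - X * X)).
Proof.
move=> ys X; have -> : X - X * X = ml (y - P y - cstar (P y) - y ** y).
  rewrite !mlD !mlN -mstar_ml !ml_act mstarM mstar_ml ys PS mlM /X.
  rewrite mulrDl !mulrDr PP; ncr.
by rewrite /defect !mlD.
Qed.

Lemma nrm_defect y : nrm y <= 64^-1 -> nrm (defect P y) <= 4^-1.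
Proof.
move=> y64; rewrite /defect; set b := y - _ - _ - _.
have Py := nrm_mproj y PS PP; have y0 := nrm_ge0 y.
have h : nrm b <= 4 * nrm y.
  apply: le_trans (nrmB _ _) _; have := nrmB (y - P y) (cstar (P y)).
  have := nrmB y (P y); have := nrmM y y; rewrite nrm_star.
  have : nrm y * nrm y <= 64^-1 * nrm y by apply: ler_wpM2r.
  lra.
apply: le_trans (nrmD _ _) _; have := nrmD b b; lra.
Qed.

Lemma lift_comm y (X : M) : cstar y = y -> nrm y <= 64^-1 -> X * P = P * X ->
  X * ml y = ml y * X -> X * ml (isq (defect P y)) = ml (isq (defect P y)) * X.
Proof.
move=> ys yn XP Xy; apply: mult_ext => c.
apply: (isq_mcomm (m := X)); first exact: nrm_defect.
have h : X * (P + ml y) = (P + ml y) * X by rewrite mulrDl mulrDr XP Xy.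
suff : X * ml (defect P y) = ml (defect P y) * X by move=> k d; exact: (mult_at d k).
rewrite ml_defect //=; set Y := P + ml y in h *; clearbody Y.
have : X * (Y - Y * Y) = (Y - Y * Y) * X by rewrite mulrBr mulrBl mulrA h -!mulrA h.
by move: (Y - Y * Y) => b hb; rewrite !mulrDl !mulrDr hb.
Qed.

Section Lift.
Variable y : C.
Hypothesis ys : cstar y = y.
Hypothesis yn : nrm y <= 64^-1.
Variables (X : M) (g : C).
Hypothesis XE : X = P + ml y.
Hypothesis gE : g = isq (defect P y).

(** In other words 2 T - 1 is the sign of 2 X - 1, where T = P + lift. Self-adjointness, idempotence
    and commutation of T follow after cancelling factors 2. *)
Lemma lift_double : (P + ml (lift P y)) + (P + ml (lift P y)) = 1 + (X + X - 1) * (1 + ml g).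
Proof.
have e : ml (lift P y) + ml (lift P y) = ml y + ml y + (P * ml g + ml y * ml g + (P * ml g + ml y * ml g) - ml g).
  by rewrite -mlD /lift -gE addrACA hfD !(mlD, mlN) !ml_act !mlM.
rewrite addrACA e XE; ncr.
Qed.

Lemma lift_self_comm : X * ml g = ml g * X.
Proof.
have k4 := nrm_defect yn.
rewrite gE; apply: mult_ext => c; apply: (isq_mcomm (m := X)) => // d.
suff : X * ml (defect P y) = ml (defect P y) * X by move=> k; exact: (mult_at d k).
rewrite ml_defect //= -XE; have : X * (X - X * X) = (X - X * X) * X.
  by rewrite mulrBr mulrBl mulrA.
by move: (X - X * X) => b hb; rewrite !mulrDl !mulrDr hb.
Qed.

Lemma lift_star : mstar (P + ml (lift P y)) = P + ml (lift P y).
Proof.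
have Xs : mstar X = X by rewrite XE mstarD PS mstar_ml ys.
have ds : cstar (defect P y) = defect P y.
  apply: ml_inj; rewrite -mstar_ml ml_defect //= -XE.
  have : mstar (X - X * X) = X - X * X by rewrite mstarD mstarN mstarM Xs.
  by move: (X - X * X) => b hb; rewrite !mstarD hb.
have gs : mstar (ml g) = ml g by rewrite mstar_ml gE isq_star// nrm_defect.
apply: double_inj; rewrite -mstarD lift_double mstarD mstarM !mstarD mstarN !mstar1 Xs gs.
by rewrite (sgn_comm lift_self_comm).
Qed.

Lemma lift_idem : (P + ml (lift P y)) * (P + ml (lift P y)) = P + ml (lift P y).
Proof.
have WW : (X + X - 1) * (1 + ml g) * ((X + X - 1) * (1 + ml g)) = 1.
  have := isq_mul (nrm_defect yn); rewrite -gE ml_defect //= -XE => h.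
  rewrite -[RHS]h; have Xg := lift_self_comm; move: (ml g) Xg => G Xg.
  have ZG := sgn_comm Xg.
  transitivity ((1 + G) * ((X + X - 1) * (X + X - 1)) * (1 + G)).
    by rewrite -{1}ZG !mulrA.
  by congr (_ * _ * _); ncr.
have := lift_double; move: (_ * (1 + ml g)) WW (P + _) => W WW T TT.
apply: double_inj; apply: double_inj.
have -> : T * T + T * T + (T * T + T * T) = (T + T) * (T + T) by ncr.
by rewrite TT mulrDl !mulrDr !mul1r !mulr1 WW; ncr.
Qed.

Lemma lift_commute (Y : M) : Y * P = P * Y -> Y * ml y = ml y * Y ->
  Y * (P + ml (lift P y)) = (P + ml (lift P y)) * Y.
Proof.
move=> YP Yy; have Yg : Y * ml g = ml g * Y by rewrite gE; exact: lift_comm.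
have YX : Y * X = X * Y by rewrite XE mulrDl mulrDr YP Yy.
apply: double_inj; rewrite -mulrDr -mulrDl lift_double.
have YZ : Y * (X + X - 1) = (X + X - 1) * Y.
  by rewrite mulrBr mulrBl mulrDr mulrDl YX mulr1 mul1r.
move: (X + X - 1) YZ (ml g) Yg => Z YZ G Yg.
have -> : Y * (1 + Z * (1 + G)) = Y + (Y * Z + Y * Z * G) by ncr.
by rewrite YZ -(mulrA Z Y G) Yg; ncr.
Qed.

(** Where X already agrees with a projection the defect vanishes, hence also its inverse square root
    correction, and taking the sign changes nothing. *)
Lemma lift_cut (p E : M) : p * p = p -> p * X = X * p -> p * X = p * E -> p * E = E * p -> E * E = E ->
  p * (P + ml (lift P y)) = p * E.
Proof.
move=> pp pX pXE pE EE.
have pg : p * ml g = 0.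
  have pk : p * ml (defect P y) = 0.
    rewrite ml_defect //= -XE; have : p * (X - X * X) = 0.
      rewrite mulrBr mulrA pXE -mulrA.
      have -> : E * X = E * X by [].
      rewrite -{1}pp -mulrA; have -> : p * (E * X) = p * E.
        by rewrite mulrA pE -mulrA pXE pE mulrA EE.
      by rewrite mulrA pp subrr.
    by move: (X - X * X) => b hb; rewrite !mulrDr hb !addr0.
  have [_ _ Pr] := isqP (nrm_defect yn).
  rewrite gE; apply: (Pr [set u | p * ml u = 0]).
  - move=> u l us ul; apply: mult_ext => c /=; have h n : p (u n ** c) = 0 by exact: (mult_at c (us n)).
    apply: cstar_mul_inj => w; rewrite mult_starr cmul0r.
    apply: (@cvg_eq0 _ _ _ \oo _ (fun n => cstar (mstar p w) ** (u n ** c)) (fun=> 0)).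
    + apply: cvg_cmul; first exact: cvg_cst.
      by apply: cvg_cmul => //; exact: cvg_cst.
    + exact: cvg_cst.
    + by near=> n; rewrite -mult_starr h cmul0r.
  - by rewrite /= ml0 mulr0.
  - move: (defect P y) pk => k pk u /= pu; rewrite /isqF.
    have hfx (v : C) : p * ml v = 0 -> p * ml (hf v) = 0.
      by move=> pv; apply: double_inj; rewrite -mulrDr -mlD hfD addr0.
    apply: hfx; rewrite !(mlD, mlN, mlM) !(mulrDr, mulrN, mulrA).
    by rewrite pk pu !mul0r !(addr0, oppr0).
apply: double_inj; rewrite -mulrDr lift_double -(sgn_comm lift_self_comm).
have -> : p * (1 + (1 + ml g) * (X + X - 1)) = p * X + p * X + p * ml g * (X + X - 1) by ncr.
by rewrite pg mul0r addr0 pXE.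
Unshelve. all: by end_near.
Qed.

End Lift.

Lemma lift0 : lift P 0 = 0.
Proof.
have d0 : defect P 0 = 0 by rewrite /defect mult0 cstar0 cmul0l !subr0 !addr0.
by rewrite /lift d0 isq0 mult0 cmul0l subr0 !addr0 /hf scaler0 addr0.
Qed.

Lemma lift_continuous (T : topologicalType) (y : T -> C) : continuous y ->
  (forall t, nrm (y t) <= 64^-1) -> continuous (fun t => lift P (y t)).
Proof.
move=> yc y64; have Pc (u : T -> C) : continuous u -> continuous (fun t => P (u t)).
  apply: (cont_lip (P := setT) (k := 1)) => // a b _ _.
  by rewrite mul1r -mult_sub nrm_mproj.
have hfc (u : T -> C) : continuous u -> continuous (fun t => hf (u t)).
  by move=> uc; apply: cont_rcZ => //; exact: cont_cst.
have dc : continuous (fun t => defect P (y t)).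
  have bc : continuous (fun t => y t - P (y t) - cstar (P (y t)) - y t ** y t).
    apply: cont_sub; last exact: cont_cmul.
    apply: cont_sub; last by apply: cont_cstar; exact: Pc.
    by apply: cont_sub => //; exact: Pc.
  by have bb := cont_add bc bc; exact: (cont_add bb bb).
have gc : continuous (fun t => isq (defect P (y t))).
  apply: (cont_lip (P := [set k | nrm k <= 4^-1]) (k := 9)) dc => [a b|t] /=.
    exact: isq_lip.
  exact: nrm_defect.
apply: cont_add => //; apply: hfc; apply: cont_sub => //.
have h : continuous (fun t => P (isq (defect P (y t))) + y t ** isq (defect P (y t))).
  by apply: cont_add; [exact: Pc|exact: cont_cmul].
exact: (cont_add h h).
Qed.

End Sign.

(** * Pairs of projections commuting with a representation *)

Section ProjectionPairs.
Context {R : realType} {D : unitalCstarAlgType R} {C : cstarAlgType R}.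
Local Notation "1D" := (cone D).
Local Notation M := (multiplier C).
Variables (al : multRep D C) (m : nat -> nat -> C).
Hypothesis su : stable_units al m.
Variables (S : cuntzIsometries C) (U : R -> M).
Hypothesis cs : cuntz_system al m S U.
Hypothesis rC : representable C.
Variable g : multRep D C.
Hypothesis g1 : mm g 1D = 1.

Definition cmt (X : M) := forall a, X * mm g a = mm g a * X.

Lemma cmt1 : cmt 1. Proof. by move=> a; rewrite mul1r mulr1. Qed.
Lemma cmtD X Y : cmt X -> cmt Y -> cmt (X + Y).
Proof. by move=> x y a; rewrite mulrDl mulrDr x y. Qed.
Lemma cmtN X : cmt X -> cmt (- X).
Proof. by move=> x a; rewrite mulNr mulrN x. Qed.
Lemma cmtM X Y : cmt X -> cmt Y -> cmt (X * Y).
Proof. by move=> x y a; rewrite -mulrA y mulrA x mulrA. Qed.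
Lemma cmtS X : cmt X -> cmt (mstar X).
Proof.
move=> x a; have := congr1 (@mstar R C) (x (cstar a)).
by rewrite !mstarM !mm_star cstarK => ->.
Qed.

Hypothesis gm : forall i j, cmt (ml (m i j)).
Hypothesis gs1 : cmt (iso1 S).
Hypothesis gs2 : cmt (iso2 S).

Record gproj := GProj { gp :> M; gpS : mstar gp = gp; gpP : gp * gp = gp; gpC : cmt gp }.

Lemma cut_subproof (P : gproj) :
  [/\ forall x : C, linear (fun a => P (g a x)),
   forall a b (x : C), P (g (a ** b) x) = P (g a (P (g b x))) &
   forall a (x y : C), cstar (P (g a x)) ** y = cstar x ** P (g (cstar a) y)].
Proof.
have cg a x : P (g a x) = g a (P x) by exact: mult_at (gpC P a).
split=> [x z a b|a b x|a x y].
- by rewrite mrep_linear mult_linear.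
- by rewrite -cg mrep_mul -[in RHS]mult_mulE gpP.
- by rewrite mult_starl gpS mrep_star cg.
Qed.
Definition cut (P : gproj) : multRep D C :=
  let: And3 p q s := cut_subproof P in MultRep p q s.
Lemma cutE P a x : cut P a x = P (g a x).
Proof. by rewrite /cut; case: cut_subproof. Qed.
Lemma cut_eq (P Q : gproj) : gp P = gp Q -> cut P = cut Q.
Proof. by move=> h; apply: mrep_ext => a x; rewrite !cutE h. Qed.

Lemma ppair_subproof (P Q : gproj) d : gp P - gp Q = ml d -> forall a x,
  cut P a x - cut Q a x = g a d ** x.
Proof.
move=> h a x; have cg (T : gproj) : T (g a x) = g a (T x) by exact: mult_at (gpC T a).
rewrite !cutE !cg -mrepBr -mrepM; congr (g a _).
by rewrite -[d ** x]/(ml d x) -h.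
Qed.
Definition ppair (P Q : gproj) d (h : gp P - gp Q = ml d) : cuntzPair D C :=
  CuntzPair (ppair_subproof h).

Lemma gp_compl_subproof (P : gproj) : [/\ mstar (1 - gp P) = 1 - gp P,
  (1 - gp P) * (1 - gp P) = 1 - gp P & cmt (1 - gp P)].
Proof.
split; first by rewrite mstarD mstarN mstar1 gpS.
  have -> : (1 - gp P) * (1 - gp P) = 1 - gp P - gp P + gp P * gp P by ncr.
  by rewrite gpP; ncr.
by apply: cmtD; [exact: cmt1|apply: cmtN; exact: gpC].
Qed.
Definition gp_compl P : gproj := let: And3 p q s := gp_compl_subproof P in GProj p q s.
Lemma gp_complE P : gp (gp_compl P) = 1 - gp P.
Proof. by rewrite /gp_compl; case: gp_compl_subproof. Qed.

Lemma gp_conj_subproof (V : isom) (P : gproj) : cmt (iso_m V) ->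
  [/\ mstar (iso_m V * gp P * mstar V) = iso_m V * gp P * mstar V,
   iso_m V * gp P * mstar V * (iso_m V * gp P * mstar V) = iso_m V * gp P * mstar V &
   cmt (iso_m V * gp P * mstar V)].
Proof.
move=> cV; split; first by rewrite !mstarM mstarK gpS mulrA.
  have -> : iso_m V * gp P * mstar V * (iso_m V * gp P * mstar V) =
    iso_m V * (gp P * (mstar V * iso_m V) * gp P) * mstar V by rewrite !mulrA.
  by rewrite isomK mulr1 gpP.
by apply: cmtM; [apply: cmtM => //; exact: gpC|exact: cmtS].
Qed.
Definition gp_conj (V : isom) (P : gproj) (cV : cmt (iso_m V)) : gproj :=
  let: And3 p q s := gp_conj_subproof P cV in GProj p q s.
Lemma gp_conjE V P cV : gp (@gp_conj V P cV) = iso_m V * gp P * mstar V.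
Proof. by rewrite /gp_conj; case: gp_conj_subproof. Qed.
Lemma mrep_conj_cut V P cV : mrep_conj V (cut P) = cut (@gp_conj V P cV).
Proof.
apply: mrep_ext => a x; rewrite mrep_conjE !cutE gp_conjE !mult_mulE.
by have -> : mstar V (g a x) = g a (mstar V x) by exact: mult_at (cmtS cV a).
Qed.

Local Notation a := (iso1 S).
Local Notation b := (iso2 S).
Local Notation a' := (mstar (iso1 S)).
Local Notation b' := (mstar (iso2 S)).
Let aa : a' * a = 1 := iso1_isometry S.
Let bb : b' * b = 1 := iso2_isometry S.
Let ab : a' * b = 0 := iso_orth S.
Let ba : b' * a = 0 := iso_orth' S.

Lemma sum_mul (x y z w : M) : (a * x * a' + b * y * b') * (a * z * a' + b * w * b') =
  a * (x * z) * a' + b * (y * w) * b'.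
Proof.
have -> : (a * x * a' + b * y * b') * (a * z * a' + b * w * b') =
  a * (x * (a' * a) * z) * a' + a * x * (a' * b) * w * b' +
  (b * y * (b' * a) * z * a' + b * (y * (b' * b) * w) * b') by ncr.
by rewrite aa bb ab ba !mulr1 !mulr0 !mul0r addr0 add0r.
Qed.

Lemma gp_sum_subproof (P Q : gproj) : let T := a * gp P * a' + b * gp Q * b' in
  [/\ mstar T = T, T * T = T & cmt T].
Proof.
split; first by rewrite mstarD !mstarM !mstarK !gpS !mulrA.
  by rewrite sum_mul !gpP.
apply: cmtD; apply: cmtM; try apply: cmtM => //; try exact: gpC; exact: cmtS.
Qed.
Definition gp_sum (P Q : gproj) : gproj := let: And3 p q s := gp_sum_subproof P Q in GProj p q s.
Lemma gp_sumE P Q : gp (gp_sum P Q) = a * gp P * a' + b * gp Q * b'.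
Proof. by rewrite /gp_sum; case: gp_sum_subproof. Qed.
Lemma mrep_add_cut P Q : mrep_add S (cut P) (cut Q) = cut (gp_sum P Q).
Proof.
apply: mrep_ext => d x; rewrite cutE gp_sumE.
change (a (cut P d (a' x)) + b (cut Q d (b' x)) = a (P (a' (g d x))) + b (Q (b' (g d x)))).
rewrite !cutE.
have -> : a' (g d x) = g d (a' x) by exact: mult_at (cmtS gs1 d).
by have -> : b' (g d x) = g d (b' x) by exact: mult_at (cmtS gs2 d).
Qed.

(** The degenerate pair added is that of 1 - Q. The isometry J = s_1 Q + s_2 (1 - Q) has range Q (+)
    (1 - Q), and Y = s_1 J^* + s_2 (1 - J J^* ) is an isometry with Y J = s_1; so conjugation by Y
    turns this range projection into s_1 s_1^*. *)
Lemma normal_form (P Q : gproj) d (h : gp P - gp Q = ml d) :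
  exists (P' E : gproj) c (h' : gp P' - gp E = ml c), gp E = a * a' /\
    cp_homotopic (ppair h) (ppair h').
Proof.
pose Rm := gp_compl Q; pose q := gp Q; pose r := gp Rm.
have rE : r = 1 - q by exact: gp_complE.
have qq : q * q = q := gpP Q; have rr : r * r = r := gpP Rm.
have qs : mstar q = q := gpS Q; have rs : mstar r = r := gpS Rm.
have qr : q * r = 0 by rewrite rE mulrBr mulr1 qq subrr.
have rq : r * q = 0 by rewrite rE mulrBl mul1r qq subrr.
have cq : cmt q by exact: gpC. have cr : cmt r by exact: gpC.
pose J := a * q + b * r.
have J'E : mstar J = q * a' + r * b' by rewrite mstarD !mstarM qs rs.
have JJ : mstar J * J = 1.
  rewrite J'E; have -> : (q * a' + r * b') * J = q * (a' * a) * q + q * (a' * b) * r +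
    (r * (b' * a) * q + r * (b' * b) * r) by rewrite /J; ncr.
  by rewrite aa ab ba bb !mulr1 !mulr0 !mul0r addr0 add0r qq rr rE addrCA subrr addr0.
have QJ : J * mstar J = a * q * a' + b * r * b'.
  rewrite J'E; have -> : J * (q * a' + r * b') = a * (q * q) * a' + a * (q * r) * b' +
    (b * (r * q) * a' + b * (r * r) * b') by rewrite /J; ncr.
  by rewrite qq qr rq rr !mulr0 !mul0r addr0 add0r.
have cJ : cmt J by apply: cmtD; exact: cmtM.
clearbody J; pose K := 1 - J * mstar J.
have KK : K * K = K.
  have -> : K * K = 1 - J * mstar J - J * mstar J + J * (mstar J * J) * mstar J by rewrite /K; ncr.
  by rewrite JJ mulr1 /K; ncr.
have KJ : K * J = 0.
  have -> : K * J = J - J * (mstar J * J) by rewrite /K; ncr.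
  by rewrite JJ mulr1 subrr.
have Ks : mstar K = K by rewrite mstarD mstarN mstar1 mstarM mstarK.
have KJJ : J * mstar J + K = 1 by rewrite /K; ncr.
have cK : cmt K.
  by apply: cmtD; [exact: cmt1|apply: cmtN; apply: cmtM => //; exact: cmtS].
clearbody K; pose Y := a * mstar J + b * K.
have Y'E : mstar Y = J * a' + K * b' by rewrite mstarD !mstarM mstarK Ks.
have YY : mstar Y * Y = 1.
  rewrite Y'E; have -> : (J * a' + K * b') * Y = J * (a' * a) * mstar J + J * (a' * b) * K +
    (K * (b' * a) * mstar J + K * (b' * b) * K) by rewrite /Y; ncr.
  by rewrite aa ab ba bb !mulr1 !mulr0 !mul0r addr0 add0r KK.
have YJ : Y * J = a.
  have -> : Y * J = a * (mstar J * J) + b * (K * J) by rewrite /Y; ncr.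
  by rewrite JJ KJ mulr1 mulr0 addr0.
have cY : cmt Y.
  by apply: cmtD; apply: cmtM => //; exact: cmtS.
clearbody Y; pose Yi := Isom YY; have cYi : cmt (iso_m Yi) by [].
pose P' := gp_conj (gp_sum P Rm) cYi; pose E := gp_conj (gp_sum Q Rm) cYi.
have EE : gp E = a * a'.
  rewrite gp_conjE gp_sumE -/q -/r -QJ /=.
  by rewrite mulrA YJ -mulrA -mstarM YJ.
have h' : gp P' - gp E = ml (mult_conj (Y * a) d).
  rewrite ml_conj -h !gp_conjE !gp_sumE /= -/q -/r mstarM; ncr.
exists P', E, (mult_conj (Y * a) d), h'; split=> //.
apply: homotopic_trans (homotopic_add_deg cs rC _ (cut Rm)) _.
apply: homotopic_trans (homotopic_isom cs rC Yi _) _.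
rewrite (_ : cp_conj _ _ = ppair h'); first exact: homotopic_refl.
have e T x y : mrep_conj Yi (mrep_add S (cut T) (cut Rm)) x y = cut (gp_conj (gp_sum T Rm) cYi) x y.
  by rewrite mrep_add_cut (mrep_conj_cut _ cYi).
by apply: cp_ext => x y; exact: e.
Qed.

Lemma hpath_ppair (P : R -> gproj) (Q : gproj) (d : R -> C) (h : forall t, gp (P t) - gp Q = ml (d t)) :
  continuous d -> hpath (fun t => ppair (h t)).
Proof.
move=> dc; have gc x : continuous (fun t => g x (d t)) by exact: cont_mrep.
split=> [x c|x c|x] //=; last exact: cont_cst.
rewrite (_ : (fun t => _) = (fun t => cut Q x c + g x (d t) ** c)).
  by apply: cont_add; [exact: cont_cst|apply: cont_cmul => //; exact: cont_cst].
by apply/funext => t; rewrite -(ppair_subproof (h t)); zmod.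
Qed.

Lemma corner_hom_subproof (e : C) (P : gproj) : gp P = ml e ->
  [/\ linear (fun x => g x e), {morph (fun x => g x e) : x y / x ** y} &
   {morph (fun x => g x e) : x / cstar x}].
Proof.
move=> Pe; have lE x : ml (g x e) = mm g x * ml e by exact: ml_act (mm g x) e.
have ce x : ml e * mm g x = mm g x * ml e by rewrite -Pe; exact: gpC.
have ee : ml e * ml e = ml e by rewrite -Pe gpP.
split=> [z x y|x y|x]; first exact: mrep_linear.
  apply: ml_inj; rewrite mlM !lE mmM -!mulrA; congr (_ * _).
  by rewrite mulrA ce -mulrA ee.
apply: ml_inj; rewrite -mstar_ml !lE mstarM mm_star -Pe gpS Pe; exact: esym (ce _).
Qed.
Definition corner_hom (e : C) (P : gproj) (h : gp P = ml e) : starHom D C :=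
  let: And3 p q s := corner_hom_subproof h in StarHom p q s.
Lemma corner_homE e P (h : gp P = ml e) x : corner_hom h x = g x e.
Proof. by rewrite /corner_hom; case: corner_hom_subproof. Qed.
Lemma corner_hom1 e P (h : gp P = ml e) : corner_hom h 1D = e.
Proof. by rewrite corner_homE -mmE g1. Qed.
Lemma mrep_hom_corner e P (h : gp P = ml e) : mrep_hom (corner_hom h) = cut P.
Proof.
apply: mrep_ext => x c; rewrite cutE /= corner_homE -mrepM -[e ** c]/(ml e c) -h.
exact: esym (mult_at c (gpC P x)).
Qed.

(** Both projections lie in [C], so the two components may be moved independently without the
    difference leaving [C]. With s_1 on both sides at first, the second component alone is rotated
    to s_2. *)
Lemma ppair_hom (P Q : gproj) e f d (h : gp P - gp Q = ml d) (he : gp P = ml e) (hf : gp Q = ml f) :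
  cp_homotopic (ppair h) (cp_add S (cp_hom (corner_hom he)) (cp_opp (cp_hom (corner_hom hf)))).
Proof.
apply: homotopic_trans (homotopic_isom cs rC (isom1 S) _) _.
have [T [T0 T1 Tc Tc']] := rotation_path_isom (V := isom1 S) (W := isom2 S) ab.
have dP t x c : mrep_conj (isom1 S) (cut P) x c - mrep_conj (T t) (cut Q) x c =
    (mult_conj a (corner_hom he x) - mult_conj (T t) (corner_hom hf x)) ** c.
  by rewrite cmulBl !mult_conjE -(mrep_hom_corner he) -(mrep_hom_corner hf) !mrep_conjE.
have hp := hpath_conj rC (cp_hom (corner_hom hf)) Tc Tc'; have [hp1 _ hp3] := hp.
apply/homotopicP; exists (fun t => CuntzPair (dP t)); split.
- by apply: cp_ext => x c //=; rewrite !mrep_conjE T0.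
- apply: cp_ext => x c /=; rewrite mrep_conjE.
    by rewrite -(mrep_hom_corner he) /= /mrep_add_fun /= mult0 addr0.
  by rewrite -(mrep_hom_corner hf) T1 /= /mrep_add_fun /= mult0 add0r.
- split=> [x c|x c|x] /=; first exact: cont_cst.
    have := hp1 x c; rewrite /= (mrep_hom_corner hf); apply.
  by apply: cont_sub; [exact: cont_cst|exact: hp3].
Qed.

End ProjectionPairs.

(** * Classes of pairs of projections *)

Section PairClass.
Context {R : realType} {D : unitalCstarAlgType R} {C : cstarAlgType R}.
Local Notation "1D" := (cone D).
Local Notation M := (multiplier C).
Variables (al : multRep D C) (m : nat -> nat -> C).
Hypothesis su : stable_units al m.
Variables (S : cuntzIsometries C) (U : R -> M).
Hypothesis cs : cuntz_system al m S U.
Hypothesis rC : representable C.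
Variables gam bet : starHom D D.
Hypothesis sp : ssa_pair gam bet.
Hypothesis sD : separable D.
Variable (J : set (D -> C)).
Hypothesis ab : absorbing al J.
Variable iota : starHom D C.
Hypothesis iotaE : forall x, ml (iota x) = mm al x * ml (m 0 0).

Local Notation a := (iso1 S).
Local Notation b := (iso2 S).
Local Notation a' := (mstar (iso1 S)).
Local Notation b' := (mstar (iso2 S)).
Local Notation q := (munit m).
Let mM := su_mul su.
Let mS := su_star su.

Lemma munit_comm n d : mm al d * ml (q n) = ml (q n) * mm al d.
Proof.
elim: n => [|n ih]; first by rewrite /munit big_nil ml0 mulr0 mul0r.
by rewrite munitS mlD mulrDr mulrDl ih (su_comm su).
Qed.

Lemma unit_hom_subproof n : [/\ linear (fun x => al x (q n)),
  {morph (fun x => al x (q n)) : x y / x ** y} & {morph (fun x => al x (q n)) : x / cstar x}].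
Proof.
have lE x : ml (al x (q n)) = mm al x * ml (q n) by exact: ml_act (mm al x) _.
have [qs qq] := munit_projection mM mS n.
split=> [z x y|x y|x]; first exact: mrep_linear.
  apply: ml_inj; rewrite mlM !lE mmM -!mulrA; congr (_ * _).
  by rewrite mulrA -munit_comm -mulrA -mlM qq.
apply: ml_inj; rewrite -mstar_ml !lE mstarM mm_star mstar_ml qs; exact: munit_comm.
Qed.
Definition unit_hom n : starHom D C := let: And3 p r s := unit_hom_subproof n in StarHom p r s.
Lemma unit_homE n x : unit_hom n x = al x (q n).
Proof. by rewrite /unit_hom; case: unit_hom_subproof. Qed.
Lemma unit_hom1 n : unit_hom n 1D = q n.
Proof. by rewrite unit_homE (ab_one ab). Qed.

Lemma add_hom_subproof (f h : starHom D C) :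
  let F x := mult_conj a (f x) + mult_conj b (h x) in
  [/\ linear F, {morph F : x y / x ** y} & {morph F : x / cstar x}].
Proof.
have lE x : ml (mult_conj a (f x) + mult_conj b (h x)) = a * ml (f x) * a' + b * ml (h x) * b'.
  by rewrite mlD !ml_conj.
split=> [z x y|x y|x].
- by rewrite !sh_linear !mult_conjD !mult_conjZ scalerDr addrACA.
- by apply: ml_inj; rewrite mlM !lE sum_mul !sh_mul !mlM.
- by rewrite cstarD -!mult_conj_star !sh_star.
Qed.
Definition add_hom f h : starHom D C := let: And3 p r s := add_hom_subproof f h in StarHom p r s.
Lemma add_homE f h x : add_hom f h x = mult_conj a (f x) + mult_conj b (h x).
Proof. by rewrite /add_hom; case: add_hom_subproof. Qed.
Lemma cp_add_hom f h : cp_add S (cp_hom f) (cp_hom h) = cp_hom (add_hom f h).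
Proof.
apply: cp_ext => x c /=; rewrite /mrep_add_fun /= ?mult0 ?addr0//.
by rewrite add_homE cmulDl !mult_conjE.
Qed.

(** The element w sends the copy of m_00 in the first summand to m_nn and the copy of q_n in the
    second to q_n, so it is an equivalence between the unit of the sum and q_(n+1). *)
Lemma homotopic_unit_hom n : cp_homotopic (cp_add S (cp_hom iota) (cp_hom (unit_hom n)))
  (cp_hom (unit_hom n.+1)).
Proof.
rewrite cp_add_hom; pose w := cstar (a (m 0 n)) + cstar (b (q n)).
have wE : ml w = ml (m n 0) * a' + ml (q n) * b'.
  by rewrite /w mlD -!mstar_ml !ml_act !mstarM !mstar_ml mS (munit_star mS).
have wE' : ml (cstar w) = a * ml (m 0 n) + b * ml (q n).
  by rewrite -mstar_ml wE mstarD !mstarM !mstarK !mstar_ml mS (munit_star mS).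
have qq : ml (q n) * ml (q n) = ml (q n) by rewrite -mlM munitM// minnn.
have mq : ml (m 0 n) * ml (q n) = 0 by rewrite -mlM munit_r// ltnn ml0.
have qm : ml (q n) * ml (m n 0) = 0 by rewrite -mlM munit_l// ltnn ml0.
apply: (homotopic_equiv_unit cs rC sp sD ab (w := w)); apply: ml_inj; rewrite mlM wE wE'.
- rewrite add_homE mlD !ml_conj unit_hom1.
  have -> : ml (iota 1D) = ml (m 0 n) * ml (m n 0).
    by rewrite iotaE (mm_one (ab_one ab)) mul1r -mlM mM eqxx.
  have -> : (a * ml (m 0 n) + b * ml (q n)) * (ml (m n 0) * a' + ml (q n) * b') =
    a * (ml (m 0 n) * ml (m n 0)) * a' + a * (ml (m 0 n) * ml (q n)) * b' +
    (b * (ml (q n) * ml (m n 0)) * a' + b * (ml (q n) * ml (q n)) * b') by ncr.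
  by rewrite mq qm qq !mulr0 !mul0r addr0 add0r.
- rewrite unit_hom1 munitS mlD.
  have -> : (ml (m n 0) * a' + ml (q n) * b') * (a * ml (m 0 n) + b * ml (q n)) =
    ml (m n 0) * (a' * a) * ml (m 0 n) + ml (m n 0) * (a' * b) * ml (q n) +
    (ml (q n) * (b' * a) * ml (m 0 n) + ml (q n) * (b' * b) * ml (q n)) by ncr.
  rewrite iso1_isometry iso2_isometry iso_orth iso_orth' !mulr1 !mulr0 !mul0r addr0 add0r qq.
  by rewrite -mlM mM eqxx addrC.
Qed.

Lemma kk_natmul_unit n : kk_natmul n (kk_hom iota) = kk_hom (unit_hom n).
Proof.
elim: n => [|n ih]; rewrite /kk_natmul /=.
  congr kk_class; apply: cp_ext => x c //=.
  by rewrite unit_homE /munit big_nil mrep0r cmul0l.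
rewrite -/(kk_natmul n _) ih /kk_hom (kk_add_class cs rC).
by apply: kk_class_eq; exact: homotopic_unit_hom.
Qed.

Variable g : multRep D C.
Hypothesis g1 : mm g 1D = 1.
Local Notation cmt := (cmt g).
Hypothesis gm : forall i j, cmt (ml (m i j)).
Hypothesis gs1 : cmt a.
Hypothesis gs2 : cmt b.
Local Notation gproj := (gproj g).

Lemma range_unit n : ml (q n.*2) * a = a * ml (q n).
Proof.
apply: (stable_ext su) => k; rewrite -!mulrA (cs_unit1 cs) -!mlM !munit_l// ltn_double.
by case: ifP => _; rewrite ?ml0 ?mulr0// (cs_unit1 cs).
Qed.

Lemma cmt_munit n : cmt (ml (q n)).
Proof.
elim: n => [|n ih]; last by rewrite munitS mlD; exact: cmtD.
by move=> x; rewrite /munit big_nil ml0 mulr0 mul0r.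
Qed.

(** The difference c is deformed to p c p for a large finite projection p, the operator P + y t
    being replaced by its spectral projection. At the end it agrees with E off p, and the common
    part under 1 - p splits off as a degenerate pair. *)
Lemma cut_homotopic (P E : gproj) c (h : gp P - gp E = ml c) : gp E = a * a' ->
  exists (e f : gproj) e0 f0 n d (h' : gp e - gp f = ml d), [/\ gp e = ml e0, gp f = ml f0,
    f0 = mult_conj a (q n) & cp_homotopic (ppair h) (ppair h')].
Proof.
move=> EE.
have cstr : cstar c = c.
  by apply: ml_inj; rewrite -mstar_ml -h mstarD mstarN !gpS.
have e0 : (0 : R) < 128^-1 by rewrite invr_gt0.
(* The even size 2 n is forced by the range of s_1, spanned by the even basis vectors: q_(2n)
   commutes with s_1 s_1^* and cuts it to s_1 q_n s_1^*, equivalent to q_n. *)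
have [N hN] := su_unit su c e0; pose n := N; pose p := q n.*2.
have pp : projection p by exact: munit_projection mM mS _.
have [ps pi] := pp; have pn := nrm_proj pp.
have hc : nrm (c - p ** c) < 128^-1 by apply: hN; rewrite -addnn leq_addr.
(* Cutting on both sides costs twice 1/128, which is the bound 1/64 needed by [lift]. *)
pose y t := rc (clamp t) *: (p ** c ** p - c).
have y1n : nrm (p ** c ** p - c) <= 64^-1.
  have -> : p ** c ** p - c = - (p ** cstar (c - p ** c)) - (c - p ** c).
    by rewrite cstarB cstarM cstr ps; cring.
  apply: le_trans (nrmB _ _) _; rewrite nrmN.
  have := nrm_mul1l (cstar (c - p ** c)) pn; rewrite nrm_star.
  have -> : (64^-1 : R) = 128^-1 + 128^-1 by field.
  by lra.
have ys t : cstar (y t) = y t.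
  by rewrite /y cstarZ rc_conj cstarB !cstarM cstr ps cmulA.
have yn t : nrm (y t) <= 64^-1.
  rewrite /y nrmZ nrm_rc ger0_norm ?clamp_ge0//.
  have := ler_wpM2r (nrm_ge0 (p ** c ** p - c)) (clamp_le1 t); rewrite mul1r; lra.
have yc : continuous y by apply: cont_rcZ; [exact: continuous_clamp|exact: cont_cst].
have cc : cmt (ml c) by rewrite -h; apply: cmtD; [exact: gpC|apply: cmtN; exact: gpC].
have cp : cmt (ml p) by exact: cmt_munit.
have cy t : cmt (ml (y t)).
  move=> x; apply: mult_ext => v; rewrite !multE /= /y !cmulZl mrepZr; congr (_ *: _).
  have hh : cmt (ml (p ** c ** p - c)).
    by rewrite mlD mlN !mlM; apply: cmtD; [apply: cmtM => //; exact: cmtM|exact: cmtN].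
  exact: mult_at v (hh x).
pose T t := GProj (lift_star (gpS P) (gpP P) (ys t) (yn t) erefl erefl)
  (lift_idem (gpS P) (gpP P) (ys t) (yn t) erefl erefl)
  (fun x => esym (lift_commute (gpS P) (gpP P) (ys t) (yn t) erefl erefl (esym (gpC P x)) (esym (cy t x)))).
have dT t : gp (T t) - gp E = ml (c + lift P (y t)) by rewrite mlD -h /=; ncr.
pose T1 := T 1.
have pE : ml p * gp E = gp E * ml p.
  have h1 : ml p * (a * a') = a * ml (q n) * a' by rewrite mulrA range_unit.
  rewrite EE h1; have := congr1 (@mstar R C) h1.
  by rewrite !mstarM !mstarK !mstar_ml ps (munit_star mS) => ->; rewrite mulrA.
have pEE : gp E * ml p = ml (mult_conj a (q n)).
  by rewrite -pE EE ml_conj mulrA range_unit.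
have plp : ml p * ml p = ml p by rewrite -mlM pi.
have XE : gp P + ml (y 1) = gp E + ml p * ml c * ml p.
  rewrite /y clamp1 rc1 scale1r mlD mlN !mlM -h; ncr.
have pX : ml p * (gp P + ml (y 1)) = (gp P + ml (y 1)) * ml p.
  rewrite XE mulrDr mulrDl pE; congr (_ + _).
  by rewrite !mulrA plp -!mulrA plp.
have pT : ml p * gp T1 = gp T1 * ml p.
  have pP : (gp P + ml (y 1)) * ml p = ml p * (gp P + ml (y 1)) by rewrite pX.
  have hX : gp T1 + gp T1 = 1 + (gp P + ml (y 1) + (gp P + ml (y 1)) - 1) *
      (1 + ml (isq (defect P (y 1)))) by exact: lift_double.
  apply: double_inj; rewrite -mulrDr -mulrDl hX.
  have pg : ml p * ml (isq (defect P (y 1))) = ml (isq (defect P (y 1))) * ml p.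
    apply: mult_ext => v; apply: (isq_mcomm (m := ml p)); first exact: (nrm_defect (gpS P) (gpP P) (yn 1)).
    move=> w; suff k : ml p * ml (defect P (y 1)) = ml (defect P (y 1)) * ml p by exact: (mult_at w k).
    rewrite (ml_defect (gpS P) (gpP P) (ys 1)) /=; move: (gp P + ml (y 1)) pX => X pX'.
    have : ml p * (X - X * X) = (X - X * X) * ml p by rewrite mulrBr mulrBl mulrA pX' -!mulrA pX'.
    by move: (X - X * X) => v' hv; rewrite !mulrDl !mulrDr hv.
  move: (gp P + ml (y 1)) pX (ml (isq _)) pg => X pX' G pg.
  have -> : ml p * (1 + (X + X - 1) * (1 + G)) = ml p + (ml p * X + ml p * X - ml p) * (1 + G) by ncr.
  rewrite pX'; have -> : ml p + (X * ml p + X * ml p - ml p) * (1 + G) =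
    ml p + (X + X - 1) * (ml p + ml p * G) by ncr.
  by rewrite pg; ncr.
have cutT : (1 - ml p) * gp T1 = (1 - ml p) * gp E.
  apply: (lift_cut (gpS P) (gpP P) (ys 1) (yn 1) erefl erefl).
  - have -> : (1 - ml p) * (1 - ml p) = 1 - ml p - ml p + ml p * ml p by ncr.
    by rewrite plp; ncr.
  - by rewrite mulrBl mulrBr mul1r mulr1 pX.
  - rewrite XE mulrDr; have -> : (1 - ml p) * (ml p * ml c * ml p) = (ml p - ml p * ml p) * ml c * ml p by ncr.
    by rewrite plp subrr !mul0r addr0.
  - by rewrite mulrBl mulrBr mul1r mulr1 pE.
  - exact: gpP.
have proj_sub (Q : gproj) : ml p * gp Q = gp Q * ml p ->
  [/\ mstar (gp Q * ml p) = gp Q * ml p, gp Q * ml p * (gp Q * ml p) = gp Q * ml p & cmt (gp Q * ml p)].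
  move=> pQ; split; first by rewrite mstarM mstar_ml ps gpS.
    have -> : gp Q * ml p * (gp Q * ml p) = gp Q * (ml p * gp Q) * ml p by ncr.
    by rewrite pQ mulrA gpP -mulrA plp.
  by apply: cmtM => //; exact: gpC.
have proj_compl (Q : gproj) : ml p * gp Q = gp Q * ml p ->
  [/\ mstar ((1 - ml p) * gp Q) = (1 - ml p) * gp Q,
      (1 - ml p) * gp Q * ((1 - ml p) * gp Q) = (1 - ml p) * gp Q & cmt ((1 - ml p) * gp Q)].
  move=> pQ; have pQ' : (1 - ml p) * gp Q = gp Q * (1 - ml p) by rewrite mulrBl mulrBr mul1r mulr1 pQ.
  split; first by rewrite mstarM mstarD mstarN mstar1 mstar_ml ps gpS pQ'.
    have -> : (1 - ml p) * gp Q * ((1 - ml p) * gp Q) = (1 - ml p) * (gp Q * (1 - ml p)) * gp Q by ncr.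
    rewrite -pQ' mulrA; have -> : (1 - ml p) * (1 - ml p) = 1 - ml p - ml p + ml p * ml p by ncr.
    rewrite plp -mulrA gpP; ncr.
  by apply: cmtM; [apply: cmtD; [exact: cmt1|exact: cmtN]|exact: gpC].
have [es ee ec] := proj_sub _ pT; have [fs ff fc] := proj_sub _ (pE).
have [Fs FF Fc] := proj_compl _ pE.
pose e := GProj es ee ec; pose f := GProj fs ff fc; pose F := GProj Fs FF Fc.
have eE : gp e = ml (gp T1 p) by rewrite ml_act.
pose d := gp T1 p - mult_conj a (q n).
have h' : gp e - gp f = ml d by rewrite mlD mlN -eE -pEE.
exists e, f, (gp T1 p), (mult_conj a (q n)), n, d, h'; split=> //.
have st : cp_homotopic (ppair h) (ppair (dT 1)).
  apply/homotopicP; exists (fun t => ppair (dT t)); split=> //.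
    have T0 : gp (T 0) = gp P.
      by rewrite /= /y clamp0 rc0 scale0r lift0 ml0 addr0.
    by apply: cp_ext => x v //=; rewrite !cutE T0.
  apply: (hpath_ppair rC dT); apply: cont_add; first exact: cont_cst.
  exact: (lift_continuous (gpS P) (gpP P) yc yn).
apply: homotopic_trans st _.
(* V separates the part under p from the part under 1 - p. After conjugation the pair is the sum of
   (e, f) and the degenerate pair of F. *)
pose V := a * ml p + b * (1 - ml p).
have VV : mstar V * V = 1.
  have -> : mstar V = ml p * a' + (1 - ml p) * b'.
    by rewrite mstarD !mstarM mstarD mstarN mstar1 mstar_ml ps.
  have -> : (ml p * a' + (1 - ml p) * b') * V = ml p * (a' * a) * ml p + ml p * (a' * b) * (1 - ml p) +
     ((1 - ml p) * (b' * a) * ml p + (1 - ml p) * (b' * b) * (1 - ml p)) by rewrite /V; ncr.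
  rewrite iso1_isometry iso2_isometry iso_orth iso_orth' !mulr1 !mulr0 !mul0r addr0 add0r plp.
  have -> : (1 - ml p) * (1 - ml p) = 1 - ml p - ml p + ml p * ml p by ncr.
  by rewrite plp; ncr.
pose Vi := Isom VV; have cV : cmt (iso_m Vi).
  by apply: cmtD; apply: cmtM => //; apply: cmtD; [exact: cmt1|exact: cmtN].
have Vconj (Q Q1 : gproj) : gp Q1 = gp Q * ml p -> ml p * gp Q = gp Q * ml p ->
    (1 - ml p) * gp Q = gp F -> gp (gp_conj Q cV) = gp (gp_sum gs1 gs2 Q1 F).
  move=> Q1E pQ QF; rewrite gp_conjE gp_sumE -QF Q1E /= /V mstarD !mstarM mstarD mstarN mstar1 mstar_ml ps.
  have -> : (a * ml p + b * (1 - ml p)) * gp Q * (ml p * a' + (1 - ml p) * b') =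
    a * ((ml p * gp Q) * ml p) * a' + a * (ml p * gp Q - (ml p * gp Q) * ml p) * b' +
    (b * (gp Q * ml p - ml p * gp Q * ml p) * a' +
     b * (gp Q - ml p * gp Q - (gp Q * ml p - ml p * gp Q * ml p)) * b') by ncr.
  rewrite pQ -(mulrA (gp Q)) plp subrr !mulr0 !mul0r addr0 add0r; congr (_ + _ * _ * _).
  by rewrite subr0 mulrBl mul1r pQ.
apply: homotopic_trans (homotopic_isom cs rC Vi _) _.
rewrite (_ : cp_conj _ _ = cp_add S (ppair h') (cp_deg (cut F))).
  by apply: homotopic_sym; exact: (homotopic_add_deg cs rC).
have hh (Q Q1 : gproj) x v : gp (gp_conj Q cV) = gp (gp_sum gs1 gs2 Q1 F) ->
    mrep_conj Vi (cut Q) x v = mrep_add S (cut Q1) (cut F) x v.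
  by move=> k; rewrite (mrep_conj_cut _ cV) (mrep_add_cut gs1 gs2) (cut_eq k).
by apply: cp_ext => x v; apply: hh; apply: Vconj.
Qed.

Lemma ppair_class (P Q : gproj) d (h : gp P - gp Q = ml d) :
  exists (phi : starHom D C) n, kk_class (ppair h) = kk_sub (kk_hom phi) (kk_natmul n (kk_hom iota)).
Proof.
have [P' [E [c [h1 [EE k1]]]]] := normal_form cs rC gs1 gs2 h.
have [e [f [e0 [f0 [n [d' [h' [he hf f0E k2]]]]]]]] := cut_homotopic h1 EE.
have k3 := ppair_hom cs rC h' he hf.
exists (corner_hom he), n; rewrite kk_natmul_unit /kk_sub /kk_hom (kk_opp_class) (kk_add_class cs rC).
apply: kk_class_eq; apply: homotopic_trans k1 _; apply: homotopic_trans k2 _.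
apply: homotopic_trans k3 _; apply: homotopic_add; first exact: homotopic_refl.
apply: homotopic_opp; apply: (homotopic_equiv_unit cs rC sp sD ab (w := cstar (a (q n)))).
- rewrite corner_hom1// f0E cstarK; apply: ml_inj; rewrite mlM ml_conj -mstar_ml !ml_act mstarM mstar_ml.
  rewrite (munit_star mS) -!mulrA (mulrA (ml _) (ml _)) -mlM munitM// minnn.
  by [].
- rewrite cstarK unit_hom1; apply: ml_inj; rewrite mlM -mstar_ml !ml_act mstarM mstar_ml (munit_star mS).
  by rewrite mulrA -(mulrA _ a') iso1_isometry mulr1 -mlM munitM// minnn.
Qed.

End PairClass.

(** * Reduction of Cuntz pairs to pairs of projections *)

Section Reduction.
Context {R : realType} {D : unitalCstarAlgType R} {C : cstarAlgType R}.
Local Notation "1D" := (cone D).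
Variables (al : multRep D C) (m : nat -> nat -> C).
Hypothesis su : stable_units al m.
Hypothesis rC : representable C.
Hypothesis al1 : forall x, al 1D x = x.
Variables gam bet : starHom D D.
Hypothesis sp : ssa_pair gam bet.
Variable g : starHom C C.
Hypothesis gcomm : forall d c, mm al (bet d) * ml (g c) = ml (g c) * mm al (bet d).
Variable v : R -> D.
Hypothesis vc : continuous v.
Hypothesis v0 : v 0 = 1D.
Hypothesis vu : forall t, unitaries 1D (v t).
Hypothesis vg : forall c, (fun t => cj al (v t) c) @ +oo --> g c.
Local Notation q := (munit m).
Implicit Type r : multRep D C.

Definition conj_path t : isom := Isom (mm_uniK al1 (vu t)).

Lemma conj_munit t r a N c :
  mrep_conj (conj_path t) r a (q N ** c) = cj al (v t) (r a (q N)) ** c.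
Proof.
rewrite mrep_conjE /cj mult_conjE; congr (_ (_ : C)).
have -> : mstar (conj_path t) (q N ** c) = q N ** mstar (mm al (v t)) c.
  exact: mult_at c (munit_comm su N (cstar (v t))).
by rewrite mrepM.
Qed.

Lemma conj_path_lip t r a x y :
  nrm (mrep_conj (conj_path t) r a x - mrep_conj (conj_path t) r a y) <= nrm a * nrm (x - y).
Proof. by rewrite -mrepBr; exact: mrep_nrm. Qed.

Lemma conj_limit_exists r a : exists F : C -> C,
  (forall x y, nrm (F x - F y) <= nrm a * nrm (x - y)) /\
  (forall N c, F (q N ** c) = g (r a (q N)) ** c).
Proof.
pose P (x y : C) := exists N c, x = q N ** c /\ y = g (r a (q N)) ** c.
have Plim x y : P x y -> (fun t => mrep_conj (conj_path t) r a x) @ +oo --> y.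
  move=> [N [c [-> ->]]].
  rewrite (_ : (fun t => _) = (fun t => cj al (v t) (r a (q N)) ** c)).
    by apply: cvg_cmul; [exact: vg|exact: cvg_cst].
  by apply/funext => t; rewrite conj_munit.
have [||F [F1 F2 _]] := @extend_lipschitz R C C P (nrm a) (nrm_ge0 a).
- move=> x y x' y' /Plim xy /Plim xy'.
  apply: (cvg_nrm_le (u := fun t => mrep_conj (conj_path t) r a x - mrep_conj (conj_path t) r a x')
    (F := +oo)); first exact: cvgB.
  by near=> t; exact: conj_path_lip.
- move=> x e /(su_unit su x)[N hN].
  by exists (q N ** x), (g (r a (q N)) ** x); split; [exists N, x|exact: hN].
by exists F; split=> // N c; apply: F2; exists N, c.
Unshelve. all: by end_near.
Qed.

(* [r'] is the composition of [r] with the strict extension of [g] to M(C). *)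
Lemma conj_limit r : exists r' : multRep D C,
  (forall a c, (fun t => mrep_conj (conj_path t) r a c) @ +oo --> r' a c) /\
  (forall a d, mm al (bet d) * mm r' a = mm r' a * mm al (bet d)).
Proof.
have [F hF] := choice (conj_limit_exists r).
have Flim a c : (fun t => mrep_conj (conj_path t) r a c) @ +oo --> F a c.
  have k0 : 0 < nrm a + 1 by have := nrm_ge0 a; lra.
  (* [dense_limit_filter] is stated for contractions, so both sides are scaled down by |a| + 1 and
     the limit is scaled back. *)
  pose s := (nrm a + 1)^-1; have s0 : 0 < s by rewrite invr_gt0.
  have sn (x y : C) X : nrm X <= nrm a * nrm (x - y) -> nrm (rc s *: X) <= nrm (x - y).
    move=> h; rewrite nrmZ nrm_rc gtr0_norm// mulrC ler_pdivrMr//.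
    apply: le_trans h _; have := nrm_ge0 (x - y); lra.
  have h : (fun t => rc s *: mrep_conj (conj_path t) r a c) @ +oo --> rc s *: F a c.
    apply: (dense_limit_filter (G := +oo) (F := fun t c => rc s *: mrep_conj (conj_path t) r a c)
      (L := fun c => rc s *: F a c)).
    + by move=> t x y; rewrite -scalerBr; apply: sn; exact: conj_path_lip.
    + by move=> x y; rewrite -scalerBr; apply: sn; exact: (proj1 (hF a)).
    + move=> e /(su_unit su c)[N hN]; exists (q N ** c); first exact: hN.
      rewrite (proj2 (hF a)); apply: cvgZr.
      rewrite (_ : (fun t => _) = (fun t => cj al (v t) (r a (q N)) ** c)).
        by apply: cvg_cmul; [exact: vg|exact: cvg_cst].
      by apply/funext => t; rewrite conj_munit.
  have e1 (X : C) : rc (nrm a + 1) *: (rc s *: X) = X.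
    by rewrite scalerA -rcM /s divff ?rc1 ?scale1r// gt_eqF.
  rewrite -[F a c]e1 (_ : (fun t => _) = (fun t => rc (nrm a + 1) *: (rc s *: mrep_conj (conj_path t) r a c))).
    exact: cvgZr h.
  by apply/funext => t; rewrite e1.
have uniq a c l : (fun t => mrep_conj (conj_path t) r a c) @ +oo --> l -> F a c = l.
  by move=> h; exact: (cvg_unique (@norm_hausdorff _ _) (Flim a c) h).
have Flin c : linear (F^~ c).
  move=> z x y; apply: uniq.
  rewrite (_ : (fun t => _) = (fun t => z *: mrep_conj (conj_path t) r x c + mrep_conj (conj_path t) r y c)).
    by apply: cvgD; [apply: cvgZr|].
  by apply/funext => t; rewrite mrep_linear.
have FM a b c : F (a ** b) c = F a (F b c).
  apply: uniq; apply/cvg_nrmP => e e0; have e2 : 0 < e / 2 by rewrite divr_gt0.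
  have /cvg_nrmP/(_ _ e2) h1 := Flim a (F b c).
  have d0 : 0 < e / 2 / (nrm a + 1) by rewrite divr_gt0//; have := nrm_ge0 a; lra.
  have /cvg_nrmP/(_ _ d0) h2 := Flim b c; near=> t.
  have : nrm (mrep_conj (conj_path t) r a (F b c) - F a (F b c)) < e / 2 by near: t.
  have : nrm (mrep_conj (conj_path t) r b c - F b c) < e / 2 / (nrm a + 1) by near: t.
  rewrite ltr_pdivlMr; last by have := nrm_ge0 a; lra.
  have := conj_path_lip t r a (mrep_conj (conj_path t) r b c) (F b c); rewrite -mrep_mul.
  have := nrm_ge0 a; have := nrm_ge0 (mrep_conj (conj_path t) r b c - F b c).
  have := nrm_tri (mrep_conj (conj_path t) r a (F b c)) (mrep_conj (conj_path t) r (a ** b) c) (F a (F b c)).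
  nra.
have FS a x y : cstar (F a x) ** y = cstar x ** F (cstar a) y.
  have l1 : (fun t => cstar (mrep_conj (conj_path t) r a x) ** y) @ +oo --> cstar (F a x) ** y.
    by apply: cvg_cmul; [apply: cvg_cstar; exact: Flim|exact: cvg_cst].
  have l2 : (fun t => cstar x ** mrep_conj (conj_path t) r (cstar a) y) @ +oo --> cstar x ** F (cstar a) y.
    by apply: cvg_cmul; [exact: cvg_cst|exact: Flim].
  by apply: (cvg_eq0 l1 l2); near=> t; rewrite mrep_star.
exists (MultRep Flin FM FS); split=> [//|a d].
apply: (stable_ext su) => n.
have h N : mm al (bet d) * mm (MultRep Flin FM FS) a * ml (q N) =
    mm (MultRep Flin FM FS) a * mm al (bet d) * ml (q N).
  apply: mult_ext => c; rewrite !mult_mulE /= (proj2 (hF a)).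
  have -> : al (bet d) (q N ** c) = q N ** al (bet d) c.
    exact: mult_at c (munit_comm su N (bet d)).
  by rewrite (proj2 (hF a)); exact: mult_at c (gcomm d _).
have -> : ml (m n n) = ml (q n.+1) * ml (m n n).
  by rewrite -mlM (munit_l (su_mul su)) ltnS leqnn.
by rewrite !mulrA h.
Unshelve. all: by end_near.
Qed.

Lemma homotopic_limit z : exists z' : cuntzPair D C, cp_homotopic z z' /\
  (forall a d, mm al (bet d) * mm (cp_pos z') a = mm (cp_pos z') a * mm al (bet d)) /\
  (forall a d, mm al (bet d) * mm (cp_neg z') a = mm (cp_neg z') a * mm al (bet d)) /\
  (forall a, cp_diff z' a = g (cp_diff z a)).
Proof.
have [p [pl pc]] := conj_limit (cp_pos z); have [n [nl nc]] := conj_limit (cp_neg z).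
have dP a c : p a c - n a c = g (cp_diff z a) ** c.
  have l1 : (fun t => mrep_conj (conj_path t) (cp_pos z) a c -
      mrep_conj (conj_path t) (cp_neg z) a c) @ +oo --> p a c - n a c.
    by apply: cvgB; [exact: pl|exact: nl].
  have l2 : (fun t => cj al (v t) (cp_diff z a) ** c) @ +oo --> g (cp_diff z a) ** c.
    by apply: cvg_cmul; [exact: vg|exact: cvg_cst].
  apply: (cvg_eq0 l1 l2); near=> t.
  exact: (cp_diffP (cp_conj (conj_path t) z)).
exists (CuntzPair dP); split=> //.
have z0 : z = cp_conj (conj_path 0) z.
  by apply: cp_ext => a c; rewrite /= mrep_conjE /= v0 (proj1 (projection_one D)) !al1.
rewrite [X in cp_homotopic X _]z0.
apply: (homotopic_infty (h := fun t => cp_conj (conj_path t) z)) => //; last by move=> a; exact: vg.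
apply: (hpath_conj rC) => c /=.
  apply: (cont_lip (P := setT) (k := nrm c) (f := fun d => al d c)) vc => // x y _ _.
  by rewrite -mrepBl mulrC; exact: mrep_nrm.
apply: (cont_lip (P := setT) (k := nrm c) (f := fun d => al d c)) (cont_cstar vc) => // x y _ _.
by rewrite -mrepBl mulrC; exact: mrep_nrm.
Unshelve. all: by end_near.
Qed.

Variable w : R -> D.
Hypothesis wc : continuous w.
Hypothesis w0 : w 0 = 1D.
Hypothesis wu : forall t, unitaries 1D (w t).
Hypothesis wb : forall a, (fun t => w t ** gam a ** cstar (w t)) @ +oo --> bet a.

Let gb := mrep_comp al bet.

(** Once the pair (p, n) commutes with bet(D), each component extends to [D] by gam(a) bet(b) |->
    p(a) bet(b), and is recovered by composing with gam. Moving gam to bet inside [D] turns it into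
    p(1) bet, a projection times bet. *)
Lemma homotopic_ppair z : exists (P Q : gproj gb) d (h : gp P - gp Q = ml d),
  cp_homotopic z (ppair h).
Proof.
have [z' [zz' [pcm [ncm dz]]]] := homotopic_limit z.
pose p := cp_pos z'; pose n := cp_neg z'.
have phi (r : multRep D C) : (forall a d, mm al (bet d) * mm r a = mm r a * mm al (bet d)) ->
    exists F : multRep D C, forall a b x, F (gam a ** bet b) x = r a (al (bet b) x).
  move=> rc'; apply: (sp_univ sp (f := r) (g := gb)) => // a b x.
  exact: mult_at x (esym (rc' a b)).
have [Fp hp] := phi p pcm; have [Fn hn] := phi n ncm.
(* The difference of the two extensions must stay in [C] along the path. This holds on finite sums
   of gam(a) bet(b), and persists in the limit because the difference is Lipschitz with constant
   2. *)
pose Pr (x : D) (k : C) := forall c, Fp x c - Fn x c = k ** c.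
have Pgb a b : Pr (gam a ** bet b) (al (bet b) (g (cp_diff z a))).
  move=> c; rewrite hp hn cp_diffP dz -mrepM; exact: esym (mult_at c (gcomm b _)).
have [||Fd [d1 d2 d3]] := @extend_lipschitz R D C Pr 2 (ler0n _ _).
- move=> x y x' y' Px Px'; apply: nrm_lmul => [|c]; first by rewrite mulr_ge0 ?nrm_ge0.
  rewrite cmulBl -Px -Px'; have -> : Fp x c - Fn x c - (Fp x' c - Fn x' c) = Fp (x - x') c - Fn (x - x') c.
    by rewrite !mrepBl; zmod.
  have := nrmB (Fp (x - x') c) (Fn (x - x') c).
  have := mrep_nrm Fp (x - x') c rC; have := mrep_nrm Fn (x - x') c rC; lra.
- move=> x e /(sp_dense sp x)[s hs].
  exists (\sum_(i <- s) gam i.1 ** bet i.2), (\sum_(i <- s) al (bet i.2) (g (cp_diff z i.1))).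
  split=> // c; elim: s {hs} => [|i s ih].
    by rewrite !big_nil cmul0l -!mmE !mm0 subrr.
  rewrite !big_cons cmulDl -Pgb -ih -!mmE !mmD !mult_addE; zmod.
have FdP x : Pr x (Fd x).
  have [u [Pu ux]] := d3 x; move=> c.
  have Fl (F : multRep D C) : (fun i => F (u i) c) @ \oo --> F x c.
    apply: (cvg_lipschitz_map (f := fun d => F d c) (nrm_ge0 c)) ux => y y'.
    by rewrite -mrepBl mulrC; exact: mrep_nrm.
  have l1 : (fun i => Fp (u i) c - Fn (u i) c) @ \oo --> Fp x c - Fn x c.
    by apply: cvgB; exact: Fl.
  have l2 : (fun i => Fd (u i) ** c) @ \oo --> Fd x ** c.
    apply: cvg_cmul; last exact: cvg_cst.
    exact: (cvg_lipschitz_map (f := Fd) (M := 2)) ux.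
  by apply: (cvg_eq0 l1 l2); near=> i; exact: Pu.
have ws t : cstar (w t) ** w t = gam 1D by rewrite (sp_gam1 sp); have [] := wu t.
pose W t := ad_hom (ws t).
have WE t a : W t a = w t ** gam a ** cstar (w t) by exact: ad_homE.
have hP t a c : mrep_comp Fp (W t) a c - mrep_comp Fn (W t) a c = Fd (W t a) ** c by exact: FdP.
have Wc a : continuous (fun t => W t a).
  rewrite (_ : (fun t => _) = (fun t => w t ** gam a ** cstar (w t))).
    apply: cont_cmul; last exact: cont_cstar.
    by apply: cont_cmul => //; exact: cont_cst.
  by apply/funext => t; exact: WE.
have Wl a : (fun t => W t a) @ +oo --> bet a.
  rewrite (_ : (fun t => _) = (fun t => w t ** gam a ** cstar (w t)))//.
  by apply/funext => t; exact: WE.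
have gpr (r : multRep D C) : (forall a d, mm al (bet d) * mm r a = mm r a * mm al (bet d)) ->
    exists P : gproj gb, gp P = mm r 1D.
  move=> rc'; have p1 := projection_one D.
  have e1 : mstar (mm r 1D) = mm r 1D by rewrite mm_star (proj1 p1).
  have e2 : mm r 1D * mm r 1D = mm r 1D by rewrite -mmM (proj2 p1).
  have e3 : cmt gb (mm r 1D) by move=> a; apply: mult_ext => c; exact: mult_at c (esym (rc' 1D a)).
  by exists (GProj e1 e2 e3).
have [P PE] := gpr p pcm; have [Q QE] := gpr n ncm.
have h : gp P - gp Q = ml (cp_diff z' 1D).
  by apply: mult_ext => c; rewrite PE QE; exact: cp_diffP.
have bF r' F (T : gproj gb) a c : (forall a b x, F (gam a ** bet b) x = r' a (al (bet b) x)) ->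
   gp T = mm r' 1D -> F (bet a) c = cut T a c.
  by move=> hF TE; rewrite cutE TE -[bet a]cmul1l -(sp_gam1 sp) hF (sp_gam1 sp).
have gF (r' F : multRep D C) a c : (forall a b x, F (gam a ** bet b) x = r' a (al (bet b) x)) ->
   F (gam a) c = r' a c.
  by move=> hF; rewrite -[gam a]cmul1r -(sp_bet1 sp) hF (sp_bet1 sp) al1.
exists P, Q, (cp_diff z' 1D), h; apply: homotopic_trans zz' _.
have z0 : z' = CuntzPair (hP 0).
  apply: cp_ext => a c /=; rewrite WE w0 (proj1 (projection_one D)) cmul1l cmul1r.
    by rewrite (gF p).
  by rewrite (gF n).
rewrite [X in cp_homotopic X _]z0.
have Fcont (F : multRep D C) c : forall x y, nrm (F x c - F y c) <= nrm c * nrm (x - y).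
  by move=> x y; rewrite -mrepBl mulrC; exact: mrep_nrm.
apply: (homotopic_infty (h := fun t => CuntzPair (hP t))).
- split=> [a c|a c|a] /=.
  + by apply: (cont_lip (P := setT) (f := fun d => Fp d c)) (Wc a) => // x y _ _; exact: Fcont.
  + by apply: (cont_lip (P := setT) (f := fun d => Fn d c)) (Wc a) => // x y _ _; exact: Fcont.
  + by apply: (cont_lip (P := setT) (f := Fd)) (Wc a) => // x y _ _; exact: d1.
- move=> a c /=; rewrite -(bF p Fp P)//.
  exact: (cvg_lipschitz_map (f := fun d => Fp d c) (nrm_ge0 c) (Fcont Fp c) (Wl a)).
- move=> a c /=; rewrite -(bF n Fn Q)//.
  exact: (cvg_lipschitz_map (f := fun d => Fn d c) (nrm_ge0 c) (Fcont Fn c) (Wl a)).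
- move=> a /=; have -> : al (bet a) (cp_diff z' 1D) = Fd (bet a).
    apply: cmul_ext => c; rewrite -FdP (bF p Fp P)// (bF n Fn Q)//.
    exact: esym (ppair_subproof h a c).
  exact: (cvg_lipschitz_map (f := Fd) (ler0n _ 2) d1 (Wl a)).
Unshelve. all: by end_near.
Qed.

End Reduction.

(** * The corollary *)

Section TensorInduction.
Context {R : realType} {A B T : cstarAlgType R} (t : cstarTensor A B T).

Lemma tens_ind (P : T -> Prop) : (forall x y, P x -> P y -> P (x + y)) ->
  (forall a b, P (t a b)) ->
  (forall x, (forall e : R, 0 < e -> exists2 y, nrm (x - y) < e & P y) -> P x) -> forall x, P x.
Proof.
move=> PD Pt Pc x; apply: Pc => e /(tens_dense_seq t x)[s hs]; exists (tsum t s) => //.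
rewrite /tsum; elim: s {hs} => [|i s ih]; last by rewrite big_cons; exact: PD.
rewrite big_nil; have -> : 0 = t 0 0 :> T; last exact: Pt.
by rewrite tens0l.
Qed.

End TensorInduction.

Section ExtendedRep.
Context {R : realType} {D : unitalCstarAlgType R} {C : cstarAlgType R}.
Local Notation "1D" := (cone D).
Variable chi : nat -> starHom D C.
Hypothesis rC : representable C.
Hypothesis chi_r : forall N M d, (N <= M)%N -> chi M d ** chi N 1D = chi N d.
Hypothesis chi_unit : forall c (eps : R), 0 < eps -> exists N0, forall N, (N0 <= N)%N ->
  nrm (c - chi N 1D ** c) < eps.

(** This produces d |-> 1 (x) 1 (x) d as the strict limit of the homomorphisms q_N (x) 1 (x) d into
    corners of [C]. *)
Lemma extended_rep : exists al : multRep D C, (forall c, al 1D c = c) /\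
  forall d c, (fun N => chi N d ** c) @ \oo --> al d c.
Proof.
pose P d (x y : C) := exists N c, x = chi N 1D ** c /\ y = chi N d ** c.
have ex d : exists F : C -> C, (forall x y, nrm (F x - F y) <= nrm d * nrm (x - y)) /\
    forall N c, F (chi N 1D ** c) = chi N d ** c.
  have [||F [F1 F2 _]] := @extend_lipschitz R C C (P d) (nrm d) (nrm_ge0 d).
  - move=> x y x' y' [N [c [-> ->]]] [N' [c' [-> ->]]].
    pose M := maxn N N'.
    have h k u : (k <= M)%N -> chi k d ** u = chi M d ** (chi k 1D ** u).
      by move=> kM; rewrite cmulA chi_r.
    rewrite (h N) ?leq_maxl// (h N') ?leq_maxr// -cmulBr; apply: le_trans (nrmM _ _) _.
    by apply: ler_wpM2r; [exact: nrm_ge0|exact: starHom_nrm].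
  - move=> x e /(chi_unit x)[N hN].
    by exists (chi N 1D ** x), (chi N d ** x); split; [exists N, x|exact: hN].
  by exists F; split=> // N c; apply: F2; exists N, c.
have [F hF] := choice ex.
have ucvg c : (fun N => chi N 1D ** c) @ \oo --> c.
  apply/cvg_nrmP => e /(chi_unit c)[N hN]; exists N => // n Nn /=.
  by rewrite nrmBC; exact: hN.
have Fl d c : (fun N => chi N d ** c) @ \oo --> F d c.
  rewrite (_ : (fun N => _) = (fun N => F d (chi N 1D ** c))).
    exact: (cvg_lipschitz_map (nrm_ge0 d) (proj1 (hF d)) (@ucvg c)).
  by apply/funext => N; rewrite (proj2 (hF d)).
have uniq d c l : (fun N => chi N d ** c) @ \oo --> l -> F d c = l.
  by move=> h; exact: (cvg_unique (@norm_hausdorff _ _) (Fl d c) h).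
have Flin c : linear (F^~ c).
  move=> z x y; apply: uniq.
  rewrite (_ : (fun N => _) = (fun N => z *: (chi N x ** c) + chi N y ** c)).
    by apply: cvgD; [apply: cvgZr; exact: Fl|exact: Fl].
  by apply/funext => N; rewrite sh_linear cmulDl cmulZl.
have FM a b c : F (a ** b) c = F a (F b c).
  apply: uniq; apply/cvg_nrmP => e e0; have e2 : 0 < e / 2 by rewrite divr_gt0.
  have /cvg_nrmP/(_ _ e2) h1 := Fl a (F b c).
  have d0 : 0 < e / 2 / (nrm a + 1) by rewrite divr_gt0//; have := nrm_ge0 a; lra.
  have /cvg_nrmP/(_ _ d0) h2 := Fl b c; near=> N.
  have : nrm (chi N a ** F b c - F a (F b c)) < e / 2 by near: N.
  have : nrm (chi N b ** c - F b c) < e / 2 / (nrm a + 1) by near: N.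
  rewrite ltr_pdivlMr; last by have := nrm_ge0 a; lra.
  have := nrmM (chi N a) (chi N b ** c - F b c); have := starHom_nrm (chi N) a rC.
  rewrite sh_mul -(cmulA (chi N a)) cmulBr.
  have := nrm_ge0 a; have := nrm_ge0 (chi N b ** c - F b c).
  have := nrm_tri (chi N a ** F b c) (chi N a ** (chi N b ** c)) (F a (F b c)).
  move=> h3 h4 h5 h6 h7; have := ler_wpM2r h4 h6; nra.
have FS a x y : cstar (F a x) ** y = cstar x ** F (cstar a) y.
  have l1 : (fun N => cstar (chi N a ** x) ** y) @ \oo --> cstar (F a x) ** y.
    by apply: cvg_cmul; [apply: cvg_cstar; exact: Fl|exact: cvg_cst].
  have l2 : (fun N => cstar x ** (chi N (cstar a) ** y)) @ \oo --> cstar x ** F (cstar a) y.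
    by apply: cvg_cmul; [exact: cvg_cst|exact: Fl].
  by apply: (cvg_eq0 l1 l2); near=> N; rewrite cstarM sh_star cmulA.
by exists (MultRep Flin FM FS); split=> // c; apply: uniq.
Unshelve. all: by end_near.
Qed.

End ExtendedRep.

Theorem corollary3p6 (R : realType)
  (* the compact operators K on a separable infinite-dimensional Hilbert space,
     and a rank one projection p in K *)
  (H : hilbertType R) (hHsep : separable H) (hHinf : infinite_dimensional H)
  (K : cstarAlgType R) (piK : compactOperators K H)
  (p : K) (hp : rank_one_projection piK p)
  (D : unitalCstarAlgType R)
  (hD : strongly_self_absorbing D) (hDsep : separable D) (hDK1 : K1_injective D)
  (A : unitalCstarAlgType R) (hA : separable A)
  (* AD is A (x) D and KAD is K (x) A (x) D *)
  (AD : cstarAlgType R) (tAD : cstarTensor A D AD)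
  (KAD : cstarAlgType R) (tKAD : cstarTensor K AD KAD) :
  let iota : starHom D AD := tens_proj tAD (projection_one A) in
  let stab : starHom AD KAD := tens_proj tKAD (rank_one_projectionP hp) in
  (forall e : KAD, projection e ->
   forall phi psi : starHom D KAD,
     (forall d, corner e (phi d)) -> phi (cone D) = e ->
     (forall d, corner e (psi d)) -> psi (cone D) = e ->
     strongly_asymp_unitarily_equivalent e phi psi /\
     kk_hom phi = kk_hom psi)
  /\
  KK D KAD =
    [set X | exists (phi : starHom D KAD) (n : nat),
       X = kk_sub (kk_hom phi) (kk_natmul n (kk_hom (star_comp stab iota)))].
Proof.
move=> iota stab.
have [gam [bet sp]] := strongly_self_absorbing_pair hD hDK1.
have rC : representable KAD := tens_rep tKAD.
have [E [E00 EM ES Eu]] := compact_matrix_units hHsep hHinf hp.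
pose oneAD := tAD (cone A) (cone D).
have one1 x : oneAD ** x = x /\ x ** oneAD = x := tens_one tAD x.
have pr N : projection (munit E N) := munit_projection EM ES N.
pose chi N : starHom D KAD := star_comp (tens_proj tKAD (pr N)) iota.
have chiE N d : chi N d = tKAD (munit E N) (tAD (cone A) d) by [].
have chi_r N M d : (N <= M)%N -> chi M d ** chi N (cone D) = chi N d.
  by move=> NM; rewrite !chiE -!tens_mul !cmul1r (munitM EM) (minn_idPr NM).
have Pk k y (eps : R) : 0 < eps -> exists N0, forall N, (N0 <= N)%N ->
    nrm (tKAD k y - tKAD (munit E N ** k) y) < eps.
  move=> e0; have d0 : 0 < eps / (nrm y + 1) by rewrite divr_gt0//; have := nrm_ge0 y; lra.
  have [N0 hN] := Eu k _ d0; exists N0 => N /hN; rewrite -tensBl => h.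
  apply: le_lt_trans (nrm_tens tKAD _ _) _; move: h.
  rewrite ltr_pdivlMr; last by have := nrm_ge0 y; lra.
  by have := nrm_ge0 y; have := nrm_ge0 (k - munit E N ** k); rewrite /munit; nra.
have chi_unit c (eps : R) : 0 < eps -> exists N0, forall N, (N0 <= N)%N ->
    nrm (c - chi N (cone D) ** c) < eps.
  move: c eps; apply: (tens_ind (t := tKAD)) => [x y hx hy eps e0|k y eps e0|x hx eps e0].
  - have e2 : 0 < eps / 2 by rewrite divr_gt0.
    have [N1 h1] := hx _ e2; have [N2 h2] := hy _ e2; exists (maxn N1 N2) => N.
    rewrite geq_max => /andP[/h1 n1 /h2 n2]; rewrite cmulDr.
    have -> : x + y - (chi N (cone D) ** x + chi N (cone D) ** y) =
      (x - chi N (cone D) ** x) + (y - chi N (cone D) ** y) by zmod.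
    by apply: le_lt_trans (nrmD _ _) _; lra.
  - have [N0 hN] := Pk k y eps e0; exists N0 => N /hN.
    by rewrite chiE -tens_mul -/oneAD (proj1 (one1 y)).
  - have e3 : 0 < eps / 3 by rewrite divr_gt0.
    have [y xy hy] := hx _ e3; have [N0 hN] := hy _ e3; exists N0 => N /hN h.
    have -> : x - chi N (cone D) ** x = (x - y) + (y - chi N (cone D) ** y) -
       chi N (cone D) ** (x - y) by rewrite cmulBr; zmod.
    have c1 := nrm_proj (sh_projection (chi N) (projection_one D)).
    apply: le_lt_trans (nrmB _ _) _; have := nrm_mul1l (x - y) c1.
    have := nrmD (x - y) (y - chi N (cone D) ** y); lra.
have [al [al1 all]] := extended_rep rC chi_r chi_unit.
have al_l d k y : al d (tKAD k y) = tKAD k (tAD (cone A) d ** y).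
  apply: (cvg_unique (@norm_hausdorff _ _) (all d (tKAD k y))).
  apply/cvg_nrmP => e e0; have [N0 hN] := Pk k (tAD (cone A) d ** y) e e0.
  by exists N0 => // N /hN; rewrite /= -tens_mul nrmBC.
have al_r d k y x : tKAD k y ** al d x = tKAD k (y ** tAD (cone A) d) ** x.
  have := mrep_star al (cstar d) (cstar (tKAD k y)) x; rewrite !cstarK => <-.
  rewrite -tens_star al_l -tens_star cstarK cstarM cstarK -tens_star cstarK.
  by rewrite (proj1 (projection_one A)).
(* Only the third factor varies: two applications of [tens_ind] show that these maps reach all of K
   (x) A (x) D, whatever A is. *)
pose J : set (D -> KAD) := [set j | exists k a, j = fun d => tKAD k (tAD a d)].
have ab : absorbing al J.
  split=> //.
  - move=> _ [k [a ->]]; exists (nrm k * nrm a); first by rewrite mulr_ge0 ?nrm_ge0.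
    move=> x y; rewrite -tensBr -tensBr; apply: le_trans (nrm_tens _ _ _) _.
    by rewrite -mulrA; apply: ler_wpM2l; [exact: nrm_ge0|exact: nrm_tens].
  - by move=> _ b d [k [a ->]]; rewrite al_l -tens_mul cmul1l.
  - by move=> _ b d x [k [a ->]]; rewrite al_r -tens_mul cmul1r.
  - move=> P PD PJ Pc; apply: (tens_ind (t := tKAD)) => // k.
    apply: (tens_ind (t := tAD)) => [x y hx hy|a d|x hx].
    + by rewrite tensDr; exact: PD.
    + by apply: (PJ (fun d => tKAD k (tAD a d))); exists k, a.
    + apply: Pc => e e0.
      have d0 : 0 < e / (nrm k + 1) by rewrite divr_gt0//; have := nrm_ge0 k; lra.
      have [y xy Py] := hx _ d0; exists (tKAD k y) => //; rewrite -tensBr.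
      apply: le_lt_trans (nrm_tens _ _ _) _; move: xy.
      rewrite ltr_pdivlMr; last by have := nrm_ge0 k; lra.
      by have := nrm_ge0 k; have := nrm_ge0 (x - y); nra.
pose m i j := tKAD (E i j) oneAD.
have t0 y : tKAD 0 y = 0 by exact: tens0l.
have mq N : munit m N = chi N (cone D).
  rewrite chiE -/oneAD; elim: N => [|N ih]; first by rewrite /munit !big_nil t0.
  by rewrite !munitS ih tensDl.
have su : stable_units al m.
  split=> [i j k l|i j|d i j|c eps].
  - rewrite /m -tens_mul EM (proj1 (one1 _)); by case: ifP => // _; rewrite t0.
  - by rewrite /m -tens_star ES /oneAD -tens_star (proj1 (projection_one A)) (proj1 (projection_one D)).
  - apply: mult_ext => x; rewrite !mult_mulE /=.
    by rewrite mrepM al_l al_r (proj1 (one1 _)) (proj2 (one1 _)).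
  - by move=> /(chi_unit c)[N0 hN]; exists N0 => N /hN; rewrite mq.
have [S [U cs]] := cuntz_system_exists su.
have same := homotopic_same_unit sp hDsep ab.
split.
  move=> e pe phi psi _ phi1 _ psi1; split; last first.
    by apply: kk_class_eq; apply: same; rewrite phi1 psi1.
  have [u [uc u0 uu ul]] := asymptotic_uniqueness sp hDsep ab pe phi1 psi1.
  by exists u; split=> //; exact: continuous_subspaceT.
have iotaE x : ml (star_comp stab iota x) = mm al x * ml (m 0%N 0%N).
  rewrite -ml_act; congr ml; rewrite mmE al_l (proj2 (one1 _)) E00.
  by [].
pose gb := mrep_comp al bet.
have g1 : mm gb (cone D) = 1.
  by apply: mult_ext => x; rewrite mmE /= (sp_bet1 sp) al1.
have gmE d : mm gb d = mm al (bet d) by apply: mult_ext.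
have gm i j : cmt gb (ml (m i j)) by move=> d; rewrite gmE (su_comm su).
have gs1 : cmt gb (iso1 S) by move=> d; rewrite gmE (cs_comm1 cs).
have gs2 : cmt gb (iso2 S) by move=> d; rewrite gmE (cs_comm2 cs).
pose idD := StarHom (sh_fun := @id D) (fun _ _ _ => erefl) (fun _ _ => erefl) (fun _ => erefl).
have p1 := projection_one D; have abD := absorbing_self (sp_rep sp).
(* The homotopies of Cuntz pairs need continuous families, so the sequences of unitaries are
   replaced by paths in [D], from asymptotic uniqueness with [D] as its own absorbing algebra. *)
have [v [vc v0 vu vl]] := asymptotic_uniqueness sp hDsep abD p1 (erefl : idD (cone D) = cone D) (sp_gam1 sp).
have [w [wc w0 wu wl]] := asymptotic_uniqueness sp hDsep abD p1 (sp_gam1 sp) (sp_bet1 sp).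
have [g [gcomm [glim _]]] := absorbing_endo ab sp hDsep.
have vg : forall c, (fun t => cj al (v t) c) @ +oo --> g c.
  by apply: glim => //; exact: proper_pinfty_nbhs.
apply/seteqP; split=> X.
  move=> [z _ <-] /=.
  have [P [Q [d [h zh]]]] := homotopic_ppair su rC al1 sp gcomm vc v0 vu vg wc w0 wu wl z.
  have [phi [n hn]] := ppair_class su cs rC sp hDsep ab iotaE g1 gm gs1 gs2 h.
  by exists phi, n; rewrite (kk_class_eq zh).
move=> [phi [n ->]].
rewrite (kk_natmul_unit su cs rC sp hDsep ab iotaE) /kk_sub /kk_hom kk_opp_class (kk_add_class cs rC).
by eexists.
Qed.
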